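(* Let $R$ be a rational function with $\deg R \geq 2$. Consider the $C^*$-algebra $\mathcal{O}_R$ associated with $R$ and the gauge action $\gamma : \mathbb{R} \to \operatorname{Aut} \mathcal{O}_R$ such that $\gamma_t(S_f) = e^{it}S_f$ for $f \in X$. Suppose that the Julia set $J_R$ contains no critical points of $R$. Then $(\mathcal{O}_R, \gamma)$ has a KMS state at the inverse temperature $\beta$ if and only if $\beta = \log(\deg R)$, and the corresponding KMS state $\varphi$ is unique. Moreover the restriction of $\varphi$ to $A = C(J_R)$ is given by the Lyubich measure $\mu$, that is, $\varphi(a) = \int a \, d\mu$ for all $a \in A$.
   Context: A rational function $R = P/Q$ ($P,Q$ relatively prime complex polynomials) is regarded as a map of the Riemann sphere $\hat{\mathbb{C}}$ to itself, and $\deg R = \max\{\deg P, \deg Q\}$. The Fatou set $F_R$ is the maximal open subset of $\hat{\mathbb{C}}$ on which the iterates $(R^n)_n$ are equicontinuous; the Julia set is $J_R = \hat{\mathbb{C}} \setminus F_R$. It satisfies $R(J_R) = J_R = R^{-1}(J_R)$ and is non-empty if $\deg R \ge 2$. The branch index $e(x) = e_R(x)$ at $x \in \hat{\mathbb{C}}$ is the integer $n\ge 1$ such that, in appropriate local charts, $R(z) = R(x) + c(z-x)^n + (\text{higher terms})$ with $c \neq 0$; $x$ is a critical point iff $e(x) \ge 2$. Let $A = C(J_R)$, $\operatorname{graph} R|_{J_R} = \{(x,y) \in J_R\times J_R : y = R(x)\}$ and $X = C(\operatorname{graph} R|_{J_R})$. $X$ is a full Hilbert bimodule over $A$ with $(a\cdot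 f\cdot b)(x,y) = a(x)f(x,y)b(y)$ and right $A$-valued inner product $(f|g)_A(y) = \sum_{x \in R^{-1}(y)} e(x)\overline{f(x,y)}g(x,y)$; the left action is the faithful unital homomorphism $\phi : A \to L(X)$, $(\phi(a)f)(x,y)=a(x)f(x,y)$, where $L(X)$ denotes the adjointable operators and $K(X)\subset L(X)$ the closed span of the rank one operators $\theta_{\xi,\eta}(\zeta) = \xi(\eta|\zeta)_A$. $\mathcal{O}_R$ is the Cuntz-Pimsner algebra $\mathcal{O}_X$: with $I_X = \phi^{-1}(K(X))$, it is the universal $C^*$-algebra generated by $i(a)$ ($a \in A$, $i$ a $*$-homomorphism) and $S_\xi$ ($\xi \in X$, linear in $\xi$) satisfying $i(a)S_\xi = S_{\phi(a)\xi}$, $S_\xi i(a) = S_{\xi a}$, $S_\xi^* S_\eta = i((\xi|\eta)_A)$, and $i(a) = i_K(\phi(a))$ for $a \in I_X$, where $i_K : K(X)\to \mathcal{O}_X$ is the homomorphism with $i_K(\theta_{\xi,\eta}) = S_\xi S_\eta^*$. One identifies $i(a)$ with $a$. The gauge action fixes $A$ pointwise. A KMS state of $(\mathcal{O}_R,\gamma)$ at inverse temperature $\beta \in \mathbb{R}$ is a state $\varphi$ with $\varphi(x\gamma_{i\beta}(y)) = \varphi(yx)$ for all $x,y$ in a dense $\gamma$-invariant $*$-subalgebra of $\gamma$-analytic elements (here $\gamma_{i\beta}(S_f) = e^{-\beta}S_f$). The Lyubich measure $\mu$ of $R$, with $d = \deg R$: for $y \in \hat{\mathbb{C}}$ and $n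 \in \mathbb{N}$ put $\mu_n^y = \sum_{\{x : R^n(x) = y\}} d^{-n} e_{R^n}(x)\, \delta_x$, where $\delta_x$ is the Dirac measure and $e_{R^n}$ is the branch index of $R^n$; by Lyubich, $(\mu_n^y)_n$ converges weakly to a probability measure $\mu$ with support $J_R$, independent of the choice of $y$ (for $y\in J_R$, say). *)

(* Defs.v *)
From HB Require Import structures.
From mathcomp Require Import all_boot all_order all_algebra finmap complex.
From mathcomp Require Import all_classical all_reals all_analysis.

Set Implicit Arguments.
Unset Strict Implicit.
Unset Printing Implicit Defensive.

Import Order.TTheory GRing.Theory Num.Theory numFieldNormedType.Exports.

Local Open Scope classical_set_scope.
Local Open Scope complex_scope.
Local Open Scope ring_scope.

Section Sphere.
Variable R : realType.

(* Inverse stereographic projection onto the unit sphere of R^3, with None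
   standing for the point at infinity. *)
Definition stereo (x : option R[i]) : R * R * R :=
  if x is Some z then
    let s := complex.Re z ^+ 2 + complex.Im z ^+ 2 in
    (2 * complex.Re z / (1 + s), 2 * complex.Im z / (1 + s), (s - 1) / (1 + s))
  else (0, 0, 1).

(* The topology is that of the one-point compactification of the plane; the
   uniformity, used for equicontinuity, is that of the chordal metric. *)
Definition sphere : Type := initial_topology stereo.

HB.instance Definition _ := Pointed.copy sphere (option R[i]).
HB.instance Definition _ := PseudoMetric.copy sphere (initial_topology stereo).

Definition borel_sphere : Type := g_sigma_algebraType (@open sphere).

HB.instance Definition _ :=
  Measurable.copy borel_sphere (g_sigma_algebraType (@open sphere)).

Definition rat_degree (P Q : {poly R[i]}) : nat := (maxn (size P) (size Q)).-1.

(* At infinity, P / Q is evaluated through its coefficients of degree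
   d = rat_degree P Q, at least one of which is nonzero. *)
Definition rat_map (P Q : {poly R[i]}) (x : sphere) : sphere :=
  let quot a b : sphere := if b == 0 then None else Some (a / b) in
  if x is Some z then quot P.[z] Q.[z]
  else quot P`_(rat_degree P Q) Q`_(rat_degree P Q).

(* The local parameter at x: z |-> x + z if x is finite, z |-> 1 / z if x is
   infinity; [coord x] is the inverse chart (with an irrelevant value away from
   x where the chart is not defined). *)
Definition param (x : sphere) (z : R[i]) : sphere :=
  if x is Some a then Some (a + z) else if z == 0 then None else Some z^-1.

Definition coord (x y : sphere) : R[i] :=
  match x, y with
  | Some a, Some b => b - a
  | None, Some b => b^-1
  | _, None => 0
  end.

Definition is_branch_index (f : sphere -> sphere) (x : sphere) (n : nat) : Prop :=
  (1 <= n)%N /\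
  exists c M : R[i], c != 0 /\
    \forall z \near (0 : R[i]^o),
      `|coord (f x) (f (param x z)) - c * z ^+ n| <= M * `|z| ^+ n.+1.

(* At most one n satisfies [is_branch_index f x n], and one does when f is a
   nonconstant rational map. *)
Definition branch_index (f : sphere -> sphere) (x : sphere) : nat :=
  xget 0%N [set n | is_branch_index f x n].

Definition critical (f : sphere -> sphere) (x : sphere) : Prop :=
  (2 <= branch_index f x)%N.

Definition fatou_set (f : sphere -> sphere) : set sphere :=
  \bigcup_(U in [set U : set sphere | open U /\
     forall x, U x -> {for x, equicontinuous setT (fun n => iter n f)}]) U.

Definition julia_set (f : sphere -> sphere) : set sphere := ~` fatou_set f.

(* mu_n^y: the measure with mass d^-n e_{f^n}(x) at each x in the finite set
   f^{-n}(y). *)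
Definition lyubich_approx (f : sphere -> sphere) (d : nat) (y : sphere) (n : nat) :
    {measure set borel_sphere -> \bar R} :=
  let s := enum_fset (fset_set [set x | iter n f x = y]) in
  msum (fun k => let x := nth None s k : borel_sphere in
    mscale (((d%:R ^+ n)^-1 * (branch_index (iter n f) x)%:R)%:nng)
           (dirac x)) (size s).

(* The Lyubich measure is the weak limit of the mu_n^y, for every y in J; this
   determines mu, and implies that its support is J. *)
Definition is_lyubich_measure (f : sphere -> sphere) (d : nat)
    (mu : probability borel_sphere R) : Prop :=
  forall y, julia_set f y -> forall g : sphere -> R, continuous g ->
    (fun n => \int[lyubich_approx f d y n]_x (g x)%:E)%E @ \oo
      --> (\int[mu]_x (g x)%:E)%E.

End Sphere.

Section ContinuousFunctions.
Variables (R : realType) (T : topologicalType).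

Definition cfuns : {pred T -> R[i]^o} := [pred f | `[< continuous f >]].

Lemma cfunsP f : reflect (continuous f) (f \in cfuns).
Proof. exact: asboolP. Qed.

Lemma cfuns_subring : subring_closed cfuns.
Proof.
split.
- by apply/cfunsP => x; exact: cvg_cst.
- by move=> f g /cfunsP cf /cfunsP cg; apply/cfunsP => x; apply: cvgB;
    [exact: cf|exact: cg].
- by move=> f g /cfunsP cf /cfunsP cg; apply/cfunsP => x; apply: cvgM;
    [exact: cf|exact: cg].
Qed.

Lemma cfuns_submod : submod_closed cfuns.
Proof.
split; first by apply/cfunsP => x; exact: cvg_cst.
move=> a f g /cfunsP cf /cfunsP cg; apply/cfunsP => x.
by apply: cvgD; [apply: cvgZr; exact: cf|exact: cg].
Qed.

HB.instance Definition _ := GRing.isSubringClosed.Build _ cfuns cfuns_subring.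
HB.instance Definition _ := GRing.isSubmodClosed.Build _ _ cfuns cfuns_submod.

Record cfun := Cfun { cfun_val :> T -> R[i]^o; _ : cfun_val \in cfuns }.

HB.instance Definition _ := [isSub for cfun_val].
HB.instance Definition _ := [Choice of cfun by <:].
HB.instance Definition _ :=
  GRing.SubChoice_isSubComPzRing.Build _ _ cfun cfuns_subring.
HB.instance Definition _ := [SubZmodule_isSubLmodule of cfun by <:].

End ContinuousFunctions.

Arguments cfun R T : clear implicits.

Section ContinuousFunctionsOps.
Variable R : realType.

Lemma conjc_continuous : continuous (@conjc R : R[i]^o -> R[i]^o).
Proof.
move=> z; apply/(@cvgrPdist_lt _ R[i]^o _ (nbhs (z : R[i]^o)) (nbhs_filter _)) => e e0.
apply: filterS (@nbhsx_ballx _ R[i]^o z e e0) => w.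
by rewrite -ball_normE /= -[in X in _ -> X]rmorphB normcJ.
Qed.

Lemma cfun_continuous (T : topologicalType) (a : cfun R T) : continuous a.
Proof. by case: a => a /= /cfunsP. Qed.

Lemma cfun_conj_subproof (T : topologicalType) (a : cfun R T) :
  (fun x => conjc (a x) : R[i]^o) \in @cfuns R _.
Proof.
apply/cfunsP => x.
by apply: (@continuous_comp _ _ _ a (@conjc R : R[i]^o -> R[i]^o));
  [exact: cfun_continuous|exact: conjc_continuous].
Qed.

Definition cfun_conj (T : topologicalType) (a : cfun R T) : cfun R T :=
  Cfun (cfun_conj_subproof a).

Lemma cfun_comp_subproof (S T : topologicalType) (g : continuousType S T)
  (a : cfun R T) : (fun x => a (g x)) \in @cfuns R _.
Proof.
apply/cfunsP => x.
by apply: continuous_comp; [exact: cts_fun|exact: cfun_continuous].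
Qed.

Definition cfun_comp (S T : topologicalType) (g : continuousType S T)
  (a : cfun R T) : cfun R S := Cfun (cfun_comp_subproof g a).

End ContinuousFunctionsOps.

(* Not necessarily unital. *)
HB.mixin Record isCstarAlgebra (R : realType) (A : Type)
    of CompleteNormedModule R[i] A := {
  cmul : A -> A -> A;
  star : A -> A;
  cmulA : associative cmul;
  cmulDl : left_distributive cmul +%R;
  cmulDr : right_distributive cmul +%R;
  cmulZl : forall (k : R[i]) x y, cmul (k *: x) y = k *: cmul x y;
  cmulZr : forall (k : R[i]) x y, cmul x (k *: y) = k *: cmul x y;
  starK : involutive star;
  starD : {morph star : x y / x + y};
  starZ : forall (k : R[i]) x, star (k *: x) = conjc k *: star x;
  starM : forall x y, star (cmul x y) = cmul (star y) (star x);
  norm_cmul : forall x y, `|cmul x y| <= `|x| * `|y|;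
  norm_star_cmul : forall x, `|cmul (star x) x| = `|x| ^+ 2
}.

#[short(type="cstarAlgType")]
HB.structure Definition CstarAlgebra (R : realType) :=
  {A of isCstarAlgebra R A & CompleteNormedModule R[i] A}.

Section CstarAlgebras.
Variable R : realType.

Record star_hom (A B : cstarAlgType R) (f : A -> B) : Prop := StarHom {
  star_hom_linear : linear f;
  star_hom_mul : {morph f : x y / cmul x y};
  star_hom_star : {morph f : x / star x}
}.

Record star_subalgebra (A : cstarAlgType R) (D : set A) : Prop := StarSubalgebra {
  star_subalgebra0 : D 0;
  star_subalgebra_linear : forall (k : R[i]) x y, D x -> D y -> D (k *: x + y);
  star_subalgebra_mul : forall x y, D x -> D y -> D (cmul x y);
  star_subalgebra_star : forall x, D x -> D (star x)
}.

Record is_state (A : cstarAlgType R) (phi : A -> R[i]) : Prop := IsState {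
  state_linear : scalar phi;
  state_ge0 : forall x, 0 <= phi (cmul (star x) x);
  state_norm_le1 : forall x, `|phi x| <= `|x|;
  state_norm_ge1 : forall e : R[i], 0 < e ->
    exists2 x, `|x| <= 1 & 1 - e < `|phi x|
}.

(* F is the entire extension of t |-> gamma_t (y), so that F z = gamma_z (y). *)
Definition analytic_extension (A : cstarAlgType R) (gamma : R -> A -> A) (y : A)
    (F : R[i]^o -> A) : Prop :=
  (forall z, derivable F z 1) /\ (forall t : R, F t%:C = gamma t y).

Record is_kms_state (A : cstarAlgType R) (gamma : R -> A -> A) (beta : R)
    (phi : A -> R[i]) : Prop := IsKmsState {
  kms_state : is_state phi;
  kms_condition : exists D : set A,
    [/\ dense D, star_subalgebra D,
        (forall t x, D x -> D (gamma t x)),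
        (forall y, D y -> exists F, analytic_extension gamma y F) &
        forall x y F, D x -> D y -> analytic_extension gamma y F ->
          phi (cmul x (F (0 +i* beta))) = phi (cmul y x)]
}.

End CstarAlgebras.

Section Bimodule.
Variables (R : realType) (f : sphere R -> sphere R).

Definition graph_julia : set (sphere R * sphere R) :=
  [set p | [/\ julia_set f p.1, julia_set f p.2 & p.2 = f p.1]].

Lemma graph_src_subproof (p : graph_julia) : (\val p).1 \in julia_set f.
Proof. by apply/mem_set; case: p => p /= /set_mem []. Qed.

Lemma graph_tgt_subproof (p : graph_julia) : (\val p).2 \in julia_set f.
Proof. by apply/mem_set; case: p => p /= /set_mem []. Qed.

Definition graph_src (p : graph_julia) : julia_set f := SigSub (graph_src_subproof p).
Definition graph_tgt (p : graph_julia) : julia_set f := SigSub (graph_tgt_subproof p).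

Lemma graph_src_continuous : continuous graph_src.
Proof.
apply: continuous_comp_initial => p.
apply: (@continuous_comp _ _ _ (\val : graph_julia -> _) fst).
  exact: initial_continuous.
exact: cvg_fst.
Qed.

Lemma graph_tgt_continuous : continuous graph_tgt.
Proof.
apply: continuous_comp_initial => p.
apply: (@continuous_comp _ _ _ (\val : graph_julia -> _) snd).
  exact: initial_continuous.
exact: cvg_snd.
Qed.

HB.instance Definition _ := isContinuous.Build _ _ graph_src graph_src_continuous.
HB.instance Definition _ := isContinuous.Build _ _ graph_tgt graph_tgt_continuous.

Local Notation A := (cfun R (julia_set f)).
Local Notation X := (cfun R graph_julia).

Definition lact (a : A) (xi : X) : X := cfun_comp graph_src a * xi.
Definition ract (xi : X) (b : A) : X := xi * cfun_comp graph_tgt b.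

(* When f is a nonconstant rational map, the sum is finite and is a continuous
   function of y, the points of a fibre being counted with multiplicity, so
   that the default value of [insubd] is not used. *)
Definition inner (xi eta : X) : A :=
  insubd 0 (fun y : julia_set f =>
    \sum_(p \in [set p : graph_julia | graph_tgt p = y])
      (branch_index f (\val p).1)%:R * (conjc (xi p) * eta p) : R[i]^o).

Definition xnorm (xi : X) : R :=
  Num.sqrt (sup (range (fun y : julia_set f => complex.Re `|inner xi xi y|))).

Definition adjoint (T T' : X -> X) : Prop :=
  forall xi eta, inner (T xi) eta = inner xi (T' eta).

Definition rank_one (xi eta : X) : X -> X := fun zeta => ract xi (inner eta zeta).

(* T belongs to K(X): it is adjointable and, for every e, at distance at most e
   in operator norm from a finite sum of rank one operators. *)
Definition compact_op (T : X -> X) : Prop :=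
  (exists T', adjoint T T') /\
  forall e : R, 0 < e -> exists s : seq (X * X), forall zeta,
    xnorm (T zeta - \sum_(p <- s) rank_one p.1 p.2 zeta) <= e * xnorm zeta.

(* The homomorphism on K(X); its values outside K(X) are irrelevant. *)
Record is_iK (B : cstarAlgType R) (S : X -> B) (iK : (X -> X) -> B) : Prop := IsIK {
  iK_linear : forall (k : R[i]) T T', compact_op T -> compact_op T' ->
    iK (k *: T + T') = k *: iK T + iK T';
  iK_comp : forall T T', compact_op T -> compact_op T' ->
    iK (T \o T') = cmul (iK T) (iK T');
  iK_adjoint : forall T T', compact_op T -> compact_op T' -> adjoint T T' ->
    iK T' = star (iK T);
  iK_rank_one : forall xi eta, iK (rank_one xi eta) = cmul (S xi) (star (S eta))
}.

Record covariant_rep (B : cstarAlgType R) (i : {linear A -> B})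
    (S : {linear X -> B}) : Prop := CovariantRep {
  rep_mul : forall a b, i (a * b) = cmul (i a) (i b);
  rep_star : forall a, i (cfun_conj a) = star (i a);
  rep_lact : forall a xi, cmul (i a) (S xi) = S (lact a xi);
  rep_ract : forall xi a, cmul (S xi) (i a) = S (ract xi a);
  rep_inner : forall xi eta, cmul (star (S xi)) (S eta) = i (inner xi eta);
  rep_covariant : exists2 iK, is_iK S iK &
    forall a, compact_op (lact a) -> i a = iK (lact a)
}.

(* (O, i, S) is the universal C*-algebra generated by the i(a) and S_xi subject
   to the relations of [covariant_rep]. *)
Record is_cuntz_pimsner (O : cstarAlgType R) (i : {linear A -> O})
    (S : {linear X -> O}) : Prop := IsCuntzPimsner {
  cp_rep : covariant_rep i S;
  cp_generated : forall D : set O, closed D -> star_subalgebra D ->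
    (forall a, D (i a)) -> (forall xi, D (S xi)) -> D = setT;
  cp_universal : forall (B : cstarAlgType R) (j : {linear A -> B})
    (T : {linear X -> B}), covariant_rep j T ->
    exists pi : O -> B,
      [/\ star_hom pi, forall a, pi (i a) = j a & forall xi, pi (S xi) = T xi]
}.

Record is_gauge_action (O : cstarAlgType R) (i : {linear A -> O})
    (S : {linear X -> O}) (gamma : R -> O -> O) : Prop := IsGaugeAction {
  gauge_hom : forall t, star_hom (gamma t);
  gauge0 : forall x, gamma 0 x = x;
  gaugeD : forall s t x, gamma (s + t) x = gamma s (gamma t x);
  gauge_continuous : forall x, continuous (gamma ^~ x);
  gauge_fix : forall t a, gamma t (i a) = i a;
  gauge_gen : forall t xi, gamma t (S xi) = (cos t +i* sin t) *: S xi
}.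

Definition cintegral (mu : probability (borel_sphere R) R) (a : A) : R[i] :=
  let b := 'valL_0 a : sphere R -> R[i] in
  Rintegral mu (julia_set f) (fun x => complex.Re (b x))
    +i* Rintegral mu (julia_set f) (fun x => complex.Im (b x)).

End Bimodule.

(* Main.v *)
(* Write [d = deg R]. As [J_R] contains no critical points, every [y] in [J_R] has exactly
   [d] preimages and they move continuously with [y]. A partition of unity subordinate to a
   cover of [J_R] by sets on which [R] is injective therefore gives a finite basis [(u)] of
   [X] with [\sum_u S_u S_u^* = 1], and [(u | a u)_A] sums over [u] to the transfer operator
   [(T a)(y) = \sum_(R x = y) a x].

   Uniqueness. If [phi] is a KMS state at [beta], then, summing
   [phi (S_u^* a S_u) = e^beta phi (S_u S_u^* a)] over the basis, [phi (T a) = e^beta phi a];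
   [a = 1] gives [e^beta = d]. The averages [d^-n T^n a] are integrals against Lyubich's
   [mu_n^y], so they are bounded and converge pointwise to the integral of [a] against [mu],
   and bounded convergence gives [phi a = \int a dmu]. On the rest of [O_R], [phi] vanishes on
   monomials [S_x1 .. S_xm a S_yn^* .. S_y1^*] with [m <> n], and for [m = n] the KMS condition
   reduces the length. The KMS condition is only given on some dense subalgebra of analytic
   elements, so it is first transferred to elements of a fixed gauge degree [k] by comparing
   the [k]-th Fourier coefficients of an entire function on the lines [Im z = 0] and
   [Im z = beta], which Cauchy's theorem relates by the factor [e^(k beta)].

   Existence. [O_R] acts on [l^2(J_R * Z)] by [(a h)(x, m) = a x h(x, m)] and
   [(S_xi h)(x, m) = xi(x, R x) h(R x, m - 1)]. Diagonal matrix coefficients at [(x, 0)] are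
   continuous in [x], and integrating them against [mu] gives a state; it is KMS because the
   matrix coefficients are invariant under [m |-> m + 1] and [\int T a dmu = d \int a dmu]. *)
From HB Require Import structures.
Require Import Defs.
From mathcomp Require Import all_boot all_order all_algebra complex.
From mathcomp Require Import all_classical all_reals all_analysis.
From mathcomp Require Import measurable_realfun.
From mathcomp Require Import ring lra finmap.
Import Order.TTheory GRing.Theory Num.Theory numFieldNormedType.Exports.

Set Implicit Arguments.
Unset Strict Implicit.
Unset Printing Implicit Defensive.

Local Open Scope classical_set_scope.
Local Open Scope complex_scope.
Local Open Scope ring_scope.

(** Three obstacles shape the development. The KMS condition concerns an unknown dense subalgebra
    whose elements need not be homogeneous, and conversely it must be verified for every analytic
    extension; hence the identity theorem for entire functions that vanish on the real line. Norm
    bounds for star homomorphisms and positive functionals are not part of the structures: both come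
    from one square root of [1 - a], so [phi \o gamma t] and the vector functionals of [pi] are
    estimated as positive functionals. Finally, the means converge only pointwise, so passing to the
    limit under [phi] takes a bounded convergence theorem for positive functionals on continuous
    functions. The absence of critical points acts through finiteness: [X] has a finite frame, each
    left multiplication has finite rank, and covariance becomes a finite sum. The integer coordinate
    of the representation space separates gauge degrees: over [J] alone a monomial of nonzero degree
    could have nonzero diagonal coefficients at periodic points, and these would spoil
    continuity. *)

Section RealNorm.
Variable R : realType.
Local Notation C := R[i].

Lemma complex_normr_real (V : normedZmodType C) (x : V) : `|x| = (complex.Re `|x|)%:C.
Proof. by have := normr_ge0 x; rewrite lecE /= => /andP[/eqP h _]; apply/eqP; rewrite eq_complex /= h !eqxx. Qed.

(* Norms over [R[i]] are [R[i]]-valued. *)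
Definition rnorm (V : normedZmodType C) (x : V) : R := complex.Re `|x|.

Lemma rnormE (V : normedZmodType C) (x : V) : `|x| = (rnorm x)%:C.
Proof. exact: complex_normr_real. Qed.

Lemma rnorm_ge0 (V : normedZmodType C) (x : V) : 0 <= rnorm x.
Proof. by have := normr_ge0 x; rewrite rnormE lecR. Qed.

Lemma rnormD (V : normedZmodType C) (x y : V) : rnorm (x + y) <= rnorm x + rnorm y.
Proof. by have := ler_normD x y; rewrite !rnormE -rmorphD lecR. Qed.

Lemma rnormN (V : normedZmodType C) (x : V) : rnorm (- x) = rnorm x.
Proof. by rewrite /rnorm normrN. Qed.

Lemma rnormB (V : normedZmodType C) (x y : V) : rnorm (x - y) <= rnorm x + rnorm y.
Proof. by rewrite -[rnorm y]rnormN rnormD. Qed.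

Lemma rdistC (V : normedZmodType C) (x y : V) : rnorm (x - y) = rnorm (y - x).
Proof. by rewrite /rnorm distrC. Qed.

Lemma rdist_triangle (V : normedZmodType C) (z x y : V) :
  rnorm (x - y) <= rnorm (x - z) + rnorm (z - y).
Proof. by rewrite (le_trans _ (rnormD _ _))// addrA subrK. Qed.

Lemma rnorm0 (V : normedZmodType C) : rnorm (0 : V) = 0.
Proof. by rewrite /rnorm normr0. Qed.

Lemma rnorm0_eq0 (V : normedZmodType C) (x : V) : rnorm x = 0 -> x = 0.
Proof. by move=> h; apply/eqP; rewrite -normr_eq0 rnormE h. Qed.

Lemma rnorm_eq0 (V : normedZmodType C) (x : V) : (rnorm x == 0) = (x == 0).
Proof. by apply/eqP/eqP => [/rnorm0_eq0//|->]; rewrite rnorm0. Qed.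

Lemma rnorm_gt0 (V : normedZmodType C) (x : V) : (0 < rnorm x) = (x != 0).
Proof. by rewrite lt0r rnorm_ge0 andbT rnorm_eq0. Qed.

Lemma rnormM (x y : C) : rnorm (x * y) = rnorm x * rnorm y.
Proof. by apply: (@complexI R); rewrite -rnormE normrM !rnormE rmorphM. Qed.

Lemma rnormX (x : C) n : rnorm (x ^+ n) = rnorm x ^+ n.
Proof. by apply: (@complexI R); rewrite -rnormE normrX !rnormE rmorphXn. Qed.

Lemma rnorm1 : rnorm (1 : C) = 1.
Proof. by rewrite /rnorm normr1. Qed.

Lemma rnormV (x : C) : rnorm x^-1 = (rnorm x)^-1.
Proof. by apply: (@complexI R); rewrite -rnormE normfV !rnormE fmorphV. Qed.

Lemma rnormZ (V : normedModType C) (k : C) (x : V) : rnorm (k *: x) = rnorm k * rnorm x.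
Proof. by apply: (@complexI R); rewrite -rnormE normrZ !rnormE rmorphM. Qed.

Lemma rnorm_conj (x : C) : rnorm (conjc x) = rnorm x.
Proof. by rewrite /rnorm normcJ. Qed.

Lemma rnorm_real (x : R) : rnorm (x%:C) = `|x|.
Proof. by rewrite /rnorm normc_def /= expr0n addr0 sqrtr_sqr. Qed.

Lemma rnorm_sum (V : normedZmodType C) (I : Type) (r : seq I) (P : pred I) (F : I -> V) :
  rnorm (\sum_(i <- r | P i) F i) <= \sum_(i <- r | P i) rnorm (F i).
Proof.
by elim/big_rec2: _ => [|j y1 y2 Pj h]; rewrite ?rnorm0// (le_trans (rnormD _ _))// lerD2l.
Qed.

Lemma sqr_rnorm (z : C) : rnorm z ^+ 2 = complex.Re z ^+ 2 + complex.Im z ^+ 2.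
Proof. by apply: (@complexI R); rewrite add_Re2_Im2 rnormE -rmorphXn. Qed.

Lemma normr_Re_le (z : C) : `|complex.Re z| <= rnorm z.
Proof.
rewrite -(ler_pXn2r (n := 2)) ?nnegrE ?rnorm_ge0// sqr_rnorm real_normK ?num_real//.
by rewrite lerDl sqr_ge0.
Qed.

Lemma normr_Im_le (z : C) : `|complex.Im z| <= rnorm z.
Proof.
rewrite -(ler_pXn2r (n := 2)) ?nnegrE ?rnorm_ge0// sqr_rnorm real_normK ?num_real//.
by rewrite lerDr sqr_ge0.
Qed.

Lemma rnorm_le_ReIm (z : C) : rnorm z <= `|complex.Re z| + `|complex.Im z|.
Proof.
rewrite -(ler_pXn2r (n := 2)) ?nnegrE ?rnorm_ge0 ?addr_ge0// sqr_rnorm sqrrD.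
rewrite !real_normK ?num_real// -addrA lerD2l lerDr mulrn_wge0// mulr_ge0//.
Qed.

Lemma conjc_mulE (z : C) : conjc z * z = (rnorm z ^+ 2)%:C.
Proof.
by apply/eqP; rewrite sqr_rnorm eq_complex; case: z => a b /=; rewrite !expr2; apply/andP; split; apply/eqP; ring.
Qed.

(** Balls in [V] have radii in [R[i]], but a positive element of [R[i]] has imaginary part zero, so
    real radii give the same neighbourhoods. *)
Lemma nbhs_rnormP (V : normedModType C) (x : V) (U : set V) :
  nbhs x U <-> exists2 e : R, 0 < e & forall y, rnorm (x - y) < e -> U y.
Proof.
split.
  move=> /nbhs_normP[e /= e0 h]; move: (e0); rewrite ltcE /= => /andP[/eqP im0 re0].
  exists (complex.Re e) => // y hy; apply: h; rewrite /ball_ /= rnormE ltcE /= im0 eqxx/=.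
  exact: hy.
move=> [e e0 h]; apply/nbhs_normP; exists e%:C => /=; first by rewrite ltcR.
by move=> y; rewrite /ball_ /= rnormE ltcR; exact: h.
Qed.

Lemma cvg_rnormP (T : Type) (F : set_system T) (FF : Filter F) (V : normedModType C)
    (f : T -> V) (l : V) :
  f @ F --> l <-> forall e : R, 0 < e -> \forall t \near F, rnorm (l - f t) < e.
Proof.
split=> [h e e0|h U /nbhs_rnormP[e e0 hU]].
  by apply: (h [set y | rnorm (l - y) < e]); apply/nbhs_rnormP; exists e.
by apply: filterS (h e e0) => t; exact: hU.
Qed.

Lemma continuous_rnormP (T : topologicalType) (V : normedModType C) (g : T -> V) :
  continuous g <-> forall x (e : R), 0 < e -> nbhs x [set y | rnorm (g x - g y) < e].
Proof.
split=> [cg x e e0|h x U /nbhs_rnormP[e e0 hU]].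
  by apply: (cg x [set z | rnorm (g x - z) < e]); apply/nbhs_rnormP; exists e.
by apply: filterS (h x e e0) => y; exact: hU.
Qed.

Lemma rnorm_lt_eps_eq0 (V : normedZmodType C) (x : V) :
  (forall e : R, 0 < e -> rnorm x <= e) -> x = 0.
Proof.
move=> h; apply: rnorm0_eq0; apply/eqP; rewrite eq_le rnorm_ge0 andbT.
by apply/ler_addgt0Pr => e e0; rewrite add0r h.
Qed.

End RealNorm.

(** * Goursat's theorem and entire functions *)

Section RealIntegral.
Variable R : realType.
Local Notation mu := (@lebesgue_measure R).

Definition rint (a b : R) (u : R -> R) : R := Rintegral mu `[a, b] u.

Lemma rint_integrable (a b : R) (u : R -> R) : continuous u ->
  mu.-integrable `[a, b] (EFin \o u).
Proof.
move=> cu; apply: continuous_compact_integrable; first exact: segment_compact.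
exact: continuous_subspaceT.
Qed.

Lemma rintD (a b : R) u v : continuous u -> continuous v ->
  rint a b (fun t => u t + v t) = rint a b u + rint a b v.
Proof. by move=> cu cv; rewrite /rint RintegralD//; exact: rint_integrable. Qed.

Lemma rintZ (a b k : R) u : continuous u ->
  rint a b (fun t => k * u t) = k * rint a b u.
Proof. by move=> cu; rewrite /rint RintegralZl//; exact: rint_integrable. Qed.

Lemma rint_eq (a b : R) u v : (forall t, a <= t <= b -> u t = v t) -> rint a b u = rint a b v.
Proof.
by move=> h; apply: eq_Rintegral => t /set_mem; rewrite /= in_itv /= => /h.
Qed.

Lemma rint_split (c a b : R) u : continuous u -> a <= c -> c <= b ->
  rint a b u = rint a c u + rint c b u.
Proof.
move=> cu ac cb; have ib := rint_integrable a b cu.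
have := Rintegral_itvB (x := c) ib; rewrite !bnd_simp => /(_ ac cb).
rewrite Rintegral_itv_obnd_cbnd; last first.
  apply: integrableS (rint_integrable c b cu) => //.
  by apply: subset_itvr; rewrite bnd_simp.
by rewrite /rint => <-; rewrite addrC subrK.
Qed.

Lemma rint_cst (a b k : R) : a <= b -> rint a b (fun=> k) = k * (b - a).
Proof.
move=> ab; rewrite /rint Rintegral_cst//= lebesgue_measure_itv /= lte_fin.
case: ifPn => [_|]; first by [].
rewrite -leNgt => ba; have -> : b = a by apply: le_anti; rewrite ba ab.
by rewrite subrr !mulr0.
Qed.

Lemma rint_le (a b : R) u v : continuous u -> continuous v ->
  (forall t, a <= t <= b -> u t <= v t) -> rint a b u <= rint a b v.
Proof.
move=> cu cv h; apply: le_Rintegral => //; try exact: rint_integrable.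
Qed.

Lemma rint_bound (a b M : R) u : continuous u -> a <= b ->
  (forall t, a <= t <= b -> `|u t| <= M) -> `|rint a b u| <= M * (b - a).
Proof.
move=> cu ab h; rewrite ler_norml -mulNr -!rint_cst//; apply/andP; split.
  by apply: rint_le => //; [move=> t; exact: cvg_cst|move=> t /h; rewrite ler_norml => /andP[]].
by apply: rint_le => //; [move=> t; exact: cvg_cst|move=> t /h; rewrite ler_norml => /andP[]].
Qed.

Lemma rint_id (a b : R) : a <= b -> rint a b id = (b ^+ 2 - a ^+ 2) / 2.
Proof.
rewrite le_eqVlt => /predU1P[->|ab].
  by rewrite subrr mul0r /rint set_itv1 Rintegral_set1.
have cF : continuous (fun x : R => x ^+ 2 / 2).
  by move=> x; apply: cvgM; [exact: exprn_continuous|exact: cvg_cst].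
rewrite /rint /Rintegral (@continuous_FTC2 _ id (fun x => x ^+ 2 / 2))//.
- by rewrite -EFinB/= -mulrBl.
- by apply: continuous_subspaceT => x; exact: cvg_id.
- split; first by move=> x _; exact: ex_derive.
  + by apply: cvg_at_right_filter; exact: cF.
  + by apply: cvg_at_left_filter; exact: cF.
- move=> x _ /=; rewrite derive1E derive_val /= /GRing.scale /=; field.
  by [].
Qed.

End RealIntegral.

Section Goursat.
Variable R : realType.
Local Notation C := R[i].

Definition cint (a b : R) (g : R -> C) : C :=
  rint a b (fun t => complex.Re (g t)) +i* rint a b (fun t => complex.Im (g t)).

Definition ccont (g : R -> C) := continuous (fun t => complex.Re (g t)) /\
  continuous (fun t => complex.Im (g t)).

Lemma cintD (a b : R) f g : ccont f -> ccont g ->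
  cint a b (fun t => f t + g t) = cint a b f + cint a b g.
Proof.
move=> [f1 f2] [g1 g2]; rewrite /cint; apply/eqP; rewrite eq_complex /=.
rewrite -!rintD//; apply/andP; split; apply/eqP; apply: rint_eq => t _; by case: (f t) (g t) => ? ? [].
Qed.

Lemma ccontZ (k : C) g : ccont g -> ccont (fun t => k * g t).
Proof.
case: k => p q [g1 g2]; split => t /=.
  have -> : (fun t => complex.Re ((p +i* q) * g t)) =
    (fun t => p * complex.Re (g t) - q * complex.Im (g t)).
    by apply/funext => s; case: (g s).
  by apply: cvgB; apply: cvgM; [exact: cvg_cst|exact: g1|exact: cvg_cst|exact: g2].
have -> : (fun t => complex.Im ((p +i* q) * g t)) =
    (fun t => p * complex.Im (g t) + q * complex.Re (g t)).
    by apply/funext => s; case: (g s).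
by apply: cvgD; apply: cvgM; [exact: cvg_cst|exact: g2|exact: cvg_cst|exact: g1].
Qed.

Lemma cintZ (a b : R) (k : C) g : ccont g -> cint a b (fun t => k * g t) = k * cint a b g.
Proof.
case: k => p q [g1 g2]; rewrite /cint; apply/eqP; rewrite eq_complex /=.
have z1 r : continuous (fun t => r * complex.Re (g t)).
  by move=> t; apply: cvgM; [exact: cvg_cst|exact: g1].
have z2 r : continuous (fun t => r * complex.Im (g t)).
  by move=> t; apply: cvgM; [exact: cvg_cst|exact: g2].
rewrite -mulNr -!rintZ// -!rintD//; apply/andP; split; apply/eqP; apply: rint_eq => t _; case: (g t) => ? ? /=; ring.
Qed.

Lemma cint_split (c a b : R) g : ccont g -> a <= c -> c <= b ->
  cint a b g = cint a c g + cint c b g.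
Proof.
move=> [g1 g2] ac cb; rewrite /cint; apply/eqP; rewrite eq_complex /=.
by rewrite -!(rint_split _ ac cb)// !eqxx.
Qed.

Lemma cint_eq (a b : R) f g : (forall t, a <= t <= b -> f t = g t) -> cint a b f = cint a b g.
Proof. by move=> h; congr (_ +i* _); apply: rint_eq => t /h ->. Qed.

(** The factor 2 comes from estimating real and imaginary parts separately; the later arguments
    tolerate any absolute constant. *)
Lemma cint_bound (a b M : R) g : ccont g -> a <= b ->
  (forall t, a <= t <= b -> rnorm (g t) <= M) -> rnorm (cint a b g) <= 2 * M * (b - a).
Proof.
move=> [g1 g2] ab h; rewrite (le_trans (rnorm_le_ReIm _))//= -mulrA mulr_natl mulr2n lerD//.
  by apply: rint_bound => // t /h; apply: le_trans; exact: normr_Re_le.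
by apply: rint_bound => // t /h; apply: le_trans; exact: normr_Im_le.
Qed.

Lemma ccont_line (H : C^o -> C^o) (p q : C) : continuous H ->
  ccont (fun t : R => H (p + q * t%:C)).
Proof.
move=> cH.
have key (t e : R) : 0 < e -> \forall s \near t, rnorm (H (p + q * t%:C) - H (p + q * s%:C)) < e.
  move=> e0; have /cvg_rnormP/(_ _ e0) := cH (p + q * t%:C).
  move=> /nbhs_rnormP[d d0 hd].
  have q0 : 0 < rnorm q + 1 by rewrite ltr_wpDl// rnorm_ge0.
  have dq : 0 < d / (rnorm q + 1) by rewrite divr_gt0.
  apply: filterS (@nbhsx_ballx _ R t _ dq) => s; rewrite -ball_normE /= => hs.
  apply: hd; rewrite opprD addrACA subrr add0r -mulrBr -rmorphB rnormM rnorm_real.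
  rewrite (@le_lt_trans _ _ ((rnorm q + 1) * `|t - s|))//.
    by rewrite ler_wpM2r// lerDl.
  by rewrite mulrC -ltr_pdivlMr.
split=> t; apply/cvgrPdist_lt => e e0; apply: filterS (key t e e0) => s; apply: le_lt_trans.
  apply: le_trans (normr_Re_le _); by case: (H _) (H _) => ? ? [].
apply: le_trans (normr_Im_le _); by case: (H _) (H _) => ? ? [].
Qed.

(** The difference quotient multiplied out: the bound also covers [w = z], so no punctured
    neighbourhood has to be carried along. *)
Lemma cdiff_derivable (V : normedModType C) (H : C^o -> V) (z : C) : derivable H z 1 ->
  exists c : V, forall e : R, 0 < e -> exists2 d : R, 0 < d &
    forall w : C, rnorm (w - z) < d -> rnorm (H w - H z - (w - z) *: c) <= e * rnorm (w - z).
Proof.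
move=> dH; exists ('D_1 H z) => e e0.
have /cvg_rnormP/(_ _ e0)[d /= d0 hd] := dH.
have /nbhs_rnormP[d' d'0 hd'] := @nbhsx_ballx _ C^o 0 d d0.
exists d' => // w wz; have [->|wz0] := eqVneq w z.
  by rewrite !subrr scale0r subr0 !rnorm0 mulr0.
have wz1 : w - z != 0 by rewrite subr_eq0.
have := hd (w - z) _ wz1.
have /[swap]/[apply] : ball_ (Num.Def.normr : C^o -> C) (0 : C^o) d (w - z).
  by have := hd' (w - z); rewrite -ball_normE sub0r rnormN; apply.
rewrite /= /GRing.scale /= mulr1 subrK => h.
have -> : H w - H z - (w - z) *: 'D_1 H z = (w - z) *: - ('D_1 H z - (w - z)^-1 *: (H w - H z)).
  by rewrite opprB scalerBr scalerA divff// scale1r.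
by rewrite rnormZ rnormN mulrC ler_wpM2r ?rnorm_ge0// ltW.
Qed.

Lemma derivable_cdiff (V : normedModType C) (H : C^o -> V) (z : C) (c : V) :
  (forall e : R, 0 < e -> exists2 d : R, 0 < d &
    forall w : C, rnorm (w - z) < d -> rnorm (H w - H z - (w - z) *: c) <= e * rnorm (w - z)) ->
  derivable H z 1.
Proof.
move=> h; apply/cvg_ex; exists c; apply/cvg_rnormP => e e0.
have [d d0 hd] := h _ (divr_gt0 e0 (ltr0Sn _ 1)).
have /nbhs_normP[d' /= d'0 hd'] : nbhs (0 : C^o) [set x : C^o | rnorm x < d].
  by apply/nbhs_rnormP; exists d => // y; rewrite sub0r rnormN.
exists d' => // x x0 nx /=; rewrite /GRing.scale /= mulr1.
have xd : rnorm x < d by apply: hd'.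
have := hd (x + z); rewrite addrK => /(_ xd) h2.
have -> : c - x^-1 *: (H (x + z) - H z) = - (x^-1 *: (H (x + z) - H z - x *: c)).
  by rewrite [in RHS]scalerBr scalerA mulVf// scale1r opprB.
rewrite rnormN rnormZ rnormV -ltr_pdivlMl ?invr_gt0 ?rnorm_gt0// invrK.
by rewrite (le_lt_trans h2)// mulrC ltr_pM2l ?rnorm_gt0// ltr_pdivrMr// ltr_pMr// ltr1n.
Qed.

Lemma derivable_entire_continuous (H : C^o -> C^o) : (forall z, derivable H z 1) -> continuous H.
Proof. by move=> dH z; apply: differentiable_continuous; apply/derivable1_diffP. Qed.

(** The counterclockwise contour integral over the boundary of a rectangle: bottom, right, minus
    top, minus left, with [dz = 'i dt] on the vertical sides. *)
Definition rect_int (H : C -> C) (x x' y y' : R) : C :=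
  cint x x' (fun t => H (t +i* y)) + 'i * cint y y' (fun t => H (x' +i* t))
  - cint x x' (fun t => H (t +i* y')) - 'i * cint y y' (fun t => H (x +i* t)).

Lemma rect_int_eq (H K : C -> C) (x x' y y' : R) : (forall z, H z = K z) ->
  rect_int H x x' y y' = rect_int K x x' y y'.
Proof. by move=> /funext ->. Qed.

Lemma ccont_hor (H : C^o -> C^o) (y : R) : continuous H -> ccont (fun t => H (t +i* y)).
Proof.
move=> /(@ccont_line H (0 +i* y) 1); congr ccont; apply/funext => t; congr H.
by apply/eqP; rewrite eq_complex /=; apply/andP; split; apply/eqP; ring.
Qed.

Lemma ccont_ver (H : C^o -> C^o) (x : R) : continuous H -> ccont (fun t => H (x +i* t)).
Proof.
move=> /(@ccont_line H (x%:C) (0 +i* 1)); congr ccont; apply/funext => t; congr H.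
by apply/eqP; rewrite eq_complex /=; apply/andP; split; apply/eqP; ring.
Qed.

Lemma rect_int_splitx (H : C^o -> C^o) (c x x' y y' : R) : continuous H -> x <= c -> c <= x' ->
  rect_int H x x' y y' = rect_int H x c y y' + rect_int H c x' y y'.
Proof.
move=> cH xc cx'; rewrite /rect_int !(cint_split _ xc cx'); try exact: ccont_hor.
ring.
Qed.

Lemma rect_int_splity (H : C^o -> C^o) (c x x' y y' : R) : continuous H -> y <= c -> c <= y' ->
  rect_int H x x' y y' = rect_int H x x' y c + rect_int H x x' c y'.
Proof.
move=> cH yc cy'; rewrite /rect_int !(cint_split _ yc cy'); try exact: ccont_ver.
ring.
Qed.

Lemma rnormi : rnorm ('i : C) = 1.
Proof. by rewrite /rnorm normc_def /= expr0n expr1n add0r sqrtr1. Qed.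

Lemma rect_int_bound (H : C^o -> C^o) (x x' y y' M : R) : continuous H -> x <= x' -> y <= y' ->
  (forall s t, x <= s <= x' -> y <= t <= y' -> rnorm (H (s +i* t)) <= M) ->
  rnorm (rect_int H x x' y y') <= 4 * M * ((x' - x) + (y' - y)).
Proof.
move=> cH xx yy h; rewrite /rect_int.
have h1 (t : R) : y <= t <= y' -> rnorm (cint x x' (fun s => H (s +i* t))) <= 2 * M * (x' - x).
  by move=> ht; apply: cint_bound => //; [exact: ccont_hor|move=> s hs; exact: h].
have h2 (s : R) : x <= s <= x' -> rnorm ('i * cint y y' (fun t => H (s +i* t))) <= 2 * M * (y' - y).
  move=> hs; rewrite rnormM rnormi mul1r.
  by apply: cint_bound => //; [exact: ccont_ver|move=> t ht; exact: h].
have a1 := h1 y; have a2 := h1 y'; have b1 := h2 x; have b2 := h2 x'.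
rewrite !lexx !xx !yy in a1 a2 b1 b2.
have := a1 isT; have := a2 isT; have := b1 isT; have := b2 isT => {a1 a2 b1 b2} b2 b1 a2 a1.
apply: (le_trans (rnormB _ _)); apply: (le_trans (lerD (rnormB _ _) (lexx _))).
apply: (le_trans (lerD (lerD (rnormD _ _) (lexx _)) (lexx _))); lra.
Qed.

Lemma rect_intD (H K : C^o -> C^o) (x x' y y' : R) : continuous H -> continuous K ->
  rect_int (fun z => H z + K z) x x' y y' = rect_int H x x' y y' + rect_int K x x' y y'.
Proof.
by move=> cH cK; rewrite /rect_int !cintD; try (exact: ccont_hor || exact: ccont_ver); ring.
Qed.

Lemma cint_affine (a b : R) (p q : C) : a <= b ->
  cint a b (fun t => p + q * t%:C) = p * (b - a)%:C + q * ((b ^+ 2 - a ^+ 2) / 2)%:C.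
Proof.
have c1 (k : R) : continuous (fun _ : R => k) by move=> t; exact: cvg_cst.
have c2 (k : R) : continuous (fun t : R => k * t).
  by move=> t; apply: cvgM; [exact: cvg_cst|exact: cvg_id].
have key (k l : R) : a <= b -> rint a b (fun t => k + l * t) = k * (b - a) + l * ((b ^+ 2 - a ^+ 2) / 2).
  by move=> ab; rewrite rintD// rint_cst// (@rintZ _ _ _ l id) ?rint_id// => t; exact: cvg_id.
case: p q => p1 p2 [q1 q2] ab; rewrite /cint; apply/eqP; rewrite eq_complex /=.
rewrite [X in X == _](_ : _ = rint a b (fun t => p1 + q1 * t)); last by apply: rint_eq => t _; ring.
rewrite [X in _ && (X == _)](_ : _ = rint a b (fun t => p2 + q2 * t)); last by apply: rint_eq => t _; ring.
by rewrite !key//; apply/andP; split; apply/eqP; ring.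
Qed.

(** Cauchy's theorem for the tangent map of Goursat's argument; the four integrals are explicit. *)
Lemma rect_int_affine (p q : C) (x x' y y' : R) : x <= x' -> y <= y' ->
  rect_int (fun z => p + q * z) x x' y y' = 0.
Proof.
move=> xx yy; rewrite /rect_int.
have e1 (s t : R) : s +i* t = s%:C + 'i * t%:C.
  by apply/eqP; rewrite eq_complex /=; apply/andP; split; apply/eqP; ring.
have h1 (t : R) : cint x x' (fun s => p + q * (s +i* t)) = cint x x' (fun s => (p + q * 'i * t%:C) + q * s%:C).
  by apply: cint_eq => s _; rewrite e1; ring.
have h2 (s : R) : cint y y' (fun t => p + q * (s +i* t)) = cint y y' (fun t => (p + q * s%:C) + (q * 'i) * t%:C).
  by apply: cint_eq => t _; rewrite e1; ring.
rewrite !h1 !h2 !cint_affine//.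
rewrite !rmorphB !rmorphM !rmorphB /=.
have -> : ((2^-1 : R)%:C) = (2^-1 : C) by rewrite fmorphV rmorph_nat.
rewrite !expr2 !rmorphM /=.
ring.
Qed.

Lemma le_max4 (M : R) (a b c d : C) : M <= rnorm (a + b + (c + d)) ->
  [\/ M / 4 <= rnorm a, M / 4 <= rnorm b, M / 4 <= rnorm c | M / 4 <= rnorm d].
Proof.
move=> h.
have := le_trans h (le_trans (rnormD _ _) (lerD (rnormD _ _) (rnormD _ _))).
case: (leP (M / 4) (rnorm a)) => [|ha]; first by constructor 1.
case: (leP (M / 4) (rnorm b)) => [|hb]; first by constructor 2.
case: (leP (M / 4) (rnorm c)) => [|hc]; first by constructor 3.
case: (leP (M / 4) (rnorm d)) => [|hd]; first by constructor 4.
lra.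
Qed.

Lemma rect_int_quarter (H : C^o -> C^o) (M s t x y : R) : continuous H -> 0 <= s -> 0 <= t ->
  M <= rnorm (rect_int H x (x + s) y (y + t)) ->
  exists x1 y1, [/\ x <= x1, x1 + s / 2 <= x + s, y <= y1, y1 + t / 2 <= y + t &
    M / 4 <= rnorm (rect_int H x1 (x1 + s / 2) y1 (y1 + t / 2))].
Proof.
move=> cH s0 t0; rewrite (@rect_int_splitx _ (x + s / 2))//; try lra.
rewrite (@rect_int_splity _ (y + t / 2) x (x + s / 2))//; try lra.
rewrite (@rect_int_splity _ (y + t / 2) (x + s / 2) (x + s))//; try lra.
have -> : x + s = x + s / 2 + s / 2 by field.
have -> : y + t = y + t / 2 + t / 2 by field.
case/le_max4 => h; [exists x, y|exists x, (y + t / 2)|exists (x + s / 2), y|exists (x + s / 2), (y + t / 2)];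
  by split=> //; lra.
Qed.

Lemma nested_intervals (s : R) (x : nat -> R) : 0 <= s ->
  (forall n, x n <= x n.+1 /\ x n.+1 + s / 2 ^+ n.+1 <= x n + s / 2 ^+ n) ->
  exists z, forall n, x n <= z <= x n + s / 2 ^+ n.
Proof.
move=> s0 h.
have mono n m : (n <= m)%N -> x n <= x m.
  by move=> /subnK <-; elim: (m - n)%N => // k; rewrite addSn => /le_trans; apply; case: (h (k + n)%N).
have mono2 n m : (n <= m)%N -> x m + s / 2 ^+ m <= x n + s / 2 ^+ n.
  move=> /subnK <-; elim: (m - n)%N => // k; rewrite addSn => h2; apply: le_trans h2.
  by case: (h (k + n)%N).
have sn n : 0 <= s / 2 ^+ n by rewrite divr_ge0// exprn_ge0.
have ub n m : x m <= x n + s / 2 ^+ n.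
  case: (leqP n m) => nm; first by rewrite (le_trans _ (mono2 _ _ nm))// lerDl.
  by rewrite (le_trans (mono _ _ (ltnW nm)))// lerDl.
exists (sup (range x)) => n; apply/andP; split.
  apply: ub_le_sup; last by exists n.
  by exists (x 0%N + s / 2 ^+ 0) => _ [m _ <-].
by apply: ge_sup; [exists (x 0%N); exists 0%N|move=> _ [m _ <-]].
Qed.

(** Repeated quartering keeps a rectangle whose contour integral is at least [M / 4 ^ n]. Near the
    common point, [H] minus its tangent map is small relative to the size of the rectangle, and the
    perimeter contributes the same size once more; both sizes are of order [2 ^ -n], so [M] is
    arbitrarily small. *)
Lemma goursat (H : C^o -> C^o) (x y s t : R) : (forall z, derivable H z 1) ->
  0 <= s -> 0 <= t -> rect_int H x (x + s) y (y + t) = 0.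
Proof.
move=> dH s0 t0; have cH := derivable_entire_continuous dH.
set M := rnorm (rect_int H x (x + s) y (y + t)).
(* A state is the generation together with the lower left corner; the side lengths follow from the
   generation. *)
pose P (p : nat * (R * R)) := M / 4 ^+ p.1 <=
  rnorm (rect_int H p.2.1 (p.2.1 + s / 2 ^+ p.1) p.2.2 (p.2.2 + t / 2 ^+ p.1)).
pose T := {p : nat * (R * R) | P p}.
pose next (p q : T) := [/\ (sval q).1 = (sval p).1.+1,
   (sval p).2.1 <= (sval q).2.1 /\ (sval q).2.1 + s / 2 ^+ (sval q).1 <= (sval p).2.1 + s / 2 ^+ (sval p).1 &
   (sval p).2.2 <= (sval q).2.2 /\ (sval q).2.2 + t / 2 ^+ (sval q).1 <= (sval p).2.2 + t / 2 ^+ (sval p).1].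
have sn (u : R) n : 0 <= u -> 0 <= u / 2 ^+ n by move=> u0; rewrite divr_ge0// exprn_ge0.
have half (u : R) n : u / 2 ^+ n / 2 = u / 2 ^+ n.+1 by rewrite exprSr invfM mulrA.
have [p0 p00] : {p0 : T | (sval p0).1 = 0%N /\ (sval p0).2 = (x, y)}.
  have h : P (0%N, (x, y)) by rewrite /P /= !expr0 !divr1.
  by exists (exist (fun p => is_true (P p)) _ h).
have stepT (p : T) : {q : T | next p q}.
  apply: cid; case: p => [[n [a b]] hP].
  have := rect_int_quarter cH (sn _ n s0) (sn _ n t0) hP.
  move=> [a1 [b1 [h1 h2 h3 h4 h5]]].
  have hq : P (n.+1, (a1, b1)).
    by move: h5; rewrite /P /= -mulrA -invfM -exprSr !half.
  by exists (exist (fun p => is_true (P p)) _ hq); split => //=; split => //; rewrite -half.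
have [f [f0 fS]] := dependent_choice stepT p0.
have f1 n : (sval (f n)).1 = n by elim: n => [|n IH]; [rewrite f0; case: p00|have [-> _ _] := fS n; rewrite IH].
have [a ha] : exists a, forall n, (sval (f n)).2.1 <= a <= (sval (f n)).2.1 + s / 2 ^+ n.
  by apply: nested_intervals => // n; have [_ h _] := fS n; move: h; rewrite !f1.
have [b hb] : exists b, forall n, (sval (f n)).2.2 <= b <= (sval (f n)).2.2 + t / 2 ^+ n.
  by apply: nested_intervals => // n; have [_ _ h] := fS n; move: h; rewrite !f1.
have [c hc] := cdiff_derivable (dH (a +i* b)).
apply: rnorm_lt_eps_eq0 => e e0; rewrite -/M.
(* The final estimate is [4 * (e / k) * r ^ 2 * 4 ^ n] with [r * 2 ^ n = s + t], so this [k] brings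
   it below [e]; the [+ 1] keeps [k] positive for a degenerate rectangle. *)
have k0 : 0 < 4 * (s + t + 1) ^+ 2 by rewrite mulr_gt0// exprn_gt0//; lra.
have [d d0 hd] := hc _ (divr_gt0 e0 k0).
have [n hn] : exists n, (s + t) / 2 ^+ n < d.
  have /archi_boundP : 0 <= (s + t + 1) / d by rewrite divr_ge0//; lra.
  set n := Num.Def.archi_bound _ => hn.
  exists n; rewrite ltr_pdivrMr ?exprn_gt0//.
  move: hn; rewrite ltr_pdivrMr// mulrC => hn.
  apply: (@le_lt_trans _ _ (s + t + 1)); first by rewrite lerDl.
  apply: (lt_le_trans hn); rewrite ler_pM2l//.
  by rewrite -natrX ler_nat ltnW// ltn_expl.
have := svalP (f n); rewrite /P f1; move: (ha n) (hb n); set a1 := (sval (f n)).2.1; set b1 := (sval (f n)).2.2.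
move=> {}ha {}hb hM.
set r := (s + t) / 2 ^+ n in hn.
have r0 : 0 <= r by apply: sn; clear - s0 t0; lra.
(* The tangent map of [H] at the common point; its contour integral vanishes, so it may be
   subtracted. *)
pose A z := (H (a +i* b) - (a +i* b) * c) + c * z.
have dA (z : C^o) : derivable (A : C^o -> C^o) z 1.
  apply: derivableD; first exact: derivable_cst.
  by apply: derivableM; [exact: derivable_cst|exact: derivable_id].
have cA := derivable_entire_continuous dA.
have cHA : continuous ((fun z => H z - A z) : C^o -> C^o).
  by apply: derivable_entire_continuous => z; apply: derivableB; [exact: dH|exact: dA].
have rE : r = s / 2 ^+ n + t / 2 ^+ n by rewrite /r mulrDl.
have se := sn _ n s0; have te := sn _ n t0.
have HE : rect_int H a1 (a1 + s / 2 ^+ n) b1 (b1 + t / 2 ^+ n) =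
  rect_int (fun z => H z - A z) a1 (a1 + s / 2 ^+ n) b1 (b1 + t / 2 ^+ n).
  have A0 : rect_int A a1 (a1 + s / 2 ^+ n) b1 (b1 + t / 2 ^+ n) = 0 by apply: rect_int_affine; clear - se te; lra.
  rewrite -[RHS]addr0 -A0 -rect_intD//.
  by apply: rect_int_eq => z; rewrite subrK.
have bd : rnorm (rect_int H a1 (a1 + s / 2 ^+ n) b1 (b1 + t / 2 ^+ n)) <=
   4 * (e / (4 * (s + t + 1) ^+ 2) * r) * r.
  rewrite HE.
  apply: (le_trans (rect_int_bound (M := e / (4 * (s + t + 1) ^+ 2) * r) cHA _ _ _)); try by clear - se te; lra.
    move=> u v hu hv.
    have dist : rnorm ((u +i* v) - (a +i* b)) <= r.
      rewrite (le_trans (rnorm_le_ReIm _))//= rE lerD// ler_norml; clear - ha hb hu hv; lra.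
    have -> : H (u +i* v) - A (u +i* v) = H (u +i* v) - H (a +i* b) - ((u +i* v) - (a +i* b)) *: c.
      by rewrite /A /GRing.scale /=; ring.
    apply: (le_trans (hd _ (le_lt_trans dist hn))).
    by rewrite ler_pM2l// divr_gt0.
  rewrite le_eqVlt; apply/orP; left; apply/eqP; rewrite rE; ring.
have {}bd := le_trans hM bd.
have p4 : 0 < (4 : R) ^+ n by rewrite exprn_gt0.
move: bd; rewrite ler_pdivrMr// => bd; apply: (le_trans bd).
have r2 : r ^+ 2 * 4 ^+ n = (s + t) ^+ 2.
  have h2 : (4 : R) ^+ n = (2 ^+ n) ^+ 2 by rewrite exprAC; congr (_ ^+ _); ring.
  rewrite /r h2 -exprMn -mulrA mulVf ?mulr1// lt0r_neq0// exprn_gt0//.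
rewrite [X in X <= _](_ : _ = (e / (s + t + 1) ^+ 2) * (r ^+ 2 * 4 ^+ n)); last first.
  by field; clear - s0 t0; lra.
rewrite r2 mulrAC ler_pdivrMr; last by rewrite exprn_gt0//; clear - s0 t0; lra.
by rewrite ler_pM2l// ler_pXn2r// ?nnegrE; clear - s0 t0; lra.
Qed.

End Goursat.

(** * Entire functions: vanishing on the real line, periodic functions, and the exponential *)

Section EntireFunctions.
Variable R : realType.
Local Notation C := R[i].

Lemma derivable_affine (V : normedModType C) (H : C^o -> V) (k a : C) :
  (forall z, derivable H z 1) -> forall z, derivable (fun z : C^o => H (k * z + a) : V) z 1.
Proof.
move=> dH z; have [c hc] := cdiff_derivable (dH (k * z + a)).
apply: (@derivable_cdiff _ _ _ _ (k *: c)) => e e0.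
have k0 : 0 < rnorm k + 1 by rewrite ltr_wpDl// rnorm_ge0.
have [d d0 hd] := hc _ (divr_gt0 e0 k0).
exists (d / (rnorm k + 1)); first by rewrite divr_gt0.
move=> w hw.
have E : k * w + a - (k * z + a) = k * (w - z) by ring.
have le1 : rnorm (k * (w - z)) <= (rnorm k + 1) * rnorm (w - z).
  by rewrite rnormM ler_wpM2r ?rnorm_ge0// lerDl.
have := hd (k * w + a); rewrite E scalerA [k * _]mulrC => h.
rewrite [(w - z) * k]mulrC; rewrite [(w - z) * k]mulrC in h.
apply: (le_trans (h _)).
  by apply: (le_lt_trans le1); rewrite mulrC -ltr_pdivlMr.
apply: (@le_trans _ _ (e / (rnorm k + 1) * ((rnorm k + 1) * rnorm (w - z)))).
  by apply: ler_wpM2l le1; rewrite divr_ge0// ltW.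
by rewrite mulrA divfK// lt0r_neq0.
Qed.

Lemma derivable_mul (f g : C^o -> C^o) (z : C^o) : derivable f z 1 -> derivable g z 1 ->
  derivable ((fun z => f z * g z) : C^o -> C^o) z 1.
Proof. by move=> df dg; exact: (@derivableM _ _ f g z 1 df dg). Qed.

Lemma derivable_sub (V : normedModType C) (f g : C^o -> V) (z : C^o) : derivable f z 1 -> derivable g z 1 ->
  derivable ((fun z => f z - g z) : C^o -> V) z 1.
Proof. by move=> df dg; exact: (@derivableB _ _ _ f g z 1 df dg). Qed.

Lemma derivable_pow (f : C^o -> C^o) (n : nat) (z : C^o) : derivable f z 1 ->
  derivable ((fun z => f z ^+ n) : C^o -> C^o) z 1.
Proof.
move=> df; elim: n => [|n IH].
  have -> : (fun z => f z ^+ 0 : C^o) = cst 1 by apply/funext => x; rewrite expr0.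
  exact: derivable_cst.
have -> : (fun z => f z ^+ n.+1 : C^o) = (fun z => f z * f z ^+ n).
  by apply/funext => x; rewrite exprS.
exact: (@derivable_mul f (fun z => f z ^+ n)).
Qed.

Lemma ccont_bounded (a b : R) (g : R -> C) : a <= b -> ccont g ->
  exists2 M : R, 0 <= M & forall t, a <= t <= b -> rnorm (g t) <= M.
Proof.
move=> ab [g1 g2].
have bd (u : R -> R) : continuous u -> exists2 M : R, 0 <= M & forall t, a <= t <= b -> `|u t| <= M.
  move=> cu.
  have cv : {within `[a, b], continuous (fun t => `|u t|)}.
    by apply: continuous_subspaceT => t; apply: cvg_norm; exact: cu.
  have [c _ hc] := EVT_max ab cv.
  exists `|u c| => // t ht; apply: hc; rewrite in_itv/=; exact: ht.
have [M1 M10 h1] := bd _ g1; have [M2 M20 h2] := bd _ g2.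
exists (M1 + M2); first exact: addr_ge0.
by move=> t ht; rewrite (le_trans (rnorm_le_ReIm _))// lerD ?h1 ?h2.
Qed.

Lemma cint_bound_fun (a b : R) (g : R -> C) (m : R -> R) : ccont g -> continuous m ->
  (forall t, a <= t <= b -> rnorm (g t) <= m t) -> rnorm (cint a b g) <= 2 * rint a b m.
Proof.
move=> [g1 g2] cm h.
have key u : continuous u -> (forall t, a <= t <= b -> `|u t| <= m t) -> `|rint a b u| <= rint a b m.
  move=> cu hu; rewrite ler_norml; apply/andP; split.
    have -> : - rint a b m = rint a b (fun t => -1 * m t) by rewrite rintZ// mulN1r.
    apply: rint_le => //.
      by move=> t; apply: cvgM; [exact: cvg_cst|exact: cm].
    by move=> t /hu; rewrite ler_norml mulN1r => /andP[].
  by apply: rint_le => // t /hu; rewrite ler_norml => /andP[].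
rewrite (le_trans (rnorm_le_ReIm _))//= mulr_natl mulr2n lerD//; apply: key => // t /h.
  exact: le_trans (normr_Re_le _).
exact: le_trans (normr_Im_le _).
Qed.

Lemma rnorm_i_sub (a b : C) : rnorm ('i * a - 'i * b) <= rnorm a + rnorm b.
Proof. by rewrite (le_trans (rnormB _ _))// !rnormM !rnormi !mul1r. Qed.

Lemma rnorm_le_addl (a b : C) : rnorm b <= rnorm (a + b) + rnorm a.
Proof. by have := rnormB (a + b) a; rewrite [a + b]addrC addrK. Qed.

Lemma geometric_small (C0 r e : R) : 0 <= r < 1 -> 0 < e -> exists n, C0 * r ^+ n < e.
Proof.
move=> /andP[r0 r1] e0.
have /cvgrPdist_lt/(_ _ e0)[n _ /(_ n (leqnn n))] : (fun n => C0 * r ^+ n) @ \oo --> (0 : R).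
  rewrite -[X in _ --> X](mulr0 C0); apply: cvgM; first exact: cvg_cst.
  by apply: cvg_expr; rewrite ger0_norm.
by rewrite /= sub0r normrN => h; exists n; rewrite (le_lt_trans (ler_norm _)).
Qed.

(* The kernel [(1 - (z - p)^2 / L^2)^N], with [p = 'i h], concentrates at [p] on the top
   side of the rectangle [-L, L] x [0, h] and decays exponentially on its vertical
   sides as soon as [L >= 5 h]. *)
Lemma entire_zero_on_line_pos (K : C^o -> C^o) (h : R) : (forall z, derivable K z 1) ->
  (forall t : R, K t%:C = 0) -> 0 < h -> K (0 +i* h) = 0.
Proof.
move=> dK K0 h0; have cK := derivable_entire_continuous dK.
pose L := 5 * h; have L0 : 0 < L by rewrite mulr_gt0.
have hL : 0 <= h by exact: ltW.
have LL : - L <= L by clear - L0; lra.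
have [M1 M10 hM1] := ccont_bounded LL (ccont_hor h cK).
have [M2 M20 hM2] := ccont_bounded hL (ccont_ver L cK).
have [M3 M30 hM3] := ccont_bounded hL (ccont_ver (- L) cK).
apply: rnorm_lt_eps_eq0 => e e0.
have e4 : 0 < e / 4 by lra.
have /cvg_rnormP/(_ _ e4)/nbhs_rnormP[d1 d10 hd1] := cK (0 +i* h).
pose d := Num.min d1 (L / 2).
have d0 : 0 < d by rewrite lt_min d10 divr_gt0.
have dL : d <= L / 2 by rewrite ge_min lexx orbT.
have dd1 : d <= d1 by rewrite ge_min lexx.
(* On the top side the base of the kernel is at most [r] for [|t| >= d] and at least [r'] for
   [0 <= t <= d / 2]. As [r < r'], errors of order [r ^ N] are negligible against the mass [W N],
   which is at least [d / 2 * r' ^ N]. *)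
pose r := 1 - d ^+ 2 / L ^+ 2; pose r' := 1 - (d / 2) ^+ 2 / L ^+ 2.
have dL2 : d ^+ 2 / L ^+ 2 <= 1 / 4.
  rewrite ler_pdivrMr ?exprn_gt0//.
  have : d ^+ 2 <= (L / 2) ^+ 2 by rewrite ler_pXn2r// nnegrE ?divr_ge0 ?ltW.
  by rewrite exprMn; clear; lra.
have dL20 : 0 < d ^+ 2 / L ^+ 2 by rewrite divr_gt0// exprn_gt0.
have r34 : 3 / 4 <= r by rewrite /r; clear - dL2; lra.
have r0 : 0 <= r by clear - r34; lra.
have r'E : r' = 1 - d ^+ 2 / L ^+ 2 / 4 by rewrite /r'; field; rewrite lt0r_neq0.
have rr' : r < r' by rewrite r'E /r; clear - dL20; lra.
have r'1 : r' < 1 by rewrite r'E; clear - dL20; lra.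
have r'0 : 0 < r' by exact: le_lt_trans rr'.
pose l : C := (L^-1)%:C.
(* The kernel is factored as a difference of squares, so that differentiability only involves affine
   maps. *)
pose q (N : nat) (z : C) : C := ((- l * z + (1 + l * (0 +i* h))) * (l * z + (1 - l * (0 +i* h)))) ^+ N.
have qE N z : q N z = (1 - (L^-2)%:C * (z - (0 +i* h)) ^+ 2) ^+ N.
  rewrite /q; congr (_ ^+ _); rewrite -exprVn rmorphXn /= -/l; ring.
have dq N (z : C^o) : derivable (q N : C^o -> C^o) z 1.
  apply: derivable_pow; apply: derivable_mul.
    exact: (@derivable_affine C^o id _ _ (fun z => @derivable_id _ _ z 1)).
  exact: (@derivable_affine C^o id _ _ (fun z => @derivable_id _ _ z 1)).
have dKq N (z : C^o) : derivable ((fun z => K z * q N z) : C^o -> C^o) z 1.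
  by apply: (@derivable_mul K (q N)); [exact: dK|exact: dq].
pose w N (t : R) : R := (1 - t ^+ 2 / L ^+ 2) ^+ N.
have qtop N t : q N (t +i* h) = (w N t)%:C.
  rewrite qE /w rmorphXn; congr (_ ^+ _).
  have -> : t +i* h - 0 +i* h = t%:C.
    by apply/eqP; rewrite eq_complex /=; apply/andP; split; apply/eqP; ring.
  by rewrite -rmorphXn -rmorphM -(rmorph1 (real_complex R)) -rmorphB; congr (_%:C); rewrite mulrC.
have w0 N t : - L <= t <= L -> 0 <= w N t <= 1.
  move=> ht; have t2 : t ^+ 2 <= L ^+ 2.
    by rewrite -(real_normK (num_real t)) ler_pXn2r ?nnegrE ?normr_ge0 ?(ltW L0)// ler_norml.
  have h1 : 0 <= 1 - t ^+ 2 / L ^+ 2 <= 1.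
    have : 0 <= t ^+ 2 / L ^+ 2 <= 1 by rewrite divr_ge0 ?sqr_ge0//= ler_pdivrMr ?exprn_gt0// mul1r.
    by clear; lra.
  by case/andP: h1 => a1 a2; rewrite /w exprn_ge0//= exprn_ile1.
have cw N : continuous (w N).
  move=> t; rewrite /w; apply: (@continuous_comp _ _ _ (fun t : R => 1 - t ^+ 2 / L ^+ 2) (fun x => x ^+ N)); last exact: exprn_continuous.
  by apply: cvgB; [exact: cvg_cst|apply: cvgM; [exact: exprn_continuous|exact: cvg_cst]].
pose W N := rint (- L) L (w N).
have Wge N : d / 2 * r' ^+ N <= W N.
  rewrite /W (@rint_split _ 0 (-L) L (w N))//; try by clear - L0; lra.
  rewrite (@rint_split _ (d / 2) 0 L (w N))//; try by clear - L0 d0 dL; lra.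
  have ge0 a b : - L <= a -> b <= L -> a <= b -> 0 <= rint a b (w N).
    move=> ha hb ab; have -> : (0 : R) = rint a b (fun=> 0) by rewrite rint_cst// mul0r.
    apply: rint_le => //; first by move=> t; exact: cvg_cst.
    by move=> t ht; have /andP[] : 0 <= w N t <= 1 by apply: w0; clear - ha hb ht; lra.
  have g1 := ge0 (- L) 0; have g2 := ge0 (d / 2) L.
  have h1 : d / 2 * r' ^+ N <= rint 0 (d / 2) (w N).
    rewrite -[X in X * _]subr0 mulrC -rint_cst//; last by clear - d0; lra.
    apply: rint_le => //; first by move=> t; exact: cvg_cst.
    move=> t ht; rewrite /w; apply: lerXn2r; rewrite ?nnegrE.
    - exact: ltW.
    - have : - L <= t <= L by clear - ht d0 dL L0; lra.
      by move=> /(w0 1%N); rewrite /w expr1 => /andP[].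
    - rewrite /r' lerD2l lerN2 ler_pM2r ?invr_gt0 ?exprn_gt0// ler_pXn2r ?nnegrE//; clear - ht d0; lra.
  by clear - g1 g2 h1 L0 d0 dL; lra.
(* Since [s ^ 2 = L ^ 2], the base of the kernel is [((t - h) ^ 2 - 2 i s (t - h)) / L ^ 2], of
   modulus at most [(h ^ 2 + 2 L h) / L ^ 2]. For [L = 5 h] this is [11 / 25], below
   [3 / 4 <= r]. *)
have vert N s (t : R) : 0 <= t <= h -> s = L \/ s = - L -> rnorm (q N (s +i* t)) <= r ^+ N.
  move=> ht hs; rewrite qE rnormX; apply: lerXn2r; rewrite ?nnegrE ?rnorm_ge0//.
  apply: (le_trans _ r34).
  have s2 : s * s = L * L by case: hs => ->; ring.
  have L20 : L * L != 0 by rewrite mulf_neq0// lt0r_neq0.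
  have -> : 1 - (L ^- 2)%:C * (s +i* t - 0 +i* h) ^+ 2 =
     ((t - h) ^+ 2 / L ^+ 2) +i* (- 2 * s * (t - h) / L ^+ 2).
    apply/eqP; rewrite eq_complex /= !expr2; apply/andP; split; apply/eqP; last by field; rewrite lt0r_neq0.
    by rewrite subr0 s2 mul0r subr0; field; rewrite lt0r_neq0.
  apply: (le_trans (rnorm_le_ReIm _)) => /=.
  rewrite !normrM !normfV !normrX (ger0_norm (ltW L0)) normrN.
  have -> : `|s| = L by case: hs => ->; rewrite ?normrN; exact: gtr0_norm.
  have th : `|t - h| <= h by rewrite ler_norml; clear - ht; lra.
  have nn := normr_ge0 (t - h).
  rewrite -mulrDl ler_pdivrMr ?exprn_gt0// normr_nat.
  have : `|t - h| ^+ 2 <= h ^+ 2 by rewrite ler_pXn2r ?nnegrE.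
  have : L * `|t - h| <= L * h by rewrite ler_wpM2l// ltW.
  by rewrite /L !expr2; clear - h0 nn; nra.
have wsmall N t : - L <= t <= L -> d <= `|t| -> w N t <= r ^+ N.
  move=> ht td; rewrite /w; apply: lerXn2r; rewrite ?nnegrE//.
    by have := w0 1%N t ht; rewrite /w expr1 => /andP[].
  rewrite /r lerD2l lerN2 ler_pM2r ?invr_gt0 ?exprn_gt0//.
  by rewrite -(real_normK (num_real t)) ler_pXn2r ?nnegrE// ltW.
have Kh : rnorm (K (0 +i* h)) <= M1 by apply: hM1; clear - L0; lra.
have alg (nK nVK nV W1 rN : R) : nVK <= 2 * (e / 4 * W1 + 2 * M1 * rN * (L - - L)) ->
    nV <= 2 * (M2 * rN) * h + 2 * (M3 * rN) * h -> nK <= nVK + nV ->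
    nK <= e / 2 * W1 + (8 * M1 * L + 2 * (M2 + M3) * h) * rN.
  by clear; lra.
have Wpos N : 0 < W N.
  by apply: lt_le_trans (Wge N); rewrite mulr_gt0 ?exprn_gt0// divr_gt0.
(* The contour integral of [K * q N] vanishes and so does its bottom side, hence the top side is a
   difference of vertical ones. Replacing [K] by [K (0 +i* h)] on the top costs at most
   [e / 4 * w N t] where [|t| < d] and [2 * M1 * r ^ N] elsewhere. *)
have main N : rnorm (K (0 +i* h)) * W N <= e / 2 * W N + (8 * M1 * L + 2 * (M2 + M3) * h) * r ^+ N.
  have LL0 : 0 <= L + L by rewrite addr_ge0// ltW.
  have := goursat (- L) 0 (dKq N) LL0 hL.
  rewrite add0r addrA addNr add0r /rect_int.
  have bottomE : cint (- L) L (fun t : R => K (t +i* 0) * q N (t +i* 0)) = 0.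
    rewrite (@cint_eq _ _ _ _ (fun t => 0 * (t%:C)))//.
      rewrite cintZ ?mul0r//; split => t; [exact: cvg_id|exact: cvg_cst].
    by move=> t _; rewrite (K0 t) !mul0r.
  move=> gE.
  have topE : cint (- L) L (fun t : R => K (t +i* h) * q N (t +i* h)) =
     'i * cint 0 h (fun t : R => K (L +i* t) * q N (L +i* t)) -
     'i * cint 0 h (fun t : R => K (- L +i* t) * q N (- L +i* t)).
    have alg2 (a b c z : C) : z = 0 -> z + a - b - c = 0 -> b = a - c.
      by move=> -> E; rewrite -[RHS]subr0 -E; ring.
    exact: alg2 bottomE gE.
  have cKq := derivable_entire_continuous (dKq N).
  have v1 : rnorm (cint 0 h (fun t : R => K (L +i* t) * q N (L +i* t))) <= 2 * (M2 * r ^+ N) * h.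
    rewrite -{2}[h]subr0; apply: cint_bound => //; first exact: (ccont_ver L cKq).
    move=> t ht; rewrite rnormM ler_pM ?rnorm_ge0//; [exact: hM2|by apply: vert => //; left].
  have v2 : rnorm (cint 0 h (fun t : R => K (- L +i* t) * q N (- L +i* t))) <= 2 * (M3 * r ^+ N) * h.
    rewrite -{2}[h]subr0; apply: cint_bound => //; first exact: (ccont_ver (- L) cKq).
    move=> t ht; rewrite rnormM ler_pM ?rnorm_ge0//; [exact: hM3|by apply: vert => //; right].
  have ccw : ccont (fun t => (w N t)%:C : C) by split; [exact: cw|move=> t; exact: cvg_cst].
  have WE : cint (- L) L (fun t => (w N t)%:C : C) = (W N)%:C.
    by rewrite /cint /= rint_cst// mul0r.
  have cc1 := ccont_hor h cKq.
  have cc2 : ccont (fun t => - K (0 +i* h) * (w N t)%:C) by apply: ccontZ.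
  have diff : rnorm (cint (- L) L (fun t => K (t +i* h) * q N (t +i* h) + - K (0 +i* h) * (w N t)%:C))
     <= 2 * rint (- L) L (fun t => e / 4 * w N t + 2 * M1 * r ^+ N).
    apply: cint_bound_fun.
    - split => t; rewrite /=.
      + have -> : (fun t0 : R => complex.Re (K (t0 +i* h) * q N (t0 +i* h) + - K (0 +i* h) * (w N t0)%:C)) =
          (fun t0 : R => complex.Re (K (t0 +i* h) * q N (t0 +i* h)) + complex.Re (- K (0 +i* h) * (w N t0)%:C)).
          by apply/funext => u; case: (_ * q N _) (- K _ * _) => ? ? [].
        by apply: cvgD; [exact: cc1.1|exact: cc2.1].
      + have -> : (fun t0 : R => complex.Im (K (t0 +i* h) * q N (t0 +i* h) + - K (0 +i* h) * (w N t0)%:C)) =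
          (fun t0 : R => complex.Im (K (t0 +i* h) * q N (t0 +i* h)) + complex.Im (- K (0 +i* h) * (w N t0)%:C)).
          by apply/funext => u; case: (_ * q N _) (- K _ * _) => ? ? [].
        by apply: cvgD; [exact: cc1.2|exact: cc2.2].
    - by move=> t; apply: cvgD; [apply: cvgM; [exact: cvg_cst|exact: cw]|exact: cvg_cst].
    - move=> t ht; rewrite qtop -mulrDl rnormM rnorm_real.
      have /andP[wt0 wt1] := w0 N t ht; rewrite ger0_norm//.
      have rN0 : 0 <= 2 * M1 * r ^+ N by rewrite !mulr_ge0// exprn_ge0.
      case: (ltP `|t| d) => td.
        have : rnorm (K (t +i* h) - K (0 +i* h)) <= e / 4.
          rewrite rdistC ltW//; apply: hd1.
          have -> : 0 +i* h - t +i* h = - t%:C.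
            by apply/eqP; rewrite eq_complex /=; apply/andP; split; apply/eqP; ring.
          by rewrite rnormN rnorm_real (lt_le_trans td).
        move=> hh; apply: (@le_trans _ _ (e / 4 * w N t)); last by rewrite lerDl.
        by rewrite ler_wpM2r.
      apply: (@le_trans _ _ (2 * M1 * r ^+ N)); last by rewrite lerDr mulr_ge0// ltW.
      apply: ler_pM => //; first exact: rnorm_ge0.
        apply: (le_trans (rnormB _ _)).
        by rewrite mulr_natl mulr2n lerD// hM1.
      exact: wsmall.
  rewrite cintD// cintZ// WE topE rintD in diff; last 2 first.
    by move=> t; apply: cvgM; [exact: cvg_cst|exact: cw].
    by move=> t; exact: cvg_cst.
  rewrite rintZ// rint_cst// -/(W N) in diff.
  have WN0 := ltW (Wpos N).
  have -> : rnorm (K (0 +i* h)) * W N = rnorm (- K (0 +i* h) * (W N)%:C).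
    by rewrite rnormM rnormN rnorm_real ger0_norm.
  set V := 'i * _ - _ in diff; set KW := - K _ * _ in diff *.
  apply: (alg _ _ (rnorm V) _ _ diff).
    by apply: (le_trans (rnorm_i_sub _ _)); apply: lerD; [exact: v1|exact: v2].
  exact: rnorm_le_addl.
have hrr : 0 <= r / r' < 1.
  by apply/andP; split; [rewrite divr_ge0// ltW|rewrite ltr_pdivrMr ?mul1r].
have e2 : 0 < e / 2 by rewrite divr_gt0.
have [N hN] := geometric_small ((8 * M1 * L + 2 * (M2 + M3) * h) / (d / 2)) hrr e2.
have r'N : 0 < r' ^+ N by rewrite exprn_gt0.
have WN := Wpos N.
rewrite -(ler_pM2r WN); apply: (le_trans (main N)).
have -> : e * W N = e / 2 * W N + e / 2 * W N by field.
rewrite lerD2l.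
apply: (@le_trans _ _ (e / 2 * (d / 2 * r' ^+ N))); last by rewrite ler_wpM2l// ltW.
have -> : (8 * M1 * L + 2 * (M2 + M3) * h) * r ^+ N =
  ((8 * M1 * L + 2 * (M2 + M3) * h) / (d / 2) * (r / r') ^+ N) * (d / 2 * r' ^+ N).
  rewrite expr_div_n; by field; rewrite !lt0r_neq0.
by rewrite ler_pM2r ?ltW// mulr_gt0// divr_gt0.
Qed.

(** A real translation moves the point to the imaginary axis, and [z |-> - z] reduces the lower half
    plane to the upper one. This is what makes analytic extensions unique. *)
Lemma entire_zero_on_line (K : C^o -> C^o) : (forall z, derivable K z 1) ->
  (forall t : R, K t%:C = 0) -> forall z, K z = 0.
Proof.
move=> dK K0 [a b].
pose Ka (k : C) : C^o -> C^o := fun z => K (k * z + a%:C).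
have dKa k z : derivable (Ka k) z 1 by apply: derivable_affine.
have [b0|b0|->] := ltgtP b 0; last exact: K0.
- have := @entire_zero_on_line_pos (Ka (-1)) (- b) (dKa (-1)); rewrite /Ka oppr_gt0 => h.
  have -> : a +i* b = -1 * (0 +i* - b) + a%:C.
    by apply/eqP; rewrite eq_complex /=; apply/andP; split; apply/eqP; ring.
  apply: h => // t; have -> : -1 * t%:C + a%:C = (a - t)%:C by rewrite rmorphB mulN1r addrC.
  exact: K0.
- have := @entire_zero_on_line_pos (Ka 1) b (dKa 1); rewrite /Ka => h.
  have -> : a +i* b = 1 * (0 +i* b) + a%:C.
    by apply/eqP; rewrite eq_complex /=; apply/andP; split; apply/eqP; ring.
  apply: h => // t; have -> : 1 * t%:C + a%:C = (a + t)%:C by rewrite rmorphD mul1r addrC.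
  exact: K0.
Qed.

(** Goursat on a rectangle one period wide: periodicity cancels the vertical sides. *)
Lemma cint_shift_periodic (H : C^o -> C^o) (T b : R) : (forall z, derivable H z 1) -> 0 <= T ->
  (forall z, H (z + T%:C) = H z) ->
  cint 0 T (fun t => H (t +i* b)) = cint 0 T (fun t => H t%:C).
Proof.
move=> dH T0 per.
have TE y : H (T +i* y) = H (0 +i* y).
  rewrite -(per (0 +i* y)); congr H.
  by apply/eqP; rewrite eq_complex /=; apply/andP; split; apply/eqP; ring.
have alg (p q r : C) : p + q - r - q = 0 -> r = p.
  by move=> h; rewrite -[LHS]addr0 -h; ring.
have [b0|b0] := leP 0 b.
  have := goursat 0 0 dH T0 b0; rewrite !add0r /rect_int.
  by rewrite (@cint_eq _ _ _ (fun t => H (T +i* t)) (fun t => H (0 +i* t)))// => /alg.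
have b0' : 0 <= - b by rewrite oppr_ge0 ltW.
have := goursat 0 b dH T0 b0'; rewrite !add0r subrr /rect_int.
by rewrite (@cint_eq _ _ _ (fun t => H (T +i* t)) (fun t => H (0 +i* t)))// => /alg ->.
Qed.

Definition expi (z : C) : C :=
  (expR (- complex.Im z))%:C * (cos (complex.Re z) +i* sin (complex.Re z)).

Lemma expiD z w : expi (z + w) = expi z * expi w.
Proof.
case: z w => a b [c d]; rewrite /expi /= opprD expRD cosD sinD rmorphM mulrACA; congr (_ * _).
by apply/eqP; rewrite eq_complex /=; apply/andP; split; apply/eqP; ring.
Qed.

Lemma expi0 : expi 0 = 1.
Proof. by rewrite /expi /= oppr0 expR0 cos0 sin0 mul1r. Qed.

Lemma expi_real (t : R) : expi t%:C = cos t +i* sin t.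
Proof. by rewrite /expi /= oppr0 expR0 mul1r. Qed.

Lemma expi_imag (b : R) : expi (0 +i* b) = (expR (- b))%:C.
Proof. by rewrite /expi /= cos0 sin0 mulr1. Qed.

Lemma derive_small (f : R -> R) (f' x e : R) : is_derive x 1 f f' -> 0 < e ->
  exists2 d, 0 < d & forall h, `|h| < d -> `|f (x + h) - f x - h * f'| <= e * `|h|.
Proof.
move=> [df fE] e0.
have : h^-1 *: (f (h *: 1 + x) - f x) @[h --> 0^'] --> f' by rewrite -fE.
move=> /cvgrPdist_lt/(_ _ e0)[d /= d0 hd]; exists d => // h hd'.
have [->|h0] := eqVneq h 0; first by rewrite addr0 subrr mul0r subrr !normr0 mulr0.
have := hd h; rewrite /= sub0r normrN => /(_ hd' h0).
rewrite /GRing.scale /= mulr1 [h + x]addrC => hh.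
have -> : f (x + h) - f x - h * f' = - (h * (f' - h^-1 * (f (x + h) - f x))).
  by rewrite mulrBr mulrA divff// mul1r; ring.
by rewrite normrN normrM mulrC ler_wpM2r// ltW.
Qed.

(** The functional equation [expiD] reduces the claim to the origin, where first order expansions of
    [cos], [sin] and [expR] at 0 suffice. *)
Lemma expi_derivable z : derivable (expi : C^o -> C^o) z 1.
Proof.
apply: (@derivable_cdiff R C^o expi z (expi z * 'i)) => e e0.
pose k := 8 * (rnorm (expi z) + 1).
have r0 := rnorm_ge0 (expi z).
have k0 : 0 < k by rewrite /k mulr_gt0// ltr_wpDl.
pose e1 := Num.min (e / k) 1.
have e10 : 0 < e1 by rewrite lt_min divr_gt0/=.
have e11 : e1 <= 1 by rewrite ge_min lexx orbT.
have e1k : e1 <= e / k by rewrite ge_min lexx.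
have [d1 d10 h1] := derive_small (is_derive_cos (0 : R)) e10.
have [d2 d20 h2] := derive_small (is_derive_sin (0 : R)) e10.
have [d3 d30 h3] := derive_small (is_derive_expR (0 : R)) e10.
pose d := Num.min (Num.min d1 d2) (Num.min d3 (e1 / 4)).
exists d; first by rewrite !lt_min d10 d20 d30 divr_gt0.
move=> w; rewrite !lt_min => /andP[/andP[hd1 hd2] /andP[hd3 hd4]].
move Eu : (w - z) => u in hd1 hd2 hd3 hd4 *.
have -> : w = z + u by rewrite -Eu addrC subrK.
rewrite expiD /GRing.scale /=.
have -> : expi z * expi u - expi z - u * (expi z * 'i) = expi z * (expi u - 1 - u * 'i) by ring.
case: u {Eu} hd1 hd2 hd3 hd4 => x y hd1 hd2 hd3 hd4.
have xr := normr_Re_le (x +i* y); have yr := normr_Im_le (x +i* y); rewrite /= in xr yr.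
set r := rnorm (x +i* y) in hd1 hd2 hd3 hd4 xr yr *.
have rr0 : 0 <= r by exact: rnorm_ge0.
have := h1 x (le_lt_trans xr hd1); have := h2 x (le_lt_trans xr hd2).
have := h3 (- y); rewrite normrN => /(_ (le_lt_trans yr hd3)).
rewrite !add0r expR0 cos0 sin0 oppr0 mulr0 mulr1 !subr0 mulr1 ?addr0.
set E := expR (- y); set c := cos x; set s := sin x => hE hs hc.
have -> : expi (x +i* y) - 1 - (x +i* y) * 'i = (E * c - 1 + y) +i* (E * s - x).
  by apply/eqP; rewrite eq_complex /= -/E -/c -/s; apply/andP; split; apply/eqP; ring.
have e1x : e1 * `|x| <= e1 * r by rewrite ler_wpM2l// ltW.
have e1y : e1 * `|y| <= e1 * r by rewrite ler_wpM2l// ltW.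
have e1r0 : 0 <= e1 * r by rewrite mulr_ge0// ltW.
have e1r : e1 * r <= r by rewrite ler_piMl.
have E2 : `|E - 1| <= 2 * r.
  have -> : E - 1 = (E - 1 - - y) + - y by ring.
  apply: (le_trans (ler_normD _ _)); rewrite normrN; clear - hE e1y e1r yr; lra.
have E3 : `|E| <= 2.
  have -> : E = (E - 1) + 1 by ring.
  apply: (le_trans (ler_normD _ _)); rewrite normr1; clear - E2 hd4 e11; lra.
have re : `|E * c - 1 + y| <= 3 * (e1 * r).
  have -> : E * c - 1 + y = E * (c - 1) + (E - 1 - - y) by ring.
  apply: (le_trans (ler_normD _ _)); rewrite normrM.
  have : `|E| * `|c - 1| <= 2 * (e1 * r) by rewrite ler_pM// (le_trans hc).
  by move=> b; clear - b hE e1y; lra.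
have im : `|E * s - x| <= 3 * (e1 * r).
  have -> : E * s - x = E * (s - x) + (E - 1) * x by ring.
  apply: (le_trans (ler_normD _ _)); rewrite !normrM.
  have : `|E| * `|s - x| <= 2 * (e1 * r) by rewrite ler_pM// (le_trans hs).
  have : `|E - 1| * `|x| <= (2 * r) * r by rewrite ler_pM.
  have : r * r <= e1 / 4 * r by rewrite ler_wpM2r// ltW.
  by move=> b1 b2 b3; clear - b1 b2 b3 e1r0; lra.
rewrite rnormM; apply: (@le_trans _ _ (rnorm (expi z) * (6 * (e1 * r)))).
  rewrite ler_wpM2l//; apply: (le_trans (rnorm_le_ReIm _)) => /=; clear - re im; lra.
have kr : rnorm (expi z) * 6 <= k by rewrite /k; clear - r0; lra.
have : e1 * k <= e by rewrite -ler_pdivlMr.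
move=> ek; rewrite !mulrA; apply: ler_wpM2r => //.
apply: (@le_trans _ _ (k * e1)); last by rewrite mulrC.
by rewrite ler_pM2r.
Qed.

Lemma expi_int_2pi (k : int) : expi (k%:~R * (2 * pi)%:C) = 1.
Proof.
have expin (n : nat) : expi (n%:R * (2 * pi)%:C) = 1.
  elim: n => [|n IH]; first by rewrite mul0r expi0.
  rewrite -addn1 natrD mulrDl expiD IH mul1r mul1r expi_real.
  by rewrite mulr_natl mulr2n -mulr2n cos2pi sin2pi.
case: k => n; first exact: expin.
apply: (@mulIf _ (expi (n.+1%:R * (2 * pi)%:C))); first by rewrite expin oner_eq0.
by rewrite -expiD NegzE rmorphN /= mulNr addNr expi0 expin mul1r.
Qed.

(* The integrals of [expi (- k z) * G z] over one period agree on the two lines by Cauchy's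
   theorem; up to the errors they are [A] and [expR (k b) * B], times the period. *)
Lemma kms_boundary (G : C^o -> C^o) (k : int) (A B : C) (b e1 e2 : R) :
  (forall z, derivable G z 1) ->
  (forall t : R, G (t + 2 * pi)%:C = G t%:C) ->
  (forall t : R, rnorm (G t%:C - expi (k%:~R * t%:C) * A) <= e1) ->
  (forall t : R, rnorm (G (t +i* b) - expi (k%:~R * t%:C) * B) <= e2) ->
  rnorm (A - (expR (k%:~R * b))%:C * B) <= 2 * e1 + 2 * expR (k%:~R * b) * e2.
Proof.
move=> dG per h1 h2.
have pi0 : 0 < 2 * pi :> R by rewrite mulr_gt0// pi_gt0.
have kE (x : R) : (k%:~R : C) * x%:C = (k%:~R * x)%:C by rewrite rmorphM rmorph_int.
have expi2pi : expi (- k%:~R * (2 * pi)%:C) = 1 by rewrite -mulrNz expi_int_2pi.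
pose H (z : C) : C := expi (- k%:~R * z) * G z.
have dE z : derivable ((fun z => expi (- k%:~R * z)) : C^o -> C^o) z 1.
  have -> : (fun z => expi (- k%:~R * z)) = (fun z => expi (- k%:~R * z + 0)).
    by apply/funext => x; rewrite addr0.
  by apply: (@derivable_affine C^o expi) => ?; exact: expi_derivable.
have dH z : derivable (H : C^o -> C^o) z 1 by apply: derivable_mul; [exact: dE|exact: dG].
(* Periodicity is given on the real line only; the identity theorem spreads it to the plane. *)
have Gper z : G (z + (2 * pi)%:C) = G z.
  apply/eqP; rewrite -subr_eq0; apply/eqP.
  apply: (@entire_zero_on_line (fun z => G (z + (2 * pi)%:C) - G z)) => [{}z|t].
    apply: derivable_sub => //.
    have -> : (fun z => G (z + (2 * pi)%:C)) = (fun z => G (1 * z + (2 * pi)%:C)).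
      by apply/funext => x; rewrite mul1r.
    exact: derivable_affine.
  by rewrite -rmorphD per subrr.
have Hper z : H (z + (2 * pi)%:C) = H z.
  by rewrite /H Gper mulrDr expiD expi2pi mulr1.
have shift := cint_shift_periodic b dH (ltW pi0) Hper.
have cH := derivable_entire_continuous dH.
have expiV (t : R) : rnorm (expi (- k%:~R * t%:C)) = 1.
  rewrite mulNr kE -rmorphN expi_real -[LHS]ger0_norm ?rnorm_ge0//.
  by apply/eqP; rewrite -sqrp_eq1 ?normr_ge0// ger0_norm ?rnorm_ge0// sqr_rnorm /= cos2Dsin2.
have expiK (t : R) : expi (- k%:~R * t%:C) * expi (k%:~R * t%:C) = 1.
  by rewrite -expiD mulNr addNr expi0.
have est (f : R -> C) (D : C) (e : R) : ccont f -> (forall t, rnorm (f t - D) <= e) ->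
    rnorm (cint 0 (2 * pi) f - (2 * pi)%:C * D) <= 2 * e * (2 * pi).
  move=> cf hf.
  have cc : ccont (fun _ : R => D) by split => t; exact: cvg_cst.
  have -> : (2 * pi)%:C * D = cint 0 (2 * pi) (fun=> D).
    rewrite /cint !rint_cst ?(ltW pi0)// subr0; case: (D) => x y.
    by apply/eqP; rewrite eq_complex /=; apply/andP; split; apply/eqP; ring.
  have <- : cint 0 (2 * pi) (fun t => f t + -1 * D) = cint 0 (2 * pi) f - cint 0 (2 * pi) (fun=> D).
    apply: etrans (cintD 0 (2 * pi) cf (ccontZ (-1) cc)) _; rewrite (cintZ 0 (2 * pi) (-1) cc) mulN1r //.
  rewrite -[X in _ <= _ * X]subr0; apply: cint_bound; [|exact: ltW|].
    have := ccontZ (-1) cc; case: cf => f1 f2 [g1 g2]; split => t.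
      have -> : (fun t => complex.Re (f t + -1 * D)) = (fun t => complex.Re (f t) + complex.Re (-1 * D)).
        by apply/funext => s; case: (f s) (-1 * D) => ? ? [].
      by apply: cvgD; [exact: f1|exact: cvg_cst].
    have -> : (fun t => complex.Im (f t + -1 * D)) = (fun t => complex.Im (f t) + complex.Im (-1 * D)).
      by apply/funext => s; case: (f s) (-1 * D) => ? ? [].
    by apply: cvgD; [exact: f2|exact: cvg_cst].
  by move=> t _; rewrite mulN1r.
have b1 : rnorm (cint 0 (2 * pi) (fun t => H t%:C) - (2 * pi)%:C * A) <= 2 * e1 * (2 * pi).
  apply: est; first exact: (ccont_hor 0 cH).
  move=> t; have -> : H t%:C - A = expi (- k%:~R * t%:C) * (G t%:C - expi (k%:~R * t%:C) * A).
    by rewrite mulrBr mulrA expiK mul1r.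
  by rewrite rnormM expiV mul1r.
have alg (E x y g D : C) : x * y = 1 -> E * x * g - E * D = E * (x * (g - y * D)).
  by move=> xy; rewrite -[D in LHS]mul1r -xy; ring.
have b2 : rnorm (cint 0 (2 * pi) (fun t => H (t +i* b)) - (2 * pi)%:C * ((expR (k%:~R * b))%:C * B)) <=
    2 * (expR (k%:~R * b) * e2) * (2 * pi).
  apply: est; first exact: (ccont_hor b cH).
  move=> t.
  have eE : expi (- k%:~R * (t +i* b)) = (expR (k%:~R * b))%:C * expi (- k%:~R * t%:C).
    have -> : - k%:~R * (t +i* b) = (0 +i* (- (k%:~R * b))) + - k%:~R * t%:C.
      have -> : t +i* b = t%:C + 'i * b%:C by apply/eqP; rewrite eq_complex /=; apply/andP; split; apply/eqP; ring.
      have -> : 0 +i* - (k%:~R * b) = - ('i * (k%:~R * b)%:C).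
        by apply/eqP; rewrite eq_complex /=; apply/andP; split; apply/eqP; ring.
      rewrite -kE; ring.
    by rewrite expiD expi_imag opprK.
  have -> : H (t +i* b) - (expR (k%:~R * b))%:C * B =
     (expR (k%:~R * b))%:C * (expi (- k%:~R * t%:C) * (G (t +i* b) - expi (k%:~R * t%:C) * B)).
    by rewrite /H eE; exact: alg (expiK t).
  rewrite rnormM rnormM expiV mul1r rnorm_real ger0_norm ?expR_ge0//.
  by rewrite ler_wpM2l ?expR_ge0.
rewrite shift in b2.
rewrite -(ler_pM2l pi0) -[X in X * rnorm _](ger0_norm (ltW pi0)) -rnorm_real -rnormM mulrBr.
rewrite (le_trans (rdist_triangle (cint 0 (2 * pi) (fun t : R => H t%:C)) _ _))//.
rewrite rdistC; apply: (le_trans (lerD b1 b2)).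
by rewrite le_eqVlt; apply/orP; left; apply/eqP; ring.
Qed.

End EntireFunctions.

(** * The Riemann sphere and rational maps *)

Section SphereTopology.
Variable R : realType.
Local Notation C := R[i].
Local Notation S2 := (sphere R).

Definition sinv (x : S2) : S2 :=
  if x is Some z then if z == 0 then None else Some z^-1 else Some 0.

Lemma sinvK : involutive sinv.
Proof.
case=> [z|] /=; last by rewrite eqxx.
by case: eqVneq => [->//|z0] /=; rewrite invr_eq0 (negPf z0) invrK.
Qed.

Lemma param_None (z : C) : param None z = sinv (param (Some 0) z).
Proof. by rewrite /= add0r. Qed.

Lemma sqr_ReIm_gt0 (z : C) : z != 0 -> 0 < complex.Re z ^+ 2 + complex.Im z ^+ 2.
Proof. by move=> z0; rewrite -sqr_rnorm exprn_gt0// rnorm_gt0. Qed.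

(** The map [z |-> 1 / z] is a half-turn of the sphere about its first axis, hence an isometry; it
    carries every local statement at 0 to infinity. *)
Lemma stereo_sinv (x : S2) : stereo (sinv x) = ((stereo x).1.1, - (stereo x).1.2, - (stereo x).2).
Proof.
case: x => [z|] /=; last by congr (_, _, _); rewrite /= ?expr0n /=; field.
case: eqVneq => [->|z0] /=; first by rewrite /= expr0n !addr0 mulr0 mul0r sub0r oppr0 divr1 opprK.
have n0 := sqr_ReIm_gt0 z0; case: z z0 n0 => a b z0 /= n0.
set n := a ^+ 2 + b ^+ 2 in n0 *.
have nn : n != 0 by rewrite lt0r_neq0.
have n1 : 1 + n != 0 by rewrite lt0r_neq0// addr_gt0.
have E : (a / n) ^+ 2 + (- b / n) ^+ 2 = n^-1.
  by rewrite !expr_div_n sqrrN -mulrDl -/n expr2 invfM mulrA mulfV ?mul1r.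
have ReE : complex.Re (a +i* b)^-1 = a / n by [].
have ImE : complex.Im (a +i* b)^-1 = - b / n by rewrite /= mulNr.
rewrite ?ReE ?ImE ?mulNr in E *; rewrite -?mulNr ?E.
rewrite /= -/n !mulNr E.
have n1' : n + 1 != 0 by rewrite addrC.
by congr (_, _, _); field; rewrite ?nn ?n1 ?n1'.
Qed.

Definition sdist_lt (x y : S2) (e : R) := [/\ `|(stereo x).1.1 - (stereo y).1.1| < e,
  `|(stereo x).1.2 - (stereo y).1.2| < e & `|(stereo x).2 - (stereo y).2| < e].

Lemma ball_sphereE (x y : S2) (e : R) : ball x e y <-> sdist_lt x y e.
Proof.
rewrite -[ball x e y]/(ball (stereo x) e (stereo y)).
by split; [move=> [[/= h1 h2] h3]|move=> [h1 h2 h3]]; split.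
Qed.

Lemma nbhs_sphereP (x : S2) (U : set S2) :
  nbhs x U <-> exists2 e : R, 0 < e & forall y, sdist_lt x y e -> U y.
Proof.
split=> [/nbhs_ballP[e /= e0 h]|[e e0 h]].
  by exists e => // y /ball_sphereE; exact: h.
by apply/nbhs_ballP; exists e => // y /ball_sphereE; exact: h.
Qed.

Lemma sdist_lt_sinv x y e : sdist_lt (sinv x) (sinv y) e <-> sdist_lt x y e.
Proof.
have E (u v : R) : `|- u - - v| = `|u - v| by rewrite -opprD normrN.
by rewrite /sdist_lt !stereo_sinv /= !E.
Qed.

Lemma nbhs_sinv (x : S2) (U : set S2) : nbhs (sinv x) U <-> nbhs x (sinv @^-1` U).
Proof.
split=> /nbhs_sphereP[e e0 h]; apply/nbhs_sphereP; exists e => // y hy.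
  by apply: h; apply/sdist_lt_sinv.
by rewrite -(sinvK y); apply: h; apply/sdist_lt_sinv; rewrite sinvK.
Qed.

Lemma stereo_Some_near (a : C) (e : R) : 0 < e ->
  exists2 d : R, 0 < d & forall b, rnorm (a - b) < d -> sdist_lt (Some a) (Some b) e.
Proof.
move=> e0; pose p : R * R := (complex.Re a, complex.Im a).
have c1x : (fun q : R * R => q.1) @ p --> p.1 by exact: cvg_fst.
have c2x : (fun q : R * R => q.2) @ p --> p.2 by exact: cvg_snd.
have cs : (fun q : R * R => q.1 ^+ 2 + q.2 ^+ 2) @ p --> p.1 ^+ 2 + p.2 ^+ 2.
  by apply: cvgD; rewrite !expr2; apply: cvgM.
have c1 : (fun q : R * R => (1 + (q.1 ^+ 2 + q.2 ^+ 2))^-1) @ p --> (1 + (p.1 ^+ 2 + p.2 ^+ 2))^-1.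
  apply: cvgV; first by rewrite lt0r_neq0// ltr_pwDl// addr_ge0 ?sqr_ge0.
  by apply: cvgD; [exact: cvg_cst|exact: cs].
have cX : (fun q : R * R => 2 * q.1 / (1 + (q.1 ^+ 2 + q.2 ^+ 2))) @ p --> 2 * p.1 / (1 + (p.1 ^+ 2 + p.2 ^+ 2)).
  by apply: cvgM; [apply: cvgM; [exact: cvg_cst|exact: c1x]|exact: c1].
have cY : (fun q : R * R => 2 * q.2 / (1 + (q.1 ^+ 2 + q.2 ^+ 2))) @ p --> 2 * p.2 / (1 + (p.1 ^+ 2 + p.2 ^+ 2)).
  by apply: cvgM; [apply: cvgM; [exact: cvg_cst|exact: c2x]|exact: c1].
have cZ : (fun q : R * R => ((q.1 ^+ 2 + q.2 ^+ 2) - 1) / (1 + (q.1 ^+ 2 + q.2 ^+ 2))) @ p -->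
    ((p.1 ^+ 2 + p.2 ^+ 2) - 1) / (1 + (p.1 ^+ 2 + p.2 ^+ 2)).
  by apply: cvgM; [apply: cvgB; [exact: cs|exact: cvg_cst]|exact: c1].
move/cvgrPdist_lt/(_ _ e0) : cX => h1; move/cvgrPdist_lt/(_ _ e0) : cY => h2.
move/cvgrPdist_lt/(_ _ e0) : cZ => h3.
have : nbhs p [set q : R * R | [/\ `|2 * p.1 / (1 + (p.1 ^+ 2 + p.2 ^+ 2)) - 2 * q.1 / (1 + (q.1 ^+ 2 + q.2 ^+ 2))| < e,
    `|2 * p.2 / (1 + (p.1 ^+ 2 + p.2 ^+ 2)) - 2 * q.2 / (1 + (q.1 ^+ 2 + q.2 ^+ 2))| < e &
    `|((p.1 ^+ 2 + p.2 ^+ 2) - 1) / (1 + (p.1 ^+ 2 + p.2 ^+ 2)) - ((q.1 ^+ 2 + q.2 ^+ 2) - 1) / (1 + (q.1 ^+ 2 + q.2 ^+ 2))| < e]].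
  by near=> q; split; near: q.
move=> /nbhs_ballP[d /= d0 hd].
exists d => // b ab.
have [|? [? ?]] := hd (complex.Re b, complex.Im b); last by split.
split; rewrite /ball /=; apply: le_lt_trans ab.
  by apply: le_trans (normr_Re_le _); case: (a) (b) => ? ? [].
by apply: le_trans (normr_Im_le _); case: (a) (b) => ? ? [].
Unshelve. all: by end_near.
Qed.

Lemma nbhs_SomeP (a : C) (U : set S2) :
  nbhs (Some a : S2) U <-> exists2 d : R, 0 < d & forall z, rnorm z < d -> U (Some (a + z)).
Proof.
split.
  move=> /nbhs_sphereP[e e0 h].
  have [d d0 hd] := stereo_Some_near a e0.
  exists d => // z zd; apply: h; apply: hd.
  by rewrite opprD addrA subrr sub0r rnormN.
move=> [d d0 h]; apply/nbhs_sphereP.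
(* The inverse projection [(X, Y) / (1 - Z)] is continuous near [p], because [1 - Z] is
   [2 / (1 + |a| ^ 2)] there. *)
pose p : R * R * R := stereo (Some a).
pose n := complex.Re a ^+ 2 + complex.Im a ^+ 2.
have n0 : 0 <= n by rewrite addr_ge0 ?sqr_ge0.
have pE : 1 - p.2 = 2 / (1 + n) by rewrite /p /= -/n; field; rewrite lt0r_neq0// ltr_pwDl.
have p0 : 0 < 1 - p.2 by rewrite pE divr_gt0// ltr_pwDl.
have cu : (fun q : R * R * R => q.1.1 / (1 - q.2)) @ p --> p.1.1 / (1 - p.2).
  apply: cvgM; first by apply: (@cvg_comp _ _ _ fst fst _ (nbhs p.1)); [exact: cvg_fst|exact: cvg_fst].
  apply: cvgV; first exact: lt0r_neq0.
  by apply: cvgB; [exact: cvg_cst|exact: cvg_snd].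
have cv : (fun q : R * R * R => q.1.2 / (1 - q.2)) @ p --> p.1.2 / (1 - p.2).
  apply: cvgM; first by apply: (@cvg_comp _ _ _ fst snd _ (nbhs p.1)); [exact: cvg_fst|exact: cvg_snd].
  apply: cvgV; first exact: lt0r_neq0.
  by apply: cvgB; [exact: cvg_cst|exact: cvg_snd].
have d2 : 0 < d / 2 by rewrite divr_gt0.
have bE (b : C) : 1 - (stereo (Some b)).2 = 2 / (1 + (complex.Re b ^+ 2 + complex.Im b ^+ 2)).
  by rewrite /=; field; rewrite lt0r_neq0// ltr_pwDl// addr_ge0 ?sqr_ge0.
have inv1 (b : C) : (stereo (Some b)).1.1 / (1 - (stereo (Some b)).2) = complex.Re b.
  by rewrite bE /=; field; rewrite lt0r_neq0// ltr_pwDl// addr_ge0 ?sqr_ge0.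
have inv2 (b : C) : (stereo (Some b)).1.2 / (1 - (stereo (Some b)).2) = complex.Im b.
  by rewrite bE /=; field; rewrite lt0r_neq0// ltr_pwDl// addr_ge0 ?sqr_ge0.
move/cvgrPdist_lt/(_ _ d2) : cu => cu; move/cvgrPdist_lt/(_ _ d2) : cv => cv.
(* This keeps the point at infinity, where [Z = 1], out of the neighbourhood. *)
have cw : \forall q \near p, q.2 < 1.
  have : (fun q : R * R * R => q.2) @ p --> p.2 by exact: cvg_snd.
  by move=> /cvgr_lt; apply; rewrite -subr_gt0.
have : nbhs p [set q | [/\ `|p.1.1 / (1 - p.2) - q.1.1 / (1 - q.2)| < d / 2,
   `|p.1.2 / (1 - p.2) - q.1.2 / (1 - q.2)| < d / 2 & q.2 < 1]].
  by near=> q; split; near: q.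
move=> /nbhs_ballP[e /= e0 he]; exists e => // -[b|] hy; last first.
  have [] := he (stereo (None : option C)); last by rewrite /= ltxx.
  by case: hy => h1 h2 h3.
have [|] := he (stereo (Some b)); first by case: hy => h1 h2 h3.
rewrite /p !inv1 !inv2 => h1 h2 _.
rewrite -[b](subrK a) addrC; apply: h; rewrite rdistC.
rewrite (le_lt_trans (rnorm_le_ReIm _))// [d]splitr.
by move: h1 h2; case: (a) (b) => ? ? [? ?] /= h1 h2; rewrite ltrD.
Unshelve. all: by end_near.
Qed.

Lemma nbhs_paramP (x : S2) (U : set S2) :
  nbhs x U <-> exists2 d : R, 0 < d & forall z, rnorm z < d -> U (param x z).
Proof.
case: x => [a|]; first exact: nbhs_SomeP.
have -> : (None : S2) = sinv (Some 0) by rewrite /= eqxx.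
rewrite nbhs_sinv nbhs_SomeP; split=> -[d d0 h]; exists d => // z zd.
  by rewrite /sinv eqxx param_None; apply: h.
by have := h z zd; rewrite /sinv eqxx param_None.
Qed.

(** Points with the same image have the same neighbourhoods, whereas a small parameter disc around
    [x] misses any other point. *)
Lemma stereo_inj : injective (@stereo R).
Proof.
move=> x y h; have h0 : forall U, nbhs (x : S2) U -> U (y : S2).
  by move=> U /nbhs_sphereP[e e0]; apply; rewrite /sdist_lt h !subrr normr0.
apply: contrapT => xy.
suff [d d0 hd] : exists2 d : R, 0 < d & forall z, rnorm z < d -> param (x : S2) z <> y.
  have /h0 : nbhs (x : S2) [set u : S2 | u <> y] by apply/nbhs_paramP; exists d.
  exact.
case: x xy {h h0} => [a|] xy; case: y xy => [b|] xy //.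
- exists (rnorm (b - a)).
    by rewrite rnorm_gt0 subr_eq0; apply: contra_not_neq xy => ->.
  by move=> z zd [E]; move: zd; rewrite -E addrC addKr ltxx.
- by exists 1.
- have [->|b0] := eqVneq b 0.
    by exists 1 => // z _; rewrite /=; case: eqVneq => // z0 [/eqP]; rewrite invr_eq0 (negPf z0).
  exists (rnorm b^-1); first by rewrite rnorm_gt0 invr_eq0.
  by move=> z zd; rewrite /=; case: eqVneq => // z0 [E]; move: zd; rewrite -E invrK ltxx.
Qed.

Lemma sphere_hausdorff : hausdorff_space S2.
Proof.
move=> x y h; apply: stereo_inj.
have hR : hausdorff_space (R * R * R)%type by exact: norm_hausdorff.
apply: hR => A B nA nB.
have nx : nbhs x (@stereo R @^-1` A) by apply: (@initial_continuous _ _ (@stereo R) x).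
have ny : nbhs y (@stereo R @^-1` B) by apply: (@initial_continuous _ _ (@stereo R) y).
by have [z [Az Bz]] := h _ _ nx ny; exists (stereo z).
Qed.

Lemma stereo_sphere (x : S2) : (stereo x).1.1 ^+ 2 + (stereo x).1.2 ^+ 2 + (stereo x).2 ^+ 2 = 1.
Proof.
case: x => [z|] /=; last by rewrite expr0n expr1n !add0r.
by field; rewrite lt0r_neq0// ltr_pwDl// addr_ge0 ?sqr_ge0.
Qed.

Lemma stereo_onto (p : R * R * R) : p.1.1 ^+ 2 + p.1.2 ^+ 2 + p.2 ^+ 2 = 1 ->
  exists x : S2, stereo x = p.
Proof.
case: p => -[a b] c /= E; have [c1|c1] := eqVneq c 1.
  move: E; rewrite c1 expr1n => /eqP; rewrite -subr_eq0 addrK paddr_eq0 ?sqr_ge0// !sqrf_eq0.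
  by move=> /andP[/eqP-> /eqP->]; exists None.
have c10 : 1 - c != 0 by rewrite subr_eq0 eq_sym.
exists (Some ((a / (1 - c)) +i* (b / (1 - c)))) => /=.
have -> : (a / (1 - c)) ^+ 2 + (b / (1 - c)) ^+ 2 = (1 + c) / (1 - c).
  have -> : (a / (1 - c)) ^+ 2 + (b / (1 - c)) ^+ 2 = (a ^+ 2 + b ^+ 2) / (1 - c) ^+ 2 by field.
  have -> : a ^+ 2 + b ^+ 2 = 1 - c ^+ 2 by rewrite -E; ring.
  by field.
have -> : 1 + (1 + c) / (1 - c) = 2 / (1 - c) by field.
by congr (_, _, _); field; rewrite c10.
Qed.

(** The image of [stereo] is the whole unit sphere of [R^3], closed and bounded, and the topology is
    pulled back along [stereo]; so a cluster point of the image filter lifts. *)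
Lemma sphere_compact : compact [set: S2].
Proof.
pose B : set (R * R * R) := (`[-1, 1] `*` `[-1, 1]) `*` `[-1, 1].
have cB : compact B by apply: compact_setX; [apply: compact_setX|]; exact: segment_compact.
pose Q := [set p : R * R * R | p.1.1 ^+ 2 + p.1.2 ^+ 2 + p.2 ^+ 2 = 1].
have clQ : closed Q.
  have -> : Q = (fun p : R * R * R => p.1.1 ^+ 2 + p.1.2 ^+ 2 + p.2 ^+ 2) @^-1` [set 1] by [].
  apply: closed_comp; last exact: closed_eq.
  move=> p _; apply: cvgD; first apply: cvgD.
  - apply: (@continuous_comp _ _ _ (fun p : R * R * R => p.1.1) (fun x => x ^+ 2)); last exact: exprn_continuous.
    by apply: (@cvg_comp _ _ _ fst fst _ (nbhs p.1)); [exact: cvg_fst|exact: cvg_fst].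
  - apply: (@continuous_comp _ _ _ (fun p : R * R * R => p.1.2) (fun x => x ^+ 2)); last exact: exprn_continuous.
    by apply: (@cvg_comp _ _ _ fst snd _ (nbhs p.1)); [exact: cvg_fst|exact: cvg_snd].
  - apply: (@continuous_comp _ _ _ (fun p : R * R * R => p.2) (fun x => x ^+ 2)); last exact: exprn_continuous.
    exact: cvg_snd.
have cQ : compact Q.
  apply: (subclosed_compact clQ cB) => -[[a b] c]; rewrite /Q /= => E.
  have h (x y z : R) : x ^+ 2 + y ^+ 2 + z ^+ 2 = 1 -> -1 <= x <= 1.
    move=> {}E; rewrite -ler_norml -(ler_pXn2r (n := 2)) ?nnegrE// expr1n real_normK ?num_real//.
    by rewrite -E -addrA lerDl addr_ge0 ?sqr_ge0.
  split; [split|]; rewrite /= in_itv /=; [exact: h E| |].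
    by apply: (h b a c); rewrite -E; ring.
  by apply: (h c a b); rewrite -E; ring.
move=> F FF _.
have [|p [Qp clp]] := cQ (@stereo R @ F) _.
  by apply: (@filterS _ F _ setT) filterT => x _; exact: (stereo_sphere x).
have [x xp] := stereo_onto Qp; exists x; split => // A U FA /nbhs_sphereP[e e0 he].
have : (@stereo R @ F) [set q | exists2 y, A y & @stereo R y = q] by apply: (@filterS _ F _ A) FA => y Ay; exists y.
move=> /clp /(_ (@nbhsx_ballx _ (R * R * R)%type p e e0))[_ [[y Ay <-] hb]].
exists y; split => //; apply: he; apply/ball_sphereE.
by rewrite -[ball x e y]/(ball (stereo x) e (stereo y)) xp.
Qed.

End SphereTopology.

(** * Rational maps in local charts: continuity and openness *)

Section LocalForm.
Variable R : realType.
Local Notation C := R[i].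
Local Notation S2 := (sphere R).

Lemma poly_lip (p : {poly C}) : exists2 K : R, 0 <= K &
  forall z, rnorm z <= 1 -> rnorm (p.[z] - p.[0]) <= K * rnorm z.
Proof.
elim/poly_ind: p => [|p c [K K0 IH]].
  by exists 0 => // z _; rewrite !horner0 subrr rnorm0 mul0r.
exists (rnorm p.[0] + K); first by rewrite addr_ge0 ?rnorm_ge0.
move=> z z1; rewrite !(hornerD, hornerM, hornerX, hornerC) mulr0 add0r addrK rnormM ler_wpM2r ?rnorm_ge0//.
have -> : p.[z] = p.[0] + (p.[z] - p.[0]) by rewrite addrC subrK.
rewrite (le_trans (rnormD _ _))// lerD2l (le_trans (IH _ z1))//.
by rewrite ler_piMr.
Qed.

Lemma poly_near0 (p : {poly C}) (e : R) : 0 < e ->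
  exists2 r : R, 0 < r & forall z, rnorm z < r -> rnorm (p.[z] - p.[0]) < e.
Proof.
move=> e0; have [K K0 h] := poly_lip p; have K1 : 0 < K + 1 by rewrite ltr_wpDl.
exists (Num.min 1 (e / (K + 1))); first by rewrite lt_min ltr01 divr_gt0.
move=> z; rewrite lt_min => /andP[z1]; rewrite ltr_pdivlMr// => ze.
rewrite (le_lt_trans (h _ (ltW z1)))// (le_lt_trans _ ze)// mulrC ler_wpM2l ?rnorm_ge0//.
by rewrite lerDl.
Qed.

Lemma poly_ge_half_near0 (D : {poly C}) : D.[0] != 0 ->
  exists2 r : R, 0 < r & forall z, rnorm z < r -> rnorm D.[0] / 2 <= rnorm D.[z].
Proof.
rewrite -rnorm_gt0 => D0; have [|r r0 h] := @poly_near0 D (rnorm D.[0] / 2); first by rewrite divr_gt0.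
exists r => // z /h; have -> : rnorm D.[0] = rnorm (D.[z] - (D.[z] - D.[0])) by rewrite opprB addrC subrK.
have := rnormB D.[z] (D.[z] - D.[0]); set n := rnorm (_ - (_ - _)); lra.
Qed.

(** A root [y] outside the disc gives [|z - y| <= 2 |y|] for [|z| <= r]; take the product over the
    linear factors. This is the quantitative input for openness. *)
Lemma min_modulus (G : {poly C}) (r : R) : 0 <= r ->
  (forall z, root G z -> r <= rnorm z) -> forall z, rnorm z <= r ->
  rnorm G.[z] <= 2 ^+ size G * rnorm G.[0].
Proof.
move=> r0 hr z zr; have [->|G0] := eqVneq G 0; first by rewrite !horner0 rnorm0 mulr0.
have [s Gs] := closed_field_poly_normal G.
have lG : lead_coef G != 0 by rewrite lead_coef_eq0.
have sG : size G = (size s).+1.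
  by rewrite Gs size_scale// size_prod_XsubC.
have hs y : y \in s -> r <= rnorm y.
  by move=> ys; apply: hr; rewrite Gs rootZ// root_prod_XsubC.
have key (t : seq C) : (forall y, y \in t -> r <= rnorm y) ->
    rnorm (\prod_(y <- t) ('X - y%:P)).[z] <= 2 ^+ size t * rnorm (\prod_(y <- t) ('X - y%:P)).[0].
  elim: t => [|y t IH] ht; first by rewrite big_nil /= expr0 mul1r !hornerC.
  rewrite !big_cons !hornerM !rnormM.
  apply: (@le_trans _ _ ((2 * rnorm ('X - y%:P).[0]) * (2 ^+ size t * rnorm (\prod_(y <- t) ('X - y%:P)).[0])));
    last by rewrite /= exprS [in X in _ <= X]mulrACA.
  apply: ler_pM; rewrite ?rnorm_ge0//.
    rewrite !hornerXsubC sub0r rnormN (le_trans (rnormB _ _))// mulr_natl mulr2n lerD2r.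
    by rewrite (le_trans zr)// ht// mem_head.
  by apply: IH => x xt; apply: ht; rewrite in_cons xt orbT.
rewrite sG Gs !hornerZ !rnormM mulrCA ler_wpM2l ?rnorm_ge0//.
apply: (le_trans (key _ hs)); rewrite ler_wpM2r ?rnorm_ge0// ler_weXn2l//; lra.
Qed.

Definition quot (a b : C) : S2 := if b == 0 then None else Some (a / b).

(* In the local parameters at [x] and [f x], the map [f] reads [z |-> N z / D z]. *)
Definition local_form (f : S2 -> S2) (x : S2) (N D : {poly C}) :=
  [/\ D.[0] != 0, N.[0] = 0, N != 0 & exists2 r : R, 0 < r &
    forall z, rnorm z < r -> D.[z] != 0 /\ f (param x z) = param (f x) (N.[z] / D.[z])].

(** Its roots are the finite points over [y], with multiplicity, when [N0] and [D0] have no common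
    root; it is also the numerator of the map read in the chart at [y]. *)
Definition fibre_poly (N0 D0 : {poly C}) (y : S2) : {poly C} :=
  if y is Some w then N0 - w *: D0 else D0.

(** At a finite value [w] one uses [N0 / D0 - w = (N0 - w D0) / D0], at infinity
    [1 / (N0 / D0) = D0 / N0]. Linear independence keeps the numerator nonzero, that is, excludes
    constant maps. *)
Lemma quot_local (N0 D0 : {poly C}) : D0.[0] != 0 \/ N0.[0] != 0 ->
  (forall a b : C, a *: N0 + b *: D0 = 0 -> a = 0 /\ b = 0) ->
  let N := fibre_poly N0 D0 (quot N0.[0] D0.[0]) in
  exists D : {poly C}, [/\ D.[0] != 0, N.[0] = 0, N != 0 & exists2 r : R, 0 < r &
    forall z, rnorm z < r -> D.[z] != 0 /\
      quot N0.[z] D0.[z] = param (quot N0.[0] D0.[0]) (N.[z] / D.[z])].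
Proof.
have nz (D : {poly C}) : D.[0] != 0 -> exists2 r : R, 0 < r & forall z, rnorm z < r -> D.[z] != 0.
  move=> D0z; have [r r0 hr] := poly_ge_half_near0 D0z; exists r => // z /hr h.
  by rewrite -rnorm_gt0 (lt_le_trans _ h)// divr_gt0// rnorm_gt0.
move=> ND free; rewrite /fibre_poly /quot; have [D00|D00] := eqVneq D0.[0] 0.
  have N00 : N0.[0] != 0 by case: ND => //; rewrite D00 eqxx.
  exists N0; split => //.
    apply/eqP => D0E; have [|_ /eqP] := free 0 1; first by rewrite D0E !scale0r scaler0 addr0.
    by rewrite oner_eq0.
  have [r r0 hr] := nz _ N00; exists r => // z zr; split; first exact: hr.
  rewrite /= mulf_eq0 invr_eq0 (negPf (hr _ zr)) orbF.
  by case: ifP => // _; rewrite invf_div.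
exists D0; split => //.
- by rewrite hornerD hornerN hornerZ divfK// subrr.
- apply/eqP => E; have [|/eqP] := free 1 (- (N0.[0] / D0.[0])); last by rewrite oner_eq0.
  by rewrite scale1r scaleNr.
- have [r r0 hr] := nz _ D00; exists r => // z zr; split; first exact: hr.
  rewrite (negPf (hr _ zr)) /=; congr Some.
  by rewrite hornerD hornerN hornerZ mulrBl mulfK ?hr// addrC subrK.
Qed.

(** The polynomial [z ^ d * p (1 / z)]: both [P] and [Q] are reversed at the common degree, so the
    power cancels in the quotient. *)
Definition rrev (d : nat) (p : {poly C}) : {poly C} := \poly_(i < d.+1) p`_(d - i).

Lemma horner_rrev d (p : {poly C}) z : (size p <= d.+1)%N -> z != 0 ->
  (rrev d p).[z] = z ^+ d * p.[z^-1].
Proof.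
move=> sp z0; rewrite horner_poly (horner_coef_wide _ sp) mulr_sumr.
rewrite (reindex_inj rev_ord_inj) /=; apply: eq_bigr => i _.
rewrite !subSS subKn -1?ltnS// mulrCA; congr (_ * _).
by rewrite exprVn expfB_cond// (negPf z0) /= add0n -ltnS.
Qed.

Lemma horner_rrev0 d p : (rrev d p).[0] = p`_d.
Proof. by rewrite horner_coef0 coef_poly /= subn0. Qed.

Section RatMap.
Variables P Q : {poly C}.
Hypothesis coprimePQ : coprimep P Q.
Hypothesis degPQ : (1 <= rat_degree P Q)%N.
Local Notation d := (rat_degree P Q).
Local Notation f := (rat_map P Q).

Lemma size_P_le : (size P <= d.+1)%N.
Proof. by rewrite (leq_trans _ (leqSpred _))// leq_maxl. Qed.

Lemma size_Q_le : (size Q <= d.+1)%N.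
Proof. by rewrite (leq_trans _ (leqSpred _))// leq_maxr. Qed.

Lemma rat_map_Some a : f (Some a) = quot P.[a] Q.[a]. Proof. by []. Qed.
Lemma rat_map_None : f None = quot P`_d Q`_d. Proof. by []. Qed.

Lemma coprime_nroot a : P.[a] != 0 \/ Q.[a] != 0.
Proof.
have [Pa|] := eqVneq P.[a] 0; [right|by left].
by apply: (coprimep_root coprimePQ); rewrite /root Pa.
Qed.

Lemma coef_deg_neq0 : P`_d != 0 \/ Q`_d != 0.
Proof.
have m0 : (0 < maxn (size P) (size Q))%N by move: degPQ; rewrite /rat_degree; case: maxn.
have lc (p : {poly C}) : size p = maxn (size P) (size Q) -> p`_d != 0.
  by move=> sp; rewrite /rat_degree -sp -lead_coefE lead_coef_eq0 -size_poly_gt0 sp.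
case: (leqP (size P) (size Q)) => h; [right|left]; apply: lc.
  by rewrite (maxn_idPr h).
by rewrite (maxn_idPl (ltnW h)).
Qed.

(** In a nontrivial relation one polynomial is a scalar multiple of the other; coprimality then
    makes both constant, against the degree hypothesis. *)
Lemma rat_free (a b : C) : a *: P + b *: Q = 0 -> a = 0 /\ b = 0.
Proof.
move=> E.
have key (p q : {poly C}) (u v : C) : coprimep p q -> (1 < maxn (size p) (size q))%N ->
    u *: p + v *: q = 0 -> u = 0.
  move=> cpq s2 {}E; apply/eqP; apply/negPn/negP => a0.
  have pE : p = (- (v / u)) *: q.
    apply: (scalerI a0); rewrite scalerA mulrN mulrCA mulfV// mulr1 scaleNr.
    by apply/eqP; rewrite -addr_eq0 E.
  have qp : q %| p by rewrite pE -mul_polyC dvdp_mull// dvdpp.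
  have : size q == 1%N.
    by have := cpq; rewrite coprimep_sym => /coprimepP/(_ q (dvdpp q) qp); rewrite size_poly_eq1.
  move=> /eqP sq; have : (size p <= 1)%N by rewrite pE (leq_trans (size_scale_leq _ _))// sq.
  by move: s2; rewrite sq; case: (size p) => [|[]].
have s2 : (1 < maxn (size P) (size Q))%N.
  by move: degPQ; rewrite /rat_degree; case: maxn => [|[]].
split; first exact: key E.
by apply: (@key Q P b a); rewrite 1?coprimep_sym// 1?maxnC// addrC.
Qed.

Definition recenter (x : S2) (G : {poly C}) : {poly C} :=
  if x is Some a then G \Po ('X + a%:P) else rrev d G.

Lemma rrevB c G H : rrev d (G - c *: H) = rrev d G - c *: rrev d H.
Proof. by apply/polyP => i; rewrite !(coefB, coefZ, coef_poly); case: ifP => _; rewrite ?coefB ?coefZ ?mulr0 ?subr0. Qed.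

Lemma recenter_fibre x y :
  recenter x (fibre_poly P Q y) = fibre_poly (recenter x P) (recenter x Q) y.
Proof.
by case: x y => [a|] [w|] //=; rewrite ?rrevB// comp_polyB comp_polyZ.
Qed.

Lemma rat_local x : exists D : {poly C}, local_form f x (recenter x (fibre_poly P Q (f x))) D.
Proof.
case: x => [a|].
  have cE (p : {poly C}) z : (p \Po ('X + a%:P)).[z] = p.[a + z].
    by rewrite horner_comp !hornerE addrC.
  have [||D [h1 h2 h3 [r r0 hr]]] := @quot_local (P \Po ('X + a%:P)) (Q \Po ('X + a%:P)).
  - by rewrite !cE addr0; case: (coprime_nroot a); [right|left].
  - move=> u v E; apply: rat_free.
    have : (u *: P + v *: Q) \Po ('X + a%:P) = 0 by rewrite comp_polyD !comp_polyZ.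
    move=> /(congr1 (fun p => p \Po ('X - a%:P))); rewrite -comp_polyA comp_poly0.
    have -> : ('X + a%:P) \Po ('X - a%:P) = 'X by rewrite comp_polyD comp_polyX comp_polyC subrK.
    by rewrite comp_polyXr.
  rewrite recenter_fibre rat_map_Some; rewrite !cE addr0 in h2 h3 hr.
  exists D; split => //; exists r => // z zr; have [h4 h5] := hr z zr.
  by split => //; rewrite rat_map_Some -h5 !cE.
have [||D [h1 h2 h3 [r r0 hr]]] := @quot_local (rrev d P) (rrev d Q).
- by rewrite !horner_rrev0; case: coef_deg_neq0; [right|left].
- move=> u v E; apply: rat_free; apply/polyP => i; rewrite coef0.
  have [id|id] := leqP i d.
    move: E => /(congr1 (fun p : {poly C} => p`_(d - i))).
    by rewrite !coefD !coefZ !coef_poly coef0 ltnS leq_subr subKn.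
  by rewrite nth_default// (leq_trans (size_polyD _ _))// geq_max !(leq_trans (size_scale_leq _ _))//;
     [rewrite (leq_trans size_Q_le)|rewrite (leq_trans size_P_le)].
rewrite recenter_fibre rat_map_None; rewrite !horner_rrev0 in h2 h3 hr.
exists D; split => //; exists r => // z zr; have [h4 h5] := hr z zr.
split => //; rewrite rat_map_None -h5.
have [->|z0] := eqVneq z 0; first by rewrite /= eqxx !horner_rrev0.
rewrite /= (negPf z0) /quot !horner_rrev ?size_P_le ?size_Q_le// mulf_eq0 expf_eq0 (negPf z0) andbF /=.
case: eqVneq => // Q0; congr Some.
by rewrite -mulf_div divff ?mul1r// expf_neq0.
Qed.

End RatMap.

Section LocalConsequences.
Variables (f : S2 -> S2) (x : S2) (N D : {poly C}).
Hypothesis loc : local_form f x N D.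

Lemma local_quot_small (e : R) : 0 < e ->
  exists2 r : R, 0 < r & forall z, rnorm z < r -> rnorm (N.[z] / D.[z]) < e.
Proof.
case: loc => D0 N0 _ _ e0; have [r r0 hr] := poly_ge_half_near0 D0.
have hD : 0 < rnorm D.[0] / 2 by rewrite divr_gt0// rnorm_gt0.
have [r' r'0 hr'] := poly_near0 N (mulr_gt0 e0 hD).
exists (Num.min r r'); first by rewrite lt_min r0.
move=> z; rewrite lt_min => /andP[/hr zr /hr']; rewrite N0 subr0 => h.
have Dz : 0 < rnorm D.[z] by exact: lt_le_trans zr.
by rewrite rnormM rnormV ltr_pdivrMr// (lt_le_trans h)// ler_pM2l.
Qed.

Lemma local_continuous : {for x, continuous f}.
Proof.
move=> U /nbhs_paramP[e e0 hU]; apply/nbhs_paramP.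
have [r r0 hr] := local_quot_small e0; case: loc => _ _ _ [r' r'0 hr'].
exists (Num.min r r'); first by rewrite lt_min r0.
by move=> z; rewrite lt_min => /andP[/hr zr /hr'[_ E]]; rewrite /= E; exact: hU.
Qed.

(** For small [w] the equation [N = w D] has a root in the disc of radius [t]: otherwise
    [min_modulus] bounds [N - w D] at [z0] by a multiple of its value [- w D(0)] at 0, although [N]
    does not vanish at [z0]. *)
Lemma local_open (V : set S2) : nbhs x V -> nbhs (f x) (f @` V).
Proof.
move=> /nbhs_paramP[e e0 hV]; case: loc => D0 N0 Nn0 [r r0 hr].
pose t := Num.min e r; have t0 : 0 < t by rewrite lt_min e0.
have [z0 z0t Nz0] : exists2 z0, rnorm z0 <= t / 2 & N.[z0] != 0.
  apply: contrapT => h.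
  have hz z : rnorm z <= t / 2 -> N.[z] = 0.
    by move=> zt; apply/eqP; apply/negPn/negP => Nz; apply: h; exists z.
  (* These are [size N] distinct points of the disc, more than a nonzero [N] has roots. *)
  pose pts := [seq ((t / 2) / (n.+1%:R))%:C : C | n <- iota 0 (size N)].
  have rts : all (root N) pts.
    apply/allP => _ /mapP[n _ ->]; apply/eqP; apply: hz.
    rewrite rnorm_real ger0_norm; last by rewrite divr_ge0 ?divr_ge0// ltW.
    by rewrite ler_pdivrMr// ler_pMr ?divr_gt0// ler1n.
  have upts : uniq pts.
    rewrite map_inj_uniq ?iota_uniq// => n m /(@complexI R).
    move=> /(mulfI (lt0r_neq0 (divr_gt0 t0 (ltr0Sn _ 1)))) /invr_inj /eqP.
    by rewrite eqr_nat => /eqP[].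
  by have := max_poly_roots Nn0 rts upts; rewrite size_map size_iota ltnn.
(* If no root existed, [|N(z0)| <= |w| K] would follow: the first term pays for [w D(z0)], the
   second for the bound of [min_modulus], and the 1 keeps [K] positive. *)
pose K := rnorm D.[z0] + 2 ^+ (maxn (size N) (size D)) * rnorm D.[0] + 1.
have K0 : 0 < K by rewrite ltr_wpDl// addr_ge0 ?mulr_ge0 ?rnorm_ge0// exprn_ge0.
apply/nbhs_paramP; exists (rnorm N.[z0] / K); first by rewrite divr_gt0// rnorm_gt0.
move=> w; rewrite ltr_pdivlMr// => wK.
have [z zt Gz] : exists2 z, rnorm z < t & root (N - w *: D) z.
  apply: contrapT => h.
  have hz z : root (N - w *: D) z -> t / 2 <= rnorm z.
    move=> Gz; rewrite leNgt; apply/negP => zt; apply: h; exists z => //.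
    by rewrite (lt_le_trans zt)// ler_pdivrMr// ler_pMr// ler1n.
  have := min_modulus (ltW (divr_gt0 t0 (ltr0Sn _ 1))) hz z0t.
  rewrite !(hornerD, hornerN, hornerZ) N0 sub0r rnormN rnormM => H.
  have szG : (size (N - w *: D)%R <= maxn (size N) (size D))%N.
    rewrite (leq_trans (size_polyD _ _))// geq_max leq_maxl size_polyN.
    by rewrite (leq_trans (size_scale_leq _ _))// leq_maxr.
  have H2 : 2 ^+ size (N - w *: D)%R <= 2 ^+ maxn (size N) (size D) :> R.
    by rewrite ler_weXn2l// ler1n.
  have : rnorm N.[z0] <= rnorm w * K.
    have -> : N.[z0] = (N.[z0] - w * D.[z0]) + w * D.[z0] by rewrite subrK.
    rewrite (le_trans (rnormD _ _))// rnormM /K mulrDr mulrDr mulr1.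
    rewrite [X in X <= _]addrC -addrA lerD2l (le_trans H)//.
    apply: (@le_trans _ _ (rnorm w * (2 ^+ maxn (size N) (size D) * rnorm D.[0]))); last by rewrite lerDl rnorm_ge0.
    by rewrite [X in _ <= X]mulrCA ler_wpM2r// mulr_ge0 ?rnorm_ge0.
  by rewrite leNgt wK.
have [zr ze] : rnorm z < r /\ rnorm z < e by move: zt; rewrite lt_min => /andP[].
have [Dz Ez] := hr z zr.
exists (param x z); first exact: hV.
rewrite Ez; congr param; move: Gz; rewrite /root !hornerE subr_eq0 => /eqP->.
by rewrite mulfK.
Qed.

End LocalConsequences.
End LocalForm.

(** * Branch indices and fibres *)

Section BranchIndex.
Variable R : realType.
Local Notation C := R[i].
Local Notation S2 := (sphere R).

Lemma is_branch_indexP (f : S2 -> S2) x n : is_branch_index f x n <->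
  (1 <= n)%N /\ exists c : C, exists M r : R, [/\ c != 0, 0 <= M, 0 < r &
    forall z, rnorm z < r -> rnorm (Defs.coord (f x) (f (param x z)) - c * z ^+ n) <= M * rnorm z ^+ n.+1].
Proof.
split=> -[n1 h]; split=> //.
  case: h => c [M [c0 /nbhs_rnormP[r r0 hr]]].
  exists c, (rnorm M), r; split=> //; first exact: rnorm_ge0.
  move=> z zr; have := hr z; rewrite sub0r rnormN => /(_ zr).
  rewrite !rnormE lecE /= => /andP[_ h]; apply: (le_trans h).
  apply: (le_trans (ler_norm _)); apply: (le_trans (normr_Re_le _)).
  by rewrite rnormM rnormX rnorm_real ger0_norm// rnorm_ge0.
case: h => c [M [r [c0 M0 r0 hr]]]; exists c, M%:C; split=> //.
apply/nbhs_rnormP; exists r => // z; rewrite sub0r rnormN => /hr h.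
by rewrite !rnormE -rmorphXn -rmorphM lecR.
Qed.

Lemma small_point (r : R) : 0 < r -> exists2 z : C, z != 0 & rnorm z < r.
Proof.
move=> r0; exists (r / 2)%:C; first by rewrite eq_complex /= eqxx andbT lt0r_neq0// divr_gt0.
rewrite rnorm_real ger0_norm ?divr_ge0 ?ltW//; lra.
Qed.

Lemma is_branch_index_unique (f : S2 -> S2) x n m :
  is_branch_index f x n -> is_branch_index f x m -> n = m.
Proof.
wlog nm : n m / (n < m)%N.
  by move=> h hn hm; have [nm|mn|//] := ltngtP n m; [exact: h|symmetry; apply: h].
move=> /is_branch_indexP[_ [c [M [r [c0 M0 r0 h]]]]] /is_branch_indexP[_ [c' [M' [r' [_ M'0 r'0 h']]]]].
exfalso; pose K := M + M' + rnorm c' + 1.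
have K0 : 0 < K by rewrite ltr_wpDl// !addr_ge0// rnorm_ge0.
have [|z z0] := @small_point (Num.min (Num.min r r') (Num.min 1 (rnorm c / K))).
  by rewrite !lt_min r0 r'0 ltr01 divr_gt0// rnorm_gt0.
rewrite !lt_min => /andP[/andP[zr zr'] /andP[z1]]; rewrite ltr_pdivlMr// => zc.
have {}h := h z zr; have {}h' := h' z zr'.
have zp : 0 < rnorm z by rewrite rnorm_gt0.
have zn : 0 < rnorm z ^+ n by rewrite exprn_gt0.
have small k : (n < k)%N -> rnorm z ^+ k <= rnorm z ^+ n.+1.
  by move=> nk; apply: ler_wiXn2l => //; rewrite ltW.
suff : rnorm c * rnorm z ^+ n <= K * rnorm z ^+ n.+1.
  by rewrite exprS mulrA ler_pM2r// leNgt mulrC zc.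
set u := Defs.coord _ _ in h h'.
have -> : rnorm c * rnorm z ^+ n = rnorm ((u - c' * z ^+ m) - (u - c * z ^+ n) + c' * z ^+ m).
  by rewrite -rnormX -rnormM; congr rnorm; ring.
apply: (le_trans (rnormD _ _)); apply: (le_trans (lerD (rnormB _ _) (lexx _))).
rewrite rnormM rnormX.
have b1 : M' * rnorm z ^+ m.+1 <= M' * rnorm z ^+ n.+1 by rewrite ler_wpM2l// small// ltnS ltnW.
have b2 : rnorm c' * rnorm z ^+ m <= rnorm c' * rnorm z ^+ n.+1 by rewrite ler_wpM2l ?rnorm_ge0// small.
have b3 := exprn_ge0 n.+1 (rnorm_ge0 z).
rewrite /K !mulrDl mul1r; clear -h h' b1 b2 b3; lra.
Qed.

Lemma branch_indexE (f : S2 -> S2) x n : is_branch_index f x n -> branch_index f x = n.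
Proof.
by move=> h; apply: xget_unique => // m hm; exact: is_branch_index_unique hm h.
Qed.

Lemma coord_param (x : S2) (z : C) : Defs.coord x (param x z) = z.
Proof.
case: x => [a|] /=; first by rewrite addrC addKr.
by case: eqVneq => [->//|z0]; rewrite invrK.
Qed.

Lemma param_coord (x y : S2) : nbhs x [set y : S2 | param x (Defs.coord x y) = y].
Proof.
by apply/nbhs_paramP; exists 1 => // z _; rewrite /= coord_param.
Qed.

(** The index is the multiplicity of 0 as a root of [N]. The second clause turns index 1 into a
    nonvanishing linear coefficient, from which the simplicity of fibres is deduced. *)
Lemma local_branch f x (N D : {poly C}) : local_form f x N D ->
  exists n, is_branch_index f x n /\ (n = 1%N -> N`_1 != 0).
Proof.
move=> [D0 N0 Nn0 [r r0 hr]].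
have [n [N1 /implyP/(_ Nn0) N10 NE]] := multiplicity_XsubC N 0.
have n1 : (1 <= n)%N.
  rewrite lt0n; apply/eqP => n0; move: N10; rewrite /root.
  by move: N0; rewrite NE n0 expr0 mulr1 => ->; rewrite eqxx.
rewrite subr0 in NE; exists n; split; last first.
  move=> n1E; rewrite NE n1E expr1 coefMX /=; move: N10.
  by rewrite /root horner_coef0.
apply/is_branch_indexP; split=> //.
(* This polynomial vanishes at 0, and times [z ^ n / (D(0) D(z))] it is the deviation of [N / D]
   from its leading term. *)
have [K K0 hK] := poly_lip (D.[0] *: N1 - N1.[0] *: D).
have [r' r'0 hr'] := poly_ge_half_near0 D0.
have D00 : 0 < rnorm D.[0] by rewrite rnorm_gt0.
exists (N1.[0] / D.[0]), (K / (rnorm D.[0] * (rnorm D.[0] / 2))), (Num.min (Num.min r r') 1); split.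
- by rewrite mulf_neq0// invr_neq0.
- by rewrite divr_ge0// mulr_ge0// ?divr_ge0// ltW.
- by rewrite !lt_min r0 r'0 ltr01.
move=> z; rewrite !lt_min => /andP[/andP[zr zr'] z1].
have [Dz ->] := hr z zr; rewrite coord_param.
have Dz' : 0 < rnorm D.[z] by rewrite rnorm_gt0.
have -> : N.[z] / D.[z] - N1.[0] / D.[0] * z ^+ n =
   (D.[0] * D.[z])^-1 * ((D.[0] *: N1 - N1.[0] *: D).[z] * z ^+ n).
  rewrite NE hornerM hornerXn hornerD hornerN !hornerZ; field; by rewrite D0 Dz.
rewrite rnormM rnormV !rnormM rnormX exprS mulrA [K / _]mulrC mulrA [X in _ <= X * _]mulrAC -!mulrA.
rewrite !mulrA ler_wpM2r ?exprn_ge0 ?rnorm_ge0// -!mulrA ler_pM ?invr_ge0 ?mulr_ge0 ?rnorm_ge0//.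
  by rewrite lef_pV2 ?posrE ?mulr_gt0 ?divr_gt0// ler_pM2l// hr'.
have := hK z (ltW z1); rewrite [X in _ - X](_ : _ = 0) ?subr0; first by rewrite mulrC.
by rewrite !hornerE mulrC subrr.
Qed.

Lemma is_branch_index_id (x : S2) : is_branch_index id x 1.
Proof.
apply/is_branch_indexP; split=> //; exists 1, 0, 1; split; rewrite ?oner_eq0//.
by move=> z _; rewrite coord_param expr1 mul1r subrr rnorm0 mul0r.
Qed.

(** The chain rule at noncritical points. Index 1 suffices, since orbits in the Julia set meet no
    critical point. Continuity keeps [f (param x z)] in the range of the chart at [f x]. *)
Lemma is_branch_index1_comp (f g : S2 -> S2) x : {for x, continuous f} ->
  is_branch_index f x 1 -> is_branch_index g (f x) 1 -> is_branch_index (g \o f) x 1.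
Proof.
move=> cf /is_branch_indexP[_ [c [M [r [c0 M0 r0 h]]]]] /is_branch_indexP[_ [c' [M' [r' [c'0 M'0 r'0 h']]]]].
have /nbhs_paramP[r2 r20 hr2] : nbhs x (f @^-1` [set y : S2 | param (f x) (Defs.coord (f x) y) = y]).
  by apply: cf; exact: param_coord.
pose K := rnorm c + M; have K0 : 0 < K by rewrite ltr_pwDl// rnorm_gt0.
apply/is_branch_indexP; split=> //.
exists (c' * c), (M' * K ^+ 2 + rnorm c' * M), (Num.min (Num.min r r2) (Num.min 1 (r' / K))); split.
- by rewrite mulf_neq0.
- by rewrite addr_ge0 ?mulr_ge0 ?rnorm_ge0 ?exprn_ge0// ltW.
- by rewrite !lt_min r0 r20 ltr01 divr_gt0.
move=> z; rewrite !lt_min => /andP[/andP[zr zr2] /andP[z1]]; rewrite ltr_pdivlMr// => zr'.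
have {}h := h z zr; have pc := hr2 z zr2; rewrite /= in pc.
set u := Defs.coord (f x) (f (param x z)) in h pc.
rewrite expr1 in h.
have uK : rnorm u <= K * rnorm z.
  have -> : u = (u - c * z) + c * z by rewrite subrK.
  apply: (le_trans (rnormD _ _)); rewrite rnormM /K mulrDl addrC lerD2l.
  by apply: (le_trans h); rewrite ler_wpM2l// expr2 ler_piMl ?rnorm_ge0 ?(ltW z1).
have := h' u; rewrite pc expr1 => /(_ _) h2.
have {}h2 := h2 (le_lt_trans uK _).
rewrite [K * _]mulrC in h2.
have {}h2 := h2 zr'.
rewrite /= expr1.
set v := Defs.coord _ _ in h2 *.
have -> : v - c' * c * z = (v - c' * u) + c' * (u - c * z) by ring.
apply: (le_trans (rnormD _ _)); rewrite rnormM mulrDl lerD//.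
  apply: (le_trans h2); rewrite -mulrA ler_wpM2l// -exprMn ler_pXn2r ?nnegrE ?rnorm_ge0//.
  by rewrite mulr_ge0 ?rnorm_ge0// ltW.
by rewrite -mulrA ler_wpM2l ?rnorm_ge0.
Qed.

End BranchIndex.

(** * Fibres of a rational map, infinity included *)

Section Fibres.
Variable R : realType.
Local Notation C := R[i].
Local Notation S2 := (sphere R).
Variables P Q : {poly C}.
Hypothesis coprimePQ : coprimep P Q.
Hypothesis degPQ : (1 <= rat_degree P Q)%N.
Local Notation d := (rat_degree P Q).
Local Notation f := (rat_map P Q).
Local Notation G := (fibre_poly P Q).

Lemma fibre_poly_neq0 y : G y != 0.
Proof.
apply/eqP => E; case: y E => [w|] /= E.
  have [] := rat_free coprimePQ degPQ (a := 1) (b := - w); first by rewrite scale1r scaleNr.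
  by move/eqP; rewrite oner_eq0.
have [] := rat_free coprimePQ degPQ (a := 0) (b := 1); first by rewrite scale0r scale1r add0r.
by move=> _ /eqP; rewrite oner_eq0.
Qed.

Lemma quot_eqP (a b : C) y : a != 0 \/ b != 0 ->
  (quot a b == y) = ((if y is Some w then a - w * b else b) == 0).
Proof.
move=> ab; rewrite /quot; case: y => [w|]; case: (eqVneq b 0) => [b0|b0] //=.
- by case: ab; rewrite b0 ?eqxx// mulr0 subr0 => /negPf->.
- by rewrite (inj_eq Some_inj) -(inj_eq (mulIf b0)) divfK// subr_eq0.
Qed.

Lemma fibre_Some a y : (f (Some a) == y) = root (G y) a.
Proof.
rewrite rat_map_Some quot_eqP; last exact: coprime_nroot.
by case: y => [w|]; rewrite /root //= !hornerE.
Qed.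

Lemma fibre_None y : (f None == y) = ((G y)`_d == 0).
Proof.
rewrite rat_map_None quot_eqP; last exact: coef_deg_neq0.
by case: y => [w|] //=; rewrite coefB coefZ.
Qed.

Lemma size_fibre_poly y : (size (G y) <= d.+1)%N.
Proof.
case: y => [w|] /=; last exact: size_Q_le.
rewrite (leq_trans (size_polyD _ _))// geq_max size_P_le/= size_polyN.
by rewrite (leq_trans (size_scale_leq _ _))// size_Q_le.
Qed.

Lemma rat_map_continuous : continuous f.
Proof.
by move=> x; have [D h] := rat_local coprimePQ degPQ x; exact: local_continuous h.
Qed.

Lemma rat_map_open x (V : set S2) : nbhs x V -> nbhs (f x) (f @` V).
Proof. by have [D h] := rat_local coprimePQ degPQ x; move=> hV; exact: (local_open h hV). Qed.

Lemma rat_map_surj y : exists x, f x = y.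
Proof.
have [dG|dG] := eqVneq (G y)`_d 0; first by exists None; apply/eqP; rewrite fibre_None dG.
have [|z Gz] := closed_rootP (G y) _; last by exists (Some z); apply/eqP; rewrite fibre_Some.
apply: contra_neq dG => /eqP; case: (ltngtP (size (G y)) 1) => // s1.
by move=> _; rewrite nth_default// s1.
Qed.

Lemma noncritical_branch x : ~ critical f x -> is_branch_index f x 1.
Proof.
have [D h] := rat_local coprimePQ degPQ x; have [n [hn _]] := local_branch h.
rewrite /critical (branch_indexE hn) => /negP; rewrite -leqNgt => n1.
have -> // : 1%N = n; apply/eqP; rewrite eqn_leq n1 andbT.
by case: hn.
Qed.

Lemma noncritical_coef1 x : ~ critical f x -> (recenter P Q x (G (f x)))`_1 != 0.
Proof.
move=> ncx; have [D h] := rat_local coprimePQ degPQ x; have [n [hn]] := local_branch h.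
by apply; exact: is_branch_index_unique hn (noncritical_branch ncx).
Qed.

Lemma noncritical_Some a y : f (Some a) = y -> ~ critical f (Some a) -> ~~ (('X - a%:P) ^+ 2 %| G y).
Proof.
move=> fa /noncritical_coef1; rewrite fa /=; apply: contra => /dvdpP[q ->].
rewrite expr2 !comp_polyM comp_polyB comp_polyX comp_polyC addrK.
by rewrite mulrA coefMX coefMX.
Qed.

(** Reversal turns the coefficient of degree [d - 1] into the linear one, so when a noncritical
    infinity lies over [y] the degree of [G y] drops from [d] by exactly one. *)
Lemma noncritical_None y : f None = y -> ~ critical f None -> (G y)`_(d.-1) != 0.
Proof.
move=> fa /noncritical_coef1; rewrite fa /= coef_poly subn1.
by case: ifP => //; rewrite eqxx.
Qed.

Lemma not_uniq_perm (T : eqType) (s : seq T) : ~~ uniq s ->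
  exists x t, perm_eq s [:: x, x & t].
Proof.
elim: s => // x s IH /=; rewrite negb_and negbK => /orP[xs|/IH[y [t st]]].
  by exists x, (rem x s); rewrite perm_cons perm_to_rem.
exists y, (x :: t); apply: (@perm_trans _ (x :: [:: y, y & t])); first by rewrite perm_cons.
by rewrite -[x :: _]/([:: x] ++ [:: y; y] ++ t) perm_catCA.
Qed.

Lemma fibre_roots y : exists rs : seq C, [/\ (size rs).+1 = size (G y),
  (forall a, (a \in rs) = root (G y) a) &
  (forall a t, perm_eq rs [:: a, a & t] -> ('X - a%:P) ^+ 2 %| G y)].
Proof.
have [rs GE] := closed_field_poly_normal (G y).
have lG : lead_coef (G y) != 0 by rewrite lead_coef_eq0 fibre_poly_neq0.
exists rs; split.
- by rewrite GE size_scale// size_prod_XsubC.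
- by move=> a; rewrite GE rootZ// root_prod_XsubC.
- move=> a t p; rewrite GE (perm_big _ p) /= !big_cons mulrA -expr2 -mul_polyC mulrCA.
  by rewrite dvdp_mulr.
Qed.

(** The roots of [G y] are simple. There are [d] of them, or [d - 1] when infinity belongs to the
    fibre and makes up for the missing one. *)
Lemma fibre_enum y : (forall x, f x = y -> ~ critical f x) ->
  exists s : seq S2, [/\ uniq s, size s = d & forall x, (x \in s) = (f x == y)].
Proof.
move=> nc; have [rs [srs mrs prs]] := fibre_roots y.
have urs : uniq rs.
  apply/negPn/negP => /not_uniq_perm[a [t p]].
  have ra : f (Some a) = y by apply/eqP; rewrite fibre_Some -mrs (perm_mem p) mem_head.
  by have := noncritical_Some ra (nc _ ra); rewrite (prs _ _ p).
have memS a : ((Some a : S2) \in map Some rs) = (f (Some a) == y).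
  by rewrite (mem_map Some_inj) mrs fibre_Some.
have memN : ((None : S2) \in map Some rs) = false by apply/mapP => -[].
have uS : uniq (map Some rs : seq S2) by rewrite (map_inj_uniq Some_inj).
have [dG|dG] := eqVneq (G y)`_d 0.
  have fN : f None = y by apply/eqP; rewrite fibre_None dG.
  have dG1 := noncritical_None fN (nc _ fN).
  have sG : size (G y) = d.
    apply/eqP; rewrite eqn_leq; apply/andP; split.
      have := size_fibre_poly y; rewrite leq_eqVlt => /orP[/eqP E|//].
      by have := fibre_poly_neq0 y; rewrite -lead_coef_eq0 lead_coefE E dG eqxx.
    rewrite leqNgt; apply/negP => h; move: dG1; rewrite nth_default ?eqxx//.
    by rewrite -ltnS prednK.
  exists (None :: map Some rs); split.
  - by rewrite /= memN.
  - by rewrite /= size_map srs.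
  - case=> [a|]; first by rewrite in_cons memS.
    by rewrite mem_head fN eqxx.
have sG : size (G y) = d.+1.
  apply/eqP; rewrite eqn_leq size_fibre_poly ltnNge; apply/negP => h.
  by move: dG; rewrite nth_default ?eqxx.
exists (map Some rs); split=> //; first by rewrite size_map; apply: succn_inj; rewrite srs.
by case=> [a|]; [exact: memS|rewrite memN fibre_None (negPf dG)].
Qed.

End Fibres.

(** * The Julia set *)

Section JuliaSet.
Variable R : realType.
Local Notation C := R[i].
Local Notation S2 := (sphere R).
Variables P Q : {poly C}.
Hypothesis coprimePQ : coprimep P Q.
Hypothesis degPQ : (2 <= rat_degree P Q)%N.
Let degPQ1 : (1 <= rat_degree P Q)%N := ltnW degPQ.
Local Notation d := (rat_degree P Q).
Local Notation f := (rat_map P Q).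
Local Notation G := (fibre_poly P Q).

Definition equicont_at (x : S2) := {for x, equicontinuous setT (fun n => iter n f)}.

Lemma fatouP x : fatou_set f x <-> \forall y \near x, equicont_at y.
Proof.
split=> [[U [oU hU] Ux]|].
  by apply: (@filterS _ _ _ U) => //; exact: open_nbhs_nbhs.
move=> h; have := h : nbhs x [set y | equicont_at y]; rewrite nbhsE => -[U [oU Ux] hU].
by exists U => //; split.
Qed.

(** Openness writes every point near [f x] as [f y] with [y] near [x]; then the iterate [n] at [f y]
    is the iterate [n + 1] at [y]. *)
Lemma equicont_at_image x : equicont_at x -> equicont_at (f x).
Proof.
move=> h A eA; have := rat_map_open coprimePQ degPQ1 (h A eA).
by apply: filterS => _ [y hy <-] n _; have := hy n.+1 I; rewrite !iterSr.
Qed.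

Lemma equicont_at_preimage x : equicont_at (f x) -> equicont_at x.
Proof.
move=> h A eA.
have h1 : nbhs x [set y | A (x, y)] by apply: filterS (nbhs_entourage x eA) => y /xsectionP.
have h2 : nbhs x (f @^-1` [set y | forall n, setT n -> A (iter n f (f x), iter n f y)]).
  exact: (@rat_map_continuous _ _ _ coprimePQ degPQ1 x _ (h A eA)).
apply: filterS (filterI h1 h2) => y [Axy hy] [|n] _ //.
by have := hy n I; rewrite /= -!iterSr.
Qed.

Lemma fatou_image x : fatou_set f (f x) <-> fatou_set f x.
Proof.
rewrite !fatouP; split=> h.
  have h2 : nbhs x (f @^-1` [set y | equicont_at y]).
    exact: (@rat_map_continuous _ _ _ coprimePQ degPQ1 x _ h).
  by apply: filterS h2 => y; exact: equicont_at_preimage.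
have := rat_map_open coprimePQ degPQ1 h.
by apply: filterS => _ [y hy <-]; exact: equicont_at_image.
Qed.

Lemma julia_image x : julia_set f (f x) <-> julia_set f x.
Proof. by rewrite /julia_set /= /setC /= fatou_image. Qed.

Lemma julia_iter n x : julia_set f (iter n f x) <-> julia_set f x.
Proof. by elim: n => //= n <-; exact: julia_image. Qed.

Lemma julia_closed : closed (julia_set f).
Proof. by apply: open_closedC; apply: bigcup_open => U []. Qed.

Lemma julia_compact : compact (julia_set f).
Proof. by apply: (subclosed_compact julia_closed (@sphere_compact R)). Qed.

Lemma compact_finite_nbhs (K : set S2) (U : S2 -> set S2) : compact K ->
  (forall x, K x -> nbhs x (U x)) ->
  exists s : seq S2, (forall x, x \in s -> K x) /\ forall y, K y -> exists2 x, x \in s & U x y.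
Proof.
rewrite compact_cover => cK hU.
have [|y Ky|D DK cov] := cK S2 K (fun x => interior (U x)).
- by move=> x _; exact: open_interior.
- by exists y => //; exact: hU.
exists (enum_fset D); split=> [x xD|y /cov[x xD hx]].
  by apply/set_mem; exact: DK.
by exists x => //; exact: interior_subset hx.
Qed.

Lemma wronskian_neq0 : P^`() * Q - P * Q^`() != 0.
Proof.
have size_deriv0 (p : {poly C}) : p^`() = 0 -> (size p <= 1)%N.
  move=> p0; apply/leq_sizeP => -[//|j] _.
  have := congr1 (fun q : {poly C} => q`_j) p0; rewrite coef_deriv coef0.
  by move/eqP; rewrite mulrn_eq0 /= => /eqP.
have szm : (2 < maxn (size P) (size Q))%N.
  by move: degPQ; rewrite /rat_degree; case: maxn => [|[|[|]]].
rewrite subr_eq0; apply/eqP => E.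
have QQ' : Q %| Q^`().
  have cQP : coprimep Q P by rewrite coprimep_sym.
  by rewrite -(Gauss_dvdpr _ cQP) -E dvdp_mull.
have Q'0 : Q^`() = 0.
  apply/eqP; apply/negPn/negP => h; have := dvdp_leq h QQ'.
  by rewrite leqNgt lt_size_deriv//; apply: contra_neq h => ->; exact: linear0.
have sQ := size_deriv0 _ Q'0.
have Q0 : Q != 0.
  apply: contraTneq szm => Q0; move: coprimePQ; rewrite Q0 coprimep0 -size_poly_eq1 => /eqP ->.
  by rewrite size_poly0.
have P'0 : P^`() = 0.
  by apply/eqP; move/eqP: E; rewrite Q'0 mulr0 mulf_eq0 (negPf Q0) orbF.
have sP := size_deriv0 _ P'0.
by move: szm; rewrite ltnNge geq_max (leq_trans sP)// (leq_trans sQ).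
Qed.

(** Were [f] injective, the fibre over a finite value other than [f None] would be one root of
    multiplicity [d >= 2], hence a root of the Wronskian; infinitely many values would give it
    infinitely many roots. *)
Lemma rat_map_not_inj : ~ injective f.
Proof.
move=> inj.
pose w0 := if f None is Some w then w else 0.
(* An infinite supply of values different from [f None], for which [G] keeps its full degree [d]. *)
pose w n : C := w0 + n.+1%:R.
have wf n : f None != Some (w n).
  rewrite /w /w0; case: (f None) => [v|]//; rewrite (inj_eq Some_inj).
  by rewrite -subr_eq0 opprD addrA subrr sub0r oppr_eq0 pnatr_eq0.
have /choice[a ha] : forall n, exists b : C, f (Some b) = Some (w n) /\ root (P^`() * Q - P * Q^`()) b.
  move=> n.
  have [rs [srs mrs prs]] := fibre_roots coprimePQ degPQ1 (Some (w n)).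
  have sG : size (G (Some (w n))) = d.+1.
    apply/eqP; rewrite eqn_leq size_fibre_poly ltnNge; apply/negP => h.
    by have := wf n; rewrite fibre_None// nth_default ?eqxx.
  have : size rs = d by apply: succn_inj; rewrite srs.
  case: rs srs mrs prs => [|b [|b' t]] srs mrs prs sd; try by move: degPQ; rewrite -sd.
  have fb : f (Some b) = Some (w n) by apply/eqP; rewrite fibre_Some// -mrs mem_head.
  have fb' : f (Some b') = Some (w n) by apply/eqP; rewrite fibre_Some// -mrs !in_cons eqxx orbT.
  have [bb'] := inj _ _ (etrans fb (esym fb')).
  exists b; split => //.
  have : ('X - b%:P) ^+ 2 %| G (Some (w n)) by apply: (prs b t); rewrite -bb'.
  move=> /dvdpP[q' Gq'].
  have r1 : P.[b] = w n * Q.[b].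
    have := congr1 (fun p : {poly C} => p.[b]) Gq'; rewrite /= hornerM horner_exp hornerXsubC subrr expr0n mulr0 hornerD hornerN hornerZ.
    by move=> /eqP; rewrite subr_eq0 => /eqP.
  have r2 : P^`().[b] = w n * Q^`().[b].
    have := congr1 (fun p : {poly C} => p^`().[b]) Gq'.
    rewrite /= expr2 derivB derivZ !derivM derivXsubC !(hornerXsubC, hornerD, hornerN, hornerZ, hornerM) subrr.
    rewrite !(mulr0, mul0r, addr0).
    by move=> /eqP; rewrite subr_eq0 => /eqP.
  by rewrite /root !hornerE r1 r2 subr_eq0; apply/eqP; ring.
have ainj : injective a.
  move=> n m E; have := (ha n).1; rewrite E (ha m).1 => -[] /addrI /eqP.
  by rewrite eqr_nat => /eqP[].
pose s := [seq a n | n <- iota 0 (size (P^`() * Q - P * Q^`())%R)].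
have rs : all (root (P^`() * Q - P * Q^`())) s by apply/allP => _ /mapP[n _ ->]; exact: (ha n).2.
have us : uniq s by rewrite map_inj_uniq ?iota_uniq.
by have := max_poly_roots wronskian_neq0 rs us; rewrite size_map size_iota ltnn.
Qed.

Lemma iter_surj n y : exists x, iter n f x = y.
Proof.
elim: n y => [|n IH] y; first by exists y.
have [z <-] := rat_map_surj coprimePQ degPQ1 y; have [x <-] := IH z.
by exists x.
Qed.

(* If the Julia set were empty, the iterates would be uniformly equicontinuous and, being
   surjective, some [f^m] with [m >= 1] would be uniformly close to the identity;
   this forces [f] to be injective. *)
Lemma julia_nonempty : julia_set f !=set0.
Proof.
apply/set0P/eqP => J0; apply: rat_map_not_inj => a b fab.
have ec x : equicont_at x.
  have : fatou_set f x by apply: contrapT => h; have : set0 x by rewrite -J0.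
  by move/fatouP => /nbhs_singleton.
apply: sphere_hausdorff => A B nA nB.
have [e e0 hAB] : exists2 e : R, 0 < e & (ball a (e + e)) b -> A `&` B !=set0.
  have /nbhs_ballP[e1 /= e10 h1] := nA; exists (e1 / 2) => [|ab]; first by rewrite divr_gt0.
  exists b; split; last exact: nbhs_singleton.
  by apply: h1; rewrite [e1]splitr.
apply: hAB; clear A B nA nB.
pose e' := e / 4; have e'0 : 0 < e' by rewrite divr_gt0.
have [s [_ hs]] := @compact_finite_nbhs setT
  (fun x => [set y | forall n, ball (iter n f x) e' (iter n f y)]) (@sphere_compact R)
  (fun x _ => filterS (fun y h n => h n I) (ec x _ (entourage_ball S2 (PosNum e'0)))).
have [t [_ ht]] := @compact_finite_nbhs setT (fun x => ball x e') (@sphere_compact R)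
  (fun x _ => nbhsx_ballx x _ e'0).
(* A colour of [n]: for each centre of the first cover, the ball of the second cover that holds its
   iterate. There are finitely many colours, so two exponents share one, and those iterates differ
   by at most four radii [e']. *)
pose col (n : nat) : {ffun 'I_(size s) -> 'I_(size t).+1} :=
  [ffun i : 'I_(size s) => inord (find (fun x => `[< ball x e' (iter n f (nth point s i)) >]) t)].
have [n [m [nm E]]] : exists n m, (n < m)%N /\ col n = col m.
  pose N := #|{ffun 'I_(size s) -> 'I_(size t).+1}|.
  have : ~ injective (fun n : 'I_N.+1 => col n).
    by move=> /leq_card; rewrite card_ord ltnn.
  move=> ninj; have /injectivePn[n [m nm E]] : ~~ injectiveb (fun n : 'I_N.+1 => col n).
    by apply/negP => /injectiveP.
  case: (ltngtP n m) => h'; [by exists n, m|by exists m, n|].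
  by move/eqP: nm; case; apply: val_inj.
have close x : ball (iter n f x) (e' + e' + (e' + e')) (iter m f x).
  have [y ys hy] := hs x I.
  pose i := Ordinal (introT idP (etrans (index_mem y s) ys)).
  have yi : nth point s i = y by rewrite /= nth_index.
  have nb k : exists2 z, ball z e' (iter k f y) & z = nth point t (col k i).
    have hast : has (fun x => `[< ball x e' (iter k f y) >]) t.
      by apply/hasP; have [z zt hz] := ht (iter k f y) I; exists z => //; apply/asboolP.
    have := nth_find point hast => /asboolP hz.
    eexists; first exact: hz.
    rewrite ffunE yi inordK// ltnS; exact: find_size.
  have [z hz zE] := nb n; have [z' hz' z'E] := nb m.
  have zz : z = z' by rewrite zE z'E E.
  apply: (@ball_triangle _ _ z).
    by apply: (@ball_triangle _ _ (iter n f y)); apply: ball_sym; [exact: hy|exact: hz].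
  by apply: (@ball_triangle _ _ (iter m f y)); [rewrite zz|exact: hy].
have eE : e' + e' + (e' + e') = e by rewrite /e'; field.
rewrite eE in close.
have near_id z : ball z e (iter (m - n) f z).
  have [x <-] := iter_surj n z.
  by rewrite -iterD subnK ?close// ltnW.
apply: (@ball_triangle _ _ (iter (m - n) f a)); first exact: near_id.
apply: ball_sym.
have -> : iter (m - n) f a = iter (m - n) f b.
  by rewrite -(subnKC nm) addSnnS addKn !iterSr fab.
exact: near_id.
Qed.

End JuliaSet.

(** * The restricted map as a finite covering: sheets, transfer operator, frame *)

Section JuliaDynamics.
Variable R : realType.
Local Notation C := R[i].
Local Notation S2 := (sphere R).
Variables P Q : {poly C}.
Hypothesis coprimePQ : coprimep P Q.
Hypothesis degPQ : (2 <= rat_degree P Q)%N.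
Local Notation d := (rat_degree P Q).
Local Notation f := (rat_map P Q).
Hypothesis noncritical : forall x, julia_set f x -> ~ critical f x.
Let degPQ1 : (1 <= d)%N := ltnW degPQ.
Local Notation J := (julia_set f).
Local Notation A := (cfun R J).
Local Notation X := (cfun R (graph_julia f)).

Lemma juliaP (x : J) : julia_set f (\val x).
Proof. exact: set_mem (valP x). Qed.

Lemma julia_map_subproof (x : J) : f (\val x) \in julia_set f.
Proof. by apply/mem_set/(julia_image coprimePQ degPQ); exact: juliaP. Qed.

Definition julia_map (x : J) : J := SigSub (julia_map_subproof x).
Local Notation fJ := julia_map.

Lemma graph_point_subproof (x : J) : (\val x, f (\val x)) \in graph_julia f.
Proof. by apply/mem_set; split => //=; [exact: juliaP|exact: set_mem (julia_map_subproof x)]. Qed.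

Definition graph_point (x : J) : graph_julia f := SigSub (graph_point_subproof x).

Lemma graph_src_graph_point x : graph_src (graph_point x) = x.
Proof. exact: val_inj. Qed.

Lemma graph_tgt_graph_point x : graph_tgt (graph_point x) = fJ x.
Proof. exact: val_inj. Qed.

Lemma graph_point_src (p : graph_julia f) : graph_point (graph_src p) = p.
Proof.
apply: val_inj => /=; case: p => -[a b] h /=.
by have [_ _ /= <-] := set_mem h.
Qed.

Lemma julia_map_src (p : graph_julia f) : fJ (graph_src p) = graph_tgt p.
Proof. by rewrite -{2}(graph_point_src p) graph_tgt_graph_point. Qed.

Lemma nbhs_juliaP (x : J) (U : set J) :
  nbhs x U <-> exists2 e : R, 0 < e & forall z : J, ball (\val x : S2) e (\val z) -> U z.
Proof.
split.
  move=> [V [[W oW <-] Wx] WU]; have : nbhs (\val x : S2) W by apply: open_nbhs_nbhs.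
  by move=> /nbhs_ballP[e e0 h]; exists e => // z hz; apply: WU; apply: h.
move=> [e e0 h].
have : nbhs x ((\val : J -> S2) @^-1` ball (\val x : S2) e).
  by apply: (@initial_continuous _ _ (\val : J -> S2)); apply: nbhsx_ballx.
by apply: filterS => z; exact: h.
Qed.

Lemma fibre_subproof (y : J) : exists s : seq J, [/\ uniq s, size s = d &
  forall x, (x \in s) = (fJ x == y)].
Proof.
have [|s [us ss ms]] := @fibre_enum _ P Q coprimePQ degPQ1 (\val y).
  move=> x fx; apply: noncritical; apply/(julia_image coprimePQ degPQ); rewrite fx.
  exact: juliaP.
have sJ x : x \in s -> x \in julia_set f.
  rewrite ms => /eqP fx; apply/mem_set/(julia_image coprimePQ degPQ); rewrite fx.
  exact: juliaP.
have pmE : map \val (pmap (insub : S2 -> option J) s) = s.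
  rewrite pmap_filter; last by move=> x; exact: insubK.
  by apply/all_filterP/allP => x /sJ; rewrite isSome_insub.
exists (pmap (insub : S2 -> option J) s); split.
- by rewrite -(map_inj_uniq val_inj) pmE.
- by rewrite -ss -[in RHS]pmE size_map.
- by move=> x; rewrite -(mem_map val_inj) pmE ms -val_eqE.
Qed.

Definition fibre (y : J) : seq J := sval (cid (fibre_subproof y)).

Lemma fibre_uniq y : uniq (fibre y).
Proof. by rewrite /fibre; case: cid => s []. Qed.

Lemma size_fibre y : size (fibre y) = d.
Proof. by rewrite /fibre; case: cid => s []. Qed.

Lemma mem_fibre y x : (x \in fibre y) = (fJ x == y).
Proof. by rewrite /fibre; case: cid => s []. Qed.

Lemma exists_common_radius (T : eqType) (s : seq T) (H : T -> R -> Prop) :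
  (forall x e e', H x e -> e' <= e -> H x e') ->
  (forall x, x \in s -> exists2 e, 0 < e & H x e) ->
  exists2 e, 0 < e & forall x, x \in s -> H x e.
Proof.
move=> mono; elim: s => [|x s IH] h; first by exists 1.
have [|e1 e10 h1] := IH; first by move=> y ys; apply: h; rewrite in_cons ys orbT.
have [e2 e20 h2] := h x (mem_head _ _).
exists (Num.min e1 e2); first by rewrite lt_min e10.
move=> y; rewrite in_cons => /orP[/eqP->|ys].
  by apply: mono h2 _; rewrite ge_min lexx orbT.
by apply: mono (h1 _ ys) _; rewrite ge_min lexx.
Qed.

Definition separated (s : seq J) (e : R) := forall x x' z : J, x \in s -> x' \in s ->
  ball (\val x : S2) e (\val z) -> ball (\val x' : S2) e (\val z) -> x = x'.

Lemma exists_separated (s : seq J) : exists2 e, 0 < e & separated s e.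
Proof.
pose H (p : J * J) (e : R) := forall z : J,
  ball (\val p.1 : S2) e (\val z) -> ball (\val p.2 : S2) e (\val z) -> p.1 = p.2.
have [|p _|e e0 h] := @exists_common_radius _ [seq (x, x') | x <- s, x' <- s] H.
- by move=> p e e' h ee' z h1 h2; apply: (h z); [exact: le_ball h1|exact: le_ball h2].
- case: p => x x'; rewrite /H /=; have [<-|xx'] := eqVneq x x'; first by exists 1.
  apply: contrapT => h; move/eqP: xx'; apply; apply: val_inj.
  apply: (@sphere_hausdorff R) => U V /nbhs_ballP[e1 /= e10 h1] /nbhs_ballP[e2 /= e20 h2].
  apply: contrapT => UV; apply: h; exists (Num.min e1 e2); first by rewrite lt_min e10.
  move=> z z1 z2; exfalso; apply: UV; exists (\val z); split.
    by apply: h1; apply: le_ball z1; rewrite ge_min lexx.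
  by apply: h2; apply: le_ball z2; rewrite ge_min lexx orbT.
- exists e => // x x' z xs x's h1 h2; apply: (h (x, x') _ z) => //.
  by apply/allpairsP; exists (x, x').
Qed.

(** Openness provides a preimage of [y] near each preimage of [y0], separation makes these distinct,
    and both fibres have exactly [d] points, so nothing is missed. *)
Lemma fibre_sheets (y0 : J) (e : R) : 0 < e -> \forall y \near y0,
  exists s : J -> J, perm_eq (fibre y) (map s (fibre y0)) /\
    forall x, x \in fibre y0 -> ball (\val x : S2) e (\val (s x)).
Proof.
move=> e0; have [e1 e10 sep] := exists_separated (fibre y0).
pose r := Num.min e e1; have r0 : 0 < r by rewrite lt_min e0.
have re : r <= e by rewrite ge_min lexx.
have re1 : r <= e1 by rewrite ge_min lexx orbT.
have [|x xy|t t0 ht] := @exists_common_radius _ (fibre y0)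
    (fun x t => forall y : J, ball (\val y0 : S2) t (\val y) -> exists2 x', fJ x' = y & ball (\val x : S2) r (\val x')).
- by move=> x t t' h tt' y hy; apply: h; exact: le_ball hy.
- have /nbhs_ballP[t /= t0 h] := rat_map_open coprimePQ degPQ1 (nbhsx_ballx (\val x : S2) r r0).
  have fx : f (\val x) = \val y0.
    by have := xy; rewrite mem_fibre => /eqP <-.
  exists t => // y; rewrite -fx => /h[z hz fz].
  have zJ : z \in julia_set f.
    by apply/mem_set/(julia_image coprimePQ degPQ); rewrite fz; exact: juliaP.
  by exists (SigSub zJ) => //; apply: val_inj.
apply/nbhs_juliaP; exists t => // y hy.
pose s (x : J) := xget y0 [set x' | fJ x' = y /\ ball (\val x : S2) r (\val x')].
have sP x : x \in fibre y0 -> fJ (s x) = y /\ ball (\val x : S2) r (\val (s x)).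
  move=> xy; have [x' h1 h2] := ht x xy y hy.
  by rewrite /s; case: xgetP => [z _ //|/(_ x')[]].
exists s; split; last by move=> x /sP[_]; exact: le_ball.
have us : uniq (map s (fibre y0)).
  rewrite map_inj_in_uniq ?fibre_uniq// => x x' hx hx' E.
  have [_ h1] := sP x hx; have [_ h2] := sP x' hx'.
  by apply: (sep x x' (s x) hx hx'); [exact: le_ball h1|rewrite E; exact: le_ball h2].
rewrite perm_sym; apply: uniq_perm => //; first exact: fibre_uniq.
apply: (fun h1 h2 => (uniq_min_size us h1 h2).2); last by rewrite size_map !size_fibre.
by move=> _ /mapP[x xy ->]; rewrite mem_fibre; case: (sP x xy) => ->.
Qed.

Definition transfer (h : J -> C) (y : J) : C := \sum_(x <- fibre y) h x.

Lemma transferE h y : transfer h y = \sum_(x <- fibre y) h x.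
Proof. by []. Qed.

Lemma transfer_continuous (h : J -> C^o) : continuous h -> continuous (transfer h : J -> C^o).
Proof.
move=> /continuous_rnormP ch; apply/continuous_rnormP => y0 e e0.
have d0 : 0 < d%:R :> R by rewrite ltr0n.
have [|x _|r r0 hr] := @exists_common_radius _ (fibre y0)
  (fun x r => forall z : J, ball (\val x : S2) r (\val z) -> rnorm (h x - h z) < e / d%:R).
- by move=> x r r' hh rr' z hz; apply: hh; exact: le_ball hz.
- by have /nbhs_juliaP[r r0 hr] := ch x _ (divr_gt0 e0 d0); exists r.
apply: filterS (fibre_sheets y0 r0) => y [s [ps hs]].
rewrite /mkset /transfer (perm_big _ ps) /= big_map -sumrB.
apply: (le_lt_trans (rnorm_sum _ _ _)).
have -> : e = \sum_(x <- fibre y0) (e / d%:R).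
  by rewrite big_const_seq count_predT size_fibre iter_addr_0 -[RHS]mulr_natr mulfVK// lt0r_neq0.
rewrite big_seq [ltRHS]big_seq; apply: ltr_sum; last by move=> x xs; apply: hr => //; exact: hs.
have : (0 < size (fibre y0))%N by rewrite size_fibre.
by case: (fibre y0) => // x s' _; apply/hasP; exists x; rewrite mem_head.
Qed.

Definition gval (xi : X) (x : J) : C := xi (graph_point x).

Lemma graph_point_continuous : continuous graph_point.
Proof.
apply: continuous_comp_initial => x.
have cv : {for x, continuous (\val : J -> S2)} by exact: initial_continuous.
have cfv : {for x, continuous (f \o (\val : J -> S2))}.
  by apply: continuous_comp; [exact: cv|exact: rat_map_continuous].
move=> U [[A1 A2] /= [n1 n2] AU].
have h := @filterI _ (nbhs x) _ _ _ (cv _ n1) (cfv _ n2).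
apply: (@filterS _ (nbhs x) (nbhs_filter x) _ _ _ (h (nbhs_filter x))) => z [h1 h2].
exact: (AU (\val z, f (\val z))).
Qed.

Lemma julia_map_continuous : continuous fJ.
Proof.
apply: continuous_comp_initial => x.
apply: (@continuous_comp _ _ _ (\val : J -> S2) f); first exact: initial_continuous.
exact: rat_map_continuous.
Qed.

Lemma gval_continuous xi : continuous (gval xi : J -> C^o).
Proof.
move=> x; apply: (@continuous_comp _ _ _ graph_point xi); first exact: graph_point_continuous.
exact: cfun_continuous.
Qed.

Lemma gval_eq xi eta : gval xi =1 gval eta -> xi = eta.
Proof.
move=> h; apply: val_inj; apply/funext => p; rewrite -(graph_point_src p); exact: h.
Qed.

Definition cfun_of (h : J -> C) : A := insubd 0 (h : J -> C^o).

Lemma cfun_ofE (h : J -> C) : continuous (h : J -> C^o) -> cfun_of h =1 h.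
Proof. by move=> ch x; rewrite /cfun_of -[LHS]/((\val (insubd (0 : A) _)) x) insubdK//; apply/cfunsP. Qed.

Lemma branch_index_julia (x : J) : branch_index f (\val x) = 1%N.
Proof.
apply: branch_indexE; apply: noncritical_branch => //.
by apply: noncritical; exact: juliaP.
Qed.

Lemma inner_transfer_continuous (xi eta : X) :
  continuous (transfer (fun x => conjc (gval xi x) * gval eta x) : J -> C^o).
Proof.
apply: transfer_continuous.
have -> : (fun x => conjc (gval xi x) * gval eta x) = gval (cfun_conj xi * eta) by apply/funext.
exact: gval_continuous.
Qed.

(** All branch indices on [J] are 1, and the resulting sum is continuous in [y], so [insubd] returns
    it instead of the default. *)
Lemma innerE xi eta y : inner xi eta y = transfer (fun x => conjc (gval xi x) * gval eta x) y.
Proof.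
have E : (fun y : J => \sum_(p \in [set p : graph_julia f | graph_tgt p = y])
      (branch_index f (\val p).1)%:R * (conjc (xi p) * eta p) : C^o) =
  transfer (fun x => conjc (gval xi x) * gval eta x).
  apply/funext => z; rewrite /transfer.
  have setE : [set p : graph_julia f | graph_tgt p = z] = [set` [seq graph_point x | x <- fibre z]].
    apply/seteqP; split=> p /=.
      move=> pz; apply/mapP; exists (graph_src p); last by rewrite graph_point_src.
      by rewrite mem_fibre julia_map_src pz.
    by move=> /mapP[x]; rewrite mem_fibre => /eqP <- ->; rewrite graph_tgt_graph_point.
  rewrite setE -fsbig_seq; last first.
    by rewrite map_inj_uniq ?fibre_uniq// => a b /(congr1 (@graph_src _ f)); rewrite !graph_src_graph_point.
  rewrite big_map; apply: eq_bigr => x _.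
  by rewrite branch_index_julia mul1r.
transitivity (cfun_of (transfer (fun x => conjc (gval xi x) * gval eta x)) y).
  by rewrite /cfun_of -E.
rewrite cfun_ofE//; exact: inner_transfer_continuous.
Qed.

Lemma gval_lact a xi x : gval (lact a xi) x = a x * gval xi x.
Proof.
rewrite /gval /lact -[LHS]/(a (graph_src (graph_point x)) * xi (graph_point x)).
by rewrite graph_src_graph_point.
Qed.

Lemma gval_ract xi b x : gval (ract xi b) x = gval xi x * b (fJ x).
Proof.
rewrite /gval /ract -[LHS]/(xi (graph_point x) * b (graph_tgt (graph_point x))).
by rewrite graph_tgt_graph_point.
Qed.

Lemma gvalD xi eta x : gval (xi + eta) x = gval xi x + gval eta x.
Proof. by []. Qed.

Lemma gvalZ k xi x : gval (k *: xi) x = k * gval xi x.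
Proof. by []. Qed.

Lemma gval_sum (I : Type) (r : seq I) (F : I -> X) x :
  gval (\sum_(i <- r) F i) x = \sum_(i <- r) gval (F i) x.
Proof. by elim/big_rec2: _ => // i u v _ <-; rewrite gvalD. Qed.

(** Two points of one fibre close to [c] both lie on the sheet through [c], so they agree; halving
    the radii of a finite cover makes the radius uniform, as for a Lebesgue number. *)
Lemma local_injective : exists2 r : R, 0 < r & forall x x' : J,
  ball (\val x : S2) r (\val x') -> fJ x = fJ x' -> x = x'.
Proof.
pose H (c : S2) (r : R) := forall x x' : J, ball c r (\val x) -> ball c r (\val x') ->
  fJ x = fJ x' -> x = x'.
have Hmono c r r' : H c r -> r' <= r -> H c r'.
  by move=> h rr' x x' h1 h2; apply: h; [exact: le_ball h1|exact: le_ball h2].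
have Hex (c : J) : exists2 r, 0 < r & H (\val c) r.
  have [e e0 sep] := exists_separated (fibre (fJ c)).
  have cc : c \in fibre (fJ c) by rewrite mem_fibre.
  have : nbhs c (fJ @^-1` [set y | exists s : J -> J, perm_eq (fibre y) (map s (fibre (fJ c))) /\
    forall x, x \in fibre (fJ c) -> ball (\val x : S2) e (\val (s x))]).
    by apply: julia_map_continuous; exact: fibre_sheets.
  move=> /nbhs_juliaP[r r0 hr]; exists (Num.min r e); first by rewrite lt_min r0.
  move=> x x' hx hx' E.
  have [s [ps hs]] : exists s : J -> J, perm_eq (fibre (fJ x)) (map s (fibre (fJ c))) /\
    forall x, x \in fibre (fJ c) -> ball (\val x : S2) e (\val (s x)).
    by apply: hr; apply: le_ball hx; rewrite ge_min lexx.
  have key z : fJ z = fJ x -> ball (\val c : S2) (Num.min r e) (\val z) -> z = s c.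
    move=> fz hz; have : z \in fibre (fJ x) by rewrite mem_fibre fz.
    rewrite (perm_mem ps) => /mapP[b bc zb]; rewrite zb; congr s.
    apply: (sep b c z) => //; first by rewrite zb; exact: hs.
    by apply: le_ball hz; rewrite ge_min lexx orbT.
  by rewrite (key x)// (key x').
have [rad hrad] : exists rad : J -> R, forall c, 0 < rad c /\ H (\val c) (rad c).
  have /choice[rad hrad] : forall c : J, exists r, 0 < r /\ H (\val c) r.
    by move=> c; have [r r0 hr] := Hex c; exists r.
  by exists rad.
pose U (x : S2) := if (insub x : option J) is Some c then ball x (rad c / 2) else setT.
have nU x : nbhs x (U x).
  rewrite /U; case: insubP => [c _ _|_]; last exact: filterT.
  by apply: nbhsx_ballx; rewrite divr_gt0//; exact: (hrad c).1.
have [s [sJ hs]] := @compact_finite_nbhs _ J U (@julia_compact _ P Q) (fun x _ => nU x).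
have [|x xs|r r0 hr] := @exists_common_radius _ s (fun x r => forall c : J, x = \val c -> r <= rad c / 2).
- by move=> x r r' h rr' c xc; apply: (le_trans rr'); exact: h.
- have xJ : x \in julia_set f by apply/mem_set; exact: sJ.
  exists (rad (SigSub xJ) / 2); first by rewrite divr_gt0//; exact: (hrad _).1.
  by move=> c xc; have -> // : SigSub xJ = c; apply: val_inj.
exists r => // x x' xx' E; have [c cs] := hs (\val x) (@juliaP x).
rewrite /U; case: insubP => [c' _ cc'|]; last by rewrite (mem_set (sJ _ cs)).
have rc := hr _ cs c' (esym cc'); rewrite -cc' => cx.
apply: ((hrad c').2 x x') => //.
  by apply: le_ball cx; rewrite ler_pdivrMr// ler_pMr ?ler1n//; exact: (hrad _).1.
rewrite [rad c']splitr; apply: ball_triangle cx _; exact: le_ball xx'.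
Qed.

Lemma stereo_comp_continuous (g : R * R * R -> R) : continuous g ->
  continuous (fun x : J => g (stereo (\val x))).
Proof.
move=> cg x; apply: (@continuous_comp _ _ _ (fun x : J => @stereo R (\val x)) g); last exact: cg.
apply: (@continuous_comp _ _ _ (\val : J -> S2) (@stereo R : S2 -> _)); first exact: initial_continuous.
exact: initial_continuous.
Qed.

(* The [u]'s are square roots of a partition of unity subordinate to a cover by sets on
   which [f] is injective. *)
Lemma exists_basis : exists us : seq X, forall x x' : J, fJ x = fJ x' ->
  \sum_(u <- us) gval u x * conjc (gval u x') = (x == x')%:R.
Proof.
have [r r0 hr] := local_injective; have r2 : 0 < r / 2 by rewrite divr_gt0.
have [s [_ hs]] := @compact_finite_nbhs _ J (fun x => ball x (r / 2)) (@julia_compact _ P Q)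
  (fun x _ => nbhsx_ballx x _ r2).
(* The positive part of [r / 2 - |c - x|]: a bump supported on the interval of radius [r / 2], whose
   products in the three coordinates are supported on balls of the sphere. *)
pose b (c x : R) : R := (r / 2 - `|c - x| + `|r / 2 - `|c - x| |) / 2.
have b0 c x : 0 <= b c x.
  rewrite /b; set t := r / 2 - _; have := ler_norm (- t); rewrite normrN => h.
  by rewrite divr_ge0// -(opprK t) addrC subr_ge0 opprK.
have bpos c x : (0 < b c x) = (`|c - x| < r / 2).
  rewrite -[RHS]subr_gt0 /b; set t := r / 2 - _; rewrite pmulr_lgt0 ?invr_gt0//.
  have [h|h] := leP t 0; first by rewrite ler0_norm// subrr ltxx.
  by rewrite gtr0_norm// addr_gt0.
have cb c : continuous (b c).
  have cu : continuous (fun x => r / 2 - `|c - x|).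
    by move=> x; apply: cvgB; [exact: cvg_cst|apply: cvg_norm; apply: cvgB; [exact: cvg_cst|exact: cvg_id]].
  move=> x; apply: cvgM; last exact: cvg_cst.
  by apply: cvgD; [exact: cu|apply: cvg_norm; exact: cu].
clearbody b; pose v (c : S2) (q : R * R * R) : R := b (stereo c).1.1 q.1.1 * b (stereo c).1.2 q.1.2 * b (stereo c).2 q.2.
have v0 c q : 0 <= v c q by rewrite !mulr_ge0.
have vpos c (x : S2) : (0 < v c (stereo x)) <-> ball c (r / 2) x.
  rewrite ball_sphereE /v; split=> [|[h1 h2 h3]]; last by rewrite !mulr_gt0// bpos.
  move=> h; have h' : [/\ b (stereo c).1.1 (stereo x).1.1 != 0, b (stereo c).1.2 (stereo x).1.2 != 0 &
      b (stereo c).2 (stereo x).2 != 0].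
    by move: (lt0r_neq0 h); rewrite !mulf_eq0 !negb_or => /andP[/andP[]].
  by case: h' => h1 h2 h3; split; rewrite -bpos lt0r b0 andbT.
have cv c : continuous (v c).
  move=> q; apply: cvgM; first apply: cvgM.
  - apply: (@continuous_comp _ _ _ (fun q : R * R * R => q.1.1) (b _)); last exact: cb.
    by apply: (@cvg_comp _ _ _ fst fst _ (nbhs q.1)); [exact: cvg_fst|exact: cvg_fst].
  - apply: (@continuous_comp _ _ _ (fun q : R * R * R => q.1.2) (b _)); last exact: cb.
    by apply: (@cvg_comp _ _ _ fst snd _ (nbhs q.1)); [exact: cvg_fst|exact: cvg_snd].
  - apply: (@continuous_comp _ _ _ (fun q : R * R * R => q.2) (b _)); last exact: cb.
    exact: cvg_snd.
pose V q := \sum_(c <- s) v c q.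
have cV : continuous V.
  rewrite /V; elim: (s) => [|c s' IH].
    by have -> : (fun q => \sum_(c <- [::]) v c q) = cst 0 by [apply/funext => q; rewrite big_nil]; move=> q; exact: cvg_cst.
  have -> : (fun q => \sum_(c <- c :: s') v c q) = (fun q => v c q + \sum_(c <- s') v c q).
    by apply/funext => q; rewrite big_cons.
  by move=> q; apply: cvgD; [exact: cv|exact: IH].
have Vpos (x : J) : 0 < V (stereo (\val x)).
  have [c cs hc] := hs (\val x) (@juliaP x).
  rewrite /V (big_rem c)//=; apply: ltr_pwDl; first exact/vpos.
  by apply: sumr_ge0.
pose w c (x : J) : R := Num.sqrt (v c (stereo (\val x)) / V (stereo (\val x))).
have cw c : continuous (w c).
  move=> x; apply: (@continuous_comp _ _ _ (fun x : J => v c (stereo (\val x)) / V (stereo (\val x))) (@Num.sqrt R)); last exact: sqrt_continuous.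
  have c2 : {for x, continuous (fun x : J => (V (stereo (\val x)))^-1)}.
    have V0 := lt0r_neq0 (Vpos x).
    apply: (@continuous_comp _ _ _ (fun x : J => V (stereo (\val x))) (@GRing.inv R)).
      exact: (stereo_comp_continuous cV).
    exact: inv_continuous.
  exact: (cvgM (stereo_comp_continuous (cv c) (x:=x)) c2).
have cu c : (fun p : graph_julia f => ((w c (graph_src p))%:C : C^o)) \in @cfuns R _.
  apply/cfunsP; apply/continuous_rnormP => p e e0.
  have cwp : {for p, continuous (fun p : graph_julia f => w c (graph_src p))}.
    by apply: (@continuous_comp _ _ _ (@graph_src _ f) (w c)); [exact: graph_src_continuous|exact: cw].
  have /cvgrPdist_lt/(_ _ e0) := cwp.
  by apply: filterS => q; rewrite /mkset -rmorphB rnorm_real.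
exists [seq Cfun (cu c) | c <- s] => x x' E.
rewrite big_map.
have gE c y : gval (Cfun (cu c)) y = (w c y)%:C by rewrite /gval /= graph_src_graph_point.
have cE (t : R) : conjc (t%:C) = t%:C by rewrite /= oppr0.
have [<-|xx'] := eqVneq x x'.
  rewrite -[RHS]/((1 : R)%:C) -(divff (lt0r_neq0 (Vpos x))) {1}/V mulr_suml rmorph_sum.
  apply: eq_bigr => c _; rewrite gE cE -rmorphM; congr (_%:C).
  by rewrite -expr2 sqr_sqrtr// divr_ge0// ltW.
apply: big1 => c _; rewrite !gE cE -rmorphM.
have [h|h] := boolP (0 < v c (stereo (\val x))); last first.
  suff -> : w c x = 0 by rewrite mul0r rmorph0.
  by rewrite /w (_ : v c _ = 0) ?mul0r ?sqrtr0//; apply: le_anti; rewrite v0 andbT leNgt.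
have [h'|h'] := boolP (0 < v c (stereo (\val x'))); last first.
  suff -> : w c x' = 0 by rewrite mulr0 rmorph0.
  by rewrite /w (_ : v c _ = 0) ?mul0r ?sqrtr0//; apply: le_anti; rewrite v0 andbT leNgt.
exfalso; move/eqP: xx'; apply; apply: hr => //.
rewrite [r]splitr; apply: (@ball_triangle _ _ c); last exact/vpos.
by apply: ball_sym; exact/vpos.
Qed.

End JuliaDynamics.

(** * Square-summable families and bounded operators *)

Section ConjMorphism.
Variable R : realType.
Implicit Types z w : R[i].

Lemma conjcD z w : conjc (z + w) = conjc z + conjc w.
Proof. exact: rmorphD. Qed.

Lemma conjcB z w : conjc (z - w) = conjc z - conjc w.
Proof. exact: rmorphB. Qed.

Lemma conjcM z w : conjc (z * w) = conjc z * conjc w.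
Proof. exact: rmorphM. Qed.

Lemma conjc_sum (I : Type) (s : seq I) (g : I -> R[i]) :
  conjc (\sum_(i <- s) g i) = \sum_(i <- s) conjc (g i).
Proof. exact: rmorph_sum. Qed.

End ConjMorphism.

Section UnconditionalSums.
Variables (R : realType).
Local Notation C := R[i].

Lemma big_uniq_subset (I : eqType) (V : nmodType) (s t : seq I) (g : I -> V) :
  uniq s -> uniq t -> {subset s <= t} ->
  \sum_(i <- t) g i = \sum_(i <- s) g i + \sum_(i <- t | i \notin s) g i.
Proof.
move=> us ut st; rewrite (bigID (mem s)) /=; congr (_ + _).
rewrite -big_filter; apply: perm_big; apply: uniq_perm => //; first exact: filter_uniq.
by move=> x; rewrite mem_filter andb_idr//; exact: st.
Qed.

Definition is_sum (I : eqType) (g : I -> C) (l : C) := forall e : R, 0 < e ->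
  exists s0 : seq I, forall s, uniq s -> {subset s0 <= s} -> rnorm (l - \sum_(i <- s) g i) <= e.

Section IndexType.
Variable I : eqType.
Implicit Types (g : I -> C) (l : C).

Lemma is_sum_approx2 g g' l l' (e : R) : is_sum g l -> is_sum g' l' -> 0 < e ->
  exists s0 : seq I, forall s, uniq s -> {subset s0 <= s} ->
    rnorm (l - \sum_(i <- s) g i) <= e /\ rnorm (l' - \sum_(i <- s) g' i) <= e.
Proof.
move=> h h' e0; have [s1 h1] := h _ e0; have [s2 h2] := h' _ e0.
exists (s1 ++ s2) => s us hs; split.
  by apply: h1 => // x xs; apply: hs; rewrite mem_cat xs.
by apply: h2 => // x xs; apply: hs; rewrite mem_cat xs orbT.
Qed.

Lemma is_sum_unique g l l' : is_sum g l -> is_sum g l' -> l = l'.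
Proof.
move=> h h'; apply/eqP; rewrite -subr_eq0; apply/eqP; apply: rnorm_lt_eps_eq0 => e e0.
have e2 : 0 < e / 2 by rewrite divr_gt0.
have [s0 hs] := is_sum_approx2 h h' e2.
have [|h1 h2] := hs _ (undup_uniq s0); first by move=> x; rewrite mem_undup.
rewrite (le_trans (rdist_triangle (\sum_(i <- undup s0) g i) _ _))// [e]splitr lerD//.
by rewrite rdistC.
Qed.

Lemma is_sum_linear k g l g' l' : is_sum g l -> is_sum g' l' ->
  is_sum (fun i => k * g i + g' i) (k * l + l').
Proof.
move=> h h' e e0; have k0 := rnorm_ge0 k.
have [|s0 hs] := is_sum_approx2 h h' (_ : 0 < e / (rnorm k + 1)).
  by rewrite divr_gt0// ltr_wpDl.
exists s0 => s us ss; have [h1 h2] := hs s us ss.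
rewrite big_split -mulr_sumr /= opprD addrACA -mulrBr.
apply: (le_trans (rnormD _ _)); rewrite rnormM.
apply: (le_trans (lerD (ler_wpM2l k0 h1) h2)).
rewrite -{2}(mul1r (e / _)) -mulrDl mulrC divfK// lt0r_neq0// ltr_wpDl//.
Qed.

Lemma is_sum_conj g l : is_sum g l -> is_sum (fun i => conjc (g i)) (conjc l).
Proof.
move=> h e e0; have [s0 hs] := h e e0; exists s0 => s us ss.
by rewrite -conjc_sum -conjcB rnorm_conj; exact: hs.
Qed.

Lemma is_sum_finite g (s : seq I) : uniq s -> (forall i, i \notin s -> g i = 0) ->
  is_sum g (\sum_(i <- s) g i).
Proof.
move=> us h e e0; exists s => t ut st.
rewrite (big_uniq_subset _ us ut st) [X in _ - (_ + X)]big1; last by move=> i; exact: h.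
by rewrite addr0 subrr rnorm0 ltW.
Qed.

Lemma ler_sum_subset (g : I -> R) (s t : seq I) : (forall i, 0 <= g i) ->
  uniq s -> uniq t -> {subset s <= t} -> \sum_(i <- s) g i <= \sum_(i <- t) g i.
Proof. by move=> g0 us ut st; rewrite (big_uniq_subset _ us ut st) lerDl sumr_ge0. Qed.

Lemma is_sum_ge0 (g : I -> R) (K : R) : (forall i, 0 <= g i) ->
  (forall s, uniq s -> \sum_(i <- s) g i <= K) ->
  exists l : R, is_sum (fun i => (g i)%:C) l%:C.
Proof.
move=> g0 gK; pose E := [set \sum_(i <- s) g i | s in [set s | uniq s]].
have supE : has_sup E.
  split; first by exists 0, [::] => //; rewrite big_nil.
  by exists K => _ [s us <-]; exact: gK.
exists (sup E) => e e0.
have [_ [s0 us0 <-] hs0] := @sup_adherent _ E _ e0 supE.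
exists s0 => s us ss.
have h1 : \sum_(i <- s) g i <= sup E by apply: ub_le_sup; [exact: supE.2|exists s].
have h2 := ler_sum_subset g0 us0 us ss.
rewrite -rmorph_sum -rmorphB rnorm_real ger0_norm ?subr_ge0//; lra.
Qed.

Lemma is_sum_partial_le (g : I -> R) (l : R) (s : seq I) : (forall i, 0 <= g i) ->
  is_sum (fun i => (g i)%:C) l%:C -> uniq s -> \sum_(i <- s) g i <= l.
Proof.
move=> g0 h us; apply/ler_addgt0Pr => e e0; have [s0 hs] := h e e0.
have ut := undup_uniq (s0 ++ s).
have sub : {subset s0 <= undup (s0 ++ s)} by move=> x xs; rewrite mem_undup mem_cat xs.
have := hs _ ut sub; rewrite -rmorph_sum -rmorphB rnorm_real ler_norml => /andP[h1 _].
have : \sum_(i <- s) g i <= \sum_(i <- undup (s0 ++ s)) g i.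
  by apply: ler_sum_subset => // x xs; rewrite mem_undup mem_cat xs orbT.
lra.
Qed.

Lemma is_sum_le (g : I -> R) (l K : R) : is_sum (fun i => (g i)%:C) l%:C ->
  (forall s, uniq s -> \sum_(i <- s) g i <= K) -> l <= K.
Proof.
move=> h hK; apply/ler_addgt0Pr => e e0; have [s0 hs] := h e e0.
have sub : {subset s0 <= undup s0} by move=> x; rewrite mem_undup.
have := hs _ (undup_uniq s0) sub; rewrite -rmorph_sum -rmorphB rnorm_real ler_norml => /andP[_ h1]; have := hK _ (undup_uniq s0); lra.
Qed.

End IndexType.

Lemma uniq_flatten_fibres (I K : eqType) (phi : I -> K) (fib : K -> seq I) (s : seq K) :
  (forall y, uniq (fib y)) -> (forall x y, (x \in fib y) = (phi x == y)) -> uniq s ->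
  uniq (flatten (map fib s)).
Proof.
move=> uf mf; elim: s => //= y s IH /andP[ys us]; rewrite cat_uniq uf IH// andbT /=.
apply/hasPn => x /flattenP[_ /mapP[z zs ->]]; rewrite mf => /eqP xz.
by rewrite mf xz; apply: contraNN ys => /eqP <-.
Qed.

Lemma mem_flatten_fibres (I K : eqType) (phi : I -> K) (fib : K -> seq I) (s : seq K) x :
  (forall x y, (x \in fib y) = (phi x == y)) ->
  (x \in flatten (map fib s)) = (phi x \in s).
Proof.
move=> mf; apply/flattenP/idP => [[_ /mapP[z zs ->]]|xs].
  by rewrite mf => /eqP ->.
by exists (fib (phi x)); [exact: map_f|rewrite mf].
Qed.

(** Summation by fibres; this identifies the adjoint of a weighted composition operator. *)
Lemma is_sum_push (I K : eqType) (phi : I -> K) (fib : K -> seq I) (g : I -> C) l :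
  (forall y, uniq (fib y)) -> (forall x y, (x \in fib y) = (phi x == y)) ->
  is_sum g l -> is_sum (fun y => \sum_(x <- fib y) g x) l.
Proof.
move=> uf mf h e e0; have [s0 hs] := h e e0; exists (map phi s0) => s us ss.
rewrite -(big_map fib xpredT (fun t => \sum_(x <- t) g x)) -big_flatten.
apply: hs; first exact: (uniq_flatten_fibres uf mf us).
by move=> x xs; rewrite (mem_flatten_fibres _ _ mf); apply: ss; exact: map_f.
Qed.

End UnconditionalSums.

(** * The Hilbert space of square-summable families *)

Section SquareSummable.
Variables (R : realType) (I : choiceType).
Local Notation C := R[i].

Definition sq_summable : {pred I -> C^o} :=
  [pred h | `[< exists K : R, forall s, uniq s -> \sum_(i <- s) rnorm (h i : C) ^+ 2 <= K >]].

Lemma sqr_rnormD_le (a b : C) : rnorm (a + b) ^+ 2 <= 2 * rnorm a ^+ 2 + 2 * rnorm b ^+ 2.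
Proof.
apply: (@le_trans _ _ ((rnorm a + rnorm b) ^+ 2)).
  by rewrite ler_pXn2r ?nnegrE ?rnorm_ge0 ?addr_ge0 ?rnorm_ge0// rnormD.
rewrite -subr_ge0 (_ : _ - _ = (rnorm a - rnorm b) ^+ 2) ?sqr_ge0//; ring.
Qed.

Lemma sq_summable_submod : submod_closed sq_summable.
Proof.
split.
  by apply/asboolP; exists 0 => s _; rewrite big1// => i _; rewrite rnorm0 expr0n.
move=> k u v /asboolP[K hK] /asboolP[L hL]; apply/asboolP.
exists (2 * (rnorm k ^+ 2 * K) + 2 * L) => s us.
apply: (@le_trans _ _ (\sum_(i <- s) (2 * (rnorm k ^+ 2 * rnorm (u i) ^+ 2) + 2 * rnorm (v i : C) ^+ 2))).
  apply: ler_sum => i _; apply: (le_trans (sqr_rnormD_le _ _)).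
  by rewrite rnormM exprMn.
rewrite big_split -!mulr_sumr lerD// ler_wpM2l//; last exact: hL.
by apply: ler_wpM2l; [exact: exprn_ge0 (rnorm_ge0 _)|exact: hK].
Qed.

HB.instance Definition _ := GRing.isSubmodClosed.Build _ _ sq_summable sq_summable_submod.

Record l2 := L2 { l2_val :> I -> C^o; _ : l2_val \in sq_summable }.

HB.instance Definition _ := [isSub for l2_val].
HB.instance Definition _ := [Choice of l2 by <:].
HB.instance Definition _ := [SubChoice_isSubLmodule of l2 by <:].

Implicit Types u v w : l2.

Lemma l2_bounded u : exists K : R, forall s, uniq s -> \sum_(i <- s) rnorm (u i : C) ^+ 2 <= K.
Proof. by case: u => u hu; exact/asboolP. Qed.

Lemma l2_eq u v : (forall i, u i = v i) -> u = v.
Proof. by move=> h; apply: val_inj; apply/funext. Qed.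

Lemma l2E (k : C) u v i : (k *: u + v) i = k * u i + v i :> C.
Proof. by []. Qed.

Lemma ip_subproof u v : exists l, is_sum (fun i => conjc (u i) * v i) l.
Proof.
have sq w : exists l, is_sum (fun i => (rnorm (w i : C) ^+ 2)%:C) l.
  have [K hK] := l2_bounded w.
  have [|l hl] := is_sum_ge0 _ hK; first by move=> i; exact: exprn_ge0 (rnorm_ge0 _).
  by exists l%:C.
have comb k g g' : (exists l, @is_sum R I g l) -> (exists l, is_sum g' l) ->
    exists l, is_sum (fun i => k * g i + g' i) l.
  by move=> [l h] [l' h']; exists (k * l + l'); exact: is_sum_linear.
(* Polarization: the summand is twice the real part of [conjc (u i) * w i], and only nonnegative
   families have been summed so far. *)
have pol w : exists l, is_sum (fun i => - 1 * (rnorm (u i : C) ^+ 2)%:C + (- 1 * (rnorm (w i : C) ^+ 2)%:C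
    + (rnorm ((u + w) i : C) ^+ 2)%:C)) l.
  exact: (comb _ _ _ (sq u) (comb _ _ _ (sq w) (sq _))).
(* With [w = - i v] the same expression is twice the imaginary part of [conjc (u i) * v i]; hence
   the coefficients [1 / 2] for [v] and [i / 2] for [c *: v]. *)
pose c : C := 0 +i* (- 1).
pose h : C := (2^-1)%:C; pose h' : C := 0 +i* 2^-1.
have zz : exists l, is_sum (fun i : I => (rnorm ((0 : l2) i : C) ^+ 2)%:C) l by exact: sq.
have [l hl] := comb h' _ _ (pol (c *: v)) (comb h _ _ (pol v) zz).
exists l; move: hl; congr is_sum; apply/funext => i.
rewrite -[(u + c *: v) i]/(u i + c * v i) -[(u + v) i]/(u i + v i) -[(c *: v) i]/(c * v i) -[(0 : l2) i]/0.
rewrite rnorm0 expr0n !sqr_rnorm /h /h' /c.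
case: (u i : C) (v i : C) => a b [a' b']; apply/eqP; rewrite eq_complex /=.
by apply/andP; split; apply/eqP; field.
Qed.

Definition ip u v : C := sval (cid (ip_subproof u v)).

Lemma ipP u v : is_sum (fun i => conjc (u i) * v i) (ip u v).
Proof. by rewrite /ip; case: cid. Qed.

Lemma ipE u v l : is_sum (fun i => conjc (u i) * v i) l -> ip u v = l.
Proof. exact: is_sum_unique (ipP u v). Qed.

Lemma ip_linear k u v w : ip u (k *: v + w) = k * ip u v + ip u w.
Proof.
apply: ipE; have := is_sum_linear k (ipP u v) (ipP u w); congr is_sum.
by apply/funext => i; rewrite l2E mulrDr mulrCA.
Qed.

Lemma ip_conj u v : ip v u = conjc (ip u v).
Proof.
apply: ipE; have := is_sum_conj (ipP u v); congr is_sum.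
by apply/funext => i; rewrite conjcM conjcK mulrC.
Qed.

Lemma ip0 u : ip u 0 = 0.
Proof. by have := ip_linear (-1) u u u; rewrite scaleN1r addNr mulN1r addNr. Qed.

Lemma ipD u v w : ip u (v + w) = ip u v + ip u w.
Proof. by rewrite -[v in LHS]scale1r ip_linear mul1r. Qed.

Lemma ipZ k u v : ip u (k *: v) = k * ip u v.
Proof. by rewrite -[k *: v]addr0 ip_linear ip0 addr0. Qed.

Lemma ipN u v : ip u (- v) = - ip u v.
Proof. by rewrite -scaleN1r ipZ mulN1r. Qed.

Lemma ipB u v w : ip u (v - w) = ip u v - ip u w.
Proof. by rewrite ipD ipN. Qed.

Lemma ipDl u v w : ip (u + v) w = ip u w + ip v w.
Proof. by rewrite ip_conj ipD conjcD -!ip_conj. Qed.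

Lemma ipZl k u v : ip (k *: u) v = conjc k * ip u v.
Proof. by rewrite ip_conj ipZ conjcM -!ip_conj. Qed.

Lemma ipBl u v w : ip (u - v) w = ip u w - ip v w.
Proof. by rewrite ip_conj ipB conjcB -!ip_conj. Qed.

Definition l2norm u : R := Num.sqrt (complex.Re (ip u u)).

Lemma l2norm_ge0 u : 0 <= l2norm u. Proof. exact: sqrtr_ge0. Qed.

Lemma ip_self u : ip u u = (l2norm u ^+ 2)%:C.
Proof.
have [K hK] := l2_bounded u.
have g0 i : 0 <= rnorm (u i : C) ^+ 2 by exact: exprn_ge0 (rnorm_ge0 _).
have [l hl] := is_sum_ge0 g0 hK.
have E : ip u u = l%:C.
  by apply: ipE; move: hl; congr is_sum; apply/funext => i; rewrite conjc_mulE.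
have l0 : 0 <= l by have := is_sum_partial_le (s := [::]) g0 hl isT; rewrite big_nil.
by rewrite /l2norm E sqr_sqrtr.
Qed.

Lemma is_sum_l2norm u : is_sum (fun i => (rnorm (u i : C) ^+ 2)%:C) (l2norm u ^+ 2)%:C.
Proof.
rewrite -ip_self; have := ipP u u; congr is_sum.
by apply/funext => i; rewrite conjc_mulE.
Qed.

Lemma l2norm_partial u s : uniq s -> \sum_(i <- s) rnorm (u i : C) ^+ 2 <= l2norm u ^+ 2.
Proof.
by apply: is_sum_partial_le; [move=> i; exact: exprn_ge0 (rnorm_ge0 _)|exact: is_sum_l2norm].
Qed.

Lemma l2norm_le u (K : R) : 0 <= K ->
  (forall s, uniq s -> \sum_(i <- s) rnorm (u i : C) ^+ 2 <= K ^+ 2) -> l2norm u <= K.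
Proof.
move=> K0 h; rewrite -(ler_pXn2r (n := 2)) ?nnegrE ?l2norm_ge0//.
exact: is_sum_le (is_sum_l2norm u) h.
Qed.

Lemma rnorm_coef_le u i : rnorm (u i : C) <= l2norm u.
Proof.
rewrite -(ler_pXn2r (n := 2)) ?nnegrE ?l2norm_ge0 ?rnorm_ge0//.
by have := @l2norm_partial u [:: i] isT; rewrite big_seq1.
Qed.

Lemma l2norm_eq0 u : l2norm u = 0 -> u = 0.
Proof.
move=> h; apply: l2_eq => i; apply: rnorm0_eq0; apply/eqP.
by rewrite eq_le rnorm_ge0 andbT -h rnorm_coef_le.
Qed.

Lemma l2normZ k u : l2norm (k *: u) = rnorm k * l2norm u.
Proof.
have : ip (k *: u) (k *: u) = ((rnorm k * l2norm u) ^+ 2)%:C.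
  by rewrite ipZl ipZ mulrA conjc_mulE ip_self -rmorphM exprMn.
rewrite ip_self => /complexI h; apply/eqP.
by rewrite -(eqrXn2 (n := 2)) ?l2norm_ge0 ?mulr_ge0 ?rnorm_ge0 ?l2norm_ge0//; apply/eqP.
Qed.

Lemma cauchy_schwarz u v : rnorm (ip u v) <= l2norm u * l2norm v.
Proof.
have [/l2norm_eq0->|v0] := eqVneq (l2norm v) 0.
  by rewrite ip0 rnorm0 mulr_ge0 ?l2norm_ge0.
have vp : 0 < l2norm v by rewrite lt0r v0 l2norm_ge0.
have D0 : 0 < l2norm v ^+ 2 by rewrite exprn_gt0.
pose b := ip v u; pose t := b * (l2norm v ^- 2)%:C.
have := ip_self (u - t *: v).
rewrite ipBl !ipB !ipZ !ipZl !ip_self (ip_conj v u) -/b.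
have bb : b * conjc b = (rnorm b ^+ 2)%:C by rewrite mulrC conjc_mulE.
have -> : t * conjc b = (rnorm b ^+ 2 / l2norm v ^+ 2)%:C by rewrite /t mulrAC bb -rmorphM.
have -> : conjc t * b = (rnorm b ^+ 2 / l2norm v ^+ 2)%:C.
  by rewrite /t conjcM mulrAC conjc_mulE (_ : conjc _ = (l2norm v ^- 2)%:C) -?rmorphM//= oppr0.
have -> : t * (conjc t * (l2norm v ^+ 2)%:C) = (rnorm b ^+ 2 / l2norm v ^+ 2)%:C.
  rewrite mulrA mulrC [t * _]mulrC conjc_mulE /t rnormM rnorm_real exprMn.
  rewrite ger0_norm ?invr_ge0 ?ltW// -rmorphM; congr (_%:C); field; exact: lt0r_neq0.
rewrite -!rmorphB => /complexI; rewrite subrr subr0 => h.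
have {h} : rnorm b ^+ 2 / l2norm v ^+ 2 <= l2norm u ^+ 2 by rewrite -subr_ge0 h sqr_ge0.
by rewrite rnorm_conj ler_pdivrMr// -exprMn ler_pXn2r ?nnegrE ?rnorm_ge0 ?mulr_ge0 ?l2norm_ge0.
Qed.

Lemma l2normD u v : l2norm (u + v) <= l2norm u + l2norm v.
Proof.
rewrite -(ler_pXn2r (n := 2)) ?nnegrE ?l2norm_ge0 ?addr_ge0 ?l2norm_ge0//.
have := ip_self (u + v); rewrite ipDl !ipD !ip_self => /(congr1 (@complex.Re R)) /= <-.
have h w z : complex.Re (ip w z) <= l2norm w * l2norm z.
  exact: le_trans (ler_norm _) (le_trans (normr_Re_le _) (cauchy_schwarz _ _)).
have := h u v; have := h v u; case: (ip u v) (ip v u) => [a b] [a' b'] /= h1 h2.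
rewrite sqrrD; lra.
Qed.

Definition delta_subproof (i : I) : (fun j => (j == i)%:R) \in sq_summable.
Proof.
apply/asboolP; exists 1 => s us.
have [is_|is_] := boolP (i \in s); last first.
  rewrite big1_seq// => j /andP[_ js].
  by rewrite (_ : (j == i) = false) ?rnorm0 ?expr0n//; apply: contraNF is_ => /eqP <-.
rewrite (bigD1_seq i)//= eqxx rnorm1 expr1n big1 ?addr0// => j /negbTE ->.
by rewrite rnorm0 expr0n.
Qed.

Definition delta (i : I) : l2 := L2 (delta_subproof i).

Lemma ip_delta i u : ip (delta i) u = u i.
Proof.
apply: ipE; have := @is_sum_finite R I (fun j => conjc (delta i j) * u j) [:: i] isT.
rewrite big_seq1 /= eqxx rmorph1 mul1r; apply=> j; rewrite inE => /negbTE ->.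
by rewrite rmorph0 mul0r.
Qed.

Lemma l2norm_delta i : l2norm (delta i) = 1.
Proof.
have := ip_self (delta i); rewrite ip_delta /= eqxx => /complexI /esym/eqP.
by rewrite sqrf_eq1 => /orP[/eqP//|/eqP h]; have := l2norm_ge0 (delta i); rewrite h; lra.
Qed.

End SquareSummable.

Section FilterLimits.
Variable R : realType.
Local Notation C := R[i].

Lemma real_cauchy_limit (T : Type) (F : set_system T) (FF : ProperFilter F) (g : T -> R) :
  (forall e : R, 0 < e -> exists c, \forall t \near F, `|c - g t| <= e) ->
  exists l, forall e : R, 0 < e -> \forall t \near F, `|l - g t| <= e.
Proof.
move=> h.
have FG : ProperFilter (fmap g F) by exact: fmap_proper_filter.
have cF : cauchy (fmap g F : set_system R^o).
  apply: cauchy_exP => e e0; have e2 : 0 < e / 2 by rewrite divr_gt0.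
  have [c hc] := h _ e2; exists c; apply: filterS hc => t ht.
  by rewrite -ball_normE /=; apply: (le_lt_trans ht); rewrite gtr_pMr// invf_lt1// ltr1n.
have hl := @cauchy_cvg R^o _ FG cF.
set l := lim _ in hl; exists l => e e0; have /cvgrPdist_le/(_ _ e0) := hl; exact.
Qed.

Lemma complex_cauchy_limit (T : Type) (F : set_system T) (FF : ProperFilter F) (g : T -> C) :
  (forall e : R, 0 < e -> exists c, \forall t \near F, rnorm (c - g t) <= e) ->
  exists l, forall e : R, 0 < e -> \forall t \near F, rnorm (l - g t) <= e.
Proof.
move=> h.
have [|a ha] := @real_cauchy_limit T F FF (fun t => complex.Re (g t)).
  move=> e e0; have [c hc] := h e e0; exists (complex.Re c); apply: filterS hc => t ht /=.
  by rewrite -raddfB; apply: le_trans ht; exact: normr_Re_le.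
have [|b hb] := @real_cauchy_limit T F FF (fun t => complex.Im (g t)).
  move=> e e0; have [c hc] := h e e0; exists (complex.Im c); apply: filterS hc => t ht /=.
  by rewrite -raddfB; apply: le_trans ht; exact: normr_Im_le.
exists (a +i* b) => e e0; have e2 : 0 < e / 2 by rewrite divr_gt0.
apply: filterS (filterI (ha _ e2) (hb _ e2)) => t [h1 h2].
apply: (le_trans (rnorm_le_ReIm _)); rewrite [e]splitr; apply: lerD.
  by rewrite raddfB.
by rewrite raddfB.
Qed.

(** The coordinates converge, and finite sums of squares pass to the limit. So the coordinatewise
    limit differs from an approximant [c] by a square-summable family whose norm is controlled by
    the same error. *)
Lemma l2_cauchy_limit (I : choiceType) (T : Type) (F : set_system T) (FF : ProperFilter F)
    (g : T -> l2 R I) :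
  (forall e : R, 0 < e -> exists c, \forall t \near F, l2norm (c - g t) <= e) ->
  exists l, forall e : R, 0 < e -> \forall t \near F, l2norm (l - g t) <= e.
Proof.
move=> h.
have /choice[l0 hl0] : forall i, exists l : C, forall e : R, 0 < e -> \forall t \near F, rnorm (l - g t i) <= e.
  move=> i; apply: complex_cauchy_limit => e e0; have [c hc] := h e e0.
  exists (c i); apply: filterS hc => t ht; apply: le_trans ht.
  exact: (rnorm_coef_le (c - g t) i).
have near_sum (s : seq I) (eta : R) : 0 < eta -> \forall t \near F, \sum_(i <- s) rnorm (l0 i - g t i) ^+ 2 <= eta.
  elim: s eta => [|i s IH] eta eta0; first by apply: nearW => t; rewrite big_nil ltW.
  have e2 : 0 < eta / 2 by rewrite divr_gt0.
  pose r := Num.min 1 (eta / 2); have r0 : 0 < r by rewrite lt_min ltr01.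
  apply: filterS (filterI (IH _ e2) (hl0 i r r0)) => t [h1 h2].
  rewrite big_cons [eta]splitr lerD// expr2.
  have h3 : rnorm (l0 i - g t i) <= 1 by apply: (le_trans h2); rewrite ge_min lexx.
  have h4 : rnorm (l0 i - g t i) <= eta / 2 by apply: (le_trans h2); rewrite ge_min lexx orbT.
  apply: le_trans h4; rewrite -[leRHS]mul1r; apply: ler_wpM2r => //; exact: rnorm_ge0.
(* By [sqr_rnormD_le] the two halves, from [c] to [g t] and from [g t] to the limit, contribute
   [2 e ^ 2] each. *)
have bound (e : R) (c : l2 R I) : 0 < e -> (\forall t \near F, l2norm (c - g t) <= e) ->
    forall s, uniq s -> \sum_(i <- s) rnorm (c i - l0 i) ^+ 2 <= (2 * e) ^+ 2.
  move=> e0 hc s us.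
  have e20 : 0 < e ^+ 2 by rewrite exprn_gt0.
  have [t [h1 h2]] := filter_ex (filterI hc (near_sum s _ e20)).
  have h3 : \sum_(i <- s) rnorm ((c - g t) i : C) ^+ 2 <= e ^+ 2.
    by apply: (le_trans (l2norm_partial _ us)); rewrite ler_pXn2r ?nnegrE ?l2norm_ge0 ?(ltW e0).
  apply: (@le_trans _ _ (\sum_(i <- s) (2 * rnorm ((c - g t) i : C) ^+ 2 + 2 * rnorm (l0 i - g t i) ^+ 2))).
    apply: ler_sum => i _.
    rewrite (rdistC (l0 i)) -[(c - g t) i]/(c i - g t i) (_ : c i - l0 i = c i - g t i + (g t i - l0 i)).
      exact: sqr_rnormD_le.
    by rewrite addrA subrK.
  rewrite big_split -!mulr_sumr /= exprMn; lra.
have [c1 hc1] := h 1 ltr01.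
have dsum : (fun i => c1 i - l0 i : C^o) \in @sq_summable R I.
  by apply/asboolP; exists ((2 * 1) ^+ 2) => s; exact: bound.
pose l := c1 - L2 dsum; have lE i : l i = l0 i.
  by rewrite -[l i]/(c1 i - (c1 i - l0 i)) opprB addrC subrK.
exists l => e e0; have e3 : 0 < e / 3 by rewrite divr_gt0.
have [c hc] := h _ e3.
have cl : l2norm (l - c) <= 2 * (e / 3).
  rewrite -opprB -scaleN1r l2normZ rnormN rnorm1 mul1r.
  apply: l2norm_le => [|s us]; first by rewrite mulr_ge0// ltW.
  rewrite (eq_bigr (fun i => rnorm (c i - l0 i) ^+ 2)); first exact: bound.
  by move=> i _; rewrite -lE.
apply: filterS hc => t ht; rewrite -(subrK c l) -addrA.
apply: (le_trans (l2normD _ _)); lra.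
Qed.

End FilterLimits.

(** * Bounded adjointable operators form a C*-algebra *)

Section BoundedOperators.
Variables (R : realType) (I : choiceType).
Local Notation C := R[i].
Local Notation H := (l2 R I).

(** Linearity comes out of the adjoint, in [bop_linear], so the predicate applies to bare functions;
    it is closed under adjoints by [adj_subproof]. *)
Definition adjointable_bounded : {pred H -> H} := [pred T | `[<
  (exists T' : H -> H, forall u v, ip (T u) v = ip u (T' v)) /\
  exists2 K : R, 0 <= K & forall u, l2norm (T u) <= K * l2norm u >]].

Lemma l2normN (u : H) : l2norm (- u) = l2norm u.
Proof. by rewrite -scaleN1r l2normZ rnormN rnorm1 mul1r. Qed.

Lemma ip_inj (v w : H) : (forall u, ip u v = ip u w) -> v = w.
Proof. by move=> h; apply: l2_eq => i; rewrite -!ip_delta. Qed.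

Lemma l2norm0 : l2norm (0 : H) = 0.
Proof. by rewrite /l2norm ip0 sqrtr0. Qed.

Lemma adjointable_bounded_submod : submod_closed adjointable_bounded.
Proof.
split.
  apply/asboolP; split; first by exists (fun=> 0) => u v; rewrite ip_conj !ip0 conjc0.
  by exists 0 => // u; rewrite mul0r l2norm0.
move=> k T1 T2 /asboolP[[T1' a1] [K1 K10 b1]] /asboolP[[T2' a2] [K2 K20 b2]].
apply/asboolP; split.
  exists (fun v => conjc k *: T1' v + T2' v) => u v.
  by rewrite ip_linear -[(k *: T1 + T2) u]/(k *: T1 u + T2 u) ipDl ipZl a1 a2.
exists (rnorm k * K1 + K2); first by rewrite addr_ge0// mulr_ge0// rnorm_ge0.
move=> u; apply: (le_trans (l2normD _ _)); rewrite l2normZ mulrDl lerD// -mulrA.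
by apply: ler_wpM2l => //; exact: rnorm_ge0.
Qed.

HB.instance Definition _ :=
  GRing.isSubmodClosed.Build _ _ adjointable_bounded adjointable_bounded_submod.

Record bop := Bop { bop_val :> H -> H; _ : bop_val \in adjointable_bounded }.

HB.instance Definition _ := [isSub for bop_val].
HB.instance Definition _ := [Choice of bop by <:].
HB.instance Definition _ := [SubChoice_isSubLmodule of bop by <:].

Implicit Types T : bop.

Lemma bop_eq T1 T2 : (forall u, T1 u = T2 u) -> T1 = T2.
Proof. by move=> h; apply: val_inj; apply/funext. Qed.

Lemma bop_boundedP T : exists2 K : R, 0 <= K & forall u, l2norm (T u) <= K * l2norm u.
Proof. by case: T => T /= /asboolP[]. Qed.

Lemma bop_adjP T : exists T' : H -> H, forall u v, ip (T u) v = ip u (T' v).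
Proof. by case: T => T /= /asboolP[]. Qed.

Definition opnorm T : R := inf [set K | 0 <= K /\ forall u, l2norm (T u) <= K * l2norm u].

Lemma opnorm_ge0 T : 0 <= opnorm T.
Proof.
have [K K0 h] := bop_boundedP T.
by apply: lb_le_inf; [exists K|move=> L []].
Qed.

Lemma opnorm_le T (K : R) : 0 <= K -> (forall u, l2norm (T u) <= K * l2norm u) -> opnorm T <= K.
Proof. by move=> K0 h; apply: ge_inf; [exists 0 => L []|]. Qed.

Lemma opnormP T u : l2norm (T u) <= opnorm T * l2norm u.
Proof.
have [K K0 h] := bop_boundedP T.
have [u0|u0] := eqVneq (l2norm u) 0.
  by have := h u; rewrite u0 !mulr0.
have up : 0 < l2norm u by rewrite lt0r u0 l2norm_ge0.
rewrite -ler_pdivrMr//; apply: lb_le_inf; first by exists K.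
by move=> L [L0 hL]; rewrite ler_pdivrMr.
Qed.

Lemma opnormD T1 T2 : opnorm (T1 + T2) <= opnorm T1 + opnorm T2.
Proof.
apply: opnorm_le => [|u]; first by rewrite addr_ge0// opnorm_ge0.
by apply: (le_trans (l2normD _ _)); rewrite mulrDl lerD// opnormP.
Qed.

Lemma opnormZ_le k T : opnorm (k *: T) <= rnorm k * opnorm T.
Proof.
apply: opnorm_le => [|u]; first by rewrite mulr_ge0// ?opnorm_ge0 ?rnorm_ge0.
rewrite -[(k *: T) u]/(k *: T u) l2normZ -mulrA; apply: ler_wpM2l; first exact: rnorm_ge0.
exact: opnormP.
Qed.

Lemma opnormZ k T : opnorm (k *: T) = rnorm k * opnorm T.
Proof.
apply: le_anti; rewrite opnormZ_le /=.
have [->|k0] := eqVneq k 0; first by rewrite rnorm0 mul0r opnorm_ge0.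
have kp : 0 < rnorm k by rewrite rnorm_gt0.
rewrite mulrC -ler_pdivlMr// mulrC -rnormV.
by apply: le_trans (opnormZ_le _ _); rewrite scalerA mulVf// scale1r.
Qed.

Lemma opnorm_eq0 T : opnorm T = 0 -> T = 0.
Proof.
move=> h; apply: bop_eq => u; apply: l2norm_eq0; apply: le_anti.
by rewrite l2norm_ge0 andbT; have := opnormP T u; rewrite h mul0r.
Qed.

Definition copnorm T : C := (opnorm T)%:C.

Lemma copnormD T1 T2 : copnorm (T1 + T2) <= copnorm T1 + copnorm T2.
Proof. by rewrite /copnorm -rmorphD lecR opnormD. Qed.

Lemma copnormZ (k : C) T : copnorm (k *: T) = `|k| * copnorm T.
Proof. by rewrite /copnorm opnormZ rmorphM rnormE. Qed.

Lemma copnorm_eq0 T : copnorm T = 0 -> T = 0.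
Proof. by move=> /complexI/opnorm_eq0. Qed.

HB.instance Definition _ := Lmodule_isNormed.Build C bop copnormD copnormZ copnorm_eq0.

Lemma rnorm_bop T : rnorm T = opnorm T.
Proof. by []. Qed.

Lemma adj_subproof T : sval (cid (bop_adjP T)) \in adjointable_bounded.
Proof.
case: cid => T' h /=; apply/asboolP; split.
  by exists T => u v; rewrite ip_conj -h -ip_conj.
exists (opnorm T); first exact: opnorm_ge0.
move=> u; have [u0|u0] := eqVneq (l2norm (T' u)) 0.
  by rewrite u0 mulr_ge0 ?opnorm_ge0 ?l2norm_ge0.
have up : 0 < l2norm (T' u) by rewrite lt0r u0 l2norm_ge0.
rewrite -(ler_pM2r up) -expr2.
have <- : rnorm (ip (T (T' u)) u) = l2norm (T' u) ^+ 2.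
  by rewrite h ip_self rnorm_real ger0_norm// sqr_ge0.
apply: (le_trans (cauchy_schwarz _ _)); rewrite mulrAC; apply: ler_wpM2r; first exact: l2norm_ge0.
exact: opnormP.
Qed.

Definition bop_adj T : bop := Bop (adj_subproof T).

Lemma ip_adj T u v : ip (T u) v = ip u (bop_adj T v).
Proof. by rewrite /bop_adj /=; case: cid. Qed.

Lemma ip_adjr T u v : ip u (T v) = ip (bop_adj T u) v.
Proof. by rewrite ip_conj ip_adj -ip_conj. Qed.

Lemma bop_adj_unique T T' : (forall u v, ip (T u) v = ip u (T' v)) -> bop_adj T = T'.
Proof. by move=> h; apply: bop_eq => v; apply: ip_inj => u; rewrite -ip_adj h. Qed.

Lemma bop_adjK : involutive bop_adj.
Proof. by move=> T; apply: bop_adj_unique => u v; rewrite ip_adjr. Qed.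

Lemma bop_linear T k u v : T (k *: u + v) = k *: T u + T v.
Proof. by apply: ip_inj => w; rewrite ip_adjr !ip_linear -!ip_adjr. Qed.

Lemma comp_subproof T1 T2 : (fun u => T1 (T2 u)) \in adjointable_bounded.
Proof.
apply/asboolP; split.
  by exists (fun v => bop_adj T2 (bop_adj T1 v)) => u v; rewrite !ip_adj.
exists (opnorm T1 * opnorm T2); first by rewrite mulr_ge0 ?opnorm_ge0.
move=> u; apply: (le_trans (opnormP _ _)); rewrite -mulrA; apply: ler_wpM2l.
  exact: opnorm_ge0.
exact: opnormP.
Qed.

Definition bop_comp T1 T2 : bop := Bop (comp_subproof T1 T2).

Lemma bop_compE T1 T2 u : bop_comp T1 T2 u = T1 (T2 u).
Proof. by []. Qed.

Lemma bop_compA : associative bop_comp.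
Proof. by move=> T1 T2 T3; apply: bop_eq. Qed.

Lemma bop_compDl : left_distributive bop_comp +%R.
Proof. by move=> T1 T2 T3; apply: bop_eq. Qed.

Lemma bop_compDr : right_distributive bop_comp +%R.
Proof.
move=> T1 T2 T3; apply: bop_eq => u; rewrite -[RHS]/(T1 (T2 u) + T1 (T3 u)).
by rewrite bop_compE -[(T2 + T3) u]/(T2 u + T3 u) -[T2 u in LHS]scale1r bop_linear scale1r.
Qed.

Lemma bop_compZl (k : C) T1 T2 : bop_comp (k *: T1) T2 = k *: bop_comp T1 T2.
Proof. exact: bop_eq. Qed.

Lemma bop_compZr (k : C) T1 T2 : bop_comp T1 (k *: T2) = k *: bop_comp T1 T2.
Proof.
apply: bop_eq => u; rewrite -[RHS]/(k *: T1 (T2 u)) bop_compE -[(k *: T2) u]/(k *: T2 u).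
by apply: ip_inj => w; rewrite ip_adjr !ipZ -ip_adjr.
Qed.

Lemma bop_adjD : {morph bop_adj : S T / S + T}.
Proof.
move=> T1 T2; apply: bop_adj_unique => u v.
by rewrite -[(T1 + T2) u]/(T1 u + T2 u) ipDl -[(bop_adj T1 + bop_adj T2) v]/(bop_adj T1 v + bop_adj T2 v) ipD !ip_adj.
Qed.

Lemma bop_adjZ (k : C) T : bop_adj (k *: T) = conjc k *: bop_adj T.
Proof.
apply: bop_adj_unique => u v.
by rewrite -[(k *: T) u]/(k *: T u) ipZl -[(conjc k *: bop_adj T) v]/(conjc k *: bop_adj T v) ipZ ip_adj.
Qed.

Lemma bop_adjM T1 T2 : bop_adj (bop_comp T1 T2) = bop_comp (bop_adj T2) (bop_adj T1).
Proof. by apply: bop_adj_unique => u v; rewrite !bop_compE !ip_adj. Qed.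

Lemma opnorm_comp T1 T2 : opnorm (bop_comp T1 T2) <= opnorm T1 * opnorm T2.
Proof.
apply: opnorm_le => [|u]; first by rewrite mulr_ge0 ?opnorm_ge0.
apply: (le_trans (opnormP T1 (T2 u))); rewrite -mulrA.
by apply: (ler_wpM2l (opnorm_ge0 _)); exact: opnormP.
Qed.

Lemma sqr_opnorm_le T : opnorm T ^+ 2 <= opnorm (bop_comp (bop_adj T) T).
Proof.
set S := bop_comp _ _.
have h : opnorm T <= Num.sqrt (opnorm S).
  apply: opnorm_le => [|u]; first exact: sqrtr_ge0.
  rewrite -(ler_pXn2r (n := 2)) ?nnegrE ?mulr_ge0 ?l2norm_ge0 ?sqrtr_ge0//.
  rewrite exprMn (sqr_sqrtr (opnorm_ge0 S)).
  have <- : rnorm (ip u (S u)) = l2norm (T u) ^+ 2.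
    by rewrite /S bop_compE -ip_adj ip_self rnorm_real ger0_norm// sqr_ge0.
  apply: (le_trans (cauchy_schwarz _ _)); rewrite expr2 mulrCA.
  by apply: (ler_wpM2l (l2norm_ge0 _)); exact: opnormP.
by rewrite -[leRHS]sqr_sqrtr ?opnorm_ge0// ler_pXn2r ?nnegrE ?opnorm_ge0 ?sqrtr_ge0.
Qed.

Lemma opnorm_adj_le T : opnorm (bop_adj T) <= opnorm T.
Proof.
have [->|a0] := eqVneq (opnorm (bop_adj T)) 0; first exact: opnorm_ge0.
have ap : 0 < opnorm (bop_adj T) by rewrite lt0r a0 opnorm_ge0.
rewrite -(ler_pM2l ap) -expr2; apply: (le_trans (sqr_opnorm_le _)).
by rewrite bop_adjK mulrC opnorm_comp.
Qed.

Lemma opnorm_adj T : opnorm (bop_adj T) = opnorm T.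
Proof. by apply: le_anti; rewrite opnorm_adj_le -{1}(bop_adjK T) opnorm_adj_le. Qed.

Lemma opnorm_adj_comp T : opnorm (bop_comp (bop_adj T) T) = opnorm T ^+ 2.
Proof.
apply: le_anti; rewrite sqr_opnorm_le andbT expr2 -{1}(opnorm_adj T); exact: opnorm_comp.
Qed.

(** Taking adjoints is isometric, so the operators and their adjoints both converge pointwise; the
    second limit is an adjoint of the first, as membership in [bop] demands. *)
Lemma bop_cauchy_cvg (F : set_system bop) : ProperFilter F -> cauchy F -> cvg F.
Proof.
move=> FF /cauchyP cF.
have cauchyF (e : R) : 0 < e -> exists T0, \forall T \near F, opnorm (T0 - T) <= e.
  move=> e0; have [|T0 hT0] := cF e%:C; first by rewrite ltcR.
  exists T0; apply: filterS hT0 => T; rewrite -ball_normE /= -[X in X < _]/((opnorm (T0 - T))%:C).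
  by rewrite ltcR => /ltW.
have limP (G : bop -> bop) : (forall S T, opnorm (G S - G T) <= opnorm (S - T)) ->
    exists L : H -> H, forall u (e : R), 0 < e -> \forall T \near F, l2norm (L u - G T u) <= e.
  move=> Gl; suff /choice[L hL] : forall u, exists l, forall e : R, 0 < e -> \forall T \near F, l2norm (l - G T u) <= e.
    by exists L.
  move=> u; apply: l2_cauchy_limit => e e0.
  have u0 : 0 < l2norm u + 1 by rewrite ltr_wpDl// l2norm_ge0.
  have [T0 hT0] := cauchyF _ (divr_gt0 e0 u0); exists (G T0 u).
  apply: filterS hT0 => T hT; rewrite -[_ - _]/((G T0 - G T) u).
  apply: (le_trans (opnormP _ _)).
  apply: (@le_trans _ _ (e / (l2norm u + 1) * l2norm u)).
    by apply: ler_wpM2r; [exact: l2norm_ge0|exact: le_trans hT].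
  by rewrite mulrAC ler_pdivrMr// ler_wpM2l ?(ltW e0)// lerDl.
have [//|L hL] := limP id.
have [S T|L' hL'] := limP bop_adj.
  rewrite -[bop_adj S - _]/(bop_adj S + - bop_adj T) -scaleN1r.
  have -> : - 1 = conjc (- 1) :> C by rewrite rmorphN rmorph1.
  by rewrite -bop_adjZ -bop_adjD scaleN1r opnorm_adj.
have Lbound (e : R) T0 : (\forall T \near F, opnorm (T0 - T) <= e) ->
    forall u, l2norm (T0 u - L u) <= e * l2norm u.
  move=> h u; apply/ler_addgt0Pr => r r0.
  have [T [h1 h2]] := filter_ex (filterI h (hL u r r0)).
  rewrite (_ : T0 u - L u = (T0 - T) u - (L u - T u)); last first.
    by rewrite -[(T0 - T) u]/(T0 u - T u) opprB addrA subrK.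
  apply: (le_trans (l2normD _ _)); rewrite l2normN lerD//.
  apply: (le_trans (opnormP _ _)); apply: ler_wpM2r => //; exact: l2norm_ge0.
have Ladj u v : ip (L u) v = ip u (L' v).
  apply/eqP; rewrite -subr_eq0; apply/eqP; apply: rnorm_lt_eps_eq0 => e e0.
  pose D := l2norm u + l2norm v + 1.
  have D0 : 0 < D by rewrite ltr_wpDl// addr_ge0 ?l2norm_ge0.
  have r0 := divr_gt0 e0 D0.
  have [T [h1 h2]] := filter_ex (filterI (hL u _ r0) (hL' v _ r0)).
  rewrite (_ : _ - _ = ip (L u - T u) v - ip u (L' v - bop_adj T v)); last first.
    by rewrite ipBl ipB ip_adj; ring.
  apply: (le_trans (rnormB _ _)).
  apply: (le_trans (lerD (cauchy_schwarz _ _) (cauchy_schwarz _ _))).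
  apply: (@le_trans _ _ (e / D * l2norm v + l2norm u * (e / D))).
    by apply: lerD; [apply: ler_wpM2r|apply: ler_wpM2l] => //; exact: l2norm_ge0.
  rewrite [l2norm u * _]mulrC -mulrDr mulrAC ler_pdivrMr// ler_wpM2l ?(ltW e0)// /D; lra.
have [T1 hT1] := cauchyF 1 ltr01.
have LB : L \in adjointable_bounded.
  apply/asboolP; split; first by exists L'.
  exists (opnorm T1 + 1) => [|u]; first by rewrite addr_ge0// opnorm_ge0.
  rewrite (_ : L u = T1 u - (T1 u - L u)); last by rewrite opprB addrC subrK.
  apply: (le_trans (l2normD _ _)); rewrite l2normN mulrDl; apply: lerD; first exact: opnormP.
  exact: Lbound.
apply/cvg_ex; exists (Bop LB); apply/cvg_rnormP => e e0.
have e3 : 0 < e / 3 by rewrite divr_gt0.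
have [T0 hT0] := cauchyF _ e3.
apply: filterS (hT0) => T hT; rewrite rnorm_bop.
have h : opnorm (T0 - Bop LB) <= e / 3.
  by apply: opnorm_le => [|u]; [exact: ltW|exact: Lbound].
rewrite -(subrK T0 (Bop LB)) -addrA; apply: (le_lt_trans (opnormD _ _)).
rewrite -opprB -scaleN1r opnormZ rnormN rnorm1 mul1r; lra.
Qed.

HB.instance Definition _ := Uniform_isComplete.Build bop bop_cauchy_cvg.

Lemma norm_bop_comp T1 T2 : `|bop_comp T1 T2| <= `|T1| * `|T2|.
Proof. by rewrite !rnormE -rmorphM lecR opnorm_comp. Qed.

Lemma norm_bop_adj_comp T : `|bop_comp (bop_adj T) T| = `|T| ^+ 2.
Proof. by rewrite !rnormE -rmorphXn; congr (_%:C); exact: opnorm_adj_comp. Qed.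

HB.instance Definition _ := isCstarAlgebra.Build R bop bop_compA bop_compDl bop_compDr
  bop_compZl bop_compZr bop_adjK bop_adjD bop_adjZ bop_adjM norm_bop_comp norm_bop_adj_comp.

End BoundedOperators.

(** * The bimodule *)

Section BimoduleAlgebra.
Variable R : realType.
Local Notation C := R[i].
Variables P Q : {poly C}.
Hypothesis coprimePQ : coprimep P Q.
Hypothesis degPQ : (2 <= rat_degree P Q)%N.
Local Notation d := (rat_degree P Q).
Local Notation f := (rat_map P Q).
Hypothesis noncritical : forall x, julia_set f x -> ~ critical f x.
Local Notation J := (julia_set f).
Local Notation A := (cfun R J).
Local Notation X := (cfun R (graph_julia f)).
Local Notation fJ := (julia_map coprimePQ degPQ).
Local Notation gval := (gval coprimePQ degPQ).
Local Notation transfer := (transfer coprimePQ degPQ noncritical).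
Local Notation fibre := (fibre coprimePQ degPQ noncritical).
Local Notation innerE := (innerE coprimePQ degPQ noncritical).

(* Sealed: the [insubd] in [inner] makes unification diverge when it is unfolded. *)
Fact sinner_key : {inn : X -> X -> A | inn = @inner R f}.
Proof. by exists (@inner R f). Qed.

Definition sinner : X -> X -> A := sval sinner_key.

Lemma sinner_inner : @inner R f = sinner.
Proof. by rewrite /sinner; case: sinner_key. Qed.

Lemma sinnerE xi eta y : sinner xi eta y = transfer (fun x => conjc (gval xi x) * gval eta x) y.
Proof. by rewrite -sinner_inner innerE. Qed.

Lemma rank_oneE xi eta (zeta : X) : rank_one xi eta zeta = ract xi (sinner eta zeta).
Proof. by rewrite /rank_one sinner_inner. Qed.

Lemma adjointE (T T' : X -> X) :
  adjoint T T' = (forall xi eta, sinner (T xi) eta = sinner xi (T' eta)).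
Proof. by rewrite /adjoint sinner_inner. Qed.

Lemma cfun_eq (a b : A) : (forall x, a x = b x) -> a = b.
Proof. by move=> h; apply: val_inj; apply/funext. Qed.

Lemma cfun_sumE (I : Type) (s : seq I) (F : I -> A) x :
  (\sum_(i <- s) F i) x = \sum_(i <- s) F i x.
Proof. by elim/big_rec2: _ => // i u v _ <-. Qed.

Lemma cfun_conjE (T : topologicalType) (a : cfun R T) x : cfun_conj a x = conjc (a x).
Proof. by []. Qed.

Lemma cfunPE (T : topologicalType) (k : C) (a b : cfun R T) x : (k *: a + b) x = k * a x + b x.
Proof. by []. Qed.

Lemma cfunME (T : topologicalType) (a b : cfun R T) x : (a * b) x = a x * b x.
Proof. by []. Qed.

Lemma inner_conj (xi eta : X) : sinner eta xi = cfun_conj (sinner xi eta).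
Proof.
apply: cfun_eq => y; rewrite cfun_conjE !sinnerE conjc_sum.
by apply: eq_bigr => x _; rewrite conjcM conjcK mulrC.
Qed.

Lemma inner_linear (k : C) (xi eta zeta : X) :
  sinner xi (k *: eta + zeta) = k *: sinner xi eta + sinner xi zeta.
Proof.
apply: cfun_eq => y; rewrite cfunPE (sinnerE xi _) (sinnerE xi eta) (sinnerE xi zeta).
rewrite mulr_sumr -big_split /=; apply: eq_bigr => x _.
by rewrite [X in _ * X = _](_ : _ = k * gval eta x + gval zeta x)// mulrDr mulrCA.
Qed.

Lemma inner0 (xi : X) : sinner xi 0 = 0.
Proof. by have := inner_linear (-1) xi xi xi; rewrite !scaleN1r !addNr. Qed.

Lemma inner_sum (I : Type) (s : seq I) (xi : X) (F : I -> X) :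
  sinner xi (\sum_(i <- s) F i) = \sum_(i <- s) sinner xi (F i).
Proof.
elim: s => [|i s IH]; first by rewrite !big_nil inner0.
by rewrite !big_cons -IH -[F i]scale1r inner_linear !scale1r.
Qed.

Lemma inner_ract (xi eta : X) (b : A) : sinner xi (ract eta b) = sinner xi eta * b.
Proof.
apply: cfun_eq => y; rewrite cfunME (sinnerE xi eta) (sinnerE xi (ract eta b)) mulr_suml.
rewrite transferE big_seq [RHS]big_seq; apply: eq_bigr => x.
by rewrite mem_fibre gval_ract mulrA => /eqP ->.
Qed.

(** The reconstruction formula of a finite Parseval frame of the Hilbert module. *)
Definition is_basis (us : seq X) :=
  forall xi : X, \sum_(u <- us) ract u (sinner u xi) = xi.

Lemma exists_is_basis : exists2 us, is_basis us & forall x x' : J, fJ x = fJ x' ->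
  \sum_(u <- us) gval u x * conjc (gval u x') = (x == x')%:R.
Proof.
have [us hus] := exists_basis coprimePQ degPQ noncritical; exists us => // xi.
apply: (@gval_eq _ _ _ coprimePQ degPQ) => x; rewrite gval_sum.
under eq_bigr do rewrite gval_ract sinnerE mulr_sumr.
rewrite exchange_big /=.
have xf : x \in fibre (fJ x) by rewrite mem_fibre.
rewrite (bigD1_seq x) ?fibre_uniq//= [X in _ + X]big1_seq ?addr0.
  under eq_bigr do rewrite mulrA; rewrite -mulr_suml hus// eqxx mul1r//.
move=> z /andP[zx]; rewrite mem_fibre => /eqP fz.
under eq_bigr do rewrite mulrA; rewrite -mulr_suml hus// eq_sym (negbTE zx) mul0r//.
Qed.

Lemma adjoint_sym (T T' : X -> X) : adjoint T T' -> forall xi eta, sinner xi (T eta) = sinner (T' xi) eta.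
Proof. by rewrite adjointE => h xi eta; rewrite inner_conj h -inner_conj. Qed.

Lemma adjoint_rank_one (xi eta : X) : adjoint (rank_one xi eta) (rank_one eta xi).
Proof.
rewrite adjointE => u v; rewrite !rank_oneE inner_ract inner_conj inner_ract.
apply: cfun_eq => y; rewrite cfun_conjE !cfunME conjcM.
rewrite (inner_conj v xi) (inner_conj eta u) !cfun_conjE mulrC //.
Qed.

Definition rank_sum (s : seq (X * X)) : X -> X := fun zeta => \sum_(p <- s) rank_one p.1 p.2 zeta.

Lemma adjoint_rank_sum s : adjoint (rank_sum s) (rank_sum [seq (p.2, p.1) | p <- s]).
Proof.
rewrite adjointE => u v; rewrite /rank_sum big_map inner_sum inner_conj inner_sum.
apply: cfun_eq => y; rewrite cfun_conjE.
rewrite [RHS]cfun_sumE [X in conjc X]cfun_sumE conjc_sum; apply: eq_bigr => p _ /=.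
rewrite -cfun_conjE -inner_conj.
by have := adjoint_rank_one p.1 p.2; rewrite adjointE => ->.
Qed.

Lemma xnorm0 : xnorm (0 : X) = 0.
Proof.
rewrite /xnorm sinner_inner inner0 (_ : range _ = [set 0]) ?sup1 ?sqrtr0//.
have [x Jx] := julia_nonempty coprimePQ degPQ; pose y0 : J := SigSub (mem_set Jx).
have E (y : J) : complex.Re `|(0 : A) y : C| = 0 by rewrite -[(0 : A) y]/(0 : C) normr0.
apply/seteqP; split => [_ [y _ <-]|_ ->]; first exact: E.
by exists y0; [|exact: E].
Qed.

Lemma compact_rank_sum s : compact_op (rank_sum s).
Proof.
split; first by exists (rank_sum [seq (p.2, p.1) | p <- s]); exact: adjoint_rank_sum.
move=> e e0; exists s => zeta; rewrite subrr xnorm0; apply: mulr_ge0; first exact: ltW.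
by rewrite /xnorm sqrtr_ge0.
Qed.

Lemma rank_sum1 xi eta : rank_sum [:: (xi, eta)] = rank_one xi eta.
Proof. by apply/funext => z; rewrite /rank_sum big_seq1. Qed.

Lemma rank_sum_cons p s : rank_sum (p :: s) = 1 *: rank_sum [:: p] + rank_sum s.
Proof.
by apply/funext => z; rewrite scale1r -[RHS]/(rank_sum [:: p] z + rank_sum s z) /rank_sum big_cons big_seq1.
Qed.

(** Multiplying the reconstruction formula by [a] shows that left multiplications have finite rank.
    Hence the ideal of the covariance condition is all of [A]. *)
Lemma lact_rank_sum us (a : A) : is_basis us -> lact a = rank_sum [seq (lact a u, u) | u <- us].
Proof.
move=> hus; apply/funext => xi; rewrite /rank_sum big_map -{1}(hus xi) /lact mulr_sumr.
by apply: eq_bigr => u _; rewrite rank_oneE /ract mulrA.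
Qed.

(** Adjointable maps are additive and right [A]-linear. Both are seen inside inner products, and
    inner products determine a vector through the frame. *)
Lemma adjoint_basis us (T T' : X -> X) xi : is_basis us -> adjoint T T' ->
  \sum_(u <- us) ract (T u) (sinner u xi) = T xi.
Proof.
move=> hus h; have hi eta : sinner eta (\sum_(u <- us) ract (T u) (sinner u xi)) = sinner eta (T xi).
  rewrite inner_sum (adjoint_sym h) -{2}(hus xi) inner_sum.
  by apply: eq_bigr => u _; rewrite !inner_ract (adjoint_sym h).
by rewrite -[LHS]hus -[RHS]hus; apply: eq_bigr => u _; rewrite hi.
Qed.

Section Representation.
Variables (B : cstarAlgType R) (i : {linear A -> B}) (S : {linear X -> B}).

Lemma cmul0l (x : B) : cmul 0 x = 0.
Proof. by have := cmulZl 0 (0 : B) x; rewrite !scale0r. Qed.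

Lemma cmul0r (x : B) : cmul x 0 = 0.
Proof. by have := cmulZr 0 x (0 : B); rewrite !scale0r. Qed.

Lemma star0 : star (0 : B) = 0.
Proof. by have := starZ 0 (0 : B); rewrite conjc0 !scale0r. Qed.

Lemma cmul_suml (I : Type) (s : seq I) (F : I -> B) x :
  cmul (\sum_(j <- s) F j) x = \sum_(j <- s) cmul (F j) x.
Proof. by elim/big_rec2: _ => [|j u v _ <-]; rewrite ?cmul0l ?cmulDl. Qed.

Lemma cmul_sumr (I : Type) (s : seq I) (F : I -> B) x :
  cmul x (\sum_(j <- s) F j) = \sum_(j <- s) cmul x (F j).
Proof. by elim/big_rec2: _ => [|j u v _ <-]; rewrite ?cmul0r ?cmulDr. Qed.

Lemma star_sum (I : Type) (s : seq I) (F : I -> B) :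
  star (\sum_(j <- s) F j) = \sum_(j <- s) star (F j).
Proof. by elim/big_rec2: _ => [|j u v _ <-]; rewrite ?star0 ?starD. Qed.

Lemma iK_rank_sum iK s : is_iK S iK ->
  iK (rank_sum s) = \sum_(p <- s) cmul (S p.1) (star (S p.2)).
Proof.
move=> h; elim: s => [|p s IH].
  have := iK_linear h (-1) (compact_rank_sum [::]) (compact_rank_sum [::]).
  rewrite (_ : -1 *: _ + _ = rank_sum [::]) => [->|].
    by rewrite scaleN1r addNr big_nil.
  by apply/funext => z; rewrite -[LHS]/(-1 *: rank_sum [::] z + _) /rank_sum big_nil scaler0 addr0.
rewrite rank_sum_cons (iK_linear h)//; [|exact: compact_rank_sum|exact: compact_rank_sum].
by rewrite IH big_cons scale1r; case: p => xi eta; rewrite rank_sum1 (iK_rank_one h).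
Qed.

Lemma rep_basis us a : covariant_rep i S -> is_basis us ->
  i a = \sum_(u <- us) cmul (S (lact a u)) (star (S u)).
Proof.
move=> h hus; have [iK hK hcov] := rep_covariant h.
have E := lact_rank_sum a hus.
rewrite (hcov a); last by rewrite E; exact: compact_rank_sum.
by rewrite [in LHS]E (iK_rank_sum _ hK) big_map.
Qed.

Lemma rep_ract_star (h : forall xi a, cmul (S xi) (i a) = S (ract xi a))
  (hs : forall a, i (cfun_conj a) = star (i a)) a xi :
  cmul (i a) (star (S xi)) = star (S (ract xi (cfun_conj a))).
Proof. by rewrite -h hs starM starK. Qed.

(* [K(X)] is unital, so the covariance condition amounts to [\sum_u S_u S_u^* ] acting as
   the unit on the image of [A]; then [iK T = \sum_u S_(T u) S_u^*]. *)
Lemma covariant_of_basis us : is_basis us ->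
  (forall a b, i (a * b) = cmul (i a) (i b)) ->
  (forall a, i (cfun_conj a) = star (i a)) ->
  (forall a xi, cmul (i a) (S xi) = S (lact a xi)) ->
  (forall xi a, cmul (S xi) (i a) = S (ract xi a)) ->
  (forall xi eta, cmul (star (S xi)) (S eta) = i (sinner xi eta)) ->
  (forall a, i a = \sum_(u <- us) cmul (S (lact a u)) (star (S u))) ->
  covariant_rep i S.
Proof.
move=> hus hmul hstar hl hr hin hcov; split => //; first by move=> xi eta; rewrite sinner_inner.
exists (fun T => \sum_(u <- us) cmul (S (T u)) (star (S u))); last by move=> a _; exact: hcov.
split.
- move=> k T T' _ _; rewrite scaler_sumr -big_split /=; apply: eq_bigr => u _.
  by rewrite -[(k *: T + T') u]/(k *: T u + T' u) linearP cmulDl cmulZl.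
- move=> T T' [[T1 h] _] _; rewrite cmul_sumr; apply: eq_bigr => v _.
  rewrite cmulA cmul_suml -[(T \o T') v]/(T (T' v)) -(adjoint_basis (T' v) hus h) raddf_sum; congr cmul.
  by apply: eq_bigr => u _; rewrite -cmulA hin hr.
- move=> T T' _ _; rewrite adjointE => h; rewrite star_sum.
  under [RHS]eq_bigr do rewrite starM starK.
  transitivity (\sum_(u <- us) \sum_(v <- us) cmul (cmul (S v) (i (sinner (T v) u))) (star (S u))).
    apply: eq_bigr => u _; rewrite -{1}(hus (T' u)) raddf_sum cmul_suml.
    by apply: eq_bigr => v _; rewrite hr h.
  rewrite exchange_big; apply: eq_bigr => v _ /=.
  rewrite -{2}(hus (T v)) raddf_sum star_sum cmul_sumr; apply: eq_bigr => u _.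
  by rewrite -cmulA (rep_ract_star hr hstar) -inner_conj.
- move=> xi eta; rewrite -[in RHS](hus eta) raddf_sum star_sum cmul_sumr.
  apply: eq_bigr => u _; rewrite rank_oneE -hr -cmulA (rep_ract_star hr hstar).
  by rewrite -inner_conj.
Qed.

End Representation.

End BimoduleAlgebra.

(** * Positive functionals on C*-algebras *)

Section CstarTheory.
Variables (R : realType) (O : cstarAlgType R).
Local Notation C := R[i].
Implicit Types (x y z : O) (D : set O).

Lemma cmulNl x y : cmul (- x) y = - cmul x y.
Proof. by rewrite -[- x]scaleN1r cmulZl scaleN1r. Qed.

Lemma cmulNr x y : cmul x (- y) = - cmul x y.
Proof. by rewrite -[- y]scaleN1r cmulZr scaleN1r. Qed.

Lemma cmulBl x y z : cmul (x - y) z = cmul x z - cmul y z.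
Proof. by rewrite cmulDl cmulNl. Qed.

Lemma cmulBr x y z : cmul x (y - z) = cmul x y - cmul x z.
Proof. by rewrite cmulDr cmulNr. Qed.

Lemma starN x : star (- x) = - star x.
Proof. by rewrite -[- x]scaleN1r starZ rmorphN rmorph1 scaleN1r. Qed.

Lemma starB x y : star (x - y) = star x - star y.
Proof. by rewrite starD starN. Qed.

Lemma rnorm_cmul x y : rnorm (cmul x y) <= rnorm x * rnorm y.
Proof. by have := norm_cmul x y; rewrite !rnormE -rmorphM lecR. Qed.

Lemma rnorm_star_cmul x : rnorm (cmul (star x) x) = rnorm x ^+ 2.
Proof. by have := norm_star_cmul x; rewrite !rnormE -rmorphXn => /complexI. Qed.

Lemma rnorm_star x : rnorm (star x) = rnorm x.
Proof.
have h y : rnorm y <= rnorm (star y).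
  have [->|y0] := eqVneq (rnorm y) 0; first exact: rnorm_ge0.
  have yp : 0 < rnorm y by rewrite lt0r y0 rnorm_ge0.
  by rewrite -(ler_pM2r yp) -expr2 -rnorm_star_cmul rnorm_cmul.
by apply: le_anti; rewrite h andbT -{2}(starK x) h.
Qed.

Definition approx D x := forall e : R, 0 < e -> exists2 y, D y & rnorm (x - y) < e.

Lemma closure_approx D x : closure D x <-> approx D x.
Proof.
split=> [h e e0|h U /nbhs_rnormP[e e0 hU]].
  have [|y [Dy xy]] := h [set y | rnorm (x - y) < e]; last by exists y.
  by apply/nbhs_rnormP; exists e.
by have [y Dy xy] := h e e0; exists y; split => //; exact: hU.
Qed.

Lemma closedP D : closed D <-> forall x, approx D x -> D x.
Proof. by split=> h x /closure_approx; exact: h. Qed.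

Lemma denseP D : dense D <-> forall x, approx D x.
Proof.
split=> [h x e e0|h U [x Ux] oU].
  have : nbhs x [set y | rnorm (x - y) < e] by apply/nbhs_rnormP; exists e.
  rewrite nbhsE => -[V [oV Vx] VU].
  have [|//|y [Vy Dy]] := h V; first by exists x.
  by exists y => //; exact: VU.
have /nbhs_rnormP[e e0 hU] : nbhs x U by apply: open_nbhs_nbhs.
by have [y Dy xy] := h x e e0; exists y; split => //; exact: hU.
Qed.

Lemma approx_self D x : D x -> approx D x.
Proof. by move=> Dx e e0; exists x => //; rewrite subrr rnorm0. Qed.

Lemma closed_approx D : closed [set x | approx D x].
Proof.
apply/closedP => x h e e0; have e2 : 0 < e / 2 by rewrite divr_gt0.
have [y hy xy] := h _ e2; have [z Dz yz] := hy _ e2; exists z => //.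
by apply: (le_lt_trans (rdist_triangle y _ _)); rewrite [e]splitr ltrD.
Qed.

Lemma approx_star_subalgebra D : star_subalgebra D -> star_subalgebra [set x | approx D x].
Proof.
move=> [D0 Dl Dm Ds]; split.
- exact: approx_self.
- move=> k x y hx hy e e0.
  have e2 : 0 < e / 2 by rewrite divr_gt0.
  have k0 : 0 < rnorm k + 1 by rewrite ltr_wpDl// rnorm_ge0.
  have [x' Dx' xx'] := hx _ (divr_gt0 e2 k0); have [y' Dy' yy'] := hy _ e2.
  exists (k *: x' + y'); first exact: Dl.
  rewrite opprD addrACA -scalerBr; apply: (le_lt_trans (rnormD _ _)).
  rewrite rnormZ [e]splitr; apply: ler_ltD => //.
  apply: (@le_trans _ _ ((rnorm k + 1) * rnorm (x - x'))).
    by apply: ler_wpM2r; [exact: rnorm_ge0|rewrite lerDl].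
  by rewrite mulrC -ler_pdivlMr// ltW.
- move=> x y hx hy e e0.
  pose K := rnorm x + rnorm y + 1.
  have K0 : 0 < K by rewrite ltr_wpDl// addr_ge0 ?rnorm_ge0.
  pose r := Num.min 1 (e / 2 / K).
  have r0 : 0 < r by rewrite lt_min ltr01 !divr_gt0.
  have r1 : r <= 1 by rewrite ge_min lexx.
  have rK : r * K <= e / 2 by rewrite -ler_pdivlMr// ge_min lexx orbT.
  have [x' Dx' xx'] := hx _ r0; have [y' Dy' yy'] := hy _ r0.
  exists (cmul x' y'); first exact: Dm.
  have -> : cmul x y - cmul x' y' = cmul x (y - y') + cmul (x - x') y'.
    by rewrite cmulBr cmulBl addrA subrK.
  apply: (le_lt_trans (rnormD _ _)).
  have n1 := rnorm_cmul x (y - y'); have n2 := rnorm_cmul (x - x') y'.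
  have ny' : rnorm y' <= rnorm y + 1.
    rewrite -[y'](subrK y) addrC; apply: (le_trans (rnormD _ _)).
    by rewrite lerD2l rdistC (le_trans (ltW yy')).
  have m1 : rnorm x * rnorm (y - y') <= rnorm x * r by apply: ler_wpM2l (ltW _); rewrite ?rnorm_ge0.
  have m2 : rnorm (x - x') * rnorm y' <= r * (rnorm y + 1).
    by apply: ler_pM => //; rewrite ?rnorm_ge0// ltW.
  apply: (le_lt_trans (lerD (le_trans n1 m1) (le_trans n2 m2))).
  rewrite (_ : _ + _ = r * K); last by rewrite /K; ring.
  by apply: (le_lt_trans rK); rewrite ltr_pdivrMr// mulr_natr mulr2n ltrDl.
- move=> x hx e e0; have [y Dy xy] := hx e e0; exists (star y); first exact: Ds.
  by rewrite -starB rnorm_star.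
Qed.

Lemma seq_cauchy_limit (u : nat -> O) :
  (forall e : R, 0 < e -> exists c, \forall n \near \oo, rnorm (c - u n) <= e) ->
  exists l, forall e : R, 0 < e -> \forall n \near \oo, rnorm (l - u n) < e.
Proof.
move=> h.
have cF : cauchy (u @ \oo).
  apply: cauchy_exP => e e0; have eE : e = (complex.Re e)%:C by rewrite -[e]gtr0_norm// rnormE.
  have r0 : 0 < complex.Re e / 2 by rewrite divr_gt0//; move: e0; rewrite eE ltcR.
  have [c hc] := h _ r0; exists c; apply: filterS hc => n hn.
  rewrite -ball_normE /= rnormE eE ltcR; apply: (le_lt_trans hn).
  by rewrite gtr_pMr ?invf_lt1 ?ltr1n//; move: e0; rewrite eE ltcR.
have hl := @cauchy_cvg O _ _ cF; exists (lim (u @ \oo)).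
exact/cvg_rnormP/hl.
Qed.

Section Unital.
Variable e : O.
Hypotheses (el : forall x, cmul e x = x) (er : forall x, cmul x e = x).

Lemma star_unit : star e = e.
Proof. by rewrite -[LHS]er -[in RHS](starK e) -{2}[star e]er starM starK. Qed.

Lemma rnorm_unit_le1 : rnorm e <= 1.
Proof.
have := rnorm_star_cmul e; rewrite star_unit el expr2 => h.
have [->|e0] := eqVneq (rnorm e) 0; first exact: ler01.
by rewrite -[X in X = _]mulr1 in h; rewrite -(mulfI e0 h).
Qed.

(* [h = e - c], where [c] is the fixed point of [c |-> (a + c^2) / 2]. *)
Lemma square_root_unit_sub (a : O) : star a = a -> rnorm a < 1 ->
  exists2 h, star h = h & cmul h h = e - a.
Proof.
move=> sa a1; pose r := rnorm a; have r0 : 0 <= r := rnorm_ge0 a.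
pose hf : C := (2^-1)%:C.
have nhf : rnorm hf = 2^-1 by rewrite rnorm_real ger0_norm// invr_ge0.
(* With [r] the norm of [a], [F] preserves the ball of radius [r] since [(r + r ^ 2) / 2 <= r], and
   it contracts distances there by [r < 1]. *)
pose F (c : O) : O := hf *: (a + cmul c c).
have Fn c : rnorm c <= r -> rnorm (F c) <= r.
  move=> cr; rewrite /F rnormZ nhf; have := rnormD a (cmul c c); have := rnorm_cmul c c.
  have : rnorm c * rnorm c <= r * 1 by apply: ler_pM => //; rewrite ?rnorm_ge0//; exact: le_trans cr (ltW a1).
  rewrite /r; lra.
have Flip c c' : rnorm c <= r -> rnorm c' <= r -> rnorm (F c - F c') <= r * rnorm (c - c').
  move=> cr cr'.
  have -> : F c - F c' = hf *: (cmul c (c - c') + cmul (c - c') c').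
    by rewrite /F -scalerBr cmulBr cmulBl addrA subrK opprD addrACA subrr add0r.
  rewrite rnormZ nhf; have := rnormD (cmul c (c - c')) (cmul (c - c') c').
  have := rnorm_cmul c (c - c'); have := rnorm_cmul (c - c') c'.
  have : rnorm c * rnorm (c - c') <= r * rnorm (c - c') by apply: ler_wpM2r; rewrite ?rnorm_ge0.
  have : rnorm (c - c') * rnorm c' <= rnorm (c - c') * r by apply: ler_wpM2l; rewrite ?rnorm_ge0.
  rewrite [rnorm (c - c') * r]mulrC; lra.
pose c n := iter n F 0.
have cr n : rnorm (c n) <= r by elim: n => [|n IH]; [rewrite rnorm0|exact: Fn].
have cs n : star (c n) = c n.
  elim: n => [|n IH]; first exact: star0.
  by rewrite /c iterS -/(c n) /F starZ starD starM IH sa /hf /= oppr0.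
have cc n k : rnorm (c (n + k)%N - c n) <= r ^+ n.
  elim: n => [|n IH]; first by rewrite /c /= subr0 expr0 (le_trans (cr k)) ?ltW.
  rewrite addSn exprS; apply: (le_trans (Flip _ _ (cr _) (cr _))).
  exact: ler_wpM2l.
have small (eps : R) : 0 < eps -> exists N, r ^+ N < eps.
  move=> eps0; have : (fun n => r ^+ n) @ \oo --> (0 : R) by apply: cvg_expr; rewrite ger0_norm.
  move=> /cvgrPdist_lt/(_ _ eps0)[N _ /(_ N (leqnn N))].
  by rewrite sub0r normrN ger0_norm ?exprn_ge0// => h; exists N.
have [|l hl] := @seq_cauchy_limit c.
  move=> eps eps0; have [N hN] := small _ eps0; exists (c N).
  exists N => // n /= Nn; rewrite rdistC -(subnKC Nn).
  exact: le_trans (cc _ _) (ltW hN).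
have lr : rnorm l <= r.
  apply/ler_addgt0Pr => eps eps0; have [n hn] := filter_ex (hl _ eps0).
  by rewrite -(subrK (c n) l) addrC; apply: (le_trans (rnormD _ _)); rewrite lerD// ltW.
have sl : star l = l.
  apply/eqP; rewrite -subr_eq0; apply/eqP; apply: rnorm_lt_eps_eq0 => eps eps0.
  have e2 : 0 < eps / 2 by rewrite divr_gt0.
  have [n hn] := filter_ex (hl _ e2).
  apply: (le_trans (rdist_triangle (c n) _ _)).
  by rewrite [eps]splitr -[in X in rnorm (star l - X)]cs -starB rnorm_star lerD// ?(rdistC (c n)) ltW.
have Fl : F l = l.
  apply/eqP; rewrite -subr_eq0; apply/eqP; apply: rnorm_lt_eps_eq0 => eps eps0.
  have e2 : 0 < eps / 2 by rewrite divr_gt0.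
  have [N _ hN] := hl _ e2; have h1 := hN N (leqnn N); have h2 := hN N.+1 (leqnSn N).
  apply: (le_trans (rdist_triangle (c N.+1) _ _)); rewrite [eps]splitr; apply: lerD.
    apply: (le_trans (Flip _ _ lr (cr N))); apply: le_trans (ltW h1).
    by rewrite -[leRHS]mul1r; apply: ler_wpM2r; rewrite ?rnorm_ge0// ltW.
  by rewrite rdistC ltW.
exists (e - l); first by rewrite starB star_unit sl.
have ll : cmul l l = l + l - a.
  apply/eqP; rewrite eq_sym subr_eq addrC -[X in X + _ == _]Fl -[X in _ + X == _]Fl /F -scalerDl.
  have -> : hf + hf = 1 by rewrite /hf -rmorphD (_ : _ + _ = 1) ?rmorph1//; lra.
  by rewrite scale1r addrC.
rewrite cmulBl !cmulBr !el er ll.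
have -> : l - (l + l - a) = a - l by rewrite opprB addrCA opprD [l + _]addrA subrr add0r.
by rewrite opprB addrA subrK.
Qed.

End Unital.

Section PositiveFunctional.
Variable phi : O -> C.
Hypotheses (phi_lin : scalar phi) (phi_ge0 : forall x, 0 <= phi (cmul (star x) x)).

Lemma functional0 : phi 0 = 0.
Proof. by have := phi_lin (-1) 0 0; rewrite scaler0 addr0 mulN1r addNr. Qed.

Lemma functionalD x y : phi (x + y) = phi x + phi y.
Proof. by rewrite -[x in LHS]scale1r phi_lin mul1r. Qed.

Lemma functionalZ (k : C) x : phi (k *: x) = k * phi x.
Proof. by rewrite -[k *: x]addr0 phi_lin functional0 addr0. Qed.

Lemma functionalB x y : phi (x - y) = phi x - phi y.
Proof. by rewrite functionalD -scaleN1r functionalZ mulN1r. Qed.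

Lemma functional_sum (I : Type) (s : seq I) (F : I -> O) :
  phi (\sum_(j <- s) F j) = \sum_(j <- s) phi (F j).
Proof. by elim/big_rec2: _ => [|j u v _ <-]; rewrite ?functional0 ?functionalD. Qed.

Definition sqn x : R := complex.Re (phi (cmul (star x) x)).

Lemma functional_sqn x : phi (cmul (star x) x) = (sqn x)%:C.
Proof. by rewrite /sqn; have := phi_ge0 x; case: (phi _) => a b; rewrite lecE /= => /andP[/eqP-> _]. Qed.

Lemma sqn_ge0 x : 0 <= sqn x.
Proof. by have := phi_ge0 x; rewrite functional_sqn lecR. Qed.

(** The functional is real on each square of [k *: x + y]; the imaginary parts of the expansions for
    [k = 1] and [k = 'i] give the two coordinates of the identity. *)
Lemma functional_herm x y : phi (cmul (star y) x) = conjc (phi (cmul (star x) y)).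
Proof.
have key (k : C) : (sqn (k *: x + y))%:C = (rnorm k ^+ 2 * sqn x)%:C +
    k * phi (cmul (star y) x) + conjc k * phi (cmul (star x) y) + (sqn y)%:C.
  rewrite -functional_sqn starD starZ cmulDl !cmulDr !cmulZl !cmulZr scalerA.
  rewrite !functionalD !functionalZ !functional_sqn conjc_mulE rmorphM; ring.
have := key 1; have := key 'i%C.
case: (phi (cmul (star y) x)) (phi (cmul (star x) y)) => a b [a' b'] /=.
move=> /(congr1 (@complex.Im R)) /= h1 /(congr1 (@complex.Im R)) /= h2.
by apply/eqP; rewrite eq_complex /=; apply/andP; split; apply/eqP; lra.
Qed.

Lemma functional_cauchy_schwarz x y :
  rnorm (phi (cmul (star x) y)) ^+ 2 <= sqn x * sqn y.
Proof.
set b := phi _.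
have key (D : R) : sqn (D%:C *: x - conjc b *: y) = D ^+ 2 * sqn x - 2 * D * rnorm b ^+ 2 + rnorm b ^+ 2 * sqn y.
  apply: (@complexI R); rewrite -functional_sqn starB !starZ cmulBl !cmulBr !cmulZl !cmulZr !scalerA conjcK.
  rewrite !functionalB !functionalZ !functional_sqn -/b (functional_herm x y) -/b.
  have -> : conjc (D%:C) = D%:C :> C by rewrite /= oppr0.
  have -> : b * conjc b = (rnorm b ^+ 2)%:C by rewrite mulrC conjc_mulE.
  have -> : D%:C * conjc b * b = (D * rnorm b ^+ 2)%:C by rewrite -mulrA conjc_mulE -rmorphM.
  have -> : b * D%:C * conjc b = (D * rnorm b ^+ 2)%:C by rewrite mulrAC [b * _]mulrC conjc_mulE mulrC -rmorphM.
  by rewrite -!rmorphM -!rmorphB; congr (_%:C); ring.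
apply/ler_addgt0Pr => eps eps0.
(* A positive substitute for [sqn y], which may vanish; the surplus is chosen so that [D * sqn x]
   exceeds [sqn x * sqn y] by at most [eps]. *)
pose D := sqn y + eps / (sqn x + 1).
have x1 : 0 < sqn x + 1 by rewrite ltr_wpDl ?sqn_ge0.
have ex0 : 0 < eps / (sqn x + 1) by rewrite divr_gt0.
have D0 : 0 < D by rewrite ltr_wpDl ?sqn_ge0.
have := sqn_ge0 (D%:C *: x - conjc b *: y); rewrite key => h.
have h' : rnorm b ^+ 2 * sqn y <= rnorm b ^+ 2 * D by apply: ler_wpM2l; rewrite ?sqr_ge0// lerDl ltW.
have {h h'} h : D * rnorm b ^+ 2 <= D * (D * sqn x).
  rewrite mulrA -expr2; move: h h'; rewrite [rnorm b ^+ 2 * D]mulrC -mulrA; lra.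
rewrite ler_pM2l// in h; apply: (le_trans h).
rewrite /D mulrDl [sqn y * _]mulrC lerD2l mulrAC ler_pdivrMr// ler_wpM2l ?(ltW eps0)// lerDl//.
Qed.

(** For [r] above the square of the norm of [y], [e - r^-1 y^* y] is the square of a selfadjoint
    element, so positivity gives [phi (y^* y) <= r * phi e]. Cauchy-Schwarz against [e] treats
    arbitrary elements. *)
Lemma functional_bounded (e : O) (el : forall x, cmul e x = x) (er : forall x, cmul x e = x) x :
  rnorm (phi x) <= complex.Re (phi e) * rnorm x.
Proof.
have se := star_unit er.
have pe : phi e = (sqn e)%:C by rewrite -functional_sqn se el.
have sa a : star a = a -> rnorm a < 1 -> complex.Re (phi a) <= sqn e.
  move=> h1 h2; have [h sh hh] := square_root_unit_sub el er h1 h2.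
  have := phi_ge0 h; rewrite sh hh functionalB pe.
  by case: (phi a) => u v; rewrite lecE /= => /andP[_]; rewrite subr_ge0.
have sq y : sqn y <= sqn e * rnorm y ^+ 2.
  apply/ler_addgt0Pr => eps eps0.
  have e1 : 0 < sqn e + 1 by rewrite ltr_wpDl ?sqn_ge0.
  pose r := rnorm y ^+ 2 + eps / (sqn e + 1).
  have ee : 0 < eps / (sqn e + 1) by rewrite divr_gt0.
  have r0 : 0 < r by rewrite ltr_wpDl ?sqr_ge0.
  have := sa ((r^-1)%:C *: cmul (star y) y).
  rewrite starZ starM starK /= oppr0 rnormZ rnorm_real rnorm_star_cmul gtr0_norm ?invr_gt0//.
  rewrite mulrC ltr_pdivrMr// mul1r ltrDl => /(_ erefl ee).
  rewrite functionalZ functional_sqn -rmorphM /= mulrC ler_pdivrMr// => h.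
  apply: (le_trans h); rewrite /r mulrDr lerD2l mulrCA ler_piMr ?(ltW eps0)//.
  by rewrite ler_pdivrMr// mul1r lerDl.
rewrite pe /= -(ler_pXn2r (n := 2)) ?nnegrE ?rnorm_ge0 ?mulr_ge0 ?sqn_ge0 ?rnorm_ge0//.
rewrite -{1}(el x) -{1}se; apply: (le_trans (functional_cauchy_schwarz _ _)).
by rewrite exprMn expr2 -mulrA; apply: ler_wpM2l => //; exact: sqn_ge0.
Qed.

End PositiveFunctional.

End CstarTheory.

(** * A representation by weighted composition operators *)

Section WeightedComposition.
Variables (R : realType) (I : choiceType).
Local Notation C := R[i].
Local Notation H := (l2 R I).

Record finite_fibres (phi : I -> I) (fib : I -> seq I) : Prop := FiniteFibres {
  fib_uniq : forall y, uniq (fib y);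
  mem_fib : forall x y, (x \in fib y) = (phi x == y);
  fib_bounded : exists d, forall y, (size (fib y) <= d)%N }.

Variables (phi : I -> I) (fib : I -> seq I).
Hypothesis ff : finite_fibres phi fib.

(** Each value [g y] is counted at most once per point of the fibre over [y], and fibres have
    bounded size. *)
Lemma sum_comp_le : exists2 D : R, 0 <= D & forall (g : I -> R) (K : R), (forall i, 0 <= g i) ->
  (forall s, uniq s -> \sum_(i <- s) g i <= K) ->
  forall s, uniq s -> \sum_(i <- s) g (phi i) <= D * K.
Proof.
have [uf mf [D hD]] := ff; exists D%:R => // g K g0 hK s us.
pose t := undup (map phi s).
apply: (@le_trans _ _ (\sum_(i <- flatten (map fib t)) g (phi i))).
  apply: ler_sum_subset => //; first exact: (uniq_flatten_fibres uf mf (undup_uniq _)).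
  by move=> x xs; rewrite (mem_flatten_fibres _ _ mf) mem_undup map_f.
rewrite big_flatten big_map -[leRHS]/(D%:R * K).
apply: (@le_trans _ _ (\sum_(y <- t) (D%:R * g y))).
  apply: ler_sum => y _; rewrite big_seq (eq_bigr (fun=> g y)); last by move=> x; rewrite mf => /eqP ->.
  rewrite -big_seq big_const_seq count_predT iter_addr_0 -[leLHS]mulr_natl.
  by apply: ler_wpM2r => //; rewrite ler_nat.
by rewrite -mulr_sumr; apply: ler_wpM2l => //; apply: hK; exact: undup_uniq.
Qed.

Lemma sqr_sum_le (s : seq I) (g : I -> C) :
  rnorm (\sum_(i <- s) g i) ^+ 2 <= (2 ^ size s)%:R * \sum_(i <- s) rnorm (g i) ^+ 2.
Proof.
elim: s => [|i s IH]; first by rewrite !big_nil rnorm0 expr0n mulr0.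
rewrite !big_cons /= expnS natrM; apply: (le_trans (sqr_rnormD_le _ _)).
rewrite mulrDr lerD//; last by rewrite -mulrA ler_wpM2l.
apply: ler_wpM2r; first exact: exprn_ge0 (rnorm_ge0 _).
by rewrite -[leLHS]mulr1 ler_wpM2l// ler1n expn_gt0.
Qed.

Variable w : I -> C.
Hypothesis wb : exists2 K : R, 0 <= K & forall i, rnorm (w i) <= K.

Lemma wcomp_bound (h : H) : exists2 L : R, 0 <= L & forall s, uniq s ->
  \sum_(i <- s) rnorm (w i * h (phi i)) ^+ 2 <= L * l2norm h ^+ 2.
Proof.
have [K K0 hK] := wb; have [D D0 hD] := sum_comp_le.
exists (K ^+ 2 * D); first by rewrite mulr_ge0// sqr_ge0.
move=> s us; rewrite -mulrA.
apply: le_trans (_ : \sum_(i <- s) K ^+ 2 * rnorm (h (phi i) : C) ^+ 2 <= _).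
  apply: ler_sum => i _; rewrite rnormM exprMn; apply: ler_wpM2r; first exact: exprn_ge0 (rnorm_ge0 _).
  by rewrite ler_pXn2r ?nnegrE ?rnorm_ge0.
rewrite -mulr_sumr; apply: ler_wpM2l; first exact: sqr_ge0.
apply: (hD (fun i => rnorm (h i : C) ^+ 2)) => //; first by move=> i; exact: exprn_ge0 (rnorm_ge0 _).
exact: l2norm_partial.
Qed.

Lemma wcomp_subproof (h : H) : (fun i => w i * h (phi i) : C^o) \in @sq_summable R I.
Proof. by have [L _ hL] := wcomp_bound h; apply/asboolP; exists (L * l2norm h ^+ 2). Qed.

Definition wcomp_fun (h : H) : H := L2 (wcomp_subproof h).

Lemma wcomp_adj_subproof (h : H) :
  (fun y => \sum_(i <- fib y) conjc (w i) * h i : C^o) \in @sq_summable R I.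
Proof.
have [uf mf [D hD]] := ff; have [K K0 hK] := wb.
apply/asboolP; exists ((2 ^ D)%:R * (K ^+ 2 * l2norm h ^+ 2)) => s us.
apply: (@le_trans _ _ (\sum_(y <- s) (2 ^ D)%:R * \sum_(i <- fib y) (K ^+ 2 * rnorm (h i : C) ^+ 2))).
  apply: ler_sum => y _; apply: (le_trans (sqr_sum_le _ _)).
  apply: ler_pM => //; first by apply: sumr_ge0 => i _; exact: exprn_ge0 (rnorm_ge0 _).
    by rewrite ler_nat leq_exp2l.
  apply: ler_sum => i _; rewrite rnormM rnorm_conj exprMn; apply: ler_wpM2r.
    exact: exprn_ge0 (rnorm_ge0 _).
  by rewrite ler_pXn2r ?nnegrE ?rnorm_ge0.
rewrite -mulr_sumr; apply: ler_wpM2l => //.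
rewrite -(big_map fib xpredT (fun t => \sum_(i <- t) (K ^+ 2 * rnorm (h i : C) ^+ 2))) -big_flatten.
rewrite -mulr_sumr; apply: ler_wpM2l; first exact: sqr_ge0.
by apply: l2norm_partial; exact: (uniq_flatten_fibres uf mf us).
Qed.

Definition wcomp_adj_fun (h : H) : H := L2 (wcomp_adj_subproof h).

Lemma wcomp_adjoint u v : ip (wcomp_fun u) v = ip u (wcomp_adj_fun v).
Proof.
have [uf mf _] := ff.
apply/esym/ipE; have := is_sum_push uf mf (ipP (wcomp_fun u) v); congr is_sum.
apply/funext => y /=; rewrite mulr_sumr big_seq [RHS]big_seq; apply: eq_bigr => i.
by rewrite mf => /eqP <-; rewrite conjcM [conjc (w i) * _]mulrC mulrA.
Qed.

Lemma wcomp_bop_subproof : wcomp_fun \in @adjointable_bounded R I.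
Proof.
apply/asboolP; split; first by exists wcomp_adj_fun; exact: wcomp_adjoint.
have [K K0 hK] := wb; have [D D0 hD] := sum_comp_le.
exists (K * Num.sqrt D); first by rewrite mulr_ge0// sqrtr_ge0.
move=> h; apply: l2norm_le => [|s us]; first by rewrite !mulr_ge0 ?sqrtr_ge0 ?l2norm_ge0.
rewrite !exprMn sqr_sqrtr// -mulrA.
apply: le_trans (_ : \sum_(i <- s) K ^+ 2 * rnorm (h (phi i) : C) ^+ 2 <= _).
  apply: ler_sum => i _; rewrite rnormM exprMn; apply: ler_wpM2r; first exact: exprn_ge0 (rnorm_ge0 _).
  by rewrite ler_pXn2r ?nnegrE ?rnorm_ge0.
rewrite -mulr_sumr; apply: ler_wpM2l; first exact: sqr_ge0.
apply: (hD (fun i => rnorm (h i : C) ^+ 2)) => //; first by move=> i; exact: exprn_ge0 (rnorm_ge0 _).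
exact: l2norm_partial.
Qed.

Definition wcomp : bop R I := Bop wcomp_bop_subproof.

Lemma wcomp_adjE h y : bop_adj wcomp h y = \sum_(i <- fib y) conjc (w i) * h i :> C.
Proof.
have -> // : bop_adj wcomp h = wcomp_adj_fun h.
by apply: ip_inj => u; rewrite -ip_adj wcomp_adjoint.
Qed.

End WeightedComposition.

(** * The covariant representation on the Hilbert space over [J * int] *)

Section ConcreteRepresentation.
Variable R : realType.
Local Notation C := R[i].
Variables P Q : {poly C}.
Hypothesis coprimePQ : coprimep P Q.
Hypothesis degPQ : (2 <= rat_degree P Q)%N.
Local Notation d := (rat_degree P Q).
Local Notation f := (rat_map P Q).
Hypothesis noncritical : forall x, julia_set f x -> ~ critical f x.
Local Notation J := (julia_set f).
Local Notation A := (cfun R J).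
Local Notation X := (cfun R (graph_julia f)).
Local Notation fJ := (julia_map coprimePQ degPQ).
Local Notation gval := (gval coprimePQ degPQ).
Local Notation transfer := (transfer coprimePQ degPQ noncritical).
Local Notation fibre := (fibre coprimePQ degPQ noncritical).
Local Notation sinner := (@sinner R P Q).
Local Notation I := (J * int)%type.

(** Compactness for neighbourhoods in the subspace [J] itself, transferred from compactness as a
    subset of the sphere. *)
Lemma julia_finite_cover (W : J -> set J) : (forall c, nbhs c (W c)) ->
  exists s : seq J, forall z, exists2 c, c \in s & W c z.
Proof.
move=> nW; pose U (x : sphere R) : set (sphere R) :=
  if (insub x : option J) is Some c then [set y | forall z : J, \val z = y -> W c z] else setT.
have nU x : J x -> nbhs x (U x).
  move=> _; rewrite /U; case: insubP => [c _ <-|_]; last exact: filterT.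
  have /nbhs_juliaP[e e0 h] := nW c.
  by apply: filterS (nbhsx_ballx (\val c : sphere R) e e0) => y hy z zy; apply: h; rewrite zy.
have [s [sJ hs]] := @compact_finite_nbhs _ J U (@julia_compact _ P Q) nU.
exists (pmap insub s) => z; have [x xs] := hs (\val z) (@juliaP _ _ _ z).
rewrite /U; case: insubP => [c _ cx|]; last by rewrite (mem_set (sJ _ xs)).
move=> h; exists c; last exact: h.
by rewrite mem_pmap; apply/mapP; exists x => //; rewrite -cx valK.
Qed.

Lemma continuous_bounded (a : J -> C) : continuous (a : J -> C^o) ->
  exists2 K : R, 0 <= K & forall x, rnorm (a x) <= K.
Proof.
move=> /continuous_rnormP ca.
have [s hs] := julia_finite_cover (fun c => ca c 1 ltr01).
exists (\sum_(c <- s) (rnorm (a c) + 1)); first by apply: sumr_ge0 => c _; rewrite addr_ge0 ?rnorm_ge0.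
move=> x; have [c cs cx] := hs x.
rewrite (big_rem c)//= -[leLHS]addr0 lerD//; last first.
  by apply: sumr_ge0 => c' _; rewrite addr_ge0 ?rnorm_ge0.
rewrite -[a x](subrK (a c)) addrC; apply: (le_trans (rnormD _ _)).
by rewrite lerD2l rdistC ltW.
Qed.

Lemma coefA_bounded (a : A) : exists2 K : R, 0 <= K & forall p : I, rnorm (a p.1 : C) <= K.
Proof. by have [K K0 h] := continuous_bounded (@cfun_continuous _ _ a); exists K => // p. Qed.

Lemma coefX_bounded (xi : X) : exists2 K : R, 0 <= K & forall p : I, rnorm (gval xi p.1) <= K.
Proof.
have [K K0 h] := continuous_bounded (@gval_continuous _ _ _ coprimePQ degPQ xi).
by exists K.
Qed.

(** The integer coordinate is a gauge grading: [repX xi] raises it by one and [repA a] preserves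
    it. *)
Definition step (p : I) : I := (fJ p.1, p.2 - 1).

Lemma stepE p : step p = (fJ p.1, p.2 - 1).
Proof. by []. Qed.
Definition step_fib (q : I) : seq I := [seq (x, q.2 + 1) | x <- fibre q.1].

Lemma step_finite_fibres : finite_fibres step step_fib.
Proof.
split.
- by move=> y; rewrite map_inj_uniq ?fibre_uniq// => a b [].
- move=> [x m] [y n]; apply/mapP/eqP => [[z]|[/= xy mn]].
    by rewrite mem_fibre => /eqP /= <- [-> ->]; rewrite /step /= addrK.
  by exists x; rewrite ?mem_fibre ?xy// -mn subrK.
- by exists d => y; rewrite size_map size_fibre.
Qed.

Lemma id_finite_fibres : finite_fibres (@id I) (fun q => [:: q]).
Proof. by split => // [x y|]; [rewrite inE|exists 1%N]. Qed.

Definition repA (a : A) : bop R I := wcomp id_finite_fibres (coefA_bounded a).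
Definition repX (xi : X) : bop R I := wcomp step_finite_fibres (coefX_bounded xi).

Lemma repAE a h p : repA a h p = a p.1 * h p :> C. Proof. by []. Qed.
Lemma repXE xi h p : repX xi h p = gval xi p.1 * h (step p) :> C. Proof. by []. Qed.

Lemma repX_adjE xi h q : bop_adj (repX xi) h q = \sum_(x <- fibre q.1) conjc (gval xi x) * h (x, q.2 + 1) :> C.
Proof. by rewrite wcomp_adjE big_map. Qed.

Lemma repA_linear : linear repA.
Proof.
move=> k a b; apply: bop_eq => h; apply: l2_eq => p.
rewrite -[RHS]/(k * (a p.1 * h p) + b p.1 * h p : C) repAE.
by rewrite -[(k *: a + b) p.1]/(k * a p.1 + b p.1 : C) mulrDl mulrA.
Qed.

Lemma repX_linear : linear repX.
Proof.
move=> k xi eta; apply: bop_eq => h; apply: l2_eq => p.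
rewrite -[RHS]/(k * (gval xi p.1 * h (step p)) + gval eta p.1 * h (step p) : C) repXE.
by rewrite gvalD gvalZ mulrDl mulrA.
Qed.

HB.instance Definition _ := GRing.isLinear.Build C A (bop R I) *:%R repA repA_linear.
HB.instance Definition _ := GRing.isLinear.Build C X (bop R I) *:%R repX repX_linear.

Definition rep_i : {linear A -> bop R I} := repA.
Definition rep_S : {linear X -> bop R I} := repX.

Lemma l2_sumE (T : Type) (s : seq T) (F : T -> l2 R I) p : (\sum_(t <- s) F t) p = \sum_(t <- s) F t p :> C.
Proof. by elim/big_rec2: _ => // t u v _ <-. Qed.

Lemma bop_sumE (T : Type) (s : seq T) (F : T -> bop R I) h : (\sum_(t <- s) F t) h = \sum_(t <- s) F t h.
Proof. by elim/big_rec2: _ => // t u v _ <-. Qed.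

Lemma concrete_rep : covariant_rep rep_i rep_S.
Proof.
have [us' hus' cancel_sum] := exists_is_basis coprimePQ degPQ noncritical.
apply: (covariant_of_basis coprimePQ degPQ noncritical hus').
- by move=> a b; apply: bop_eq => h; apply: l2_eq => p; rewrite [RHS]mulrA.
- move=> a; apply/esym/bop_adj_unique => u v; apply: ipE.
  have := ipP u (repA (cfun_conj a) v); congr is_sum; apply/funext => p.
  by rewrite !repAE conjcM cfun_conjE mulrCA mulrA.
- move=> a xi; apply: bop_eq => h; apply: l2_eq => p.
  by rewrite -[LHS]/(a p.1 * (gval xi p.1 * h (step p)) : C) repXE gval_lact mulrA.
- move=> xi a; apply: bop_eq => h; apply: l2_eq => p.
  rewrite -[LHS]/(gval xi p.1 * (a (fJ p.1) * h (step p)) : C) repXE gval_ract mulrA //.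
- move=> xi eta; apply: bop_eq => h; apply: l2_eq => -[y m].
  rewrite -[LHS]/(bop_adj (repX xi) (repX eta h) (y, m)) repX_adjE repAE sinnerE mulr_suml.
  rewrite big_seq [RHS]big_seq; apply: eq_bigr => x; rewrite mem_fibre => /eqP fx.
  by rewrite repXE /step /= fx addrK mulrA.
- move=> a; apply: bop_eq => h; apply: l2_eq => -[x m].
  rewrite bop_sumE l2_sumE repAE.
  under eq_bigr => u _ do rewrite -[bop_val _ h]/(repX (lact a u) (bop_adj (repX u) h)) repXE repX_adjE gval_lact -mulrA mulr_sumr.
  rewrite -mulr_sumr exchange_big /=; congr (_ * _).
  have xf : x \in fibre (fJ x) by rewrite mem_fibre.
  rewrite (bigD1_seq x) ?fibre_uniq//= [X in _ + X]big1_seq ?addr0.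
    by under eq_bigr do rewrite mulrA; rewrite -mulr_suml cancel_sum// eqxx mul1r subrK.
  move=> z /andP[zx]; rewrite mem_fibre => /eqP fz.
  by under eq_bigr do rewrite mulrA; rewrite -mulr_suml cancel_sum// eq_sym (negbTE zx) mul0r.
Qed.

End ConcreteRepresentation.

(** * The Lyubich measure and the transfer operator *)

Section LyubichLimit.
Variable R : realType.
Local Notation C := R[i].
Local Notation S2 := (sphere R).
Variables P Q : {poly C}.
Hypothesis coprimePQ : coprimep P Q.
Hypothesis degPQ : (2 <= rat_degree P Q)%N.
Local Notation d := (rat_degree P Q).
Local Notation f := (rat_map P Q).
Hypothesis noncritical : forall x, julia_set f x -> ~ critical f x.
Local Notation J := (julia_set f).
Local Notation A := (cfun R J).
Local Notation fJ := (julia_map coprimePQ degPQ).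
Local Notation transfer := (transfer coprimePQ degPQ noncritical).
Local Notation fibre := (fibre coprimePQ degPQ noncritical).

Fixpoint nfibre (n : nat) (y : J) : seq J :=
  if n is n'.+1 then flatten (map (nfibre n') (fibre y)) else [:: y].

Lemma mem_nfibre n x y : (x \in nfibre n y) = (iter n fJ x == y).
Proof.
elim: n x y => [|n IH] x y /=; first by rewrite inE.
by rewrite (mem_flatten_fibres _ _ IH) mem_fibre.
Qed.

Lemma nfibre_uniq n y : uniq (nfibre n y).
Proof.
elim: n y => [|n IH] y //=.
by apply: (uniq_flatten_fibres IH (mem_nfibre n)); exact: fibre_uniq.
Qed.

Lemma size_nfibre n y : size (nfibre n y) = (d ^ n)%N.
Proof.
elim: n y => [|n IH] y //=; rewrite size_flatten /shape -map_comp.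
rewrite (eq_map (g := fun=> (d ^ n)%N)); last by move=> z; rewrite /= IH.
by rewrite sumnE big_map big_const_seq count_predT iter_addn_0 size_fibre expnS mulnC.
Qed.

Lemma iter_transferE n (h : J -> C) y : iter n transfer h y = \sum_(x <- nfibre n y) h x.
Proof.
elim: n y => [|n IH] y; first by rewrite big_seq1.
rewrite iterS /= big_flatten big_map; apply: eq_bigr => x _; exact: IH.
Qed.

Lemma val_iter_julia_map n (x : J) : \val (iter n fJ x) = iter n f (\val x).
Proof. by elim: n => //= n <-. Qed.

Lemma iter_branch_index n (x : J) : branch_index (iter n f) (\val x) = 1%N.
Proof.
have h : forall n, {for \val x, continuous (iter n f)}.
  elim=> [|m IH]; first exact: cvg_id.
  apply: (@continuous_comp _ _ _ (iter m f) f); first exact: IH.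
  exact: (rat_map_continuous coprimePQ (ltnW degPQ)).
apply: branch_indexE; elim: n => [|n IH]; first exact: is_branch_index_id.
apply: (is_branch_index1_comp (h n) IH); rewrite -val_iter_julia_map.
by apply: (noncritical_branch coprimePQ (ltnW degPQ)); apply: noncritical; exact: juliaP.
Qed.

Lemma continuous_measurable_sphere (g : S2 -> R) : continuous g ->
  measurable_fun [set: borel_sphere R] (g : borel_sphere R -> R).
Proof.
move=> /continuousP cg; apply: (measurability _ (@RGenOInfty.measurableE R)).
move=> _ [_ [x ->] <-]; rewrite setTI; apply: sub_sigma_algebra.
by apply: cg; exact: interval_open.
Qed.

Lemma measurable_julia : measurable (J : set (borel_sphere R)).
Proof.
rewrite -(setCK J); apply: measurableC; apply: sub_sigma_algebra.
by apply: closed_openC; exact: julia_closed.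
Qed.

(** Every preimage of a point of [J] under the iterate lies in [J], where all branch indices are 1,
    so the atoms have equal mass. Nonnegativity lets the integral split over the sum of measures. *)
Lemma integral_lyubich_approx n (y : J) (g : S2 -> R) : continuous g -> (forall x, 0 <= g x) ->
  (\int[lyubich_approx f d (\val y) n]_x (g x)%:E =
   ((d%:R ^+ n)^-1 * \sum_(x <- nfibre n y) g (\val x))%:E)%E.
Proof.
move=> cg g0; have mg := continuous_measurable_sphere cg.
have mgE : measurable_fun [set: borel_sphere R] (fun x => (g x)%:E) by exact/measurable_EFinP.
rewrite /lyubich_approx; set s := enum_fset _.
have setE : [set x : S2 | iter n f x = \val y] = [set` map \val (nfibre n y)].
  apply/seteqP; split=> x /=.
    move=> fx; have xJ : x \in julia_set f.
      by apply/mem_set/(julia_iter coprimePQ degPQ n); rewrite fx; exact: juliaP.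
    apply/mapP; exists (SigSub xJ : J) => //; rewrite mem_nfibre.
    by apply/eqP/val_inj; rewrite val_iter_julia_map.
  by move=> /mapP[z]; rewrite mem_nfibre => /eqP <- ->; rewrite val_iter_julia_map.
have ps : perm_eq s (map \val (nfibre n y)).
  apply: uniq_perm; first exact: fset_uniq.
    by rewrite map_inj_uniq ?nfibre_uniq//; exact: val_inj.
  move=> x; rewrite /s -[LHS]/(x \in fset_set [set x : S2 | iter n f x = \val y]).
  by rewrite setE (in_fset_set (finite_seq _)); apply/idP/idP => h; [exact: set_mem h|exact/mem_set].
have sJ x : x \in s -> exists z : J, x = \val z.
  by rewrite (perm_mem ps) => /mapP[z _ ->]; exists z.
rewrite ge0_integral_measure_sum//; last by move=> x _; rewrite lee_fin.
rewrite -(big_map \val xpredT g) -(perm_big _ ps) /= mulr_sumr -sumEFin (big_nth None) big_mkord.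
apply: eq_bigr => k _.
rewrite ge0_integral_mscale//; last by move=> x _; rewrite lee_fin.
rewrite integral_dirac// diracT mul1e /=.
have [z ->] := sJ _ (mem_nth None (ltn_ord k)).
by rewrite iter_branch_index mulr1 EFinM.
Qed.

Variable mu : probability (borel_sphere R) R.
Hypothesis lyubich : is_lyubich_measure f d mu.

Definition julia_dist1 (x y : S2) : R :=
  `|(stereo x).1.1 - (stereo y).1.1| + `|(stereo x).1.2 - (stereo y).1.2| + `|(stereo x).2 - (stereo y).2|.

Definition julia_gap (x : S2) : R := inf [set julia_dist1 x y | y in J].

Lemma julia_dist1_ge0 x y : 0 <= julia_dist1 x y.
Proof. by rewrite /julia_dist1 !addr_ge0. Qed.

Lemma julia_dist1_triangle x y z : julia_dist1 x y <= julia_dist1 x z + julia_dist1 z y.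
Proof.
rewrite /julia_dist1; move: (stereo x) (stereo y) (stereo z) => [[x1 x2] x3] [[y1 y2] y3] [[z1 z2] z3] /=.
have := ler_distD z1 x1 y1; have := ler_distD z2 x2 y2; have := ler_distD z3 x3 y3; lra.
Qed.

Lemma julia_gap_lb x y : J y -> julia_gap x <= julia_dist1 x y.
Proof. by move=> Jy; apply: ge_inf; [exists 0 => _ [z _ <-]; exact: julia_dist1_ge0|exists y]. Qed.

Lemma julia_gap_ge0 x : 0 <= julia_gap x.
Proof.
have [y Jy] := julia_nonempty coprimePQ degPQ.
apply: lb_le_inf; first by exists (julia_dist1 x y), y.
by move=> _ [z _ <-]; exact: julia_dist1_ge0.
Qed.

Lemma julia_gap_lipschitz x z : julia_gap x <= julia_dist1 x z + julia_gap z.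
Proof.
have [y Jy] := julia_nonempty coprimePQ degPQ.
rewrite addrC -lerBlDr; apply: lb_le_inf; first by exists (julia_dist1 z y), y.
move=> _ [w Jw <-]; rewrite lerBlDr addrC.
by apply: le_trans (julia_gap_lb x Jw) _; exact: julia_dist1_triangle.
Qed.

Lemma julia_gap_eq0 x : julia_gap x = 0 <-> J x.
Proof.
have [y Jy] := julia_nonempty coprimePQ degPQ.
split=> [h|Jx]; last first.
  apply: le_anti; rewrite julia_gap_ge0 andbT; apply: (le_trans (julia_gap_lb x Jx)).
  by rewrite /julia_dist1 !subrr normr0 !addr0.
apply: (@julia_closed _ P Q) => U /nbhs_ballP[e /= e0 hU].
have [|_ [z Jz <-]] := @inf_adherent R [set julia_dist1 x y | y in J] e e0.
  split; first by exists (julia_dist1 x y), y.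
  by exists 0 => _ [z _ <-]; exact: julia_dist1_ge0.
rewrite -/(julia_gap x) h add0r /julia_dist1 => hz; exists z; split => //; apply: hU; apply/ball_sphereE; rewrite /sdist_lt.
move: hz; move: (stereo x) (stereo z) => [[x1 x2] x3] [[z1 z2] z3] /= hz.
have a1 := normr_ge0 (x1 - z1); have a2 := normr_ge0 (x2 - z2); have a3 := normr_ge0 (x3 - z3).
by split => /=; lra.
Qed.

Lemma julia_gap_continuous : continuous julia_gap.
Proof.
move=> x; apply/(@cvgrPdist_lt _ R^o _ (nbhs x) (nbhs_filter x)) => e e0; have e4 : 0 < e / 4 by rewrite divr_gt0.
apply: filterS (nbhsx_ballx x _ e4) => z /ball_sphereE hz.
have h : julia_dist1 x z < e.
  case: hz; rewrite /julia_dist1; move: (stereo x) (stereo z) => [[x1 x2] x3] [[z1 z2] z3] /=; lra.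
have h' : julia_dist1 z x < e by rewrite /julia_dist1 distrC (distrC _.1.2) (distrC (stereo z).2).
have := julia_gap_lipschitz x z; have := julia_gap_lipschitz z x.
rewrite ltr_norml; lra.
Qed.

(** The distance to [J] is a continuous test function whose integrals against the approximating
    measures are 0, their atoms being in [J]; so its [mu]-integral is 0, and it is positive off
    [J]. *)
Lemma lyubich_julia_full : mu (~` J) = 0.
Proof.
have [y Jy] := julia_nonempty coprimePQ degPQ; pose y0 : J := SigSub (mem_set Jy).
have := lyubich Jy julia_gap_continuous.
rewrite (_ : (fun n => _) = fun=> 0%E); last first.
  apply/funext => n; rewrite (@integral_lyubich_approx n y0)//; last exact: julia_gap_ge0.
    by rewrite big1 ?mulr0// => x _; apply/julia_gap_eq0; exact: juliaP.
  exact: julia_gap_continuous.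
move=> /(cvg_unique (@ereal_hausdorff R)) /(_ (cvg_cst _)) int0.
have mg := continuous_measurable_sphere julia_gap_continuous.
have mgE : measurable_fun [set: borel_sphere R] (fun x => (julia_gap x)%:E) by exact/measurable_EFinP.
have : ae_eq mu [set: borel_sphere R] (fun x => (julia_gap x)%:E) (cst 0%E).
  apply/(ae_eq_integral_abs _ measurableT mgE); rewrite -[RHS]int0.
  by apply: eq_integral => x _ /=; rewrite ger0_norm// julia_gap_ge0.
move=> [N [mN N0 hN]]; apply: (subset_measure0 _ mN _ N0).
  exact: measurableC measurable_julia.
move=> x nJx; have gx : julia_gap x <> 0 by move=> h; apply: nJx; apply/julia_gap_eq0.
by apply: hN => /= h; apply: gx; exact: EFin_inj (h Logic.I).
Qed.

Lemma lyubich_bounded_limit (y : J) (g : S2 -> R) (M : R) : continuous g -> (forall x, `|g x| <= M) ->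
  (fun n => (d%:R ^+ n)^-1 * \sum_(x <- nfibre n y) g (\val x)) @ \oo --> Rintegral mu J g.
Proof.
move=> cg gM.
have M0 : 0 <= M by apply: le_trans (gM (\val y)).
have mg := continuous_measurable_sphere cg.
have ig : mu.-integrable [set: borel_sphere R] (fun x => (g x)%:E).
  apply: measurable_bounded_integrable => //; first by rewrite (le_lt_trans (probability_le1 mu measurableT))// ltry.
  exists M; split; first exact: num_real.
  by move=> r Mr x _ /=; exact: le_trans (gM x) (ltW Mr).
have EJ : (\int[mu]_(x in J) (g x)%:E = \int[mu]_x (g x)%:E)%E.
  rewrite (@negligible_integral _ _ _ mu setT (~` J))//.
  - by rewrite setTD setCK.
  - exact: measurableC measurable_julia.
  - exact: lyubich_julia_full.
(* Adding [M] makes the integrand nonnegative; all the measures have mass 1, so [M] can be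
   subtracted on both sides afterwards. *)
have cgM : continuous (fun x => g x + M) by move=> x; exact: (@cvgD _ R^o _ (nbhs x) (nbhs_filter x) g (cst M) _ _ (cg x) (cvg_cst _)).
have gM0 x : 0 <= g x + M by have := gM x; rewrite ler_norml => /andP[]; lra.
have := lyubich (@juliaP _ _ _ y) cgM.
have -> : (\int[mu]_x (g x + M)%:E = (Rintegral mu J g + M)%:E)%E.
  under eq_integral do rewrite EFinD.
  rewrite integralD//; last exact: finite_measure_integrable_cst.
  have -> : (\int[mu]_(x in [set: borel_sphere R]) M%:E = M%:E)%E.
    by rewrite integral_cst// [X in (_ * X)%E](@probability_setT _ _ _ mu) mule1.
  rewrite EFinD /Rintegral EJ fineK//.
  exact: integrable_fin_num.
rewrite (_ : (fun n => _) = (fun n => ((d%:R ^+ n)^-1 * \sum_(x <- nfibre n y) g (\val x) + M)%:E)); last first.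
  apply/funext => n; rewrite integral_lyubich_approx//; congr EFin.
  rewrite big_split /= mulrDr big_const_seq count_predT size_nfibre iter_addr_0; congr (_ + _).
  by rewrite -[M *+ _]mulr_natr natrX mulrCA mulVf ?mulr1// expf_neq0// pnatr_eq0 -lt0n ltnW.
move=> /fine_cvg /= h.
have h' := cvgB h (@cvg_cst _ M _ \oo (@eventually_filter)).
have E : (fun n => (d%:R ^+ n)^-1 * \sum_(x <- nfibre n y) g (\val x)) = (fine \o
   (fun n : nat => (d%:R ^- n * \sum_(x <- nfibre n y) g (sval x) + M)%:E)) \- cst M.
  by apply/funext => n; rewrite /= addrK.
by rewrite E; rewrite (addrK M (Rintegral mu J g)) in h'; exact: h'.
Qed.

Lemma valLE (T : Type) (v : T) (h : J -> T) (z : J) : 'valL_v h (\val z) = h z.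
Proof. exact: (congr1 (fun k => k z) (valLK v h)). Qed.

Lemma real_limit (y : J) (r : J -> R) (K : R) : continuous (r : J -> R^o) -> (forall x, `|r x| <= K) ->
  (fun n => (d%:R ^+ n)^-1 * \sum_(x <- nfibre n y) r x) @ \oo --> Rintegral mu J ('valL_0 r).
Proof.
move=> cr rK; have K0 : 0 <= K by apply: le_trans (rK y).
(* Tietze extension from the closed set [J] to the sphere, whose continuous functions test weak
   convergence; [K + 1] supplies a positive bound even if [K = 0]. *)
have [|||g [gE cg gM]] := @continuous_bounded_extension S2 R pseudometric_normal J (@julia_closed _ P Q) ('valL_0 r) (K + 1).
- by rewrite ltr_wpDl.
- exact/subspace_valL_continuousP'.
- move=> x Jx; rewrite -[x]/(\val (SigSub (mem_set Jx) : J)) valLE.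
  by apply: (le_trans (rK _)); rewrite lerDl.
have gE' (z : J) : g (\val z) = r z.
  by rewrite -gE ?valLE//; exact/mem_set/juliaP.
have -> : Rintegral mu J ('valL_0 r) = Rintegral mu J g.
  by apply: eq_Rintegral => x Jx; exact: gE.
have -> : (fun n => (d%:R ^+ n)^-1 * \sum_(x <- nfibre n y) r x) =
    (fun n => (d%:R ^+ n)^-1 * \sum_(x <- nfibre n y) g (\val x)).
  by apply/funext => n; congr (_ * _); apply: eq_bigr => x _.
exact: lyubich_bounded_limit cg gM.
Qed.

Lemma cintegral_limit (y : J) (a : A) (e : R) : 0 < e ->
  \forall n \near \oo, rnorm (((d%:R ^+ n)^-1)%:C * iter n transfer a y - cintegral mu a) < e.
Proof.
move=> e0; have e2 : 0 < e / 2 by rewrite divr_gt0.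
have ca := @cfun_continuous _ _ a; have [K K0 aK] := continuous_bounded ca.
move: ca => /continuous_rnormP ca.
have part (p : C -> R) : (forall z w, `|p z - p w| <= rnorm (z - w)) -> (forall z, `|p z| <= rnorm z) ->
    (forall (k : R) (s : seq J) (F : J -> C), p (k%:C * \sum_(x <- s) F x) = k * \sum_(x <- s) p (F x)) ->
    \forall n \near \oo, `|p (((d%:R ^+ n)^-1)%:C * iter n transfer a y) - Rintegral mu J (fun x => p ('valL_0 a x))| < e / 2.
  move=> pl pb ps.
  have cp : continuous (fun x => p (a x) : R^o).
    move=> x; apply/(@cvgrPdist_lt _ R^o _ (nbhs x) (nbhs_filter x)) => eps eps0.
    by apply: filterS (ca x eps eps0) => z hz; exact: le_lt_trans (pl _ _) hz.
  have pK x : `|p (a x)| <= K by exact: le_trans (pb _) (aK x).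
  have -> : Rintegral mu J (fun x => p ('valL_0 a x)) = Rintegral mu J ('valL_0 (fun x => p (a x))).
    apply: eq_Rintegral => x Jx; rewrite -[x]/(\val (SigSub Jx : J)).
    transitivity (p (a (SigSub Jx))); first by congr p; exact: (valLE 0 a).
    exact: esym (valLE 0 (fun x => p (a x)) _).
  have /cvgrPdist_lt/(_ _ e2) := real_limit y cp pK.
  by apply: filterS => n; rewrite distrC iter_transferE ps.
have h1 := part (@complex.Re R) _ _ _; have h2 := part (@complex.Im R) _ _ _.
apply: filterS (filterI (h1 _ _ _) (h2 _ _ _)).
- move=> n [k1 k2]; apply: (le_lt_trans (rnorm_le_ReIm _)); rewrite !raddfB /=.
  by rewrite [e]splitr; apply: ltrD.
- by move=> z w; rewrite -raddfB normr_Re_le.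
- exact: normr_Re_le.
- by move=> k s F; rewrite -raddf_sum; case: (\sum_(x <- s) F x) => u v /=; rewrite mul0r subr0.
- by move=> z w; rewrite -raddfB normr_Im_le.
- exact: normr_Im_le.
- by move=> k s F; rewrite -raddf_sum; case: (\sum_(x <- s) F x) => u v /=; rewrite mul0r addr0.
Qed.

End LyubichLimit.

(** * Bounded convergence for positive functionals *)

Section BoundedConvergence.
Variables (R : realType) (T : topologicalType).
Hypothesis cover : forall W : T -> set T, (forall c, nbhs c (W c)) ->
  exists s : seq T, forall z, exists2 c, c \in s & W c z.
Implicit Types g h : T -> R.

Lemma continuousP_dist g : continuous (g : T -> R^o) <->
  forall x (e : R), 0 < e -> nbhs x [set y | `|g x - g y| < e].
Proof.
split=> cg x; first by move=> e e0; apply: (iffLR (@cvgrPdist_lt _ R^o _ (nbhs x) (nbhs_filter x) _ _) (cg x)).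
by apply/(@cvgrPdist_lt _ R^o _ (nbhs x) (nbhs_filter x)) => e e0; exact: cg.
Qed.

Lemma continuous_linear (k : R) g h : continuous (g : T -> R^o) -> continuous (h : T -> R^o) ->
  continuous (fun x => k * g x + h x : R^o).
Proof.
move=> cg ch x; apply: (@cvgD _ R^o _ (nbhs x) (nbhs_filter x)); last exact: ch.
by apply: (@cvgM _ _ (nbhs x) (nbhs_filter x)); [exact: cvg_cst|exact: cg].
Qed.

Lemma continuous_sub g h : continuous (g : T -> R^o) -> continuous (h : T -> R^o) ->
  continuous (fun x => g x - h x : R^o).
Proof.
by move=> cg ch x; apply: (@cvgB _ R^o _ (nbhs x) (nbhs_filter x)); [exact: cg|exact: ch].
Qed.

Lemma continuous_maxr g h : continuous (g : T -> R^o) -> continuous (h : T -> R^o) ->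
  continuous (fun x => Num.max (g x) (h x) : R^o).
Proof.
move=> /continuousP_dist cg /continuousP_dist ch; apply/continuousP_dist => x e e0.
apply: filterS (filterI (cg x e e0) (ch x e e0)) => y /= [].
rewrite !ltr_norml => /andP[h1 h2] /andP[h3 h4].
by case: (leP (g x) (h x)) => h5; case: (leP (g y) (h y)) => h6; apply/andP; split; lra.
Qed.

Lemma continuous_minr g h : continuous (g : T -> R^o) -> continuous (h : T -> R^o) ->
  continuous (fun x => Num.min (g x) (h x) : R^o).
Proof.
move=> /continuousP_dist cg /continuousP_dist ch; apply/continuousP_dist => x e e0.
apply: filterS (filterI (cg x e e0) (ch x e e0)) => y /= [].
rewrite !ltr_norml => /andP[h1 h2] /andP[h3 h4].
by case: (leP (g x) (h x)) => h5; case: (leP (g y) (h y)) => h6; apply/andP; split; lra.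
Qed.

Lemma dini (h : nat -> T -> R) : (forall n, continuous (h n : T -> R^o)) ->
  (forall n x, h n.+1 x <= h n x) ->
  (forall x (e : R), 0 < e -> exists n, h n x < e) ->
  forall e : R, 0 < e -> exists N, forall n x, (N <= n)%N -> h n x <= e.
Proof.
move=> ch hdec hlim e e0.
have mono m n x : (m <= n)%N -> h n x <= h m x.
  by move=> mn; rewrite -(subnKC mn); elim: (n - m)%N => [|k IH]; rewrite ?addn0 ?addnS// (le_trans (hdec _ _)).
have /choice[N hN] := fun x => hlim x e e0.
have nW c : nbhs c [set z | h (N c) z < e].
  have d0 : 0 < e - h (N c) c by rewrite subr_gt0.
  apply: filterS (iffLR (continuousP_dist (h (N c))) (ch _) c _ d0) => z /=.
  by rewrite ltr_norml => /andP[]; lra.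
have [s hs] := cover nW; exists (\sum_(c <- s) N c)%N => n x Nn.
have [c cs /= hc] := hs x; apply: le_trans (ltW hc); apply: mono.
by apply: leq_trans Nn; rewrite (big_rem c)//= leq_addr.
Qed.

Variable nu : (T -> R) -> R.
Hypothesis nu_linear : forall k g h, continuous (g : T -> R^o) -> continuous (h : T -> R^o) ->
  nu (fun x => k * g x + h x) = k * nu g + nu h.
Hypothesis nu_ge0 : forall g, continuous (g : T -> R^o) -> (forall x, 0 <= g x) -> 0 <= nu g.

Lemma nu_sub g h : continuous (g : T -> R^o) -> continuous (h : T -> R^o) ->
  nu (fun x => g x - h x) = nu g - nu h.
Proof.
move=> cg ch; rewrite (_ : (fun x => _) = (fun x => -1 * h x + g x)); last first.
  by apply/funext => x; rewrite mulN1r addrC.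
by rewrite nu_linear// mulN1r addrC.
Qed.

Lemma nu_le g h : continuous (g : T -> R^o) -> continuous (h : T -> R^o) ->
  (forall x, g x <= h x) -> nu g <= nu h.
Proof.
move=> cg ch gh; rewrite -subr_ge0 -nu_sub//; apply: nu_ge0; first exact: continuous_sub.
by move=> x; rewrite subr_ge0.
Qed.

Lemma continuous_cstr (k : R) : continuous (fun _ : T => k : R^o).
Proof. by move=> x; exact: cvg_cst. Qed.

Lemma nu_cst (k : R) : nu (fun=> k) = k * nu (fun=> 1).
Proof.
have z : nu (fun=> 0) = 0.
  have := nu_linear (-1) (@continuous_cstr 0) (@continuous_cstr 0).
  by rewrite (_ : (fun x => -1 * 0 + 0) = fun=> 0) ?mulN1r ?addNr//; apply/funext => x; rewrite mulr0 addr0.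
rewrite (_ : (fun=> k) = (fun x : T => k * 1 + 0)); last by apply/funext => x; rewrite mulr1 addr0.
by rewrite nu_linear ?z ?addr0//; exact: continuous_cstr.
Qed.

Lemma nu_sum (F : nat -> T -> R) n : (forall i, continuous (F i : T -> R^o)) ->
  continuous (fun x => \sum_(i < n) F i x : R^o) /\
  nu (fun x => \sum_(i < n) F i x) = \sum_(i < n) nu (F i).
Proof.
move=> cF; elim: n => [|n [cn IH]].
  have E : (fun x => \sum_(i < 0) F i x) = fun=> 0 by apply/funext => x; rewrite big_ord0.
  by rewrite E big_ord0 nu_cst mul0r; split => //; exact: continuous_cstr.
have E : (fun x => \sum_(i < n.+1) F i x) = (fun x => 1 * F n x + \sum_(i < n) F i x).
  by apply/funext => x; rewrite big_ord_recr /= mul1r addrC.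
rewrite E nu_linear// mul1r IH big_ord_recr addrC; split => //; exact: continuous_linear.
Qed.

Variables (b : nat -> T -> R) (K : R).
Hypothesis cb : forall n, continuous (b n : T -> R^o).
Hypothesis b_ge0 : forall n x, 0 <= b n x.
Hypothesis b_leK : forall n x, b n x <= K.
Hypothesis b_lim : forall x (e : R), 0 < e -> exists N, forall n, (N <= n)%N -> b n x <= e.

(* [0 <= c <= sup_(k >= n) b k] pointwise; the supremum itself need not be continuous. *)
Definition below n (c : T -> R) := continuous (c : T -> R^o) /\
  forall x, 0 <= c x /\ forall r, (forall k, (n <= k)%N -> b k x <= r) -> c x <= r.

Lemma below_max m n c c' : (m <= n)%N -> below m c -> below n c' ->
  below m (fun x => Num.max (c x) (c' x)).
Proof.
move=> mn [cc hc] [cc' hc']; split; first exact: continuous_maxr.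
move=> x; split; first by rewrite le_max (hc x).1.
move=> r hr; rewrite ge_max (hc x).2//= (hc' x).2// => k nk.
by apply: hr; exact: leq_trans nk.
Qed.

Lemma below_near_max n (e : R) : 0 < e ->
  exists c, below n c /\ forall c', below n c' -> nu c' <= nu c + e.
Proof.
move=> e0; pose E := [set nu c | c in below n].
have bn : below n (b n) by split=> // x; split=> // r; apply.
have supE : has_sup E.
  split; first by exists (nu (b n)), (b n).
  exists (nu (fun=> K)) => _ [c [cc hc] <-]; apply: nu_le => //; first exact: continuous_cstr.
  by move=> x; apply: (hc x).2.
have [_ [c hc <-] h] := @sup_adherent _ E _ e0 supE; exists c; split => // c' hc'.
have : nu c' <= sup E by apply: ub_le_sup; [exact: supE.2|exists c'].
by move: h; lra.
Qed.

Lemma geometric_half_sum (e : R) n : 0 < e -> \sum_(i < n) e / 2 ^+ i.+1 <= e.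
Proof.
move=> e0; have -> : \sum_(i < n) e / 2 ^+ i.+1 = e - e / 2 ^+ n.
  elim: n => [|n IH]; first by rewrite big_ord0 expr0 divr1 subrr.
  rewrite big_ord_recr /= IH exprS.
  have : 2 ^+ n != 0 :> R by rewrite expf_neq0.
  by move=> h; field.
by rewrite gerBl divr_ge0// ltW.
Qed.

(* Luxemburg's argument: with [c n] almost maximal below [n] and [h n] the minimum of
   [c 0], ..., [c n], Dini's theorem applies to [h], and [nu (c n) - nu (h n)] is small
   because the maximum of [c i] and [c n] is still below [i]. *)
Lemma bounded_convergence (e : R) : 0 < e -> exists N, forall n, (N <= n)%N -> nu (b n) <= e.
Proof.
move=> e0; have e4 : 0 < e / 4 by rewrite divr_gt0.
have ep n : 0 < (e / 4) / 2 ^+ n.+1 by rewrite divr_gt0// exprn_gt0.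
have /choice[c hc] := fun n => below_near_max n (ep n).
have cc n : continuous (c n : T -> R^o) by case: (hc n) => -[].
pose h := fix h n := if n is n'.+1 then (fun x => Num.min (h n' x) (c n'.+1 x)) else c 0%N.
have ch n : continuous (h n : T -> R^o) by elim: n => [|n IH] /=; [exact: cc|exact: continuous_minr].
have hcn n x : h n x <= c n x by case: n => [|n] //=; rewrite ge_min lexx orbT.
have h0 n x : 0 <= h n x.
  elim: n => [|n IH] /=; first exact: ((hc 0%N).1.2 x).1.
  by rewrite le_min IH; exact: ((hc n.+1).1.2 x).1.
have hmem n x : exists2 i, (i <= n)%N & h n x = c i x.
  elim: n => [|n [i ni IH]]; first by exists 0%N.
  rewrite /=; case: (leP (h n x) (c n.+1 x)) => _; last by exists n.+1.
  by exists i => //; exact: leqW.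
have nu1 : 0 <= nu (fun=> 1) by apply: nu_ge0 => //; exact: continuous_cstr.
have d0 : 0 < (e / 4) / (nu (fun=> 1) + 1) by rewrite divr_gt0// ltr_wpDl.
have [|x r r0|N hN] := @dini h ch _ _ _ d0.
- by move=> n x /=; rewrite ge_min lexx.
- have r2 : 0 < r / 2 by rewrite divr_gt0.
  have [N hN] := b_lim x r2; exists N; apply: (le_lt_trans (hcn N x)).
  apply: (@le_lt_trans _ _ (r / 2)); first exact: ((hc N).1.2 x).2.
  by rewrite gtr_pMr// invf_lt1// ltr1n.
exists N => n Nn.
have hn : nu (h n) <= e / 4.
  apply: (le_trans (nu_le (ch n) (@continuous_cstr _) (fun x => hN n x Nn))).
  by rewrite nu_cst mulrAC ler_pdivrMr ?ler_wpM2l ?(ltW e4)// ?lerDl// ltr_wpDl.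
have bn : nu (b n) <= nu (c n) + (e / 4) / 2 ^+ n.+1.
  by apply: (hc n).2; split=> // x; split=> // r; apply.
pose F i x := Num.max (c i x) (c n x) - c i x.
have cF i : continuous (F i : T -> R^o) by apply: continuous_sub => //; exact: continuous_maxr.
have F0 i x : 0 <= F i x by rewrite subr_ge0 le_max lexx.
have [cS nuS] := @nu_sum F n cF.
have key : nu (c n) - nu (h n) <= \sum_(i < n) nu (F i).
  rewrite -nu_sub// -nuS; apply: nu_le => //; first exact: continuous_sub.
  move=> x; have [i ni ->] := hmem n x.
  move: ni; rewrite leq_eqVlt => /orP[/eqP->|ni]; first by rewrite subrr sumr_ge0.
  rewrite (bigD1 (Ordinal ni))//= -[leLHS]addr0 lerD ?sumr_ge0//.
  by rewrite /F lerD2r le_max lexx orbT.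
have small : \sum_(i < n) nu (F i) <= \sum_(i < n) (e / 4) / 2 ^+ i.+1.
  apply: ler_sum => i _; rewrite /F nu_sub//; last exact: continuous_maxr.
  rewrite lerBlDl; apply: (hc i).2; apply: below_max (hc i).1 (hc n).1.
  exact: ltnW.
have g1 := geometric_half_sum n e4.
have g2 : (e / 4) / 2 ^+ n.+1 <= e / 4.
  by rewrite ler_pdivrMr ?exprn_gt0// ler_peMr ?(ltW e4)// exprn_ege1// ler1n.
lra.
Qed.

End BoundedConvergence.

(** * KMS states *)

Section Monomials.
Variable R : realType.
Local Notation C := R[i].

Section ClosedSets.
Variables (O : cstarAlgType R).

(** Identities are proved below by checking them on generators or monomials; this gives the
    closedness which that requires. *)
Lemma closed_lipschitz_zero (V : normedModType C) (F : O -> V) (K : R) :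
  (forall x y, rnorm (F x - F y) <= K * rnorm (x - y)) -> closed [set x | F x = 0].
Proof.
move=> hF; apply/closedP => x ax; apply: rnorm_lt_eps_eq0 => e e0.
have K0 : 0 < `|K| + 1 by rewrite ltr_wpDl.
have [y Fy xy] := ax _ (divr_gt0 e0 K0).
rewrite -[F x]subr0 -Fy; apply: (le_trans (hF x y)).
apply: (@le_trans _ _ ((`|K| + 1) * rnorm (x - y))).
  apply: ler_wpM2r; first exact: rnorm_ge0.
  by apply: (le_trans (ler_norm K)); rewrite lerDl.
by rewrite mulrC -ler_pdivlMr// ltW.
Qed.

Lemma rnorm_cmul_sub (x y z : O) : rnorm (cmul x y - cmul x z) <= rnorm x * rnorm (y - z).
Proof. by rewrite -cmulBr rnorm_cmul. Qed.

Lemma rnorm_cmul_subl (x y z : O) : rnorm (cmul y x - cmul z x) <= rnorm x * rnorm (y - z).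
Proof. by rewrite -cmulBl mulrC rnorm_cmul. Qed.

End ClosedSets.

Variable f : sphere R -> sphere R.
Local Notation A := (cfun R (julia_set f)).
Local Notation X := (cfun R (graph_julia f)).
Variables (O : cstarAlgType R) (i : {linear A -> O}) (S : {linear X -> O}).
Hypothesis cp : is_cuntz_pimsner i S.
Let rep : covariant_rep i S := cp_rep cp.
Implicit Types (x y z T : O) (a b : A) (xi eta : X).

Lemma cfun_conj1 : cfun_conj 1 = 1 :> A.
Proof. by apply: val_inj; apply/funext => x; exact: rmorph1. Qed.

Lemma cfun_conjK a : cfun_conj (cfun_conj a) = a.
Proof. by apply: val_inj; apply/funext => x /=; rewrite conjcK. Qed.

Lemma lact1 xi : lact 1 xi = xi.
Proof. by apply: val_inj; apply/funext => p; rewrite -[LHS]/(1 * xi p) mul1r. Qed.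

Lemma ract1 xi : ract xi 1 = xi.
Proof. by apply: val_inj; apply/funext => p; rewrite -[LHS]/(xi p * 1) mulr1. Qed.

(** The elements on which [i 1] acts as a two-sided unit form a closed star subalgebra containing
    the generators. *)
Lemma unit_cmul T : cmul (i 1) T = T /\ cmul T (i 1) = T.
Proof.
pose D := [set x : O | cmul (i 1) x - x = 0] `&` [set x | cmul x (i 1) - x = 0].
have DE x : D x <-> cmul (i 1) x = x /\ cmul x (i 1) = x.
  by split=> [[/eqP + /eqP]|[h1 h2]]; [rewrite !subr_eq0 => /eqP ? /eqP|split; apply/eqP; rewrite subr_eq0; apply/eqP].
suff : D = setT by move=> DT; apply/DE; rewrite DT.
apply: (cp_generated cp).
- apply: closedI; apply: (@closed_lipschitz_zero _ _ _ (rnorm (i 1) + 1)) => x y.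
    have -> : cmul (i 1) x - x - (cmul (i 1) y - y) = cmul (i 1) (x - y) - (x - y).
      by rewrite cmulBr !opprD addrACA.
    by apply: (le_trans (rnormB _ _)); rewrite mulrDl mul1r lerD// rnorm_cmul.
  have -> : cmul x (i 1) - x - (cmul y (i 1) - y) = cmul (x - y) (i 1) - (x - y).
    by rewrite cmulBl !opprD addrACA.
  by apply: (le_trans (rnormB _ _)); rewrite mulrDl mul1r lerD// mulrC rnorm_cmul.
- split.
  + by apply/DE; rewrite cmul0l cmul0r.
  + move=> k x y /DE[x1 x2] /DE[y1 y2]; apply/DE.
    by rewrite cmulDr cmulDl cmulZr cmulZl x1 x2 y1 y2.
  + by move=> x y /DE[x1 x2] /DE[y1 y2]; apply/DE; rewrite cmulA x1 -cmulA y2.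
  + move=> x /DE[x1 x2]; apply/DE; rewrite -cfun_conj1 (rep_star rep) -!starM.
    by rewrite x1 x2.
- by move=> a; apply/DE; rewrite -!(rep_mul rep) mul1r mulr1.
- by move=> xi; apply/DE; rewrite (rep_lact rep) (rep_ract rep) lact1 ract1.
Qed.

Lemma unit_cmull T : cmul (i 1) T = T. Proof. by case: (unit_cmul T). Qed.
Lemma unit_cmulr T : cmul T (i 1) = T. Proof. by case: (unit_cmul T). Qed.

Definition rmono T (etas : seq X) : O := foldl (fun T eta => cmul T (star (S eta))) T etas.
Definition mono (xis : seq X) a (etas : seq X) : O :=
  foldr (fun xi T => cmul (S xi) T) (rmono (i a) etas) xis.

Lemma cmul_rmono x T etas : cmul x (rmono T etas) = rmono (cmul x T) etas.
Proof. by elim: etas T => //= eta etas IH T; rewrite IH cmulA. Qed.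

Lemma cmul_i_mono a xis b etas : exists xis' b',
  size xis' = size xis /\ cmul (i a) (mono xis b etas) = mono xis' b' etas.
Proof.
case: xis => [|xi xis]; first by exists [::], (a * b); rewrite /mono /= cmul_rmono (rep_mul rep).
by exists (lact a xi :: xis), b; rewrite /mono /= cmulA (rep_lact rep).
Qed.

Definition closed_subspace (V : set O) : Prop :=
  closed V /\ forall (k : C) x y, V x -> V y -> V (k *: x + y).

(* The closed span [V0] of the monomials is stable under left multiplication by the
   generators and their adjoints, so the operators preserving it exhaust [O], and
   [T = T i(1)] lies in [V0]. *)
Lemma monomial_induction (V : set O) : closed_subspace V ->
  (forall xis a etas, V (mono xis a etas)) -> forall T, V T.
Proof.
pose good W := closed_subspace W /\ forall xis a etas, W (mono xis a etas).
pose V0 T := forall W, good W -> W T.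
have V0mono xis a etas : V0 (mono xis a etas) by move=> W [_]; apply.
have V0lin k x y : V0 x -> V0 y -> V0 (k *: x + y).
  by move=> hx hy W gW; apply: gW.1.2; [exact: hx|exact: hy].
have V00 : V0 0 by have := V0lin (-1) _ _ (V0mono [::] 0 [::]) (V0mono [::] 0 [::]); rewrite scaleN1r addNr.
have V0closed T : approx V0 T -> V0 T.
  move=> aT W gW; apply: (iffLR (closedP _) gW.1.1) => e e0.
  by have [y hy Ty] := aT e e0; exists y => //; exact: hy.
have approx_mul (W : set O) x T : (forall e : R, 0 < e -> exists2 y, W (cmul x y) & rnorm (T - y) < e) ->
    approx W (cmul x T).
  move=> h e e0; have x0 : 0 < rnorm x + 1 by rewrite ltr_wpDl// rnorm_ge0.
  have [y Wy Ty] := h _ (divr_gt0 e0 x0); exists (cmul x y) => //.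
  apply: (le_lt_trans (rnorm_cmul_sub _ _ _)).
  apply: (@le_lt_trans _ _ ((rnorm x + 1) * rnorm (T - y))).
    by apply: ler_wpM2r; [exact: rnorm_ge0|rewrite lerDl].
  by rewrite mulrC -ltr_pdivlMr.
have left_mul x : (forall xis a etas, V0 (cmul x (mono xis a etas))) -> forall T, V0 T -> V0 (cmul x T).
  move=> hx T hT W gW; apply: (hT [set y | W (cmul x y)]); split; last by move=> xis a etas; exact: hx.
  split; last by move=> k y z hy hz; rewrite /mkset cmulDr cmulZr; exact: gW.1.2.
  by apply/closedP => y ay; apply: (iffLR (closedP _) gW.1.1); exact: approx_mul.
have left_i a T : V0 T -> V0 (cmul (i a) T).
  apply: left_mul => xis b etas.
  by have [xis' [b' [_ ->]]] := cmul_i_mono a xis b etas.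
have left_S xi T : V0 T -> V0 (cmul (S xi) T).
  by apply: left_mul => xis b etas; exact: (V0mono (xi :: xis)).
have left_Sstar xi T : V0 T -> V0 (cmul (star (S xi)) T).
  apply: left_mul => -[|xi1 xis] b etas /=.
    rewrite /mono /= cmul_rmono.
    have -> : cmul (star (S xi)) (i b) = cmul (i 1) (star (S (lact (cfun_conj b) xi))).
      by rewrite unit_cmull -(rep_lact rep) starM -(rep_star rep) cfun_conjK.
    exact: (V0mono [::] 1 (_ :: etas)).
  by rewrite /mono /= cmulA (rep_inner rep); apply: left_i; exact: V0mono.
pose D := [set T : O | (forall z, V0 z -> V0 (cmul T z)) /\ (forall z, V0 z -> V0 (cmul (star T) z))].
have DT : D = setT.
  apply: (cp_generated cp).
  - apply/closedP => T aT.
    have aV z (hz : V0 z) (F : O -> O) : (forall x y, F x - F y = F (x - y)) -> (forall x, rnorm (F x) <= rnorm x) ->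
        (forall x, D x -> V0 (cmul (F x) z)) -> V0 (cmul (F T) z).
      move=> FB Fn FD; apply: V0closed => e e0.
      have z0 : 0 < rnorm z + 1 by rewrite ltr_wpDl// rnorm_ge0.
      have [y Dy Ty] := aT _ (divr_gt0 e0 z0); exists (cmul (F y) z); first exact: FD.
      apply: (le_lt_trans (rnorm_cmul_subl _ _ _)); rewrite FB.
      apply: (@le_lt_trans _ _ ((rnorm z + 1) * rnorm (T - y))).
        by apply: ler_pM; rewrite ?rnorm_ge0// lerDl.
      by rewrite mulrC -ltr_pdivlMr.
    split=> z hz; first by apply: (aV z hz id) => // x [h _]; exact: h.
    apply: (aV z hz (@star _ O)) => [x y|x|x [_ h]]; [by rewrite starB|by rewrite rnorm_star|exact: h].
  - split.
    + by split=> z _; rewrite ?star0 cmul0l.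
    + move=> k x y [x1 x2] [y1 y2]; split=> z hz.
        by rewrite cmulDl cmulZl; apply: V0lin; [exact: x1|exact: y1].
      by rewrite starD starZ cmulDl cmulZl; apply: V0lin; [exact: x2|exact: y2].
    + move=> x y [x1 x2] [y1 y2]; split=> z hz; first by rewrite -cmulA; apply: x1; exact: y1.
      by rewrite starM -cmulA; apply: y2; exact: x2.
    + by move=> x [x1 x2]; split; rewrite ?starK.
  - by move=> a; split=> z hz; [exact: left_i|rewrite -(rep_star rep); exact: left_i].
  - by move=> xi; split=> z hz; [exact: left_S|exact: left_Sstar].
move=> hV hmono T; have [h _] : D T by rewrite DT.
by rewrite -(unit_cmulr T); apply: h; [exact: (V0mono [::] 1 [::])|split].
Qed.

End Monomials.

Section Phase.
Variable R : realType.
Local Notation C := R[i].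

Definition phase (k : int) (t : R) : C := expi (k%:~R * t%:C).

Lemma phaseD k s t : phase k (s + t) = phase k s * phase k t.
Proof. by rewrite /phase rmorphD mulrDr expiD. Qed.

Lemma phase_add k l t : phase (k + l) t = phase k t * phase l t.
Proof. by rewrite /phase rmorphD mulrDl expiD. Qed.

Lemma phase0 t : phase 0 t = 1.
Proof. by rewrite /phase mul0r expi0. Qed.

Lemma phase1 t : phase 1 t = cos t +i* sin t.
Proof. by rewrite /phase mul1r expi_real. Qed.

Lemma phase_conj k t : conjc (phase k t) = phase (- k) t.
Proof.
have E (l : int) : (l%:~R : C) * t%:C = (l%:~R * t)%:C by rewrite rmorphM rmorph_int.
by rewrite /phase !E !expi_real rmorphN mulNr cosN sinN.
Qed.

Lemma phase_2pi k : phase k (2 * pi) = 1.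
Proof. exact: expi_int_2pi. Qed.

End Phase.

(** * Gauge degrees, and KMS states on homogeneous elements *)

Section GaugeKms.
Variables (R : realType) (f : sphere R -> sphere R).
Local Notation C := R[i].
Local Notation A := (cfun R (julia_set f)).
Local Notation X := (cfun R (graph_julia f)).
Variables (O : cstarAlgType R) (i : {linear A -> O}) (S : {linear X -> O}).
Hypothesis cp : is_cuntz_pimsner i S.
Variable gamma : R -> O -> O.
Hypothesis gauge : is_gauge_action i S gamma.
Let rep : covariant_rep i S := cp_rep cp.
Local Notation e := (i 1).
Let el := unit_cmull cp.
Let er := unit_cmulr cp.
Implicit Types (x y z T : O) (a b : A) (xi eta : X) (k l : int).

Definition degree k y := forall t, gamma t y = phase k t *: y.

Lemma gaugeZ t (c : C) y : gamma t (c *: y) = c *: gamma t y.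
Proof.
have h := star_hom_linear (gauge_hom gauge t).
have h0 : gamma t 0 = 0 by have := h (-1) 0 0; rewrite scaler0 addr0 scaleN1r addNr.
by have := h c y 0; rewrite addr0 h0 addr0.
Qed.

Lemma degree_i a : degree 0 (i a).
Proof. by move=> t; rewrite (gauge_fix gauge) phase0 scale1r. Qed.

Lemma degree_S xi : degree 1 (S xi).
Proof. by move=> t; rewrite (gauge_gen gauge) phase1. Qed.

Lemma degree_mul k l x y : degree k x -> degree l y -> degree (k + l) (cmul x y).
Proof.
by move=> hx hy t; rewrite (star_hom_mul (gauge_hom gauge t)) hx hy cmulZl cmulZr scalerA phase_add.
Qed.

Lemma degree_star k x : degree k x -> degree (- k) (star x).
Proof.
by move=> hx t; rewrite (star_hom_star (gauge_hom gauge t)) hx starZ phase_conj.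
Qed.

Lemma degree_mono xis a etas :
  degree ((size xis)%:Z - (size etas)%:Z) (mono i S xis a etas).
Proof.
elim: xis => [|xi xis IH] /=; last first.
  rewrite -[(size xis).+1%:Z]/(Posz (1 + size xis)) PoszD -addrA.
  by apply: degree_mul IH; exact: degree_S.
elim/last_ind: etas => [|etas eta IH]; first by rewrite subrr; exact: degree_i.
rewrite size_rcons -addn1 PoszD opprD addrA.
rewrite /mono /= /rmono foldl_rcons; apply: degree_mul IH _.
by apply: degree_star; exact: degree_S.
Qed.

Section State.
Variable phi : O -> C.
Hypothesis phi_state : is_state phi.
Let lin := state_linear phi_state.
Let pos := state_ge0 phi_state.

Lemma state_rnorm_le x : rnorm (phi x) <= rnorm x.
Proof. by have := state_norm_le1 phi_state x; rewrite !rnormE lecR. Qed.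

(** The norm of [e] is at most 1, so [phi e <= 1]; conversely [phi e] bounds the functional on the
    unit ball, where it comes arbitrarily close to 1. *)
Lemma state_unit : phi e = 1.
Proof.
have ge : phi e = (sqn phi e)%:C.
  by rewrite -(functional_sqn pos) (star_unit er) el.
have le1 : sqn phi e <= 1.
  have := state_rnorm_le e; rewrite ge rnorm_real ger0_norm ?(sqn_ge0 pos)// => h.
  exact: le_trans h (rnorm_unit_le1 el er).
rewrite ge; congr (_%:C); apply/eqP; rewrite eq_le le1 /=.
apply/ler_addgt0Pl => eps eps0.
have [|x x1] := state_norm_ge1 phi_state (_ : 0 < eps%:C); first by rewrite ltcR.
rewrite rnormE -[1]/((1 : R)%:C) -rmorphB ltcR => h.
have := functional_bounded lin pos el er x; rewrite ge /=.
have : sqn phi e * rnorm x <= sqn phi e * 1.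
  by apply: ler_wpM2l; [exact: sqn_ge0|move: x1; rewrite rnormE -[1]/((1 : R)%:C) lecR].
lra.
Qed.

Lemma sqn_le x : sqn phi x <= rnorm x ^+ 2.
Proof.
have := state_rnorm_le (cmul (star x) x).
by rewrite (functional_sqn pos) rnorm_star_cmul rnorm_real ger0_norm ?(sqn_ge0 pos).
Qed.

(** The functional [phi \o gamma t] is positive and takes the value 1 at the unit, hence is bounded
    by the norm. No norm estimate for [gamma t] itself is involved. *)
Lemma sqn_gauge_le t x : sqn phi (gamma t x) <= rnorm x ^+ 2.
Proof.
have hl : scalar (phi \o gamma t).
  by move=> c u v /=; rewrite (star_hom_linear (gauge_hom gauge t)) lin.
have hp u : 0 <= (phi \o gamma t) (cmul (star u) u).
  by rewrite /= (star_hom_mul (gauge_hom gauge t)) (star_hom_star (gauge_hom gauge t)) pos.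
have := functional_bounded hl hp el er (cmul (star x) x).
rewrite /= (gauge_fix gauge) state_unit mul1r rnorm_star_cmul.
apply: le_trans; rewrite (star_hom_mul (gauge_hom gauge t)) (star_hom_star (gauge_hom gauge t)).
by rewrite (functional_sqn pos) rnorm_real ler_norm.
Qed.

(** Uniformity in [t] is the point: replacing [y] by a nearby element changes the function of [t] by
    a small amount over a whole period. *)
Lemma state_gauge_bound t x y : rnorm (phi (cmul x (gamma t y))) <= rnorm x * rnorm y.
Proof.
rewrite -(ler_pXn2r (n := 2)) ?nnegrE ?rnorm_ge0 ?mulr_ge0 ?rnorm_ge0// exprMn.
rewrite -{1}(starK x); apply: (le_trans (functional_cauchy_schwarz lin pos _ _)).
apply: ler_pM; rewrite ?(sqn_ge0 pos) ?sqn_gauge_le//.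
by rewrite -(rnorm_star x) sqn_le.
Qed.

Lemma state_gauge_boundl t x y : rnorm (phi (cmul (gamma t y) x)) <= rnorm x * rnorm y.
Proof.
rewrite -(ler_pXn2r (n := 2)) ?nnegrE ?rnorm_ge0 ?mulr_ge0 ?rnorm_ge0// exprMn.
rewrite -{1}(starK y) (star_hom_star (gauge_hom gauge t)).
apply: (le_trans (functional_cauchy_schwarz lin pos _ _)).
rewrite mulrC; apply: ler_pM; rewrite ?(sqn_ge0 pos) ?sqn_le//.
by rewrite -(rnorm_star y) sqn_gauge_le.
Qed.

Lemma state_gauge_periodic t x y :
  phi (cmul x (gamma (t + 2 * pi) y)) = phi (cmul x (gamma t y)).
Proof.
pose F y := phi (cmul x (gamma (t + 2 * pi) y)) - phi (cmul x (gamma t y)) : C^o.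
have gB s u v : gamma s (u - v) = gamma s u - gamma s v.
  by rewrite -scaleN1r addrC (star_hom_linear (gauge_hom gauge s)) scaleN1r addrC.
suff : F y = 0 by move=> /eqP; rewrite subr_eq0 => /eqP.
have FB u v : F u - F v = F (u - v).
  by rewrite /F !gB !cmulBr !(functionalB lin) !opprD addrACA.
apply: (monomial_induction cp (V := [set y | F y = 0])).
  split.
    apply: (@closed_lipschitz_zero _ _ _ _ (2 * rnorm x)) => u v; rewrite FB /F.
    apply: (le_trans (rnormB _ _)).
    rewrite (_ : 2 * _ * _ = rnorm x * rnorm (u - v) + rnorm x * rnorm (u - v)); last by ring.
    by apply: lerD; exact: state_gauge_bound.
  move=> c u v; rewrite /mkset /F => /eqP + /eqP; rewrite !subr_eq0 => /eqP hu /eqP hv.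
  by rewrite !(star_hom_linear (gauge_hom gauge _)) !cmulDr !cmulZr !lin hu hv subrr.
move=> xis a etas; rewrite /mkset /F !degree_mono phaseD phase_2pi mulr1; exact: subrr.
Qed.

Lemma derivable_state x (F : C^o -> O) (z : C^o) : derivable F z 1 ->
  derivable ((fun w : C^o => phi (cmul x (F w)) : C^o) : C^o -> C^o) z 1.
Proof.
move=> dF; have [c hc] := cdiff_derivable dF.
have x0 : 0 < rnorm x + 1 by rewrite ltr_wpDl// rnorm_ge0.
apply: (@derivable_cdiff R C^o _ z (phi (cmul x c))) => eps eps0.
have [r r0 hr] := hc _ (divr_gt0 eps0 x0); exists r => // w hw.
have -> : phi (cmul x (F w)) - phi (cmul x (F z)) - (w - z) *: (phi (cmul x c) : C^o) =
    phi (cmul x (F w - F z - (w - z) *: c)).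
  by rewrite !cmulBr cmulZr !(functionalB lin) (functionalZ lin).
apply: (le_trans (state_rnorm_le _)); apply: (le_trans (rnorm_cmul _ _)).
apply: (@le_trans _ _ ((rnorm x + 1) * (eps / (rnorm x + 1) * rnorm (w - z)))).
  by apply: ler_pM; rewrite ?rnorm_ge0// ?lerDl// hr.
by rewrite mulrA mulrCA divff ?mulr1// lt0r_neq0.
Qed.

End State.

Section Kms.
Variables (beta : R) (phi : O -> C).
Hypothesis kms : is_kms_state gamma beta phi.
Let st := kms_state kms.
Let lin := state_linear st.

(** Neither [x] nor [y] need lie in the subalgebra [D] of the KMS condition. For [x] in [D], [y] is
    replaced by a nearby [y'] in [D], whose extension nearly has the Fourier behaviour of [y] on
    both lines, so [kms_boundary] applies; then density removes the condition on [x]. *)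
Lemma kms_degree k y x : degree k y ->
  phi (cmul x y) = (expR (k%:~R * beta))%:C * phi (cmul y x).
Proof.
move=> dy; have [D [dD sD gD exD kmsD]] := kms_condition kms.
pose E := expR (k%:~R * beta) : R; have E0 : 0 < E by exact: expR_gt0.
have key x' : D x' -> phi (cmul x' y) - E%:C * phi (cmul y x') = 0.
  move=> Dx'; apply: rnorm_lt_eps_eq0 => eps eps0.
  (* The bound of [kms_boundary] is [2 + 2 * E] times the common error, which is [rnorm x' + 1]
     times the distance from [y'] to [y]. *)
  pose M := (rnorm x' + 1) * (2 + 2 * E).
  have x'0 : 0 < rnorm x' + 1 by rewrite ltr_wpDl// rnorm_ge0.
  have M0 : 0 < M by rewrite mulr_gt0// addr_gt0// mulr_gt0.
  have [y' Dy' yy'] := iffLR (denseP D) dD y _ (divr_gt0 eps0 M0).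
  pose r := eps / M; have [F [dF Freal]] := exD y' Dy'.
  pose G (z : C^o) : C^o := phi (cmul x' (F z)).
  have gB s u v : gamma s (u - v) = gamma s u - gamma s v.
    by rewrite -scaleN1r addrC (star_hom_linear (gauge_hom gauge s)) scaleN1r addrC.
  have bound : rnorm x' * rnorm (y' - y) <= (rnorm x' + 1) * r.
    by apply: ler_pM; rewrite ?rnorm_ge0// ?lerDl// rdistC ltW.
  have Gdiff (z : C^o) : derivable G z 1 by exact: derivable_state.
  have := @kms_boundary R G k (phi (cmul x' y)) (phi (cmul y x')) beta _ _ Gdiff _ (fun t => _) (fun t => _).
  move=> /(_ ((rnorm x' + 1) * r) ((rnorm x' + 1) * r)) h.
  have {h} : rnorm (phi (cmul x' y) - E%:C * phi (cmul y x')) <=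
      2 * ((rnorm x' + 1) * r) + 2 * E * ((rnorm x' + 1) * r).
    apply: h => t.
    - by rewrite /G !Freal; exact: state_gauge_periodic.
    - rewrite /G Freal; apply: le_trans bound.
      rewrite -(functionalZ lin) -cmulZr -dy -(functionalB lin) -cmulBr -gB.
      exact: state_gauge_bound.
    (* The KMS condition speaks of the height [beta] over 0 only; applied to [gamma t y'], with the
       translated extension, it gives the values on the whole line. *)
    - have ext : analytic_extension gamma (gamma t y') (fun z : C^o => F (z + t%:C)).
        split=> [z|s]; last by rewrite -rmorphD Freal (gaugeD gauge).
        have -> : (fun z : C^o => F (z + t%:C)) = (fun w : C^o => F (1 * w + t%:C)).
          by apply/funext => w; rewrite mul1r.
        exact: derivable_affine.
      have tE : t +i* beta = (0 +i* beta) + t%:C.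
        by apply/eqP; rewrite eq_complex /= add0r addr0 !eqxx.
      rewrite /G tE (kmsD x' (gamma t y') _ Dx' (gD t _ Dy') ext).
      apply: le_trans bound.
      rewrite -(functionalZ lin) -cmulZl -dy -(functionalB lin) -cmulBl -gB.
      exact: state_gauge_boundl.
  move/le_trans; apply.
  have <- : (rnorm x' + 1) * r * (2 + 2 * E) = eps by rewrite mulrAC -/M /r mulrC divfK ?lt0r_neq0.
  by rewrite le_eqVlt; apply/orP; left; apply/eqP; ring.
suff : phi (cmul x y) - E%:C * phi (cmul y x) = 0 by move=> /eqP; rewrite subr_eq0 => /eqP.
pose F x : C^o := phi (cmul x y) - E%:C * phi (cmul y x).
have cF : closed [set x | F x = 0].
  apply: (@closed_lipschitz_zero _ _ _ _ (rnorm y + E * rnorm y)) => u v.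
  have -> : F u - F v = phi (cmul (u - v) y) - E%:C * phi (cmul y (u - v)).
    by rewrite /F cmulBl cmulBr !(functionalB lin); ring.
  apply: (le_trans (rnormB _ _)); rewrite rnormM rnorm_real (gtr0_norm E0) mulrDl; apply: lerD.
    by apply: (le_trans (state_rnorm_le st _)); rewrite mulrC rnorm_cmul.
  rewrite -mulrA; apply: ler_wpM2l; first exact: ltW.
  by apply: (le_trans (state_rnorm_le st _)); exact: rnorm_cmul.
apply: (iffLR (closedP _) cF) => eps eps0.
by have [x' Dx' xx'] := iffLR (denseP D) dD x _ eps0; exists x' => //; exact: key.
Qed.

(** Commuting [y] past the unit multiplies [phi y] by [expR (k * beta)], which differs from 1. *)
Lemma kms_degree_neq0 k y : beta != 0 -> k != 0 -> degree k y -> phi y = 0.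
Proof.
move=> b0 k0 /(kms_degree e); rewrite el er => /eqP.
rewrite -subr_eq0 -{1}[phi y]mul1r -mulrBl mulf_eq0 => /orP[|/eqP//].
rewrite subr_eq0 -[1]/((1 : R)%:C) => /eqP/complexI h.
have /expR_inj/eqP : expR (k%:~R * beta) = expR 0 by rewrite expR0.
by rewrite mulf_eq0 intr_eq0 (negbTE k0) (negbTE b0).
Qed.

Lemma kms_S xi x : phi (cmul x (S xi)) = (expR beta)%:C * phi (cmul (S xi) x).
Proof. by rewrite (kms_degree x (degree_S xi)) mul1r. Qed.

Lemma kms_i a x : phi (cmul x (i a)) = phi (cmul (i a) x).
Proof. by rewrite (kms_degree x (degree_i a)) mul0r expR0 mul1r. Qed.

End Kms.

Lemma kms_state_eq beta (phi psi : O -> C) : beta != 0 ->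
  is_kms_state gamma beta phi -> is_kms_state gamma beta psi ->
  (forall a, phi (i a) = psi (i a)) -> phi = psi.
Proof.
move=> b0 hphi hpsi agree; apply/funext => T.
have lphi := state_linear (kms_state hphi); have lpsi := state_linear (kms_state hpsi).
pose F x : C^o := phi x - psi x.
suff : F T = 0 by move=> /eqP; rewrite subr_eq0 => /eqP.
apply: (monomial_induction cp (V := [set x | F x = 0])).
  split.
    apply: (@closed_lipschitz_zero _ _ _ _ 2) => u v.
    have -> : F u - F v = phi (u - v) - psi (u - v).
      by rewrite /F (functionalB lphi) (functionalB lpsi) !opprD addrACA.
    apply: (le_trans (rnormB _ _)); rewrite mulr2n mulrDl mul1r.
    by apply: lerD; [exact: state_rnorm_le (kms_state hphi) _|exact: state_rnorm_le (kms_state hpsi) _].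
  move=> c u v; rewrite /mkset /F => /eqP + /eqP; rewrite !subr_eq0 => /eqP hu /eqP hv.
  by rewrite lphi lpsi hu hv subrr.
move=> xis a etas; rewrite /mkset /F; apply/eqP; rewrite subr_eq0; apply/eqP.
have [ss|ss] := eqVneq (size xis) (size etas); last first.
  have k0 : (size xis)%:Z - (size etas)%:Z != 0 by rewrite subr_eq0.
  by rewrite (kms_degree_neq0 hphi b0 k0 (degree_mono _ _ _)) (kms_degree_neq0 hpsi b0 k0 (degree_mono _ _ _)).
have [n sn] : exists n, size xis = n by exists (size xis).
elim: n xis a etas ss sn => [|n IH] xis a etas.
  move=> ss sn; move: ss; rewrite (size0nil sn) /= => /esym hs; rewrite (size0nil hs); exact: agree.
case: xis => // xi xis; elim/last_ind: etas => // etas eta _; rewrite size_rcons => -[ss] [sn].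
have monoE : mono i S xis a (rcons etas eta) = cmul (mono i S xis a etas) (star (S eta)).
  elim: (xis) => [|xi' xis' IH'] /=; first by rewrite /mono /= /rmono foldl_rcons.
  by rewrite -cmulA -IH'.
(* Moving the leading [S xi] to the far right places it behind [star (S eta)]; the product is
   [i (inner eta xi)], which commutes under the state and is absorbed on the left. The shortened
   monomial depends only on the data, not on the state. *)
have step ph : is_kms_state gamma beta ph -> exists xis' b', size xis' = size xis /\
   cmul (i (inner eta xi)) (mono i S xis a etas) = mono i S xis' b' etas /\
   (expR beta)%:C * ph (mono i S (xi :: xis) a (rcons etas eta)) = ph (mono i S xis' b' etas).
  move=> hph; have [xis' [b' [s' E]]] := cmul_i_mono cp (inner eta xi) xis a etas.
  exists xis', b'; split=> //; split=> //.
  rewrite -E -(kms_i hph) -(rep_inner rep) cmulA -monoE (kms_S hph) //.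
have [xis' [b' [s' [E h1]]]] := step phi hphi.
have [xis'' [b'' [_ [E' h2]]]] := step psi hpsi.
have c0 : (expR beta)%:C != 0 :> C by apply/negP => /eqP/complexI/eqP; rewrite gt_eqF// expR_gt0.
apply: (mulfI c0); rewrite h1 h2 -E' E; by apply: IH; rewrite s'.
Qed.

End GaugeKms.

(** * The Lyubich integral as a limit of averaged transfer iterates *)

Section CintegralFacts.
Variable R : realType.
Local Notation C := R[i].
Variables P Q : {poly C}.
Hypothesis coprimePQ : coprimep P Q.
Hypothesis degPQ : (2 <= rat_degree P Q)%N.
Local Notation d := (rat_degree P Q).
Local Notation f := (rat_map P Q).
Hypothesis noncritical : forall x, julia_set f x -> ~ critical f x.
Local Notation J := (julia_set f).
Local Notation A := (cfun R J).
Local Notation X := (cfun R (graph_julia f)).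
Local Notation fJ := (julia_map coprimePQ degPQ).
Local Notation gval := (gval coprimePQ degPQ).
Local Notation transfer := (transfer coprimePQ degPQ noncritical).
Local Notation fibre := (fibre coprimePQ degPQ noncritical).
Local Notation sinner := (@sinner R P Q).
Local Notation nfibre := (nfibre coprimePQ degPQ noncritical).

Definition transferA (a : A) : A := cfun_of (transfer a).

Lemma transferAE a y : transferA a y = transfer a y.
Proof. by rewrite cfun_ofE//; apply: transfer_continuous; exact: cfun_continuous. Qed.

Lemma iter_transferAE n a y : iter n transferA a y = iter n transfer a y.
Proof.
elim: n y => // n IH y; rewrite !iterS transferAE.
by congr (transfer _ y); apply/funext => x; exact: IH.
Qed.

Definition transfer_mean n (a : A) (y : J) : C := ((d%:R ^+ n)^-1)%:C * iter n transfer a y.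

Lemma dexp_gt0 n : 0 < (d%:R ^+ n : R).
Proof. by rewrite exprn_gt0// ltr0n ltnW. Qed.

Lemma transfer_mean_linear n (k : C) a b y :
  transfer_mean n (k *: a + b) y = k * transfer_mean n a y + transfer_mean n b y.
Proof.
rewrite /transfer_mean !iter_transferE mulrCA -mulrDr; congr (_ * _).
by rewrite mulr_sumr -big_split.
Qed.

Lemma transfer_mean_const n (k : C) (a : A) y : (forall x, a x = k) -> transfer_mean n a y = k.
Proof.
move=> ak; rewrite /transfer_mean iter_transferE (eq_bigr (fun=> k)); last by move=> x _; exact: ak.
rewrite big_const_seq count_predT size_nfibre iter_addr_0 -[k *+ _]mulr_natr mulrCA.
have -> : (d ^ n)%:R = (d%:R ^+ n : R)%:C :> C by rewrite natrX rmorphXn rmorph_nat.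
by rewrite -rmorphM mulVf ?mulr1// lt0r_neq0// dexp_gt0.
Qed.

Lemma transfer_mean_bound n (a : A) (K : R) y : (forall x, rnorm (a x : C) <= K) ->
  rnorm (transfer_mean n a y) <= K.
Proof.
move=> aK; rewrite /transfer_mean iter_transferE rnormM rnorm_real ger0_norm; last by rewrite invr_ge0 ltW// dexp_gt0.
rewrite mulrC ler_pdivrMr ?dexp_gt0//; apply: (le_trans (rnorm_sum _ _ _)).
apply: (@le_trans _ _ (\sum_(x <- nfibre n y) K)); first exact: ler_sum.
by rewrite big_const_seq count_predT size_nfibre iter_addr_0 -[leLHS]mulr_natr natrX.
Qed.

Lemma transfer_mean_shift n (a : A) y :
  transfer_mean n (transferA a) y = d%:R * transfer_mean n.+1 a y.
Proof.
rewrite /transfer_mean iterSr.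
have -> : (transferA a : J -> C) = transfer a by apply/funext => x; exact: transferAE.
rewrite mulrA; congr (_ * _).
have -> : d%:R = (d%:R : R)%:C :> C by rewrite rmorph_nat.
rewrite -rmorphM exprS invfM mulrA divff ?mul1r// lt0r_neq0// ltr0n ltnW//.
Qed.

Variable mu : probability (borel_sphere R) R.
Hypothesis lyubich : is_lyubich_measure f d mu.

Lemma cintegral_approx (e : R) : 0 < e -> forall a y, exists N, forall n, (N <= n)%N ->
  rnorm (transfer_mean n a y - cintegral mu a) < e.
Proof.
move=> e0 a y; have [N _ hN] := cintegral_limit coprimePQ degPQ noncritical lyubich y a e0.
by exists N => n Nn; exact: hN.
Qed.

Let y0 : J := let: exist y Jy := cid (julia_nonempty coprimePQ degPQ) in SigSub (mem_set Jy).

(** The integral is determined by the means at one base point, so its algebraic properties follow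
    from finite sums, for complex functions at once. *)
Lemma cintegral_eq (a : A) (l : C) :
  (forall e : R, 0 < e -> exists N, forall n, (N <= n)%N -> rnorm (transfer_mean n a y0 - l) <= e) ->
  cintegral mu a = l.
Proof.
move=> h; apply/eqP; rewrite -subr_eq0; apply/eqP; apply: rnorm_lt_eps_eq0 => e e0.
have e2 : 0 < e / 2 by rewrite divr_gt0.
have [N hN] := h _ e2; have [M hM] := cintegral_approx e2 a y0.
apply: (le_trans (rdist_triangle (transfer_mean (maxn N M) a y0) _ _)); rewrite [e]splitr lerD//.
  by rewrite rdistC ltW// hM// leq_maxr.
by rewrite hN// leq_maxl.
Qed.

Lemma cintegral_linear (k : C) (a b : A) :
  cintegral mu (k *: a + b) = k * cintegral mu a + cintegral mu b.
Proof.
apply: cintegral_eq => e e0.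
have k0 : 0 < rnorm k + 1 by rewrite ltr_wpDl// rnorm_ge0.
have e1 := divr_gt0 (divr_gt0 e0 (ltr0Sn R 1)) k0; have e2 : 0 < e / 2 by rewrite divr_gt0.
have [N hN] := cintegral_approx e1 a y0; have [M hM] := cintegral_approx e2 b y0.
exists (maxn N M) => n; rewrite geq_max => /andP[Nn Mn].
rewrite transfer_mean_linear opprD addrACA -mulrBr; apply: (le_trans (rnormD _ _)).
rewrite [e]splitr lerD//; last by rewrite ltW// hM.
rewrite rnormM; apply: (@le_trans _ _ ((rnorm k + 1) * (e / 2 / (rnorm k + 1)))).
  by apply: ler_pM; rewrite ?rnorm_ge0// ?lerDl// ltW// hN.
by rewrite mulrC divfK// lt0r_neq0.
Qed.

Lemma cintegral_const (k : C) (a : A) : (forall x, a x = k) -> cintegral mu a = k.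
Proof.
move=> ak; apply: cintegral_eq => e e0; exists 0%N => n _.
by rewrite (transfer_mean_const n y0 ak) subrr rnorm0 ltW.
Qed.

(** The mean of order [n] of [transferA a] is [d] times the mean of order [n + 1] of [a], and both
    orders have the same limit. *)
Lemma cintegral_transfer (a : A) : cintegral mu (transferA a) = d%:R * cintegral mu a.
Proof.
apply: cintegral_eq => e e0.
have d0 : 0 < d%:R :> R by rewrite ltr0n ltnW.
have [N hN] := cintegral_approx (divr_gt0 e0 d0) a y0; exists N => n Nn.
rewrite transfer_mean_shift -mulrBr rnormM -(rmorph_nat (real_complex R)) rnorm_real (gtr0_norm d0).
by rewrite mulrC -ler_pdivlMr// ltW// hN// leqW.
Qed.

Lemma cintegral_bound (a : A) (K : R) : (forall x, rnorm (a x : C) <= K) -> rnorm (cintegral mu a) <= K.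
Proof.
move=> aK; apply/ler_addgt0Pr => e e0; have [N hN] := cintegral_approx e0 a y0.
rewrite -(subrK (transfer_mean N a y0) (cintegral mu a)) addrC; apply: (le_trans (rnormD _ _)).
by rewrite lerD ?transfer_mean_bound// rdistC ltW// hN.
Qed.

Lemma cintegral_ge0 (a : A) : (forall x, 0 <= (a x : C)) -> 0 <= cintegral mu a.
Proof.
move=> a0.
have t0 n : 0 <= transfer_mean n a y0.
  rewrite /transfer_mean iter_transferE mulr_ge0//; last by apply: sumr_ge0 => x _; exact: a0.
  by rewrite lecR invr_ge0 ltW// dexp_gt0.
have h (e : R) : 0 < e -> - e <= complex.Re (cintegral mu a) /\ `|complex.Im (cintegral mu a)| <= e.
  move=> e0; have [N hN] := cintegral_approx e0 a y0; have := hN _ (leqnn N).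
  have := t0 N; case: (transfer_mean N a y0) => u v; case: (cintegral mu a) => u' v' /=.
  rewrite lecE /= => /andP[/eqP -> u0] hh.
  have := le_lt_trans (normr_Re_le _) hh; have := le_lt_trans (normr_Im_le _) hh.
  by rewrite /= sub0r normrN => /ltW ? ; rewrite ltr_norml => /andP[]; split => //; lra.
case: (cintegral mu a) h => u v /= h; rewrite lecE /=; apply/andP; split.
  rewrite -normr_eq0 eq_le normr_ge0 andbT; apply/ler_addgt0Pr => e e0; rewrite add0r.
  by case: (h e e0).
by rewrite -oppr_le0; apply/ler_addgt0Pr => e e0; rewrite add0r lerNl; case: (h e e0).
Qed.

End CintegralFacts.

(** * The temperature of a KMS state and its restriction to [A] *)

Section KmsRestriction.
Variable R : realType.
Local Notation C := R[i].
Variables P Q : {poly C}.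
Hypothesis coprimePQ : coprimep P Q.
Hypothesis degPQ : (2 <= rat_degree P Q)%N.
Local Notation d := (rat_degree P Q).
Local Notation f := (rat_map P Q).
Hypothesis noncritical : forall x, julia_set f x -> ~ critical f x.
Local Notation J := (julia_set f).
Local Notation A := (cfun R J).
Local Notation X := (cfun R (graph_julia f)).
Local Notation fJ := (julia_map coprimePQ degPQ).
Local Notation gval := (gval coprimePQ degPQ).
Local Notation transfer := (transfer coprimePQ degPQ noncritical).
Local Notation fibre := (fibre coprimePQ degPQ noncritical).
Local Notation transferA := (transferA coprimePQ degPQ noncritical).
Local Notation transfer_mean := (transfer_mean coprimePQ degPQ noncritical).
Variables (O : cstarAlgType R) (i : {linear A -> O}) (S : {linear X -> O}).
Hypothesis cp : is_cuntz_pimsner i S.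
Variable gamma : R -> O -> O.
Hypothesis gauge : is_gauge_action i S gamma.
Let rep : covariant_rep i S := cp_rep cp.
Let el := unit_cmull cp.
Let er := unit_cmulr cp.

Variables (beta : R) (phi : O -> C).
Hypothesis kms : is_kms_state gamma beta phi.
Let st := kms_state kms.
Let lin := state_linear st.
Let pos := state_ge0 st.

Lemma kms_transfer (a : A) : (expR beta)%:C * phi (i a) = phi (i (transferA a)).
Proof.
have [us hus cs] := exists_is_basis coprimePQ degPQ noncritical.
rewrite {1}(rep_basis coprimePQ degPQ noncritical a rep hus) (functional_sum lin) mulr_sumr.
transitivity (\sum_(u <- us) phi (i (sinner u (lact a u)))).
  apply: eq_bigr => u _; rewrite -(kms_S cp gauge kms) (rep_inner rep).
  by rewrite sinner_inner.
rewrite -(functional_sum lin) -raddf_sum; congr (phi (i _)).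
apply: cfun_eq => y; rewrite cfun_sumE transferAE.
transitivity (\sum_(u <- us) \sum_(x <- fibre y) conjc (gval u x) * gval (lact a u) x).
  by apply: eq_bigr => u _; exact: sinnerE.
rewrite exchange_big; apply: eq_bigr => x _.
transitivity (a x * \sum_(u <- us) gval u x * conjc (gval u x)).
  by rewrite mulr_sumr; apply: eq_bigr => u _; rewrite gval_lact mulrCA [conjc _ * _]mulrC.
by rewrite cs// eqxx mulr1.
Qed.

Lemma kms_expR_beta : expR beta = d%:R.
Proof.
apply: (@complexI R); have := kms_transfer 1; rewrite (state_unit cp st) mulr1 => ->.
have -> : transferA 1 = (d%:R : C) *: (1 : A).
  apply: cfun_eq => y; rewrite transferAE transferE -[RHS]/(d%:R * 1).
  rewrite (eq_bigr (fun=> 1)) // big_const_seq count_predT size_fibre iter_addr_0 mulr1 //.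
by rewrite linearZ (functionalZ lin) (state_unit cp st) mulr1 rmorph_nat.
Qed.

Lemma kms_inverse_temperature : beta = ln d%:R.
Proof. by rewrite -kms_expR_beta expRK. Qed.

Lemma kms_transfer_iter n (a : A) : phi (i a) = ((d%:R ^+ n)^-1)%:C * phi (i (iter n transferA a)).
Proof.
elim: n a => [|n IH] a; first by rewrite expr0 invr1 mul1r.
have d0 : (d%:R : R) != 0 by rewrite pnatr_eq0 -lt0n ltnW.
have E : phi (i a) = (d%:R^-1)%:C * phi (i (transferA a)).
  by rewrite -kms_transfer kms_expR_beta mulrA -rmorphM mulVf// mul1r.
by rewrite iterSr E IH mulrA -rmorphM exprS invfM.
Qed.

Variable mu : probability (borel_sphere R) R.
Hypothesis lyubich : is_lyubich_measure f d mu.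

Let nu (h : J -> R) : R := complex.Re (phi (i (cfun_of (fun x => (h x)%:C)))).

Lemma continuous_complexR (h : J -> R) : continuous (h : J -> R^o) ->
  continuous (fun x => (h x)%:C : C^o).
Proof.
move=> /continuousP_dist ch; apply/continuous_rnormP => x e e0.
by apply: filterS (ch x e e0) => y; rewrite /mkset -rmorphB rnorm_real.
Qed.

Lemma nu_linear k (g h : J -> R) : continuous (g : J -> R^o) -> continuous (h : J -> R^o) ->
  nu (fun x => k * g x + h x) = k * nu g + nu h.
Proof.
move=> cg ch; rewrite /nu.
have -> : cfun_of (fun x => (k * g x + h x)%:C) = k%:C *: cfun_of (fun x => (g x)%:C) + cfun_of (fun x => (h x)%:C) :> A.
  apply: cfun_eq => x.
  have E1 := cfun_ofE (continuous_complexR (continuous_linear (k := k) cg ch)) x.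
  have E2 := cfun_ofE (continuous_complexR cg) x; have E3 := cfun_ofE (continuous_complexR ch) x.
  apply: etrans E1 (esym (etrans (f_equal2 (fun u v => k%:C * u + v) E2 E3) _)).
  by rewrite rmorphD rmorphM.
have h' (u v : A) : complex.Re (phi (i (k%:C *: u + v))) = k * complex.Re (phi (i u)) + complex.Re (phi (i v)).
  rewrite linearP lin; case: (phi (i u)) => u1 u2.
  by case: (phi (i v)) => v1 v2 /=; rewrite mul0r subr0.
exact: h'.
Qed.

(** Positivity of [phi] concerns elements [h^* h], and [g] is one of these with [h] its square
    root. *)
Lemma nu_ge0 (g : J -> R) : continuous (g : J -> R^o) -> (forall x, 0 <= g x) -> 0 <= nu g.
Proof.
move=> cg g0; pose h : J -> C := fun x => (Num.sqrt (g x))%:C.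
have ch : continuous (h : J -> C^o).
  apply: continuous_complexR => x.
  by apply: (@continuous_comp _ _ _ g (@Num.sqrt R)); [exact: cg|exact: sqrt_continuous].
have := pos (i (cfun_of h)); rewrite -(rep_star rep) -(rep_mul rep).
have -> : cfun_conj (cfun_of h) * cfun_of h = cfun_of (fun x => (g x)%:C) :> A.
  apply: cfun_eq => x; have E1 := cfun_ofE ch x; have E2 := cfun_ofE (continuous_complexR cg) x.
  apply: etrans (f_equal2 (fun u v => conjc u * v) E1 E1) (etrans _ (esym E2)).
  by rewrite conjc_mulE /h rnorm_real ger0_norm ?sqrtr_ge0// sqr_sqrtr.
by rewrite lecE => /andP[].
Qed.

(** By transfer invariance [phi (i (g n))] is [phi (i a) - c] for every [n]. Cauchy-Schwarz against
    the unit bounds its square by [nu (b n)]; squaring the modulus makes [b n] real and nonnegative,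
    as bounded convergence requires. *)
Lemma kms_cintegral (a : A) : phi (i a) = cintegral mu a.
Proof.
apply/eqP; rewrite -subr_eq0; apply/eqP; apply: rnorm_lt_eps_eq0 => e e0.
pose c := cintegral mu a.
pose g n : A := ((d%:R ^+ n)^-1)%:C *: iter n transferA a - c *: (1 : A).
have gE n x : g n x = transfer_mean n a x - c.
  by rewrite -[LHS]/(((d%:R ^+ n)^-1)%:C * iter n transferA a x - c * 1) iter_transferAE mulr1.
have phig n : phi (i (g n)) = phi (i a) - c.
  rewrite /g addrC -scaleNr linearP linearZ lin (functionalZ lin) (state_unit cp st) mulr1 addrC.
  by rewrite -kms_transfer_iter.
have [K K0 aK] := continuous_bounded (@cfun_continuous _ _ a).
pose b n x := rnorm (g n x : C) ^+ 2.
have cb n : continuous (b n : J -> R^o).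
  apply/continuousP_dist => x eps eps0.
  have /continuous_rnormP cg := @cfun_continuous _ _ (cfun_conj (g n) * g n).
  apply: filterS (cg x eps eps0) => y; rewrite /mkset !cfunME !cfun_conjE !conjc_mulE.
  by rewrite -rmorphB rnorm_real.
have bK n x : b n x <= (K + rnorm c) ^+ 2.
  rewrite /b gE ler_pXn2r ?nnegrE ?rnorm_ge0 ?addr_ge0 ?rnorm_ge0//.
  by apply: (le_trans (rnormB _ _)); rewrite lerD2r transfer_mean_bound.
have blim x (eps : R) : 0 < eps -> exists N, forall n, (N <= n)%N -> b n x <= eps.
  move=> eps0; pose r := Num.min 1 eps; have r0 : 0 < r by rewrite lt_min ltr01.
  have [N hN] := cintegral_approx coprimePQ degPQ noncritical lyubich r0 a x.
  exists N => n Nn; rewrite /b gE; have h := hN n Nn.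
  have h1 : rnorm (transfer_mean n a x - c) <= 1 by apply: (le_trans (ltW h)); rewrite ge_min lexx.
  have h2 : rnorm (transfer_mean n a x - c) <= eps by apply: (le_trans (ltW h)); rewrite ge_min lexx orbT.
  by apply: le_trans h2; rewrite expr2 -[leRHS]mul1r; apply: ler_wpM2r => //; exact: rnorm_ge0.
have e20 : 0 < e ^+ 2 by rewrite exprn_gt0.
have [|N hN] := bounded_convergence (@julia_finite_cover _ P Q) nu_linear nu_ge0 cb _ bK blim e20.
  by move=> n x; exact: exprn_ge0 (rnorm_ge0 _).
rewrite -/c -(phig N) -(ler_pXn2r (n := 2)) ?nnegrE ?rnorm_ge0 ?(ltW e0)//.
apply: le_trans (hN N (leqnn N)).
rewrite -{1}(el (i (g N))) -{1}(star_unit er).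
apply: (le_trans (functional_cauchy_schwarz lin pos _ _)).
have -> : sqn phi (i 1) = 1 by rewrite /sqn (star_unit er) el (state_unit cp st).
rewrite mul1r /sqn /nu -(rep_star rep) -(rep_mul rep).
have -> // : cfun_conj (g N) * g N = cfun_of (fun x => (b N x)%:C) :> A.
apply: cfun_eq => x; apply: etrans _ (esym (cfun_ofE (continuous_complexR (cb N)) x)).
exact: conjc_mulE.
Qed.

End KmsRestriction.

(** * Construction of the KMS state from diagonal matrix coefficients *)

Section Existence.
Variable R : realType.
Local Notation C := R[i].
Variables P Q : {poly C}.
Hypothesis coprimePQ : coprimep P Q.
Hypothesis degPQ : (2 <= rat_degree P Q)%N.
Local Notation d := (rat_degree P Q).
Local Notation f := (rat_map P Q).
Hypothesis noncritical : forall x, julia_set f x -> ~ critical f x.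
Local Notation J := (julia_set f).
Local Notation A := (cfun R J).
Local Notation X := (cfun R (graph_julia f)).
Local Notation fJ := (julia_map coprimePQ degPQ).
Local Notation gval := (gval coprimePQ degPQ).
Local Notation transfer := (transfer coprimePQ degPQ noncritical).
Local Notation fibre := (fibre coprimePQ degPQ noncritical).
Local Notation transferA := (transferA coprimePQ degPQ noncritical).
Local Notation I := (J * int)%type.
Local Notation step := (step coprimePQ degPQ).
Local Notation repA := (@repA R P Q).
Local Notation repX := (repX coprimePQ degPQ noncritical).
Variables (O : cstarAlgType R) (i : {linear A -> O}) (S : {linear X -> O}).
Hypothesis cp : is_cuntz_pimsner i S.
Let rep : covariant_rep i S := cp_rep cp.
Let el := unit_cmull cp.
Let er := unit_cmulr cp.

Variable pi : O -> bop R I.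
Hypothesis pi_hom : star_hom pi.
Hypothesis pi_i : forall a, pi (i a) = repA a.
Hypothesis pi_S : forall xi, pi (S xi) = repX xi.

Lemma pi_cmul x y h : pi (cmul x y) h = pi x (pi y h).
Proof. by rewrite (star_hom_mul pi_hom). Qed.

Lemma pi_star x : pi (star x) = bop_adj (pi x).
Proof. exact: star_hom_star pi_hom x. Qed.

Lemma pi_linear k x y h : pi (k *: x + y) h = k *: pi x h + pi y h.
Proof. by rewrite (star_hom_linear pi_hom). Qed.

Lemma pi_unit h : pi (i 1) h = h.
Proof. by rewrite pi_i; apply: l2_eq => p; rewrite repAE mul1r. Qed.

(** The vector functional at [h] is positive with value the squared norm of [h] at the unit; apply
    its bound to [x^* x]. *)
Lemma pi_contractive x h : l2norm (pi x h) <= rnorm x * l2norm h.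
Proof.
pose psi T := ip h (pi T h).
have lin : scalar psi by move=> k u v; rewrite /psi pi_linear ip_linear.
have sq y : psi (cmul (star y) y) = (l2norm (pi y h) ^+ 2)%:C.
  by rewrite /psi pi_cmul pi_star -ip_adj ip_self.
have pos y : 0 <= psi (cmul (star y) y) by rewrite sq lecR sqr_ge0.
have := functional_bounded lin pos el er (cmul (star x) x).
rewrite sq rnorm_star_cmul rnorm_real ger0_norm ?sqr_ge0// /psi pi_unit ip_self /= -exprMn.
rewrite ler_pXn2r ?nnegrE ?l2norm_ge0 ?mulr_ge0 ?l2norm_ge0 ?rnorm_ge0// mulrC //.
Qed.

Definition entry (T : O) (p q : I) : C := pi T (delta R q) p.

Lemma entry_linear k x y p q : entry (k *: x + y) p q = k * entry x p q + entry y p q.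
Proof. by rewrite /entry pi_linear. Qed.

Lemma entryB x y p q : entry x p q - entry y p q = entry (x - y) p q.
Proof. by rewrite addrC -[in RHS](scaleN1r y) [in RHS]addrC entry_linear mulN1r. Qed.

Lemma entry_bound T p q : rnorm (entry T p q) <= rnorm T.
Proof.
apply: (le_trans (rnorm_coef_le _ _)); apply: (le_trans (pi_contractive _ _)).
by rewrite l2norm_delta mulr1.
Qed.

Lemma entry_star_self T q : 0 <= entry (cmul (star T) T) q q.
Proof.
by rewrite /entry -ip_delta pi_cmul pi_star -ip_adj ip_self lecR sqr_ge0.
Qed.

Lemma entry_unit q : entry (i 1) q q = 1.
Proof. by rewrite /entry pi_unit /= eqxx. Qed.

Lemma entry_il a T p q : entry (cmul (i a) T) p q = a p.1 * entry T p q.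
Proof. by rewrite /entry pi_cmul pi_i repAE. Qed.

Lemma entry_ir a T p q : entry (cmul T (i a)) p q = entry T p q * a q.1.
Proof.
rewrite /entry pi_cmul pi_i.
have -> : repA a (delta R q) = a q.1 *: delta R q.
  apply: l2_eq => p'; rewrite repAE -[RHS]/(a q.1 * delta R q p') /=.
  by have [->|] := eqVneq p' q; rewrite ?mulr0.
have := bop_linear (pi T) (a q.1) (delta R q) 0; rewrite !addr0 => ->.
have -> : pi T 0 = 0.
  by have := bop_linear (pi T) (-1) (delta R q) (delta R q); rewrite !scaleN1r !addNr.
by rewrite addr0 mulrC.
Qed.

Lemma entry_Sl xi T p q : entry (cmul (S xi) T) p q = gval xi p.1 * entry T (step p) q.
Proof. by rewrite /entry pi_cmul pi_S repXE. Qed.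

Lemma entry_Sstar eta T p q :
  entry (cmul T (star (S eta))) p q = entry T p (step q) * conjc (gval eta q.1).
Proof.
have e0 x y : conjc (entry (star x) y p) = entry x p y.
  by rewrite /entry -!ip_delta pi_star -ip_adj -ip_conj.
rewrite -(starK T) -starM -e0 starK entry_Sl conjcM mulrC; congr (_ * _).
by rewrite -e0 starK.
Qed.

Lemma entry_Sr xi T p (y : J) m :
  entry (cmul T (S xi)) p (y, m) = \sum_(x <- fibre y) gval xi x * entry T p (x, m + 1).
Proof.
rewrite /entry pi_cmul pi_S.
have -> : repX xi (delta R (y, m)) = \sum_(x <- fibre y) gval xi x *: delta R (x, m + 1).
  apply: l2_eq => -[z n]; rewrite repXE l2_sumE.
  transitivity (\sum_(t <- fibre y) gval xi t * delta R (t, m + 1) (z, n)); last first.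
    by apply: eq_bigr => t _.
  rewrite /step /= xpair_eqE subr_eq.
  have [fz|fz] := eqVneq (fJ z) y; last first.
    rewrite mulr0 big1_seq// => x /andP[_ xy].
    rewrite xpair_eqE; have [zx|] := eqVneq z x; last by rewrite mulr0.
    by move: xy fz; rewrite -zx mem_fibre => ->.
  have zf : z \in fibre y by rewrite mem_fibre fz.
  rewrite (bigD1_seq z) ?fibre_uniq//= xpair_eqE eqxx big1 ?addr0// => x xz.
  by rewrite xpair_eqE eq_sym (negbTE xz) mulr0.
have sumE (s : seq J) (F : J -> C) (g : J -> l2 R I) :
    pi T (\sum_(x <- s) F x *: g x) = \sum_(x <- s) F x *: pi T (g x).
  elim: s => [|x s IH]; last by rewrite !big_cons bop_linear IH.
  by rewrite !big_nil; have := bop_linear (pi T) (-1) 0 0; rewrite scaler0 addr0 scaleN1r addNr.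
by rewrite sumE l2_sumE.
Qed.

Definition shift1 (p : I) : I := (p.1, p.2 + 1).

(** The coefficients of the generators ignore the integer coordinate and [step] commutes with the
    shift, so monomials satisfy this; coefficients depend continuously on [T]. *)
Lemma entry_shift T p q : entry T (shift1 p) (shift1 q) = entry T p q.
Proof.
pose F T : C^o := entry T (shift1 p) (shift1 q) - entry T p q.
pose V := [set T | forall p q, entry T (shift1 p) (shift1 q) - entry T p q = 0 :> C^o].
suff /(_ T) : forall T, V T by move=> /(_ p q)/eqP; rewrite subr_eq0 => /eqP.
apply: (monomial_induction cp).
  split.
    have -> : V = \bigcap_(pq in [set: I * I]) [set T | entry T (shift1 pq.1) (shift1 pq.2) - entry T pq.1 pq.2 = 0 :> C^o].
      by apply/seteqP; split=> [U hU [p' q'] _|U hU p' q']; [exact: hU|exact: (hU (p', q'))].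
    apply: closed_bigI => -[p' q'] _.
    apply: (@closed_lipschitz_zero _ _ _ _ 2) => u v.
    rewrite [X in rnorm X](_ : _ = entry (u - v) (shift1 p') (shift1 q') - entry (u - v) p' q'); last first.
      by rewrite -!entryB !opprD addrACA.
    apply: (le_trans (rnormB _ _)); rewrite mulr2n mulrDl mul1r.
    by apply: lerD; exact: entry_bound.
  move=> k u v hu hv p' q'; apply/eqP; rewrite subr_eq0 !entry_linear.
  have /eqP := hu p' q'; have /eqP := hv p' q'; rewrite !subr_eq0 => /eqP -> /eqP ->.
  exact: eqxx.
have step_shift r : step (shift1 r) = shift1 (step r) by rewrite /step /shift1 /= addrAC.
move=> xis a etas p' q'; apply/eqP; rewrite subr_eq0; apply/eqP.
elim: xis p' q' => [|xi xis IH] p' q'; last first.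
  by rewrite /mono /= !entry_Sl step_shift IH.
elim/last_ind: etas p' q' => [|etas eta IH] p' q'.
  rewrite /mono /= /entry pi_i !repAE /= /shift1 !xpair_eqE /=.
  by rewrite (inj_eq (addIr 1)).
by rewrite /mono /= /rmono foldl_rcons !entry_Sstar step_shift -[foldl _ _ _]/(mono i S [::] a etas) IH.
Qed.

Definition diag (T : O) (x : J) : C := entry T (x, 0) (x, 0).

(** Each [S] at the left and each adjoint at the right moves one of the two indices along [step], so
    the induction needs entries between arbitrary iterates, not only diagonal ones. *)
Lemma mono_entry_continuous xis a etas k l : exists c : A, forall x,
  c x = entry (mono i S xis a etas) (iter k step (x, 0)) (iter l step (x, 0)).
Proof.
have iter_stepE n (x : J) : iter n step (x, 0) = (iter n fJ x, - (n%:Z)).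
  elim: n => [|n IH]; first by rewrite oppr0.
  by rewrite iterS IH /step /= -opprD -PoszD addn1.
have citer n : continuous (iter n fJ : J -> J).
  elim: n => [|n IH] x; first exact: cvg_id.
  by apply: (@continuous_comp _ _ _ (iter n fJ) fJ); [exact: IH|exact: julia_map_continuous].
have cA (h : J -> C) n : continuous (h : J -> C^o) -> exists c : A, forall x, c x = h (iter n fJ x).
  move=> ch; exists (cfun_of (fun x => h (iter n fJ x))) => x; apply: cfun_ofE => y.
  by apply: (@continuous_comp J J C^o (iter n fJ) (h : J -> C^o)); [exact: citer|exact: ch].
elim: xis k l => [|xi xis IH] k l; last first.
  have [c hc] := IH k.+1 l; have [b hb] := cA _ k (@gval_continuous _ _ _ coprimePQ degPQ xi).
  exists (b * c) => x; apply: etrans (cfunME b c x) _; rewrite hc hb.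
  by rewrite /mono /= entry_Sl -iterS; congr (_ * _); rewrite iter_stepE.
elim/last_ind: etas k l => [|etas eta IH] k l.
  (* For [k != l] the integer coordinates [- k] and [- l] differ, so the entry vanishes identically,
     even at points whose orbits coincide after [k] and [l] steps. *)
  have [kl|kl] := eqVneq k l.
    have [b hb] := cA _ k (@cfun_continuous _ _ a); exists b => x.
    by rewrite kl /mono /= /entry pi_i repAE /= eqxx mulr1 hb iter_stepE kl.
  exists 0 => x; rewrite /mono /= /entry pi_i repAE /= !iter_stepE xpair_eqE eqr_opp eqz_nat (negbTE kl).
  by rewrite andbF mulr0.
have [c hc] := IH k l.+1; have [b hb] := cA _ l (@gval_continuous _ _ _ coprimePQ degPQ eta).
exists (c * cfun_conj b) => x; apply: etrans (cfunME c _ x) _.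
rewrite -[X in _ * X]/(conjc (b x)) hc hb /mono /= /rmono foldl_rcons entry_Sstar -iterS.
by congr (_ * conjc _); rewrite iter_stepE.
Qed.

Lemma diag_continuous T : continuous (diag T : J -> C^o).
Proof.
apply: (monomial_induction cp (V := [set T | continuous (diag T : J -> C^o)])); last first.
  move=> xis a etas; have [c hc] := mono_entry_continuous xis a etas 0 0.
  have E : diag (mono i S xis a etas) = c by apply/funext => x; rewrite hc.
  by rewrite /mkset E; exact: cfun_continuous.
split.
  apply/closedP => U aU; apply/continuous_rnormP => x e e0.
  have e3 : 0 < e / 3 by rewrite divr_gt0.
  have [U' /continuous_rnormP cU' UU'] := aU _ e3.
  apply: filterS (cU' x _ e3) => y; rewrite /mkset => hy.
  have h z : rnorm (diag U z - diag U' z) < e / 3.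
    by rewrite /diag entryB; exact: le_lt_trans (entry_bound _ _ _) UU'.
  have := rdist_triangle (diag U' x) (diag U x) (diag U y).
  have := rdist_triangle (diag U' y) (diag U' x) (diag U y).
  have := h x; have := h y; rewrite (rdistC (diag U y)); lra.
move=> k u v hu hv; rewrite /mkset.
have -> : diag (k *: u + v) = (k *: (cfun_of (diag u) : A) + (cfun_of (diag v) : A)).
  apply/funext => x; rewrite cfunPE /diag entry_linear.
  exact: (f_equal2 (fun a b => k * a + b) (esym (cfun_ofE hu x)) (esym (cfun_ofE hv x))).
exact: cfun_continuous.
Qed.

(** A positive, unital [A]-bimodule map onto [A], that is, a conditional expectation. *)
Definition diagA (T : O) : A := cfun_of (diag T).

Lemma diagAE T x : diagA T x = diag T x.
Proof. by apply: cfun_ofE; exact: diag_continuous. Qed.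

Variable mu : probability (borel_sphere R) R.
Hypothesis lyubich : is_lyubich_measure f d mu.
Let cintegral_linear := cintegral_linear coprimePQ degPQ noncritical lyubich.

Definition kms_functional (T : O) : C := cintegral mu (diagA T).

Lemma kms_functional_linear : scalar kms_functional.
Proof.
move=> k u v; rewrite /kms_functional -cintegral_linear; congr cintegral.
apply: cfun_eq => x; apply: etrans (diagAE _ x) _; apply: etrans (entry_linear _ _ _ _ _) _.
exact: (f_equal2 (fun a b => k * a + b) (esym (diagAE u x)) (esym (diagAE v x))).
Qed.

Lemma kms_functional_ge0 x : 0 <= kms_functional (cmul (star x) x).
Proof.
apply: (cintegral_ge0 coprimePQ degPQ noncritical lyubich) => y.
by rewrite diagAE; exact: entry_star_self.
Qed.

Lemma kms_functional_i a x : kms_functional (cmul x (i a)) = kms_functional (cmul (i a) x).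
Proof.
apply: (f_equal (cintegral mu)); apply: cfun_eq => y.
apply: etrans (diagAE _ y) (etrans _ (esym (diagAE _ y))).
by rewrite /diag entry_ir entry_il mulrC.
Qed.

(** On the diagonal, [x S_xi] is the transfer of [S_xi x], after a shift of the integer coordinate;
    the factor [d] is the transfer identity for the integral. *)
Lemma kms_functional_S xi x : kms_functional (cmul x (S xi)) = d%:R * kms_functional (cmul (S xi) x).
Proof.
apply: etrans (cintegral_transfer coprimePQ degPQ noncritical lyubich _).
apply: (f_equal (cintegral mu)).
apply: cfun_eq => y; apply: etrans (diagAE _ y) (etrans _ (esym (transferAE _ _ _ _ y))).
rewrite /diag entry_Sr transferE big_seq [RHS]big_seq; apply: eq_bigr => z.
rewrite mem_fibre => /eqP fz; apply: etrans _ (esym (diagAE _ z)).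
rewrite /diag entry_Sl; congr (_ * _).
by rewrite -[RHS]entry_shift stepE /shift1 /= fz.
Qed.

Lemma kms_functional_state : is_state kms_functional.
Proof.
have u1 : kms_functional (i 1) = 1.
  apply: (cintegral_const coprimePQ degPQ noncritical lyubich) => x.
  by rewrite diagAE; exact: entry_unit.
split.
- exact: kms_functional_linear.
- exact: kms_functional_ge0.
- move=> x; rewrite !rnormE lecR; apply: (cintegral_bound coprimePQ degPQ noncritical lyubich) => y.
  by rewrite diagAE; exact: entry_bound.
- move=> e e0; exists (i 1); last by rewrite u1 normr1 gtrBl.
  by have := rnorm_unit_le1 el er; rewrite -lecR -rnormE.
Qed.

Variable gamma : R -> O -> O.
Hypothesis gauge : is_gauge_action i S gamma.
Let beta0 : R := ln d%:R.
Local Notation phi := kms_functional.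
Let lin := kms_functional_linear.
Let pos := kms_functional_ge0.

(** Bundling the KMS identity with the degree makes it stable under products and adjoints, so it is
    checked on generators only. *)
Definition homogeneous (k : int) (y : O) := degree gamma k y /\
  forall x, phi (cmul x y) = (expR (k%:~R * beta0))%:C * phi (cmul y x).

Lemma homogeneous_i a : homogeneous 0 (i a).
Proof.
split; first exact: degree_i gauge a.
by move=> x; rewrite mul0r expR0 mul1r; exact: kms_functional_i.
Qed.

Lemma homogeneous_S xi : homogeneous 1 (S xi).
Proof.
split; first exact: degree_S gauge xi.
move=> x; rewrite kms_functional_S mul1r /beta0 lnK ?rmorph_nat//.
by rewrite posrE ltr0n ltnW.
Qed.

Lemma homogeneousZ k (c : C) y : homogeneous k y -> homogeneous k (c *: y).
Proof.
move=> [dy hy]; split; first by move=> t; rewrite (gaugeZ gauge) dy !scalerA mulrC.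
by move=> x; rewrite cmulZr cmulZl !(functionalZ lin) hy mulrCA.
Qed.

Lemma homogeneousM k l x y : homogeneous k x -> homogeneous l y -> homogeneous (k + l) (cmul x y).
Proof.
move=> [dx hx] [dy hy]; split; first exact: degree_mul gauge _ _ _ _ dx dy.
move=> z; rewrite cmulA hy cmulA hx mulrA cmulA -rmorphM -expRD; congr ((expR _)%:C * _).
by rewrite rmorphD mulrDl addrC.
Qed.

Lemma functional_star x : phi (star x) = conjc (phi x).
Proof. by rewrite -[star x]er (functional_herm lin pos) (star_unit er) el. Qed.

Lemma homogeneous_star k y : homogeneous k y -> homogeneous (- k) (star y).
Proof.
move=> [dy hy]; split; first exact: degree_star gauge _ _ dy.
move=> x; have -> : cmul x (star y) = star (cmul y (star x)) by rewrite starM starK.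
have -> : cmul (star y) x = star (cmul (star x) y) by rewrite starM starK.
rewrite !functional_star hy conjcM mulrA.
have -> : conjc (expR (k%:~R * beta0))%:C = (expR (k%:~R * beta0))%:C :> C by rewrite /= oppr0.
by rewrite -rmorphM -expRD rmorphN mulNr addNr expR0 mul1r.
Qed.

(** The dense subalgebra required by the KMS condition; a derivation is a decomposition into
    homogeneous terms, along which the entire extension is built. *)
Inductive homogeneous_sum : O -> Prop :=
| HomogeneousNil : homogeneous_sum 0
| HomogeneousCons k y x : homogeneous k y -> homogeneous_sum x -> homogeneous_sum (y + x).

Lemma homogeneous_sum1 k y : homogeneous k y -> homogeneous_sum y.
Proof. by move=> h; rewrite -[y]addr0; exact: HomogeneousCons h HomogeneousNil. Qed.

Lemma homogeneous_sumD x y : homogeneous_sum x -> homogeneous_sum y -> homogeneous_sum (x + y).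
Proof.
move=> hx hy; elim: hx => [|k y' x' h _ IH]; first by rewrite add0r.
by rewrite -addrA; exact: HomogeneousCons h IH.
Qed.

Lemma homogeneous_sumZ (c : C) x : homogeneous_sum x -> homogeneous_sum (c *: x).
Proof.
elim=> [|k y x' h _ IH]; first by rewrite scaler0; exact: HomogeneousNil.
by rewrite scalerDr; apply: HomogeneousCons IH; exact: homogeneousZ h.
Qed.

Lemma homogeneous_sum_subalgebra : star_subalgebra homogeneous_sum.
Proof.
split.
- exact: HomogeneousNil.
- by move=> k x y hx hy; apply: homogeneous_sumD hy; exact: homogeneous_sumZ.
- move=> x y hx hy; elim: hx => [|k u x' hu _ IH]; first by rewrite cmul0l; exact: HomogeneousNil.
  rewrite cmulDl; apply: homogeneous_sumD IH.
  elim: hy => [|l v y' hv _ IHy]; first by rewrite cmul0r; exact: HomogeneousNil.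
  by rewrite cmulDr; apply: HomogeneousCons IHy; exact: homogeneousM hu hv.
- move=> x; elim=> [|k y x' h _ IH]; first by rewrite star0; exact: HomogeneousNil.
  by rewrite starD; apply: HomogeneousCons IH; exact: homogeneous_star h.
Qed.

Lemma homogeneous_sum_dense : dense (homogeneous_sum : set O).
Proof.
apply/denseP => x.
suff : [set y | approx (homogeneous_sum : set O) y] = setT.
  by move=> E; have : [set: O] x by []; rewrite -E.
apply: (cp_generated cp).
- exact: closed_approx.
- exact: approx_star_subalgebra homogeneous_sum_subalgebra.
- by move=> a; apply: approx_self; exact: homogeneous_sum1 (homogeneous_i a).
- by move=> xi; apply: approx_self; exact: homogeneous_sum1 (homogeneous_S xi).
Qed.

Lemma derivable_phase_scale (k : int) (y : O) (F : C^o -> O) (z : C^o) : derivable F z 1 ->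
  derivable ((fun w : C^o => expi (k%:~R * w) *: y + F w : O) : C^o -> O) z 1.
Proof.
move=> dF; have [c hc] := cdiff_derivable dF.
have dE : derivable ((fun w : C^o => expi (k%:~R * w)) : C^o -> C^o) z 1.
  have -> : (fun w : C^o => expi (k%:~R * w) : C^o) = (fun w : C^o => expi (k%:~R * w + 0) : C^o).
    by apply: funext => w; rewrite addr0.
  by apply: (@derivable_affine R C^o (@expi R)) => ?; exact: expi_derivable.
have [b hb] := cdiff_derivable dE.
have y0 : 0 < rnorm y + 1 by rewrite ltr_wpDl// rnorm_ge0.
apply: (@derivable_cdiff R O _ z (b *: y + c)) => e e0.
have e2 : 0 < e / 2 by rewrite divr_gt0.
have [r1 r10 h1] := hb _ (divr_gt0 e2 y0); have [r2 r20 h2] := hc _ e2.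
exists (Num.min r1 r2); first by rewrite lt_min r10.
move=> w; rewrite lt_min => /andP[w1 w2].
have -> : expi (k%:~R * w) *: y + F w - (expi (k%:~R * z) *: y + F z) - (w - z) *: (b *: y + c) =
    (expi (k%:~R * w) - expi (k%:~R * z) - (w - z) * b) *: y + (F w - F z - (w - z) *: c).
  have alg (u v s t : C) (p q r : O) :
      u *: y + p - (v *: y + q) - s *: (t *: y + r) = (u - v - s * t) *: y + (p - q - s *: r).
    rewrite !scalerBl scalerDr scalerA !opprD.
    by rewrite [X in X + _ = _]addrACA [LHS]addrACA.
  exact: alg.
apply: (le_trans (rnormD _ _)); rewrite [e in leRHS]splitr [leRHS]mulrDl; apply: lerD; last exact: h2.
rewrite rnormZ; apply: (@le_trans _ _ (e / 2 / (rnorm y + 1) * rnorm (w - z) * (rnorm y + 1))).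
  by apply: ler_pM; rewrite ?rnorm_ge0 ?lerDl//; exact: h1.
by rewrite mulrAC divfK// lt0r_neq0.
Qed.

Lemma homogeneous_sum_extension y : homogeneous_sum y ->
  exists2 F, analytic_extension gamma y F &
    forall x, phi (cmul x (F (0 +i* beta0))) = phi (cmul y x).
Proof.
have gaugeD' t u v : gamma t (u + v) = gamma t u + gamma t v.
  by rewrite -[u in LHS]scale1r (star_hom_linear (gauge_hom gauge t)) scale1r.
elim=> [|k u x' [du hu] _ [F [dF Freal] hF]].
  exists (fun=> 0); last by move=> x; rewrite cmul0l cmul0r.
  split=> [z|t]; first exact: derivable_cst.
  by have := gaugeZ gauge t 0 0; rewrite !scale0r.
exists (fun w : C^o => expi (k%:~R * w) *: u + F w).
  split=> [z|t]; first exact: derivable_phase_scale.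
  by rewrite gaugeD' du Freal.
move=> x; rewrite cmulDr cmulDl !(functionalD lin) hF cmulZr (functionalZ lin) hu mulrA.
have -> : (k%:~R : C) * (0 +i* beta0) = 0 +i* (k%:~R * beta0).
  rewrite -(rmorph_int (real_complex R)); apply/eqP; rewrite eq_complex /=.
  by rewrite !mul0r mulr0 subr0 addr0 !eqxx.
(* At [z = i beta0] the phase of degree [k] is [expR (- k beta0)], which cancels the factor of the
   KMS identity. *)
by rewrite expi_imag -rmorphM -expRD addNr expR0 mul1r.
Qed.

Lemma kms_functional_kms : is_kms_state gamma beta0 phi.
Proof.
split; first exact: kms_functional_state.
exists homogeneous_sum; split.
- exact: homogeneous_sum_dense.
- exact: homogeneous_sum_subalgebra.
- move=> t x; elim=> [|k y x' [dy hy] _ IH].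
    have -> : gamma t 0 = 0 by have := gaugeZ gauge t 0 0; rewrite !scale0r.
    exact: HomogeneousNil.
  have -> : gamma t (y + x') = gamma t y + gamma t x'.
    by rewrite -[y in LHS]scale1r (star_hom_linear (gauge_hom gauge t)) scale1r.
  by rewrite dy; apply: HomogeneousCons IH; apply: homogeneousZ; split; [exact: dy|exact: hy].
- by move=> y /homogeneous_sum_extension[F hF _]; exists F.
- move=> x y F _ /homogeneous_sum_extension[G [dG Greal] hG] [dF Freal].
  rewrite -hG; apply/eqP; rewrite -subr_eq0; apply/eqP.
  (* The KMS condition quantifies over all extensions; an arbitrary [F] agrees with the explicit [G]
     on the real line, hence also at [i beta0] after pairing with [x]. *)
  apply: (@entire_zero_on_line R (fun z => phi (cmul x (F z)) - phi (cmul x (G z)))) => [z|t].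
    by apply: derivable_sub; apply: (derivable_state kms_functional_state).
  by rewrite Freal Greal subrr.
Qed.

End Existence.

Theorem theorem6p1 (R : realType) (P Q : {poly R[i]%C})
  (coprimePQ : coprimep P Q)
  (degPQ : (2 <= rat_degree P Q)%N)
  (noncritical : forall x, julia_set (rat_map P Q) x -> ~ critical (rat_map P Q) x)
  (O : cstarAlgType R)
  (i : {linear cfun R (julia_set (rat_map P Q)) -> O})
  (S : {linear cfun R (graph_julia (rat_map P Q)) -> O})
  (O_cuntz_pimsner : is_cuntz_pimsner i S)
  (gamma : R -> O -> O)
  (gauge : is_gauge_action i S gamma)
  (mu : probability (borel_sphere R) R)
  (lyubich : is_lyubich_measure (rat_map P Q) (rat_degree P Q) mu) :
  let beta0 : R := ln (rat_degree P Q)%:R in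
  [/\ forall beta : R,
        (exists phi : O -> R[i]%C, is_kms_state gamma beta phi) <-> beta = beta0,
      exists! phi : O -> R[i]%C, is_kms_state gamma beta0 phi &
      forall phi : O -> R[i]%C, is_kms_state gamma beta0 phi ->
        forall a, phi (i a) = cintegral mu a].
Proof.
move=> beta0.
have [pi [pi_hom pi_i pi_S]] :=
  cp_universal O_cuntz_pimsner (concrete_rep coprimePQ degPQ noncritical).
have kms0 : is_kms_state gamma beta0 (kms_functional pi mu) :=
  kms_functional_kms O_cuntz_pimsner pi_hom pi_i pi_S lyubich gauge.
have restriction phi beta : is_kms_state gamma beta phi -> forall a, phi (i a) = cintegral mu a.
  by move=> kms a; exact: (kms_cintegral coprimePQ degPQ noncritical O_cuntz_pimsner gauge kms lyubich).
split; last by move=> phi; exact: restriction.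
- move=> beta; split=> [[phi kms]|->]; last by exists (kms_functional pi mu).
  exact: (kms_inverse_temperature coprimePQ degPQ noncritical O_cuntz_pimsner gauge kms).
- exists (kms_functional pi mu); split=> // phi kms.
  have beta0_neq0 : beta0 != 0 by rewrite gt_eqF// ln_gt0// ltr1n.
  apply: (kms_state_eq O_cuntz_pimsner gauge beta0_neq0 kms0 kms) => a.
  by apply: etrans (restriction _ _ kms0 a) (esym (restriction _ _ kms a)).
Qed.
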